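(* Let $g$ be an analytic, nonunivalent (i.e. non-injective) function on $\mathbb{H}$ with $0\notin g'(\mathbb{H})$, and let $D\in\mathfrak{D}$. Then there is an analytic function $\rho$ on $D$ with $\rho(D)\subset\mathbb{H}$ such that every antiderivative $f$ on $D$ of the function $z\mapsto g'(\rho(z))$ (that is, every analytic $f$ on $D$ with $f'(z)=g'(\rho(z))$) extends continuously to $\overline{D}$ and satisfies $\dim(\Delta(z_0,r)\cap\mathcal{I}(f))=1$ for all $r>0$ and all $z_0\in f(\partial D)$.
   Context: $\mathbb{H}=\{z\in\mathbb{C}:\Im z>0\}$ is the upper half-plane. $\mathfrak{D}$ is the class of domains consisting of $\mathbb{H}$ together with all smoothly bounded Jordan domains, i.e. all bounded domains in $\mathbb{C}$ whose boundary is a $C^\infty$ (regularly parametrized) Jordan curve. $\Delta(a,r)=\{z\in\mathbb{C}:|z-a|<r\}$. For $X\subset\mathbb{C}$, $\dim(X)$ is the Hausdorff dimension of $X$. For an analytic function $f$ on a domain $D$, $\mathcal{I}(f)$ is the set of infinite valence values of $f$: the set of $w\in f(D)$ for which $f^{-1}(w)=\{z\in D: f(z)=w\}$ is infinite. $\partial D$ and $\overline{D}$ denote the boundary and closure of $D$ in $\mathbb{C}$ (so $\partial\mathbb{H}=\mathbb{R}$), and $f(\partial D)$ is the image of $\partial D$ under the continuous extension of $f$ to $\overline{D}$. *)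

(* Defs.v *)
From HB Require Import structures.
From mathcomp Require Import all_boot all_order all_algebra.
From mathcomp Require Import all_classical all_reals all_analysis.
From mathcomp Require Import complex.
Set Implicit Arguments.
Unset Strict Implicit.
Unset Printing Implicit Defensive.
Import Order.TTheory GRing.Theory Num.Theory numFieldNormedType.Exports.
Local Open Scope ring_scope.
Local Open Scope complex_scope.
Local Open Scope classical_set_scope.

(* The topology and the norm of the complex plane are carried by the regular
   algebra R[i]^o; the bare type R[i] has no canonical topology.  With scalar
   field R[i], [derivable f z 1] is complex differentiability at z and
   [f^`() z] is the complex derivative. *)
Notation Cplx R := (R[i]^o).

Section Defs.
Variable R : realType.
Implicit Types (D J U X : set (Cplx R)) (f : Cplx R -> Cplx R).

Definition upper_half_plane : set (Cplx R) :=
  [set z | 0 < complex.Im (z : R[i])].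

(* Functions on D are total functions whose values off D are irrelevant;
   this is only used with D open. *)
Definition analytic_on D f := forall z, D z -> derivable f z 1.

Definition boundary D : set (Cplx R) := closure D `\` interior D.

Definition domain D := [/\ D !=set0, open D & connected D].

Definition smooth (u : R -> R) :=
  forall (n : nat) (t : R), derivable (u^`(n)) t 1.

Definition smooth_jordan_curve J :=
  exists x y : R -> R,
    let gamma (t : R) : Cplx R := x t +i* y t in
    [/\ smooth x /\ smooth y,
        forall t, (x^`() t, y^`() t) <> (0, 0),
        forall t, gamma (t + 1) = gamma t,
        set_inj `[0, 1[ gamma &
        J = range gamma].

Definition smooth_jordan_domain D :=
  [/\ domain D, bounded_set D & smooth_jordan_curve (boundary D)].

Definition frakD : set (set (Cplx R)) :=
  [set D | D = upper_half_plane \/ smooth_jordan_domain D].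

Definition infinite_valence D f : set (Cplx R) :=
  [set w | (f @` D) w /\ infinite_set (D `&` f @^-1` [set w])].

Definition dist (x y : Cplx R) : R := complex.Re (`|x - y| : R[i]).

Definition diam U : \bar R :=
  ereal_sup [set (dist x y)%:E | x in U & y in U].

(* The supremum of the empty set is -oo and 0 `^ 0 = 1, so the empty set is
   treated apart: it contributes 0 for every s, including s = 0. *)
Definition diam_pow (s : R) U : \bar R :=
  if `[< U = set0 >] then 0%E else poweR (diam U) s.

Definition hausdorff_pre (s delta : R) X : \bar R :=
  ereal_inf [set (\sum_(0 <= n <oo) diam_pow s (U n))%E
    | U in [set U : nat -> set (Cplx R) |
              X `<=` \bigcup_n U n /\ forall n, (diam (U n) <= delta%:E)%E]].

Definition hausdorff_measure (s : R) X : \bar R :=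
  ereal_sup [set hausdorff_pre s delta X | delta in [set d : R | 0 < d]].

Definition hausdorff_dim X : \bar R :=
  ereal_inf [set s%:E | s in [set s : R | 0 <= s /\ hausdorff_measure s X = 0%E]].

End Defs.

Arguments upper_half_plane {R}.
Arguments frakD {R}.

(* Main.v *)
Require Import Defs.
From HB Require Import structures.
From mathcomp Require Import all_boot all_order all_algebra.
From mathcomp Require Import all_classical all_reals all_analysis.
From mathcomp Require Import complex ring lra.
Import Order.TTheory GRing.Theory Num.Theory numFieldNormedType.Exports.
Local Open Scope ring_scope.
Local Open Scope complex_scope.
Local Open Scope classical_set_scope.
Set Implicit Arguments.
Unset Strict Implicit.
Unset Printing Implicit Defensive.

(** Let g(a) = g(b) with a <> b and Im b <= Im a.  We take rho = kappa^-1 o sigma, where kappa is the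
    Moebius map from the half-plane onto the unit disc with kappa(b) = 0, and sigma is a sum of
    rescaled copies of a bump Phi attached to boundary points c of D.  The bump is such that
    kappa^-1 (Phi z) is close to b + u z near the segment from 0 to q = (a - b) / u, u close to 1.
    There an antiderivative phi of g' o kappa^-1 o Phi is close to g(b + u z) / u, so that
    phi(q) = phi(0) up to a small error, and phi takes near q all values near phi(0).  Hence near c,
    at the scale of the bump, f takes all values near its boundary value F(c).

    Bumps are added in stages.  A node c of one stage gets as children N equidistant boundary
    points next to it, whose bumps have a size kap h much smaller than their mutual distance h.
    Far from the bumps f' is close to g'(b) <> 0, so f separates the children of a node, and the
    limit points of the tree are mapped by F onto a set E such that the inverse of an address map
    from [0, 1[ is s-Hoelder, for each s < 1 if the N increase fast enough.  A limit point is close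
    to nodes at all scales, hence E consists of infinite values and has dimension at least s; a new
    root is added at each stage, so that such sets are dense along the boundary.

    Conversely, since f' does not vanish, the solutions of f(z) = w accumulate only on the boundary
    of D, so that infinite values lie on the curve F(bd D), which is locally Lipschitz. *)

(** * The real-valued modulus of complex numbers *)

Section Modulus.
Variable R : realType.
Local Notation C := R[i].
Local Notation Re := (@complex.Re R).
Local Notation Im := (@complex.Im R).
Implicit Types (z w : C).
Local Notation ii := (Complex (0 : R) (1 : R)).

(** The modulus of a bump comes close to 1, so two of them must not be large at the same point.
    Hence each node reserves a disc on which the current sum is small. Since [Phi 0 = 0], such discs
    are at hand about the children, and the decay 1 / |z|^2 bounds the influence of N equidistant
    bumps on each other independently of N. At a new root, where the sum has a value v, the term - v
    i / (zeta + i) is added, zeta being the local coordinate: it cancels v and hardly increases the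
    modulus.

    If Im a = Im b, then a - b is real and would lie on the edge of the region where the bump is
    under control. The factor u turns it upwards by a multiple of 1 / B, where B is the large
    parameter of the bump; the approximation errors are of order 1 / B too, so their ratio can be
    settled before B is chosen.

    N is chosen after kap, large against a power of the scale which grows with the stage, so that
    passing from h to kap h costs nothing in the limiting dimension. The boundary enters through a
    locally bi-Lipschitz parametrization and through inner and outer balls of one radius. *)

Definition cm : C -> R := locked (fun z => Re `|z|).

(** The norm of [R[i]] takes values in [R[i]], whereas [cm] is real. It is locked, so that
    arithmetic tactics see an atom, and it is opened only here. *)
Lemma cmRe z : cm z = Re `|z|. Proof. by rewrite /cm -lock. Qed.

Lemma normC_cm z : `|z| = (cm z)%:C.
Proof. by rewrite cmRe normc_def. Qed.

Lemma cmE z : cm z = Num.sqrt (Re z ^+ 2 + Im z ^+ 2).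
Proof. by rewrite cmRe normc_def. Qed.

Lemma cm_ge0 z : 0 <= cm z. Proof. by rewrite cmE sqrtr_ge0. Qed.

Lemma cm_sqr z : cm z ^+ 2 = Re z ^+ 2 + Im z ^+ 2.
Proof. by rewrite cmE sqr_sqrtr // addr_ge0 ?sqr_ge0. Qed.

Lemma cmD z w : cm (z + w) <= cm z + cm w.
Proof. by have := ler_normD z w; rewrite !normC_cm -rmorphD lecR. Qed.

Lemma cmM z w : cm (z * w) = cm z * cm w.
Proof. by have := normrM z w; rewrite !normC_cm -rmorphM => /complexI. Qed.

Lemma cmN z : cm (- z) = cm z. Proof. by rewrite !cmRe normrN. Qed.

Lemma cmBC z w : cm (z - w) = cm (w - z). Proof. by rewrite -cmN opprB. Qed.

Lemma cmB z w : cm (z - w) <= cm z + cm w.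
Proof. by rewrite (le_trans (cmD _ _)) // cmN. Qed.

Lemma cmV z : cm z^-1 = (cm z)^-1.
Proof. by have := normfV z; rewrite !normC_cm -fmorphV => /complexI. Qed.

Lemma cm_eq0 z : (cm z == 0) = (z == 0).
Proof. by rewrite -(inj_eq (@complexI _)) -normC_cm; exact: normr_eq0. Qed.

Lemma cm_gt0 z : (0 < cm z) = (z != 0).
Proof. by rewrite lt_def cm_ge0 andbT cm_eq0. Qed.

Lemma cm0 : cm 0 = 0. Proof. by apply/eqP; rewrite cm_eq0. Qed.

Lemma cmX z n : cm (z ^+ n) = cm z ^+ n.
Proof. by have := normrX n z; rewrite !normC_cm -rmorphXn => /complexI. Qed.

Lemma cm_real (x : R) : cm x%:C = `|x|.
Proof. by rewrite cmE /= expr0n /= addr0 sqrtr_sqr. Qed.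

Lemma cm1 : cm 1 = 1. Proof. by rewrite (cm_real 1) normr1. Qed.

Lemma cmi : cm ii = 1. Proof. by rewrite cmE /= expr0n expr1n add0r sqrtr1. Qed.

Lemma cm_nat n : cm n%:R = n%:R.
Proof.
have -> : (n%:R : C) = (n%:R : R)%:C by rewrite rmorph_nat.
by rewrite cm_real normr_nat.
Qed.

Lemma ler_Re_cm z : `|Re z| <= cm z.
Proof. by rewrite cmE -sqrtr_sqr ler_wsqrtr // lerDl sqr_ge0. Qed.

Lemma ler_Im_cm z : `|Im z| <= cm z.
Proof. by rewrite cmE -sqrtr_sqr ler_wsqrtr // lerDr sqr_ge0. Qed.

Lemma ler_cm_ReIm z : cm z <= `|Re z| + `|Im z|.
Proof.
rewrite -(@ler_pXn2r _ 2) ?nnegrE ?cm_ge0 ?addr_ge0 // cm_sqr.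
rewrite sqrrD !real_normK ?num_real //.
have := mulr_ge0 (normr_ge0 (Re z)) (normr_ge0 (Im z)); lra.
Qed.

Lemma cmBB z w : cm z - cm w <= cm (z - w).
Proof. by rewrite lerBlDr -{1}(subrK w z) cmD. Qed.

Lemma cm_tri (u z w : C) : cm (z - w) <= cm (z - u) + cm (u - w).
Proof. by rewrite -{1}(subrK u z) -addrA cmD. Qed.

Lemma cm_div z w : cm (z / w) = cm z / cm w.
Proof. by rewrite cmM cmV. Qed.

Lemma ReD z w : Re (z + w) = Re z + Re w. Proof. by case: z w => [? ?] [? ?]. Qed.
Lemma ImD z w : Im (z + w) = Im z + Im w. Proof. by case: z w => [? ?] [? ?]. Qed.
Lemma ReN z : Re (- z) = - Re z. Proof. by case: z. Qed.
Lemma ImN z : Im (- z) = - Im z. Proof. by case: z. Qed.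
Lemma ReM z w : Re (z * w) = Re z * Re w - Im z * Im w.
Proof. by case: z w => [? ?] [? ?]. Qed.
Lemma ImM z w : Im (z * w) = Re z * Im w + Im z * Re w.
Proof. by case: z w => [? ?] [? ?]. Qed.
Lemma ReC (x : R) : Re x%:C = x. Proof. by []. Qed.
Lemma ImC (x : R) : Im x%:C = (0 : R). Proof. by []. Qed.
Lemma Re0 : Re 0 = (0 : R). Proof. by []. Qed.
Lemma Im0 : Im 0 = (0 : R). Proof. by []. Qed.
Lemma Re1 : Re 1 = (1 : R). Proof. by []. Qed.
Lemma Im1 : Im 1 = (0 : R). Proof. by []. Qed.
Lemma Rei : Re ii = (0 : R). Proof. by []. Qed.
Lemma Imi : Im ii = (1 : R). Proof. by []. Qed.

(** A locked i: an atom for [ring] and [field], whose parts are computed through [reimE]. *)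
Definition ci : C := locked (Complex (0 : R) (1 : R)).
Lemma Re_ci : Re ci = (0 : R). Proof. by rewrite /ci -lock. Qed.
Lemma Im_ci : Im ci = (1 : R). Proof. by rewrite /ci -lock. Qed.
Lemma cm_ci : cm ci = 1. Proof. by rewrite cmE Re_ci Im_ci expr0n expr1n add0r sqrtr1. Qed.

Definition reimE := (Re_ci, Im_ci, ReD, ImD, ReN, ImN, ReM, ImM, ReC, ImC, Re0, Im0, Re1, Im1, Rei, Imi).

Lemma complex_ext z w : Re z = Re w -> Im z = Im w -> z = w.
Proof. by case: z w => [? ?] [? ?] /= -> ->. Qed.

Lemma cm_lt_sqr z (r : R) : 0 <= r -> (cm z < r) = (cm z ^+ 2 < r ^+ 2).
Proof. by move=> r0; rewrite ltr_pXn2r // ?nnegrE ?cm_ge0. Qed.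

Lemma cm_le_sqr z (r : R) : 0 <= r -> (cm z <= r) = (cm z ^+ 2 <= r ^+ 2).
Proof. by move=> r0; rewrite ler_pXn2r // ?nnegrE ?cm_ge0. Qed.

Lemma cm_ge_sqr z (r : R) : 0 <= r -> (r <= cm z) = (r ^+ 2 <= cm z ^+ 2).
Proof. by move=> r0; rewrite ler_pXn2r // ?nnegrE ?cm_ge0. Qed.

Lemma cm_sum (I : Type) (r : seq I) (P : pred I) (F : I -> C) :
  cm (\sum_(i <- r | P i) F i) <= \sum_(i <- r | P i) cm (F i).
Proof.
elim/big_rec2: _ => [|i y1 y2 _ h]; first by rewrite cm0.
by apply: le_trans (cmD _ _) _; rewrite lerD2l.
Qed.

End Modulus.
Arguments ci {R}.

(* [lra] compares atoms up to conversion, so local definitions are first made opaque. *)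
Ltac clra := repeat match goal with x := _ |- _ => clearbody x end; lra.

(** * Complex derivatives with real epsilon and delta *)

Section Derivative.
Variable R : realType.
Local Notation C := R[i].
Local Notation Re := (@complex.Re R).
Local Notation Im := (@complex.Im R).

(** The error is measured against [cm h] with a weak inequality, so that h = 0 needs no exception.
    [derivable_hasd] and [hasd_derivable] relate it to the derivative by filters. *)
Definition hasd (f : C -> C) (z l : C) := forall e : R, 0 < e ->
  exists2 d : R, 0 < d &
    forall h, cm h < d -> cm (f (z + h) - f z - l * h) <= e * cm h.

Definition ccont (f : C -> C) (z : C) := forall e : R, 0 < e ->
  exists2 d : R, 0 < d & forall w, cm (w - z) < d -> cm (f w - f z) <= e.

Lemma ball_cm (z w : Cplx R) (r : R) : ball z r%:C w <-> cm (z - w) < r.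
Proof. by rewrite -ball_normE /= normC_cm ltcR. Qed.

Lemma nbhs_cm (z : Cplx R) (A : set (Cplx R)) :
  nbhs z A <-> exists2 r : R, 0 < r & forall w, cm (z - w) < r -> A w.
Proof.
split.
  case/nbhs_ballP => e /= e0 H; have eR : e = (Re e)%:C.
    by apply/esym/RRe_real; rewrite realE ltW.
  exists (Re e); first by rewrite eR ltcR in e0.
  by move=> w zw; apply: H; rewrite eR; apply/ball_cm.
case=> r r0 H; apply/nbhs_ballP; exists r%:C => /=; first by rewrite ltcR.
by move=> w /ball_cm; apply: H.
Qed.

Lemma openP_cm (A : set (Cplx R)) :
  open A <-> forall z, A z -> exists2 r : R, 0 < r & forall w, cm (z - w) < r -> A w.
Proof.
rewrite openE; split=> H z Az; first by apply/nbhs_cm; exact: H.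
by apply/nbhs_cm; exact: H.
Qed.

Lemma closureP_cm (A : set (Cplx R)) z :
  closure A z <-> forall r : R, 0 < r -> exists2 w, A w & cm (z - w) < r.
Proof.
split.
  move=> cl r r0; have /cl[w [Aw Bw]] : nbhs z [set w | cm (z - w) < r].
    by apply/nbhs_cm; exists r.
  by exists w.
move=> H B /nbhs_cm[r r0 rB]; have [w Aw zw] := H r r0.
by exists w; split=> //; exact: rB.
Qed.

Lemma derivable_hasd (f : Cplx R -> Cplx R) z :
  derivable f z 1 -> hasd f z (f^`() z).
Proof.
rewrite /derivable derive1E /derive => /(cvg_ballP _).
set l := lim _ => H e e0.
have e0' : (0 : R[i]) < e%:C by rewrite ltcR.
have := H _ e0'; rewrite near_withinE => /nbhs_ballP[d /= d0 Hd].
have dR : d = (Re d)%:C by apply/esym/RRe_real; rewrite realE ltW.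
exists (Re d); first by rewrite dR ltcR in d0.
move=> h hd; have [->|h0] := eqVneq h 0; first by rewrite addr0 mulr0 !subrr cm0 mulr0.
have := Hd h; rewrite dR => /(_ _ h0).
rewrite ball_cm sub0r cmN => /(_ hd) /ball_cm.
rewrite /= => /ltW H2.
rewrite -[X in X <= _]mulr1 -ler_pdivrMr ?cm_gt0 // mulr1 -cm_div -cmN.
apply: le_trans H2; rewrite le_eqVlt; apply/orP; left; apply/eqP.
congr cm; rewrite /GRing.scale /= mulr1 (addrC h z); field; exact: h0.
Qed.

Lemma hasd_derivable (f : Cplx R -> Cplx R) z l :
  hasd f z l -> derivable f z 1 /\ f^`() z = l.
Proof.
move=> H.
have cv : (h : R[i])^-1 *: ((f \o shift z) (h *: (1 : Cplx R)) - f z) @[h --> (0 : Cplx R)^'] --> (l : Cplx R).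
  apply/cvg_ballP => e e0; rewrite near_withinE.
  have eR : e = (Re e)%:C by apply/esym/RRe_real; rewrite realE ltW.
  have e0' : 0 < Re e / 2 by rewrite divr_gt0 //; rewrite eR ltcR in e0.
  have [d d0 Hd] := H _ e0'.
  apply/nbhs_ballP; exists d%:C; first by rewrite /= ltcR.
  move=> h /= /ball_cm; rewrite sub0r cmN => hd h0.
  rewrite eR; apply/ball_cm.
  have := Hd h hd; rewrite -ler_pdivrMr ?cm_gt0 // -cm_div -cmN => H2.
  rewrite /=; have -> : l - h^-1 *: (f (h *: (1 : Cplx R) + z) - f z) =
     - ((f (z + h) - f z - l * h) / h).
    rewrite /GRing.scale /= mulr1 (addrC h z); field; exact: h0.
  apply: le_lt_trans H2 _; lra.
split; first by apply/cvg_ex; exists l.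
rewrite derive1E; apply: cvg_lim cv; exact: norm_hausdorff.
Qed.

Lemma hasd_ccont f z l : hasd f z l -> ccont f z.
Proof.
move=> H e e0; have [d d0 Hd] := H 1 ltr01.
have c0 : 0 < cm l + 1 by rewrite ltr_wpDl // cm_ge0.
exists (Num.min d (e / (cm l + 1))); first by rewrite lt_min d0 divr_gt0.
move=> w; rewrite lt_min => /andP[h1 h2].
have := Hd _ h1; rewrite mul1r [z + _]addrC subrK => h3.
have h4 : cm (f w - f z) <= cm (w - z) * (cm l + 1).
  have -> : f w - f z = f w - f z - l * (w - z) + l * (w - z) by rewrite subrK.
  apply: le_trans (cmD _ _) _; rewrite [cm (_ * _)]cmM; lra.
by apply: le_trans h4 _; rewrite -ler_pdivlMr // ltW.
Qed.

Lemma hasd_local (f g : C -> C) (z l : C) (r : R) : 0 < r ->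
  (forall w, cm (w - z) < r -> f w = g w) -> hasd f z l -> hasd g z l.
Proof.
move=> r0 fg H e e0; have [d d0 Hd] := H e e0.
exists (Num.min d r); first by rewrite lt_min d0.
move=> h; rewrite lt_min => /andP[hd hr].
rewrite -!fg ?subrr ?cm0 //; first exact: Hd.
by rewrite [z + h]addrC addrK.
Qed.

Lemma hasd_cst (k z : C) : hasd (fun _ => k) z 0.
Proof. by move=> e e0; exists 1 => // h _; rewrite mul0r !subrr cm0 mulr_ge0 ?cm_ge0 // ltW. Qed.

Lemma hasd_id (z : C) : hasd (fun w => w) z 1.
Proof.
move=> e e0; exists 1 => // h _; have -> : z + h - z - 1 * h = 0 by ring.
rewrite cm0.
by rewrite mulr_ge0 ?cm_ge0 // ltW.
Qed.

Lemma hasdD f g z l m : hasd f z l -> hasd g z m ->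
  hasd (fun w => f w + g w) z (l + m).
Proof.
move=> Hf Hg e e0; have e2 : 0 < e / 2 by lra.
have [d d0 Hd] := Hf _ e2; have [d' d0' Hd'] := Hg _ e2.
exists (Num.min d d'); first by rewrite lt_min d0.
move=> h; rewrite lt_min => /andP[h1 h2].
have -> : f (z + h) + g (z + h) - (f z + g z) - (l + m) * h =
  (f (z + h) - f z - l * h) + (g (z + h) - g z - m * h) by ring.
apply: le_trans (cmD _ _) _; have := Hd _ h1; have := Hd' _ h2; lra.
Qed.

Lemma hasdM f g z l m : hasd f z l -> hasd g z m ->
  hasd (fun w => f w * g w) z (l * g z + f z * m).
Proof.
move=> Hf Hg e e0.
set K := cm (g z) + cm (f z) + cm l + 2.
have K0 : 0 < K by rewrite /K; have := cm_ge0 (g z); have := cm_ge0 (f z); have := cm_ge0 l; lra.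
(* With e' at most 1, [K] dominates the total coefficient of e' |h| in the three error terms
   below. *)
pose e' := Num.min 1 (e / K).
have e1 : 0 < e' by rewrite lt_min ltr01 divr_gt0.
have e'1 : e' <= 1 by rewrite ge_min lexx.
have eK : e' * K <= e by rewrite -ler_pdivlMr // ge_min lexx orbT.
have [d d0 Hd] := Hf _ e1; have [d' d0' Hd'] := Hg _ e1.
have [d2 d20 Hd2] := hasd_ccont Hg e1.
exists (Num.min (Num.min d d') d2); first by rewrite !lt_min d0 d0' d20.
move=> h; rewrite !lt_min => /andP[/andP[h1 h2] h3].
have -> : f (z + h) * g (z + h) - f z * g z - (l * g z + f z * m) * h =
  (f (z + h) - f z - l * h) * g (z + h) + (f z * (g (z + h) - g z - m * h)
  + l * h * (g (z + h) - g z)) by ring.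
have {}h3 : cm (g (z + h) - g z) <= e' by apply: Hd2; rewrite addrAC subrr add0r.
have h4 : cm (g (z + h)) <= cm (g z) + e'.
  by have := cmBB (g (z + h)) (g z); lra.
have ch := cm_ge0 h.
have {}h1 := Hd _ h1; have {}h2 := Hd' _ h2.
have cl := cm_ge0 l; have cf := cm_ge0 (f z); have cg := cm_ge0 (g z).
apply: le_trans (cmD _ _) _.
have t1 : cm ((f (z + h) - f z - l * h) * g (z + h)) <= e' * cm h * (cm (g z) + e').
  by rewrite cmM ler_pM ?cm_ge0.
have t2 : cm (f z * (g (z + h) - g z - m * h)) <= cm (f z) * (e' * cm h).
  by rewrite cmM ler_wpM2l.
have t3 : cm (l * h * (g (z + h) - g z)) <= cm l * cm h * e'.
  by rewrite !cmM ler_wpM2l // mulr_ge0.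
have t4 := cmD (f z * (g (z + h) - g z - m * h)) (l * h * (g (z + h) - g z)).
have t5 : e' * (cm (g z) + e' + cm (f z) + cm l) * cm h <= e * cm h.
  by rewrite ler_wpM2r // (le_trans _ eK) // ler_wpM2l ?(ltW e1) // /K; lra.
nra.
Qed.

Lemma hasdZ (k : C) f z l : hasd f z l -> hasd (fun w => k * f w) z (k * l).
Proof. by move=> H; have := hasdM (hasd_cst k z) H; rewrite mul0r add0r. Qed.

Lemma hasdN f z l : hasd f z l -> hasd (fun w => - f w) z (- l).
Proof.
move=> H; have := hasdZ (-1) H; rewrite mulN1r.
by apply: (@hasd_local _ _ _ _ 1) => // w _; rewrite mulN1r.
Qed.

Lemma hasdB f g z l m : hasd f z l -> hasd g z m ->
  hasd (fun w => f w - g w) z (l - m).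
Proof. by move=> Hf Hg; apply: hasdD Hf (hasdN Hg). Qed.

Lemma hasd_comp (f g : C -> C) (z l m : C) : hasd f z l -> hasd g (f z) m ->
  hasd (g \o f) z (m * l).
Proof.
move=> Hf Hg e e0.
pose K := cm m + cm l + 2.
have K0 : 0 < K by rewrite /K; have := cm_ge0 m; have := cm_ge0 l; lra.
pose e' := Num.min 1 (e / K).
have e1 : 0 < e' by rewrite lt_min ltr01 divr_gt0.
have e'1 : e' <= 1 by rewrite ge_min lexx.
have eK : e' * K <= e by rewrite -ler_pdivlMr // ge_min lexx orbT.
have [d d0 Hd] := Hf _ e1; have [d' d0' Hd'] := Hg _ e1.
have d'2 : 0 < d' / 2 by lra.
have [d2 d20 Hd2] := hasd_ccont Hf d'2.
exists (Num.min d d2); first by rewrite !lt_min d0 d20.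
move=> h; rewrite lt_min => /andP[h1 h2] /=.
set k := f (z + h) - f z.
have kd : cm k < d' by apply: (@le_lt_trans _ _ (d' / 2)); [apply: Hd2; rewrite addrAC subrr add0r|lra].
have := Hd' _ kd; rewrite {1}/k [f z + _]addrC subrK => h3.
have -> : g (f (z + h)) - g (f z) - m * l * h =
  (g (f (z + h)) - g (f z) - m * k) + m * (k - l * h) by ring.
have h4 := Hd _ h1; rewrite -/k in h4.
have h5 : cm k <= (e' + cm l) * cm h.
  have -> : k = (k - l * h) + l * h by rewrite subrK.
  apply: le_trans (cmD _ _) _; rewrite [cm (l * h)]cmM; lra.
apply: le_trans (cmD _ _) _.
have t1 : cm (m * (k - l * h)) <= cm m * (e' * cm h) by rewrite cmM ler_wpM2l ?cm_ge0.
have t2 : e' * cm k <= e' * ((e' + cm l) * cm h) by rewrite ler_wpM2l // ltW.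
have t5 : e' * (cm m + e' + cm l) * cm h <= e * cm h.
  by rewrite ler_wpM2r ?cm_ge0 // (le_trans _ eK) // ler_wpM2l ?(ltW e1) // /K; lra.
lra.
Qed.

Lemma hasdV (z : C) : z != 0 -> hasd (fun w => w^-1) z (- z^-1 ^+ 2).
Proof.
move=> z0 e e0; have cz : 0 < cm z by rewrite cm_gt0.
pose d := Num.min (cm z / 2) (e * cm z ^+ 3 / 2).
exists d.
  by rewrite lt_min !divr_gt0 // mulr_gt0 // exprn_gt0.
move=> h; rewrite lt_min => /andP[h1 h2].
have zh : cm z / 2 <= cm (z + h).
  by have := cmBB z (- h); rewrite opprK cmN; lra.
have zh0 : z + h != 0 by rewrite -cm_gt0; lra.
have -> : (z + h)^-1 - z^-1 - - z^-1 ^+ 2 * h = h ^+ 2 / ((z + h) * z ^+ 2).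
  by field; rewrite zh0 z0.
rewrite cm_div !expr2 !cmM ler_pdivrMr; last by rewrite !mulr_gt0 // cm_gt0.
have ch := cm_ge0 h.
have : cm h * cm h <= cm h * (e * cm z ^+ 3 / 2) by rewrite ler_wpM2l // ltW.
have : cm h * e * cm z ^+ 2 * (cm z / 2) <= cm h * e * cm z ^+ 2 * cm (z + h).
  by rewrite ler_wpM2l // mulr_ge0 ?exprn_ge0 ?(ltW cz) // mulr_ge0 // ltW.
rewrite !expr2; nra.
Qed.

Lemma is_derive_eps (phi : R -> R) (t l : R) :
  (forall e : R, 0 < e -> exists2 d : R, 0 < d &
     forall h, `|h| < d -> `|phi (t + h) - phi t - l * h| <= e * `|h|) ->
  is_derive t 1 phi l.
Proof.
move=> H.
have cv : h^-1 *: ((phi \o shift t) (h *: (1 : R)) - phi t) @[h --> (0 : R)^'] --> l.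
  apply/cvg_ballP => e e0; rewrite near_withinE.
  have e0' : 0 < e / 2 by rewrite divr_gt0.
  have [d d0 Hd] := H _ e0'.
  apply/nbhs_ballP; exists d => // h /=.
  rewrite -ball_normE /= sub0r normrN => hd h0.
  rewrite distrC.
  have := Hd h hd; rewrite -ler_pdivrMr ?normr_gt0 // -normf_div => H2.
  have -> : h^-1 *: (phi (h *: (1 : R) + t) - phi t) - l = (phi (t + h) - phi t - l * h) / h.
    rewrite /GRing.scale /= mulr1 (addrC h t); field; exact: h0.
  apply: le_lt_trans H2 _; lra.
split; first by apply/cvg_ex; exists l.
apply: cvg_lim cv; exact: norm_hausdorff.
Qed.

(** The factor [k] selects a real component of f; theorems on real functions are then applied along
    a line. *)
Lemma hasd_line (f : C -> C) (k a v l : C) (t : R) : hasd f (a + t%:C * v) l ->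
  is_derive t 1 (fun t : R => Re (k * f (a + t%:C * v))) (Re (k * l * v)).
Proof.
move=> H; apply: is_derive_eps => e e0.
have K0 : 0 < cm k * cm v + 1 by rewrite ltr_wpDl // mulr_ge0 ?cm_ge0.
have V0 : 0 < cm v + 1 by rewrite ltr_wpDl // cm_ge0.
have e1 : 0 < e / (cm k * cm v + 1) by rewrite divr_gt0.
have [d d0 Hd] := H _ e1.
exists (d / (cm v + 1)); first by rewrite divr_gt0.
move=> h; rewrite ltr_pdivlMr // => hd.
have h1 : cm (h%:C * v) < d.
  by rewrite cmM cm_real; apply: le_lt_trans hd; rewrite ler_wpM2l // lerDl.
have := Hd _ h1.
have -> : a + t%:C * v + h%:C * v = a + (t + h)%:C * v by rewrite rmorphD /=; ring.
move=> h2.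
have -> : Re (k * f (a + (t + h)%:C * v)) - Re (k * f (a + t%:C * v)) - Re (k * l * v) * h =
  Re (k * (f (a + (t + h)%:C * v) - f (a + t%:C * v) - l * (h%:C * v))).
  by rewrite !reimE; ring.
apply: le_trans (ler_Re_cm _) _; rewrite cmM.
apply: le_trans (ler_wpM2l (cm_ge0 k) h2) _; rewrite cmM cm_real.
set A := cm k in K0 *; set B := cm v in K0 *.
have -> : A * (e / (A * B + 1) * (`|h| * B)) = (e * `|h|) * (A * B / (A * B + 1)).
  by field; rewrite gt_eqF.
rewrite ler_piMr ?mulr_ge0 ?(ltW e0) // ler_pdivrMr // mul1r; lra.
Qed.

(** The real mean value theorem is applied to the component of f - L z in the direction of its own
    increment D, namely Re (conj D (f - L z)), whose total increment is |D|^2. With L = 0 this is a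
    Lipschitz bound; with L near f' it compares f with an affine map. *)
Lemma seg_mvt (f : C -> C) (a b L : C) (M : R) :
  (forall t : R, 0 <= t <= 1 -> exists2 l, hasd f (a + t%:C * (b - a)) l & cm (l - L) <= M) ->
  cm (f b - f a - L * (b - a)) <= M * cm (b - a).
Proof.
move=> H; set v := b - a; set D := f b - f a - L * v.
have M0 : 0 <= M.
  by have [|l _ ] := H 0; [rewrite lexx ler01|apply: le_trans; exact: cm_ge0].
have [D0|D0] := eqVneq D 0; first by rewrite D0 cm0 mulr_ge0 ?cm_ge0.
pose f2 := fun w => f w - L * w.
have f2d (t : R) : 0 <= t <= 1 -> exists2 l, hasd f2 (a + t%:C * v) l & cm l <= M.
  move=> /H[l h1 h2]; exists (l - L) => //.
  by have := hasdB h1 (hasdZ L (@hasd_id (a + t%:C * v))); rewrite mulr1.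
(* A derivative is chosen for every t, with the default value 0 off [0, 1], because [MVT_segment]
   takes a total function. *)
have /choice[l Hl] : forall t : R, exists l, 0 <= t <= 1 -> hasd f2 (a + t%:C * v) l /\ cm l <= M.
  move=> t; have [/f2d[l h1 h2]|_] := boolP (0 <= t <= 1); first by exists l.
  by exists 0.
pose phi t := Re (conjc D * f2 (a + t%:C * v)).
have dphi (t : R) : 0 <= t <= 1 -> is_derive t 1 phi (Re (conjc D * l t * v)).
  by move=> /Hl[h _]; apply: hasd_line.
have [| |c c01 E] := @MVT_segment R phi (fun t => Re (conjc D * l t * v)) 0 1 ler01.
- by move=> t; rewrite in_itv /= => /andP[h1 h2]; apply: dphi; rewrite !ltW.
- apply: derivable_within_continuous => t; rewrite in_itv /= => /dphi h.
  exact: ex_derive.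
rewrite in_itv /= in c01; have [_ lM] := Hl c c01.
have E2 : cm D ^+ 2 = Re (conjc D * l c * v).
  move: E; rewrite subr0 mulr1 => <-; rewrite /phi rmorph0 rmorph1 mul0r mul1r addr0.
  have -> : a + v = b by rewrite /v addrC subrK.
  have -> : D = f2 b - f2 a by rewrite /D /f2 /v; ring.
  rewrite cm_sqr; case: (f2 b) (f2 a) => [x y] [x' y'] /=; ring.
have cD : cm (conjc D) = cm D by rewrite !cmE; case: (D) => x y /=; rewrite sqrrN.
have := ler_Re_cm (conjc D * l c * v); rewrite -E2 !cmM cD => h.
have {}h : cm D ^+ 2 <= cm D * cm (l c) * cm v by apply: le_trans h; exact: ler_norm.
have D1 : 0 < cm D by rewrite cm_gt0.
rewrite -(ler_pM2l D1) -expr2; apply: le_trans h _.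
by rewrite -mulrA ler_wpM2l ?cm_ge0 // ler_wpM2r ?cm_ge0.
Qed.

End Derivative.

(** * Integrals along rectangles, Goursat's theorem and Cauchy's estimate *)

Section Goursat.
Variable R : realType.
Local Notation C := R[i].
Local Notation Re := (@complex.Re R).
Local Notation Im := (@complex.Im R).
Local Notation mu := (@lebesgue_measure R).

Definition rint (u : R -> R) (a b : R) : R := \int[mu]_(x in `[a, b]) u x.

(** Continuity is two-sided at the end points as well, as it is for a restriction to a segment of a
    function satisfying [ccont] there. *)
Definition rcont (u : R -> R) (a b : R) :=
  forall t : R, a <= t <= b -> {for t, continuous u}.

Lemma rcont_within u a b : rcont u a b -> {within `[a, b], continuous u}.
Proof.
move=> H; apply: continuous_in_subspaceT => t; rewrite inE /= in_itv /=.
exact: H.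
Qed.

Lemma rcont_integrable u a b : rcont u a b -> mu.-integrable `[a, b] (EFin \o u).
Proof.
move=> H; apply: continuous_compact_integrable; first exact: segment_compact.
exact: rcont_within.
Qed.

Lemma rint_split u a c b : a <= c -> c <= b -> rcont u a b ->
  rint u a b = rint u a c + rint u c b.
Proof.
move=> ac cb H; have := @Rintegral_itvB R u (BLeft a) (BRight b) c.
move=> /(_ (rcont_integrable H)); rewrite !bnd_simp => /(_ ac cb).
rewrite (@Rintegral_itv_obnd_cbnd R); last first.
  apply: (@integrableS _ _ _ mu `[a, b]) => //; last exact: rcont_integrable.
  by move=> x /=; rewrite !in_itv /= => /andP[h1 h2]; rewrite h2 andbT (le_trans ac) // ltW.
by move=> h; rewrite /rint -[X in _ + X]h addrC subrK.
Qed.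

Lemma rintB u v a b : rcont u a b -> rcont v a b ->
  rint (fun x => u x - v x) a b = rint u a b - rint v a b.
Proof.
by move=> hu hv; rewrite /rint RintegralB //; exact: rcont_integrable.
Qed.

Lemma rint_cst (k a b : R) : a <= b -> rint (fun _ => k) a b = k * (b - a).
Proof.
move=> ab; rewrite /rint Rintegral_cst //= lebesgue_measure_itv /= lte_fin.
by case: ltgtP ab => // -> _; rewrite subrr.
Qed.

Lemma rcont_cst (k a b : R) : rcont (fun _ => k) a b.
Proof. by move=> t _; exact: cvg_cst. Qed.

Lemma rint_le u v a b : rcont u a b -> rcont v a b ->
  (forall t, a <= t <= b -> u t <= v t) -> rint u a b <= rint v a b.
Proof.
move=> hu hv H; apply: le_Rintegral => //; try exact: rcont_integrable.
Qed.

Lemma rint_ge u a b (m : R) : a <= b -> rcont u a b ->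
  (forall t, a <= t <= b -> m <= u t) -> m * (b - a) <= rint u a b.
Proof. by move=> ab hu H; rewrite -rint_cst //; apply: rint_le => //; exact: rcont_cst. Qed.

Lemma rint_bound u a b (M : R) : a <= b -> rcont u a b ->
  (forall t, a <= t <= b -> `|u t| <= M) -> `|rint u a b| <= M * (b - a).
Proof.
move=> ab hu H; rewrite ler_norml -mulNr -!rint_cst //.
by apply/andP; split; apply: rint_le => //; try exact: rcont_cst;
   move=> t /H; rewrite ler_norml => /andP[].
Qed.

Lemma rint_prim u U a b : a <= b -> rcont u a b ->
  (forall t, a <= t <= b -> is_derive t 1 U (u t)) -> rint u a b = U b - U a.
Proof.
rewrite le_eqVlt => /orP[/eqP->|ab] hu hU.
  by rewrite /rint set_itv1 Rintegral_set1 subrr.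
rewrite /rint /Rintegral (@continuous_FTC2 R u U a b) //.
- exact: rcont_within.
- have hc t : a <= t <= b -> {for t, continuous U}.
    by move=> /hU h; apply: differentiable_continuous; apply/derivable1_diffP; exact: ex_derive.
  split.
  + by move=> t; rewrite in_itv /= => /andP[h1 h2]; apply: ex_derive; apply: hU; rewrite !ltW.
  + by apply: cvg_at_right_filter; apply: hc; rewrite lexx ltW.
  + by apply: cvg_at_left_filter; apply: hc; rewrite lexx ltW.
- move=> t; rewrite in_itv /= => /andP[h1 h2]; rewrite derive1E.
  by apply: derive_val; apply: hU; rewrite !ltW.
Qed.

Definition pc (phi : R -> C) (a b : R) := forall t : R, a <= t <= b ->
  forall e : R, 0 < e -> exists2 d : R, 0 < d &
  forall s, `|s - t| < d -> cm (phi s - phi t) <= e.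

Definition pint (phi : R -> C) (a b : R) : C :=
  (rint (fun t => Re (phi t)) a b) +i* (rint (fun t => Im (phi t)) a b).

Lemma rcont_eps u a b : (forall t : R, a <= t <= b ->
  forall e : R, 0 < e -> exists2 d : R, 0 < d &
  forall s, `|s - t| < d -> `|u s - u t| <= e) -> rcont u a b.
Proof.
move=> H t tab; apply/cvg_ballP => e e0.
have e2 : 0 < e / 2 by lra.
have [d d0 Hd] := H t tab _ e2.
apply/nbhs_ballP; exists d => // s /=.
rewrite distrC => /Hd h; rewrite -ball_normE /= distrC; apply: le_lt_trans h _; lra.
Qed.

Lemma pc_Re phi a b : pc phi a b -> rcont (fun t => Re (phi t)) a b.
Proof.
move=> H; apply: rcont_eps => t tab e e0; have [d d0 Hd] := H t tab e e0.
exists d => // s /Hd; apply: le_trans; rewrite -ReN -ReD; exact: ler_Re_cm.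
Qed.

Lemma pc_Im phi a b : pc phi a b -> rcont (fun t => Im (phi t)) a b.
Proof.
move=> H; apply: rcont_eps => t tab e e0; have [d d0 Hd] := H t tab e e0.
exists d => // s /Hd; apply: le_trans; rewrite -ImN -ImD; exact: ler_Im_cm.
Qed.

Lemma pint_split phi a c b : a <= c -> c <= b -> pc phi a b ->
  pint phi a b = pint phi a c + pint phi c b.
Proof.
move=> ac cb H; rewrite /pint (rint_split ac cb (pc_Re H)).
by rewrite (rint_split ac cb (pc_Im H)).
Qed.

Lemma pintB phi psi a b : pc phi a b -> pc psi a b ->
  pint (fun t => phi t - psi t) a b = pint phi a b - pint psi a b.
Proof.
move=> h1 h2; apply: complex_ext; rewrite ?ReD ?ImD ?ReN ?ImN /=.
  rewrite -rintB; try exact: pc_Re.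
  by congr rint; apply: funext => t; rewrite ReD ReN.
rewrite -rintB; try exact: pc_Im.
by congr rint; apply: funext => t; rewrite ImD ImN.
Qed.

Lemma pint_bound phi a b (M : R) : a <= b -> pc phi a b ->
  (forall t, a <= t <= b -> cm (phi t) <= M) -> cm (pint phi a b) <= M * 2 * (b - a).
Proof.
move=> ab H HM; apply: le_trans (ler_cm_ReIm _) _ => /=.
have h1 := rint_bound ab (pc_Re H) (fun t h => le_trans (ler_Re_cm _) (HM t h)).
have h2 := rint_bound ab (pc_Im H) (fun t h => le_trans (ler_Im_cm _) (HM t h)).
lra.
Qed.

Lemma pint_prim phi (F : C -> C) (p v : C) a b : a <= b -> pc phi a b ->
  (forall t, a <= t <= b -> exists2 l, hasd F (p + t%:C * v) l & l * v = phi t) ->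
  pint phi a b = F (p + b%:C * v) - F (p + a%:C * v).
Proof.
move=> ab H HF; apply: complex_ext; rewrite ?ReD ?ImD ?ReN ?ImN /=.
  apply: (@rint_prim _ (fun t => Re (F (p + t%:C * v))) a b ab (pc_Re H)).
  move=> t /HF[l h1 <-]; have := hasd_line 1 h1; rewrite mul1r.
  by under eq_fun do rewrite mul1r.
apply: (@rint_prim _ (fun t => Im (F (p + t%:C * v))) a b ab (pc_Im H)).
move=> t /HF[l h1 <-]; have := hasd_line (0 -i* 1) h1.
have E z : Re ((0 -i* 1) * z) = Im z by case: z => x y /=; ring.
by rewrite -mulrA E; under eq_fun do rewrite E.
Qed.

(* [hint] and [vint] integrate f(z) dz along horizontal and vertical segments. *)
Definition hint (f : C -> C) (y a b : R) := pint (fun x => f (x +i* y)) a b.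
Definition vint (f : C -> C) (x c d : R) := pint (fun y => 'i%C * f (x +i* y)) c d.
Definition rect f x0 x1 y0 y1 : C :=
  hint f y0 x0 x1 - hint f y1 x0 x1 + vint f x1 y0 y1 - vint f x0 y0 y1.

Definition cont_rect f (x0 x1 y0 y1 : R) := forall x y : R,
  x0 <= x <= x1 -> y0 <= y <= y1 -> ccont f (x +i* y).

Definition on_bd (x0 x1 y0 y1 x y : R) := [&& x0 <= x <= x1, y0 <= y <= y1 &
  [|| x == x0, x == x1, y == y0 | y == y1]].

Definition cont_bd f x0 x1 y0 y1 := forall x y : R,
  on_bd x0 x1 y0 y1 x y -> ccont f (x +i* y).

Lemma cont_rect_bd f x0 x1 y0 y1 : cont_rect f x0 x1 y0 y1 -> cont_bd f x0 x1 y0 y1.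
Proof. by move=> H x y /and3P[h1 h2 _]; exact: H. Qed.

Lemma cont_rect_sub f x0 x1 y0 y1 a b c d : x0 <= a -> b <= x1 -> y0 <= c -> d <= y1 ->
  cont_rect f x0 x1 y0 y1 -> cont_rect f a b c d.
Proof.
move=> k1 k2 k3 k4 H s t /andP[s1 s2] /andP[t1 t2]; apply: H.
  by rewrite (le_trans k1) // (le_trans s2).
by rewrite (le_trans k3) // (le_trans t2).
Qed.

Lemma cm_le_iter (s t y : R) : cm ((s +i* y) - (t +i* y)) = `|s - t|.
Proof. by rewrite cmE /= subrr expr0n /= addr0 sqrtr_sqr. Qed.

Lemma cm_le_itei (s t x : R) : cm ((x +i* s) - (x +i* t)) = `|s - t|.
Proof. by rewrite cmE /= subrr expr0n /= add0r sqrtr_sqr. Qed.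

Lemma pc_h f x0 x1 y0 y1 y : y0 <= y1 -> cont_bd f x0 x1 y0 y1 -> (y == y0) || (y == y1) ->
  pc (fun x => f (x +i* y)) x0 x1.
Proof.
move=> h01 H hy t ht e e0; have [|d d0 Hd] := H t y _ e e0.
  by apply/and3P; split=> //; case/orP: hy => /eqP->; rewrite ?eqxx ?lexx ?h01 ?orbT.
by exists d => // s hs; apply: Hd; rewrite cm_le_iter.
Qed.

Lemma pc_v f x0 x1 y0 y1 x : x0 <= x1 -> cont_bd f x0 x1 y0 y1 -> (x == x0) || (x == x1) ->
  pc (fun y => 'i%C * f (x +i* y)) y0 y1.
Proof.
move=> h01 H hx t ht e e0; have [|d d0 Hd] := H x t _ e e0.
  by apply/and3P; split=> //; case/orP: hx => /eqP->; rewrite ?eqxx ?lexx ?h01 ?orbT.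
by exists d => // s hs; rewrite -mulrBr cmM cmi mul1r; apply: Hd; rewrite cm_le_itei.
Qed.

(** The two integrals along the cut cancel whatever their values, so continuity is asked for on the
    outer boundary only. *)
Lemma rect_splitx f x0 x1 y0 y1 (c : R) : cont_bd f x0 x1 y0 y1 -> x0 <= c <= x1 ->
  y0 <= y1 -> rect f x0 x1 y0 y1 = rect f x0 c y0 y1 + rect f c x1 y0 y1.
Proof.
move=> H /andP[c0 c1] h01; rewrite /rect /hint.
rewrite (pint_split c0 c1 (pc_h (y := y0) h01 H _)) ?eqxx //.
rewrite (pint_split c0 c1 (pc_h (y := y1) h01 H _)) ?eqxx ?orbT //; ring.
Qed.

Lemma rect_splity f x0 x1 y0 y1 (c : R) : cont_bd f x0 x1 y0 y1 -> y0 <= c <= y1 ->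
  x0 <= x1 -> rect f x0 x1 y0 y1 = rect f x0 x1 y0 c + rect f x0 x1 c y1.
Proof.
move=> H /andP[c0 c1] h01; rewrite /rect /vint.
rewrite (pint_split c0 c1 (pc_v (x := x1) h01 H _)) ?eqxx ?orbT //.
rewrite (pint_split c0 c1 (pc_v (x := x0) h01 H _)) ?eqxx //; ring.
Qed.

Lemma rectB f g x0 x1 y0 y1 : cont_bd f x0 x1 y0 y1 -> cont_bd g x0 x1 y0 y1 ->
  x0 <= x1 -> y0 <= y1 ->
  rect (fun z => f z - g z) x0 x1 y0 y1 = rect f x0 x1 y0 y1 - rect g x0 x1 y0 y1.
Proof.
move=> hf hg hx hy; rewrite /rect /hint /vint.
have E x : (fun y => 'i%C * (f (x +i* y) - g (x +i* y))) =
   (fun y => 'i%C * f (x +i* y) - 'i%C * g (x +i* y)).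
  by apply: funext => y; rewrite mulrBr.
rewrite !E !pintB;
  try by [apply: (pc_h hy); [eassumption|rewrite eqxx ?orbT]|
          apply: (pc_v hx); [eassumption|rewrite eqxx ?orbT]].
ring.
Qed.

Lemma rect_bound f x0 x1 y0 y1 (M : R) : cont_bd f x0 x1 y0 y1 ->
  x0 <= x1 -> y0 <= y1 ->
  (forall x y, on_bd x0 x1 y0 y1 x y -> cm (f (x +i* y)) <= M) ->
  cm (rect f x0 x1 y0 y1) <= 4 * M * (x1 - x0 + (y1 - y0)).
Proof.
move=> H hx hy HM; rewrite /rect.
have hh y : (y == y0) || (y == y1) -> cm (hint f y x0 x1) <= M * 2 * (x1 - x0).
  move=> hy'; apply: pint_bound => //; first exact: pc_h H hy'.
  move=> t ht; apply: HM; apply/and3P; split=> //;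
  by case/orP: hy' => /eqP->; rewrite ?eqxx ?lexx ?hy ?orbT.
have vv x : (x == x0) || (x == x1) -> cm (vint f x y0 y1) <= M * 2 * (y1 - y0).
  move=> hx'; apply: pint_bound => //; first exact: pc_v H hx'.
  move=> t ht; rewrite cmM cmi mul1r; apply: HM; apply/and3P; split=> //;
  by case/orP: hx' => /eqP->; rewrite ?eqxx ?lexx ?hx ?orbT.
have := hh y0; rewrite eqxx => /(_ isT) a1; have := hh y1; rewrite eqxx orbT => /(_ isT) a2.
have := vv x0; rewrite eqxx => /(_ isT) a3; have := vv x1; rewrite eqxx orbT => /(_ isT) a4.
apply: le_trans (cmB _ _) _; have b1 := cmD (hint f y0 x0 x1 - hint f y1 x0 x1) (vint f x1 y0 y1).
have b2 := cmB (hint f y0 x0 x1) (hint f y1 x0 x1).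
clear -a1 a2 a3 a4 b1 b2; lra.
Qed.

Lemma rect_prim f F x0 x1 y0 y1 : x0 <= x1 -> y0 <= y1 -> cont_rect f x0 x1 y0 y1 ->
  (forall x y, x0 <= x <= x1 -> y0 <= y <= y1 -> hasd F (x +i* y) (f (x +i* y))) ->
  rect f x0 x1 y0 y1 = 0.
Proof.
move=> hx hy H HF.
have h y : (y == y0) || (y == y1) -> hint f y x0 x1 = F (x1 +i* y) - F (x0 +i* y).
  move=> hy'; have E (t : R) : (0 +i* y) + t%:C * 1 = t +i* y.
    by simpc.
  rewrite /hint (@pint_prim _ F (0 +i* y) 1) ?E //; first exact: pc_h hy (cont_rect_bd H) hy'.
  move=> t ht; exists (f (t +i* y)); last by rewrite mulr1.
  by rewrite E; apply: HF => //; case/orP: hy' => /eqP->; rewrite lexx ?hy.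
have v x : (x == x0) || (x == x1) -> vint f x y0 y1 = F (x +i* y1) - F (x +i* y0).
  move=> hx'; have E (t : R) : (x +i* 0) + t%:C * 'i%C = x +i* t.
    by simpc.
  rewrite /vint (@pint_prim _ F (x +i* 0) 'i%C) ?E //; first exact: pc_v hx (cont_rect_bd H) hx'.
  move=> t ht; exists (f (x +i* t)); last by rewrite mulrC.
  by rewrite E; apply: HF => //; case/orP: hx' => /eqP->; rewrite lexx ?hx.
by rewrite /rect !h ?v ?eqxx ?orbT //; ring.
Qed.

Lemma small_pow2 (c d : R) : 0 < d -> exists n, c / 2 ^+ n < d.
Proof.
move=> d0; have [c0|c0] := leP c 0.
  by exists 0%N; rewrite expr0 divr1; apply: le_lt_trans d0.
exists (Num.bound (c / d)); rewrite ltr_pdivrMr ?exprn_gt0 // mulrC -ltr_pdivrMr //.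
apply: lt_le_trans (archi_boundP _) _; first by rewrite divr_ge0 // ltW.
by rewrite -natrX ler_nat ltnW // ltn_expl.
Qed.

(** Compactness of a rectangle as an induction principle: a failure of [P] on the whole passes to a
    nested sequence of quarters, which shrink to a point where the local hypothesis contradicts it.
    The index n counts the halvings. It yields Goursat's theorem, the boundedness of functions on
    rectangles and the existence of accumulation points. *)
Lemma bisection (P : R -> R -> nat -> Prop) (x0 y0 w v : R) : 0 <= w -> 0 <= v ->
  (forall x y n (w' := w / 2 ^+ n.+1) (v' := v / 2 ^+ n.+1),
     x0 <= x -> x + (w' + w') <= x0 + w -> y0 <= y -> y + (v' + v') <= y0 + v ->
     P x y n.+1 -> P (x + w') y n.+1 -> P x (y + v') n.+1 ->
     P (x + w') (y + v') n.+1 -> P x y n) ->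
  (forall x y, x0 <= x <= x0 + w -> y0 <= y <= y0 + v ->
     exists2 d : R, 0 < d & forall x' y' n,
       x0 <= x' -> x' + w / 2 ^+ n <= x0 + w -> y0 <= y' -> y' + v / 2 ^+ n <= y0 + v ->
       x' <= x <= x' + w / 2 ^+ n -> y' <= y <= y' + v / 2 ^+ n ->
       (w + v) / 2 ^+ n < d -> P x' y' n) ->
  P x0 y0 0%N.
Proof.
move=> w0 v0 step loc; apply: contrapT => nP.
pose wn n : R := w / 2 ^+ n; pose vn n : R := v / 2 ^+ n.
have wS n : wn n = wn n.+1 + wn n.+1 by rewrite /wn exprS; field; rewrite expf_neq0.
have vS n : vn n = vn n.+1 + vn n.+1 by rewrite /vn exprS; field; rewrite expf_neq0.
have wn0 n : 0 <= wn n by rewrite divr_ge0 // exprn_ge0.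
have vn0 n : 0 <= vn n by rewrite divr_ge0 // exprn_ge0.
pose next (p : R * R) n := let: (x, y) := p in
  if ~~ `[< P x y n.+1 >] then (x, y) else
  if ~~ `[< P (x + wn n.+1) y n.+1 >] then (x + wn n.+1, y) else
  if ~~ `[< P x (y + vn n.+1) n.+1 >] then (x, y + vn n.+1) else
  (x + wn n.+1, y + vn n.+1).
pose fix s (n : nat) : R * R := if n is m.+1 then next (s m) m else (x0, y0).
have sx n : (s n).1 <= (s n.+1).1 <= (s n).1 + wn n.+1.
  rewrite /= /next; case: (s n) => x y.
  by do 3 ?[case: asboolP => _ /=]; rewrite ?lexx ?lerDl ?wn0.
have sy n : (s n).2 <= (s n.+1).2 <= (s n).2 + vn n.+1.
  rewrite /= /next; case: (s n) => x y.
  by do 3 ?[case: asboolP => _ /=]; rewrite ?lexx ?lerDl ?vn0.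
have rg n : [/\ x0 <= (s n).1, (s n).1 + wn n <= x0 + w, y0 <= (s n).2 &
                    (s n).2 + vn n <= y0 + v].
  elim: n => [|n [h1 h2 h3 h4]]; first by rewrite /wn /vn expr0 !divr1 !lexx.
  have /andP[a1 a2] := sx n; have /andP[b1 b2] := sy n.
  by have := wS n; have := vS n; clear -h1 h2 h3 h4 a1 a2 b1 b2; split; lra.
have bad n : ~ P (s n).1 (s n).2 n.
  elim: n => [//|n IH Pn]; apply: IH; have [h1 h2 h3 h4] := rg n.
  move: Pn => /=; rewrite /next; move: h1 h2 h3 h4; case: (s n) => x y /= h1 h2 h3 h4.
  case: asboolP => //= p1; case: asboolP => //= p2; case: asboolP => //= p3 p4.
  by apply: step; rewrite -/(wn _) -/(vn _) -?wS -?vS.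
have mono (u : nat -> R) : (forall n, u n <= u n.+1) -> forall n m, (n <= m)%N -> u n <= u m.
  by move=> H n m; exact: (homo_leq (r := Order.le) (fun _ => lexx _) (@le_trans _ _) H).
have lim (u : nat -> R) (t : nat -> R) (b : R) : (forall n, u n <= u n.+1 <= u n + t n.+1) ->
   (forall n, t n = t n.+1 + t n.+1) -> (forall n, 0 <= t n) -> 
   exists X, forall n, u n <= X <= u n + t n.
  move=> hu ht t0.
  have hu1 n : u n <= u n.+1 by have /andP[] := hu n.
  have up n m : u m <= u n + t n.
    have [nm|mn] := leqP n m; last first.
      by have := mono _ hu1 _ _ (ltnW mn); have := t0 n; lra.
    have : u m + t m <= u n + t n.
      rewrite -(subnK nm); elim: (m - n)%N => [|k IH]; first by [].
      by rewrite addSn; have /andP[_] := hu (k + n)%N; have := ht (k + n)%N; lra.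
    by have := t0 m; lra.
  have hs : has_sup (range u).
    split; first by exists (u 0%N), 0%N.
    by exists (u 0%N + t 0%N) => _ [m _ <-].
  exists (sup (range u)) => n; apply/andP; split.
    by apply: sup_upper_bound => //; exists n.
  by apply: ge_sup => //; [exists (u 0%N), 0%N|move=> _ [m _ <-]].
have [X HX] := lim (fun n => (s n).1) wn 0 sx wS wn0.
have [Y HY] := lim (fun n => (s n).2) vn 0 sy vS vn0.
have hX : x0 <= X <= x0 + w.
  by have := HX 0%N; rewrite /= /wn expr0 divr1.
have hY : y0 <= Y <= y0 + v.
  by have := HY 0%N; rewrite /= /vn expr0 divr1.
have [d d0 Hd] := loc X Y hX hY.
have [n hn] := small_pow2 (w + v) d0.
have [h1 h2 h3 h4] := rg n.
by apply: (bad n); apply: Hd.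
Qed.

Lemma goursat f x0 x1 y0 y1 : x0 <= x1 -> y0 <= y1 ->
  (forall x y, x0 <= x <= x1 -> y0 <= y <= y1 -> exists l, hasd f (x +i* y) l) ->
  rect f x0 x1 y0 y1 = 0.
Proof.
move=> hx hy df.
have cf : cont_rect f x0 x1 y0 y1.
  by move=> x y h1 h2; have [l] := df x y h1 h2; exact: hasd_ccont.
pose w := x1 - x0; pose v := y1 - y0.
have w0 : 0 <= w by rewrite subr_ge0.
have v0 : 0 <= v by rewrite subr_ge0.
suff H e : 0 < e -> cm (rect f x0 x1 y0 y1) <= e * (4 * (w + v) ^+ 2 + 1).
  apply/eqP; rewrite -cm_eq0 eq_le cm_ge0 andbT leNgt; apply/negP => h.
  have K0 : 0 < 4 * (w + v) ^+ 2 + 1 by have := sqr_ge0 (w + v); lra.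
  have := H (cm (rect f x0 x1 y0 y1) / (2 * (4 * (w + v) ^+ 2 + 1))).
  rewrite divr_gt0 // ?mulr_gt0 // => /(_ isT).
  set A := cm _ in h *; set B := (4 * _ + 1) in K0 *.
  have -> : A / (2 * B) * B = A / 2 by field; rewrite gt_eqF.
  lra.
move=> e0.
have -> : rect f x0 x1 y0 y1 = rect f x0 (x0 + w / 2 ^+ 0) y0 (y0 + v / 2 ^+ 0).
  by rewrite !expr0 !divr1 /w /v [x0 + _]addrC subrK [y0 + _]addrC subrK.
(* The bound K / 4^n is the sum of four bounds K / 4^(n+1), hence passes from the quarters to the
   whole; [K] is what the estimate of a small rectangle yields. *)
pose K := 4 * e * (w + v) ^+ 2.
suff : cm (rect f x0 (x0 + w / 2 ^+ 0) y0 (y0 + v / 2 ^+ 0)) <= K / 4 ^+ 0.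
  move/le_trans; apply; rewrite expr0 divr1 /K; lra.
apply: (@bisection (fun x y n => cm (rect f x (x + w / 2 ^+ n) y (y + v / 2 ^+ n)) <= K / 4 ^+ n)
   x0 y0 w v) => //.
  move=> x y n w' v' h1 h2 h3 h4 p1 p2 p3 p4.
  have w'0 : 0 <= w' by rewrite divr_ge0 // exprn_ge0.
  have v'0 : 0 <= v' by rewrite divr_ge0 // exprn_ge0.
  have -> : w / 2 ^+ n = w' + w' by rewrite /w' exprS; field; rewrite expf_neq0.
  have -> : v / 2 ^+ n = v' + v' by rewrite /v' exprS; field; rewrite expf_neq0.
  have cf' a b c d : x <= a -> b <= x + (w' + w') -> y <= c -> d <= y + (v' + v') ->
    cont_rect f a b c d.
    rewrite /w [x0 + _]addrC subrK in h2; rewrite /v [y0 + _]addrC subrK in h4.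
    by move=> k1 k2 k3 k4; apply: cont_rect_sub cf; [apply: le_trans k1|apply: le_trans h2|
      apply: le_trans k3|apply: le_trans h4].
  have xw : x <= x + w' by rewrite lerDl.
  have yv : y <= y + v' by rewrite lerDl.
  have xw2 : x + w' <= x + (w' + w') by rewrite addrA lerDl.
  have yv2 : y + v' <= y + (v' + v') by rewrite addrA lerDl.
  have xw3 := le_trans xw xw2; have yv3 := le_trans yv yv2.
  rewrite (@rect_splitx f x _ y _ (x + w')) ?xw //; last exact: (cont_rect_bd (cf' _ _ _ _ _ _ _ _)).
  rewrite (@rect_splity f x _ y _ (y + v')) ?yv //; last exact: (cont_rect_bd (cf' _ _ _ _ _ _ _ _)).
  rewrite (@rect_splity f (x + w') _ y _ (y + v')) ?yv //; last exact: (cont_rect_bd (cf' _ _ _ _ _ _ _ _)).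
  rewrite -/w' -/v' -!addrA in p1 p2 p3 p4.
  have -> : K / 4 ^+ n = 4 * (K / 4 ^+ n.+1) by rewrite exprS; field; rewrite expf_neq0.
  have H4 (a b c d : C) (k : R) : cm a <= k -> cm b <= k -> cm c <= k -> cm d <= k ->
     cm (a + b + (c + d)) <= 4 * k.
    by clear; move=> *; have := cmD (a + b) (c + d); have := cmD a b; have := cmD c d; lra.
  exact: H4.
move=> x y hX hY; have {}hX : x0 <= x <= x1 by rewrite /w addrC subrK in hX.
have {}hY : y0 <= y <= y1 by rewrite /v addrC subrK in hY.
have [l dl] := df x y hX hY; have [d d0 Hd] := dl e e0.
exists d => // x' y' n h1 h2 h3 h4 hx' hy' hn.
set w' := w / 2 ^+ n in h2 hx' *; set v' := v / 2 ^+ n in h4 hy' *.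
have w'0 : 0 <= w' by rewrite divr_ge0 // exprn_ge0.
have v'0 : 0 <= v' by rewrite divr_ge0 // exprn_ge0.
have wv : (w + v) / 2 ^+ n = w' + v' by rewrite mulrDl.
set p := x +i* y in dl Hd.
(* The affine part of f at p has the primitive [F], so its integral vanishes; the remainder is at
   most e (w' + v') on a boundary of length 2 (w' + v'). *)
pose lin z := f p + l * (z - p).
pose F z := f p * z + l / 2 * (z - p) ^+ 2.
have dF z : hasd F z (lin z).
  have := hasdD (hasdZ (f p) (hasd_id z)) (hasdZ (l / 2)
    (hasdM (hasdB (hasd_id z) (hasd_cst p z)) (hasdB (hasd_id z) (hasd_cst p z)))).
  have -> : f p * 1 + l / 2 * ((1 - 0) * (z - p) + (z - p) * (1 - 0)) = lin z.
    by rewrite /lin; field.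
  by [].
have dlin z : hasd lin z l.
  have := hasdD (hasd_cst (f p) z) (hasdZ l (hasdB (hasd_id z) (hasd_cst p z))).
  by rewrite subr0 mulr1 add0r.
have cl : cont_rect lin x' (x' + w') y' (y' + v') by move=> s t _ _; apply: hasd_ccont (dlin _).
have cf' : cont_rect f x' (x' + w') y' (y' + v').
  rewrite /w [x0 + _]addrC subrK in h2; rewrite /v [y0 + _]addrC subrK in h4.
  by apply: cont_rect_sub cf.
have cfd s t : x' <= s <= x' + w' -> y' <= t <= y' + v' -> exists m, hasd f (s +i* t) m.
  rewrite /w [x0 + _]addrC subrK in h2; rewrite /v [y0 + _]addrC subrK in h4.
  move=> /andP[s1 s2] /andP[t1 t2]; apply: df.
    by rewrite (le_trans h1) // (le_trans s2).
  by rewrite (le_trans h3) // (le_trans t2).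
have z0 : rect lin x' (x' + w') y' (y' + v') = 0.
  by apply: (@rect_prim lin F); rewrite ?lerDl.
have := rectB (cont_rect_bd cf') (cont_rect_bd cl); rewrite !lerDl z0 subr0 => /(_ w'0 v'0) <-.
have -> : K / 4 ^+ n = 4 * (e * (w' + v')) * (w' + v').
  have H4 : (4 : R) ^+ n = 2 ^+ n * 2 ^+ n by rewrite -exprMn -natrM.
  by rewrite -wv /K H4; field; rewrite expf_neq0.
have := @rect_bound (fun z => f z - lin z) x' (x' + w') y' (y' + v') (e * (w' + v')).
rewrite ![_ + _ - _]addrAC !subrr !add0r !lerDl; apply => //.
  by move=> s t /and3P[hs ht _]; have [m dm] := cfd s t hs ht; exact: (hasd_ccont (hasdB dm (dlin _))).
move=> s t /and3P[hs ht _]; have -> : f (s +i* t) - lin (s +i* t) = f (p + (s +i* t - p)) - f p - l * (s +i* t - p).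
  by rewrite [p + _]addrC subrK /lin; ring.
have hz : cm (s +i* t - p) <= w' + v'.
  apply: le_trans (ler_cm_ReIm _) _ => /=.
  by apply: lerD; rewrite ler_norml; clear -hs ht hx' hy'; lra.
apply: le_trans (Hd _ _) _; first by apply: le_lt_trans hz _; rewrite -wv.
by rewrite ler_wpM2l // ltW.
Qed.

Lemma rintZ (k : R) u a b : rcont u a b -> rint (fun x => k * u x) a b = k * rint u a b.
Proof. by move=> hu; rewrite /rint RintegralZl //; exact: rcont_integrable. Qed.

Lemma rcontZ (k : R) u a b : rcont u a b -> rcont (fun x => k * u x) a b.
Proof. by move=> hu t ht; apply: cvgMl_tmp; exact: hu. Qed.

Lemma rintD u v a b : rcont u a b -> rcont v a b ->
  rint (fun x => u x + v x) a b = rint u a b + rint v a b.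
Proof.
by move=> hu hv; rewrite /rint RintegralD //; exact: rcont_integrable.
Qed.

Lemma pintZ (k : C) phi a b : pc phi a b -> pint (fun t => k * phi t) a b = k * pint phi a b.
Proof.
move=> H; have h1 := pc_Re H; have h2 := pc_Im H.
apply: complex_ext; rewrite ?ReM ?ImM /=.
  rewrite -rintZ // -rintZ // -rintB; try exact: rcontZ.
  by congr rint; apply: funext => t; rewrite ReM.
rewrite -rintZ // -rintZ // -rintD; try exact: rcontZ.
by congr rint; apply: funext => t; rewrite ImM.
Qed.

Lemma rectZ (k : C) f x0 x1 y0 y1 : x0 <= x1 -> y0 <= y1 -> cont_bd f x0 x1 y0 y1 ->
  rect (fun z => k * f z) x0 x1 y0 y1 = k * rect f x0 x1 y0 y1.
Proof.
move=> hx hy H; rewrite /rect /hint /vint.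
have E x : (fun y => 'i%C * (k * f (x +i* y))) = (fun y => k * ('i%C * f (x +i* y))).
  by apply: funext => y; rewrite mulrCA.
rewrite !E !(pintZ k);
  try by [apply: (pc_h hy); [eassumption|rewrite eqxx ?orbT]|
          apply: (pc_v hx); [eassumption|rewrite eqxx ?orbT]].
ring.
Qed.

Lemma Im_inv (x y : R) : Im (x +i* y)^-1 = - y / (x ^+ 2 + y ^+ 2).
Proof. by rewrite /= mulNr. Qed.

Lemma Re_inv (x y : R) : Re (x +i* y)^-1 = x / (x ^+ 2 + y ^+ 2).
Proof. by []. Qed.

(** The exact value of the integral is 2 pi i, but a lower bound is enough. On each side the
    component of the integrand that counts is r / (t^2 + r^2) up to sign, at least 1 / (2 r), and
    the side has length 2 r. *)
Lemma rect_inv (p q r : R) : 0 < r ->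
  cont_bd (fun z => (z - (p +i* q))^-1) (p - r) (p + r) (q - r) (q + r) ->
  4 <= Im (rect (fun z => (z - (p +i* q))^-1) (p - r) (p + r) (q - r) (q + r)).
Proof.
move=> r0 H; set k := (fun z => _) in H *.
have hx : p - r <= p + r by lra.
have hy : q - r <= q + r by lra.
have kE x y : k (x +i* y) = ((x - p) +i* (y - q))^-1 by [].
have kI x y : Im (k (x +i* y)) = - (y - q) / ((x - p) ^+ 2 + (y - q) ^+ 2).
  by rewrite kE Im_inv.
have kR x y : Re (k (x +i* y)) = (x - p) / ((x - p) ^+ 2 + (y - q) ^+ 2).
  by rewrite kE Re_inv.
clearbody k.
have bnd (t : R) : `|t| <= r -> (2 * r)^-1 <= r / (t ^+ 2 + r ^+ 2).
  move=> ht; have t2 : t ^+ 2 <= r ^+ 2 by rewrite -(@real_normK _ t) ?num_real // ler_pXn2r // nnegrE // ltW.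
  have r2 : 0 < t ^+ 2 + r ^+ 2 by rewrite ltr_wpDl ?sqr_ge0 // exprn_gt0.
  rewrite ler_pdivlMr // mulrC ler_pdivrMr ?mulr_gt0 //.
  by clear -t2; rewrite !expr2 in t2 *; lra.
have one (a : R) : (2 * r)^-1 * (a + r - (a - r)) = 1 by field; rewrite gt_eqF.
have bot : 1 <= Im (hint k (q - r) (p - r) (p + r)).
  rewrite -[X in X <= _](one p); apply: (rint_ge hx).
    by apply: pc_Im; apply: pc_h H _ => //; rewrite eqxx.
  move=> t ht; rewrite kI; have -> : q - r - q = - r by ring.
  rewrite opprK sqrrN; apply: bnd; rewrite ler_norml; lra.
have top : Im (hint k (q + r) (p - r) (p + r)) <= -1.
  rewrite -[X in _ <= - X](one p) -mulNr -(rint_cst _ hx); apply: rint_le.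
  - by apply: pc_Im; apply: pc_h H _ => //; rewrite eqxx orbT.
  - exact: rcont_cst.
  move=> t ht; rewrite kI; have -> : q + r - q = r by ring.
  by rewrite mulNr lerN2; apply: bnd; rewrite ler_norml; lra.
have ReIm x : (fun t => Im ('i%C * k (x +i* t))) = (fun t => Re (k (x +i* t))).
  by apply: funext => t; rewrite ImM Rei Imi mul0r add0r mul1r.
have rgt : 1 <= Im (vint k (p + r) (q - r) (q + r)).
  rewrite -[X in X <= _](one q); apply: (rint_ge hy).
    by apply: pc_Im; apply: pc_v H _ => //; rewrite eqxx orbT.
  move=> t ht; rewrite ImM Rei Imi mul0r add0r mul1r kR; have -> : p + r - p = r by ring.
  rewrite addrC; apply: bnd; rewrite ler_norml; lra.
have lft : Im (vint k (p - r) (q - r) (q + r)) <= -1.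
  rewrite -[X in _ <= - X](one q) -mulNr -(rint_cst _ hy); apply: rint_le.
  - by apply: pc_Im; apply: pc_v H _ => //; rewrite eqxx.
  - exact: rcont_cst.
  move=> t ht; rewrite ImM Rei Imi mul0r add0r mul1r kR; have -> : p - r - p = - r by ring.
  rewrite sqrrN mulNr lerN2 addrC; apply: bnd; rewrite ler_norml; lra.
rewrite /rect !(ImD, ImN); clear -bot top rgt lft; lra.
Qed.

(** The lines through the sides of the small square cut the rest of the large one into four
    rectangles free of the singular point, to which [goursat] applies. *)
Lemma rect_annulus h (p q r s : R) : 0 < s -> s <= r ->
  (forall x y, p - r <= x <= p + r -> q - r <= y <= q + r -> (x != p) || (y != q) ->
     exists m, hasd h (x +i* y) m) ->
  rect h (p - r) (p + r) (q - r) (q + r) = rect h (p - s) (p + s) (q - s) (q + s).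
Proof.
move=> s0 sr dh.
have cb a b c d : p - r <= a -> b <= p + r -> q - r <= c -> d <= q + r ->
    (forall x y, on_bd a b c d x y -> (x != p) || (y != q)) -> cont_bd h a b c d.
  move=> h1 h2 h3 h4 hn x y B; have hz := hn _ _ B.
  move: B => /and3P[/andP[b1 b2] /andP[b3 b4] _].
  have [||m dm] := dh x y _ _ hz; last exact: hasd_ccont dm.
    by rewrite (le_trans h1) // (le_trans b2).
  by rewrite (le_trans h3) // (le_trans b4).
have gz a b c d : p - r <= a -> b <= p + r -> q - r <= c -> d <= q + r -> a <= b -> c <= d ->
    (forall x y, a <= x <= b -> c <= y <= d -> (x != p) || (y != q)) -> rect h a b c d = 0.
  move=> h1 h2 h3 h4 h5 h6 hn; apply: goursat => // x y B1 B2; have hz := hn _ _ B1 B2.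
  move: B1 B2 => /andP[b1 b2] /andP[b3 b4]; apply: dh => //.
    by rewrite (le_trans h1) // (le_trans b2).
  by rewrite (le_trans h3) // (le_trans b4).
have [p1 p2 p3] : [/\ p - r <= p - s, p - s <= p + s & p + s <= p + r] by clear -s0 sr; split; lra.
have [q1 q2 q3] : [/\ q - r <= q - s, q - s <= q + s & q + s <= q + r] by clear -s0 sr; split; lra.
have p12 := le_trans p1 p2; have p23 := le_trans p2 p3; have p123 := le_trans p1 p23.
have q12 := le_trans q1 q2; have q23 := le_trans q2 q3; have q123 := le_trans q1 q23.
have p4 : p + s != p by rewrite -subr_eq0 addrAC subrr add0r gt_eqF.
have p5 : p - s != p by rewrite -subr_eq0 addrAC subrr add0r oppr_eq0 gt_eqF.
have p6 : p + r != p by rewrite -subr_eq0 addrAC subrr add0r gt_eqF // (lt_le_trans s0).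
have p7 : p - r != p by rewrite -subr_eq0 addrAC subrr add0r oppr_eq0 gt_eqF // (lt_le_trans s0).
have q4 : q + s != q by rewrite -subr_eq0 addrAC subrr add0r gt_eqF.
have q5 : q - s != q by rewrite -subr_eq0 addrAC subrr add0r oppr_eq0 gt_eqF.
have q6 : q + r != q by rewrite -subr_eq0 addrAC subrr add0r gt_eqF // (lt_le_trans s0).
have q7 : q - r != q by rewrite -subr_eq0 addrAC subrr add0r oppr_eq0 gt_eqF // (lt_le_trans s0).
have bdn (a b c d x y : R) : [&& a != p, b != p, c != q & d != q] ->
     on_bd a b c d x y -> (x != p) || (y != q).
  move=> /and4P[n1 n2 n3 n4] /and3P[_ _ /or4P[]/eqP->]; by rewrite ?n1 ?n2 ?n3 ?n4 ?orbT.
have ltn (a b t : R) : a <= t <= b -> (b < p) || (p < a) -> t != p.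
  by move=> /andP[t1 t2] /orP[]H; [rewrite lt_eqF // (le_lt_trans t2)|rewrite gt_eqF // (lt_le_trans H)].
have ltn' (a b t : R) : a <= t <= b -> (b < q) || (q < a) -> t != q.
  by move=> /andP[t1 t2] /orP[]H; [rewrite lt_eqF // (le_lt_trans t2)|rewrite gt_eqF // (lt_le_trans H)].
rewrite (@rect_splity h _ _ _ _ (q - s)) ?q1 //; last first.
  by apply: cb => // x y; apply: bdn; rewrite p6 p7 q6 q7.
rewrite (gz _ _ _ (q - s)) //; last first.
  by move=> x y _ /ltn' ->; rewrite ?orbT // gtrBl s0.
rewrite add0r (@rect_splity h _ _ _ _ (q + s)) ?q2 //; last first.
  by apply: cb => // x y; apply: bdn; rewrite p6 p7 q5 q6.
rewrite (gz _ _ (q + s)) //; last first.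
  by move=> x y _ /ltn' ->; rewrite ?orbT // ltrDl s0 orbT.
rewrite addr0 (@rect_splitx h _ _ _ _ (p - s)) ?p1 //; last first.
  by apply: cb => // x y; apply: bdn; rewrite p6 p7 q5 q4.
rewrite (gz _ (p - s)) //; last first.
  by move=> x y /ltn -> //; rewrite gtrBl s0.
rewrite add0r (@rect_splitx h _ _ _ _ (p + s)) ?p2 //; last first.
  by apply: cb => // x y; apply: bdn; rewrite p5 p6 q5 q4.
rewrite (gz (p + s)) ?addr0 // => x y /ltn -> //; by rewrite ltrDl s0 orbT.
Qed.

(** The functions [H1] = (g - g z0) / (z - z0)^2 and l / (z - z0) have the same integral, since
    their difference [h] is o(1 / |z - z0|) and its integral can be taken over arbitrarily small
    squares. The integral of 1 / (z - z0) has modulus at least 4 and that of [H1] is at most 32 M /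
    r, whence the bound on l. *)
Lemma cauchy_square g (p q r M : R) (l : C) : 0 < r ->
  (forall x y, p - r <= x <= p + r -> q - r <= y <= q + r ->
     (exists m, hasd g (x +i* y) m) /\ cm (g (x +i* y)) <= M) ->
  hasd g (p +i* q) l -> cm l <= 8 * M / r.
Proof.
move=> r0 dg dl; set z0 := p +i* q in dl *.
have M0 : 0 <= M.
  by have [||_] := dg p q; [lra|lra|apply: le_trans; exact: cm_ge0].
pose H1 z := (g z - g z0) * ((z - z0)^-1 * (z - z0)^-1).
pose k z := (z - z0)^-1.
pose h z := H1 z - l * k z.
have dk z : z != z0 -> hasd k z (- (z - z0)^-1 ^+ 2).
  move=> zz; have zz' : z - z0 != 0 by rewrite subr_eq0.
  have := hasd_comp (hasdB (hasd_id z) (hasd_cst z0 z)) (hasdV zz').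
  by rewrite subr0 mulr1.
have dH1 x y : p - r <= x <= p + r -> q - r <= y <= q + r -> x +i* y != z0 ->
   exists m, hasd H1 (x +i* y) m.
  move=> hx hy zz; have [[m dm] _] := dg x y hx hy.
  by eexists; apply: (hasdM (hasdB dm (hasd_cst (g z0) _)) (hasdM (dk _ zz) (dk _ zz))).
have dh x y : p - r <= x <= p + r -> q - r <= y <= q + r -> x +i* y != z0 ->
   exists m, hasd h (x +i* y) m.
  move=> hx hy zz; have [m dm] := dH1 x y hx hy zz.
  by eexists; apply: (hasdB dm (hasdZ l (dk _ zz))).
have nz x y : (x != p) || (y != q) -> x +i* y != z0.
  by move=> H; rewrite /z0 eq_complex /= negb_and.
have bdz (s x y : R) : 0 < s -> on_bd (p - s) (p + s) (q - s) (q + s) x y ->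
    x +i* y != z0 /\ s <= cm (x +i* y - z0).
  move=> s0 /and3P[hx hy E].
  have : s <= `|x - p| \/ s <= `|y - q|.
    case/or4P: E => /eqP->; [left|left|right|right];
      rewrite ?[_ - s]addrC ?[_ + s]addrC addrK ?normrN; exact: ler_norm.
  move=> H; split.
    apply: nz; apply/orP; case: H => H; [left|right]; apply/eqP => E2;
    by move: H; rewrite E2 subrr normr0 leNgt s0.
  by case: H => /le_trans; apply; [apply: le_trans (ler_Re_cm _)|apply: le_trans (ler_Im_cm _)].
have annulus (s : R) : 0 < s -> s <= r ->
   rect h (p - r) (p + r) (q - r) (q + r) = rect h (p - s) (p + s) (q - s) (q + s).
  by move=> s0 sr; apply: rect_annulus => // x y hx hy /nz; exact: dh.
have bdr x y : on_bd (p - r) (p + r) (q - r) (q + r) x y ->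
   [/\ p - r <= x <= p + r, q - r <= y <= q + r, x +i* y != z0 & r <= cm (x +i* y - z0)].
  by move=> B; have [h1 h2] := bdz _ _ _ r0 B; move: B => /and3P[].
have px : p - r <= p + r by lra.
have qy : q - r <= q + r by lra.
have h0 : rect h (p - r) (p + r) (q - r) (q + r) = 0.
  apply/eqP; rewrite -cm_eq0 eq_le cm_ge0 andbT leNgt; apply/negP.
  set A := cm _ => A0; have AE : A = cm (rect h (p - r) (p + r) (q - r) (q + r)) by [].
  clearbody A; have e0 : 0 < A / 32 by clear -A0; lra.
  have [d d0 Hd] := dl _ e0.
  pose s := Num.min r (d / 4).
  have s0 : 0 < s by rewrite lt_min r0 divr_gt0.
  have sr : s <= r by rewrite ge_min lexx.
  have sd : s <= d / 4 by rewrite ge_min lexx orbT.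
  have hs := annulus s s0 sr.
  have : A <= 4 * (A / 32 / s) * (p + s - (p - s) + (q + s - (q - s))).
    rewrite {1}AE hs; clear AE hs annulus bdr px qy; apply: rect_bound; [|clear -s0; lra|clear -s0; lra|].
      move=> x y B; have [hz _] := bdz _ _ _ s0 B; move: B => /and3P[hx hy _].
      by have [||m dm] := dh x y _ _ hz; [clear -hx sr; lra|clear -hy sr; lra|exact: hasd_ccont dm].
    move=> x y B; have [hz hzs] := bdz _ _ _ s0 B; move: B => /and3P[hx hy _].
    set z := x +i* y in hz hzs *.
    have zz : z - z0 != 0 by rewrite subr_eq0.
    have -> : h z = (g (z0 + (z - z0)) - g z0 - l * (z - z0)) * ((z - z0)^-1 * (z - z0)^-1).
      by rewrite [z0 + _]addrC subrK /h /H1 /k; field.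
    have cz : cm (z - z0) < d.
      apply: le_lt_trans (ler_cm_ReIm _) _; rewrite /z /z0 /=.
      have h1 : `|x - p| <= s by rewrite ler_norml; clear -hx; lra.
      have h2 : `|y - q| <= s by rewrite ler_norml; clear -hy; lra.
      clear -h1 h2 sd s0; lra.
    have zp : 0 < cm (z - z0) by rewrite cm_gt0.
    have h1 := Hd _ cz; rewrite [cm (_ * _)]cmM [cm (_^-1 * _)]cmM cmV.
    apply: le_trans (ler_wpM2r _ h1) _; first by rewrite mulr_ge0 ?invr_ge0 ?cm_ge0.
    have -> : A / 32 * cm (z - z0) * ((cm (z - z0))^-1 / cm (z - z0)) = A / 32 / cm (z - z0).
      by field; rewrite gt_eqF.
    apply: ler_wpM2l; first exact: ltW e0.
    by rewrite lef_pV2 ?posrE.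
  have -> : 4 * (A / 32 / s) * (p + s - (p - s) + (q + s - (q - s))) = A / 2.
    by field; rewrite gt_eqF.
  lra.
have cbH1 : cont_bd H1 (p - r) (p + r) (q - r) (q + r).
  by move=> x y /bdr[h1 h2 h3 _]; have [m dm] := dH1 _ _ h1 h2 h3; exact: hasd_ccont dm.
have cbk : cont_bd k (p - r) (p + r) (q - r) (q + r).
  by move=> x y /bdr[h1 h2 h3 _]; exact: hasd_ccont (dk _ h3).
have cbk2 : cont_bd (fun z => l * k z) (p - r) (p + r) (q - r) (q + r).
  by move=> x y /bdr[h1 h2 h3 _]; exact: hasd_ccont (hasdZ l (dk _ h3)).
have E : rect H1 (p - r) (p + r) (q - r) (q + r) = l * rect k (p - r) (p + r) (q - r) (q + r).
  by rewrite -rectZ //; apply/eqP; rewrite -subr_eq0 -rectB //; apply/eqP.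
have b1 : cm (rect H1 (p - r) (p + r) (q - r) (q + r)) <= 32 * M / r.
  have -> : 32 * M / r = 4 * (2 * M / r ^+ 2) * (p + r - (p - r) + (q + r - (q - r))).
    by field; rewrite gt_eqF.
  apply: rect_bound => // x y /bdr[h1 h2 h3 h4]; rewrite /H1 !cmM cmV.
  have [_ m1] := dg _ _ h1 h2; have [||_ m2] := dg p q; try lra.
  have {}m1 : cm (g (x +i* y) - g z0) <= 2 * M by have := cmB (g (x +i* y)) (g z0); rewrite -/z0 in m2; lra.
  rewrite expr2 invfM; have c0 : 0 < cm (x +i* y - z0) by apply: lt_le_trans h4.
  have iv : (cm (x +i* y - z0))^-1 <= r^-1 by rewrite lef_pV2 ?posrE.
  by rewrite ler_pM ?cm_ge0 ?mulr_ge0 ?invr_ge0 ?cm_ge0 // ler_pM ?invr_ge0 ?cm_ge0.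
have b2 : 4 <= cm (rect k (p - r) (p + r) (q - r) (q + r)).
  apply: le_trans (rect_inv r0 cbk) _; apply: le_trans (ler_norm _) _; exact: ler_Im_cm.
rewrite E cmM in b1.
have : cm l * 4 <= 32 * M / r by apply: le_trans b1; rewrite ler_wpM2l ?cm_ge0.
have -> : 32 * M / r = 4 * (8 * M / r) by ring.
clear; lra.
Qed.

Lemma cauchy_estimate g (z0 : C) (r M : R) (l : C) : 0 < r ->
  (forall z, cm (z - z0) <= r -> (exists m, hasd g z m) /\ cm (g z) <= M) ->
  hasd g z0 l -> cm l <= 16 * M / r.
Proof.
case: z0 => p q r0 H dl; have r2 : 0 < r / 2 by lra.
have -> : 16 * M / r = 8 * M / (r / 2) by field; rewrite gt_eqF.
apply: (cauchy_square r2 _ dl) => x y hx hy; apply: H.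
apply: le_trans (ler_cm_ReIm _) _ => /=.
have h1 : `|x - p| <= r / 2 by rewrite ler_norml; lra.
have h2 : `|y - q| <= r / 2 by rewrite ler_norml; lra.
lra.
Qed.

End Goursat.

(** * Consequences of Cauchy's estimate: Taylor's formula, limits, local surjectivity *)

Section Analytic.
Variable R : realType.
Local Notation C := R[i].
Local Notation Re := (@complex.Re R).
Local Notation Im := (@complex.Im R).

Definition cder : (C -> C) -> C -> C :=
  locked (fun f : Cplx R -> Cplx R => f^`()).

Lemma cderE (f : Cplx R -> Cplx R) z : cder f z = f^`() z.
Proof. by rewrite /cder -lock. Qed.

Lemma hasd_cder f z l : hasd f z l -> cder f z = l.
Proof. by rewrite cderE => /hasd_derivable[_]. Qed.

Lemma hasdP f z : (exists l, hasd f z l) -> hasd f z (cder f z).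
Proof. by case=> l h; rewrite (hasd_cder h). Qed.

Lemma cm_ge_sub (a b : C) : cm a - cm (b - a) <= cm b.
Proof. by have := cmD b (a - b); rewrite [b + _]addrC subrK cmBC; lra. Qed.

Definition bounded_diff (g : C -> C) (z0 : C) (r M : R) :=
  forall z, cm (z - z0) <= r -> (exists m, hasd g z m) /\ cm (g z) <= M.

Lemma bounded_diff_ge0 g z0 (r M : R) : 0 < r -> bounded_diff g z0 r M -> 0 <= M.
Proof.
move=> r0 H; have [|_] := H z0; first by rewrite subrr cm0 ltW.
by apply: le_trans; exact: cm_ge0.
Qed.

Lemma bounded_diff_sub g z0 z1 (r s M : R) : cm (z1 - z0) + s <= r ->
  bounded_diff g z0 r M -> bounded_diff g z1 s M.
Proof.
move=> h H z hz; apply: H; apply: le_trans (cm_tri z1 _ _) _.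
by clear -h hz; clra.
Qed.

Lemma lip_of_deriv f (a b : C) (M : R) :
  (forall t : R, 0 <= t <= 1 -> exists2 l, hasd f (a + t%:C * (b - a)) l & cm l <= M) ->
  cm (f b - f a) <= M * cm (b - a).
Proof.
move=> H; have := @seg_mvt R f a b 0 M; rewrite mul0r subr0; apply.
by move=> t /H[l h1 h2]; exists l => //; rewrite subr0.
Qed.

Lemma seg_cm (a b z0 : C) (r t : R) : 0 <= t <= 1 -> cm (a - z0) <= r -> cm (b - z0) <= r ->
  cm (a + t%:C * (b - a) - z0) <= r.
Proof.
move=> /andP[t0 t1] ha hb.
have -> : a + t%:C * (b - a) - z0 = (1 - t)%:C * (a - z0) + t%:C * (b - z0).
  by rewrite rmorphB rmorph1; ring.
apply: le_trans (cmD _ _) _; rewrite !cmM !cm_real !ger0_norm ?subr_ge0 //.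
have h1 : (1 - t) * cm (a - z0) <= (1 - t) * r by rewrite ler_wpM2l ?subr_ge0.
have h2 : t * cm (b - z0) <= t * r by rewrite ler_wpM2l.
by clear -h1 h2; clra.
Qed.

(** The factor 16 of [cauchy_estimate], the factor 32 of the bound on g' over the disc of half
    radius, and 4 for the radius r / 4 on which differences are estimated. *)
Definition tayC : R := 16 * (32 * 4).

Lemma tayC_ge0 : 0 <= tayC. Proof. by rewrite /tayC; lra. Qed.

(** Cauchy's estimate is applied to z |-> g (z + k) - g z, which is O(|k|) on the disc of radius r /
    4 by the bound on g'. No second derivative appears. *)
Lemma deriv_lip g z0 (r M : R) (k l l' : C) : 0 < r -> bounded_diff g z0 r M ->
  cm k <= r / 4 -> hasd g z0 l -> hasd g (z0 + k) l' -> cm (l' - l) <= tayC * M / r ^+ 2 * cm k.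
Proof.
move=> r0 H hk dl dl'.
have r2 : 0 < r / 2 by clra.
have r4 : 0 < r / 4 by clra.
have d1 z m : cm (z - z0) <= r / 2 -> hasd g z m -> cm m <= 32 * M / r.
  move=> hz dm; have -> : 32 * M / r = 16 * M / (r / 2) by field; rewrite gt_eqF.
  apply: (cauchy_estimate r2 _ dm); apply: bounded_diff_sub H; clra.
pose d z := g (z + k) - g z.
have kz z : z + k - z = k by rewrite addrAC subrr add0r.
have hd z : cm (z - z0) <= r / 4 -> (exists m, hasd d z m) /\ cm (d z) <= 32 * M / r * cm k.
  move=> hz.
  have hzk : cm (z + k - z0) <= r / 2.
    by rewrite addrAC; apply: le_trans (cmD _ _) _; clear -hz hk; clra.
  have hz2 : cm (z - z0) <= r / 2 by clear -hz r0; clra.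
  have hr x : x <= r / 2 -> x <= r by move=> hx; clear -hx r0; clra.
  split.
    have [[m dm] _] := H _ (hr _ hzk); have [[m' dm'] _] := H _ (hr _ hz2).
    exists (m - m'); apply: hasdB dm'.
    have := hasd_comp (hasdD (hasd_id z) (hasd_cst k z)) dm.
    by rewrite addr0 mulr1.
  rewrite /d -[X in _ * cm X](kz z); apply: lip_of_deriv => t ht.
  have hs := seg_cm ht hz2 hzk.
  by have [[m dm] _] := H _ (hr _ hs); exists m => //; exact: d1 dm.
have dd : hasd d z0 (l' - l).
  apply: hasdB dl; have := hasd_comp (hasdD (hasd_id z0) (hasd_cst k z0)) dl'.
  by rewrite addr0 mulr1.
apply: le_trans (cauchy_estimate r4 hd dd) _.
by rewrite le_eqVlt /tayC; apply/orP; left; apply/eqP; field; rewrite gt_eqF.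
Qed.

Lemma taylor2 g z0 (r M : R) (l h : C) : 0 < r -> bounded_diff g z0 r M ->
  cm h <= r / 4 -> hasd g z0 l ->
  cm (g (z0 + h) - g z0 - l * h) <= tayC * M / r ^+ 2 * cm h ^+ 2.
Proof.
move=> r0 H hh dl.
have E : z0 + h - z0 = h by rewrite addrAC subrr add0r.
have M0 := bounded_diff_ge0 r0 H.
rewrite -[X in l * X]E expr2 mulrA -[X in _ * cm X]E; apply: seg_mvt => t ht.
have ht2 : cm (t%:C * (z0 + h - z0)) <= cm h.
  by rewrite E cmM cm_real ger0_norm ?ler_piMl ?cm_ge0 //; case/andP: ht.
have [|[m dm] _] := H (z0 + t%:C * (z0 + h - z0)).
  by rewrite [z0 + _ * _]addrC addrK; clear -hh ht2 r0; clra.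
exists m => //; apply: le_trans (deriv_lip r0 H _ dl dm) _.
  exact: le_trans hh.
apply: ler_wpM2l => //.
by rewrite mulr_ge0 ?invr_ge0 ?exprn_ge0 ?(ltW r0) // mulr_ge0 // tayC_ge0.
Qed.

(** The limit is the supremum of the numbers that are eventually lower bounds of the sequence. *)
Lemma cauchy_lim (u : nat -> R) :
  (forall e : R, 0 < e -> exists N : nat, forall n m, (N <= n)%N -> (N <= m)%N -> `|u n - u m| <= e) ->
  exists l : R, forall e : R, 0 < e -> exists N : nat, forall n, (N <= n)%N -> `|u n - l| <= e.
Proof.
move=> H; pose S := [set x : R | exists N : nat, forall n, (N <= n)%N -> x <= u n].
have hS e N : (forall n m, (N <= n)%N -> (N <= m)%N -> `|u n - u m| <= e) ->
    S (u N - e) /\ (forall x, S x -> x <= u N + e).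
  move=> h; split.
    by exists N => n Nn; have := h n N Nn (leqnn N); rewrite ler_norml => /andP[]; clra.
  move=> x [N' hx]; have := hx (maxn N N') (leq_maxr _ _).
  by have := h _ _ (leq_maxl N N') (leqnn N); rewrite ler_norml => /andP[]; clra.
have sS : has_sup S.
  have [N hN] := H 1 ltr01; have [h1 h2] := hS _ _ hN.
  by split; [exists (u N - 1)|exists (u N + 1)].
exists (sup S) => e e0; have e2 : 0 < e / 2 by clra.
have [N hN] := H _ e2; have [h1 h2] := hS _ _ hN.
have a1 : u N - e / 2 <= sup S by apply: sup_upper_bound.
have a2 : sup S <= u N + e / 2 by apply: ge_sup => //; case: sS.
exists N => n Nn; have := hN n N Nn (leqnn N); rewrite !ler_norml => /andP[b1 b2].
by clear -a1 a2 b1 b2; clra.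
Qed.

Definition ccvg (u : nat -> C) (l : C) := forall e : R, 0 < e ->
  exists N : nat, forall n, (N <= n)%N -> cm (u n - l) <= e.

Lemma ccauchy_lim (u : nat -> C) :
  (forall e : R, 0 < e -> exists N : nat, forall n m, (N <= n)%N -> (N <= m)%N -> cm (u n - u m) <= e) ->
  exists l : C, ccvg u l.
Proof.
move=> H.
have [a ha] : exists l : R, forall e : R, 0 < e -> exists N : nat, forall n, (N <= n)%N -> `|Re (u n) - l| <= e.
  apply: cauchy_lim => e e0; have [N hN] := H e e0; exists N => n m h1 h2.
  by rewrite -ReN -ReD; apply: le_trans (ler_Re_cm _) _; exact: hN.
have [b hb] : exists l : R, forall e : R, 0 < e -> exists N : nat, forall n, (N <= n)%N -> `|Im (u n) - l| <= e.
  apply: cauchy_lim => e e0; have [N hN] := H e e0; exists N => n m h1 h2.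
  by rewrite -ImN -ImD; apply: le_trans (ler_Im_cm _) _; exact: hN.
exists (a +i* b) => e e0; have e2 : 0 < e / 2 by clra.
have [N hN] := ha _ e2; have [N' hN'] := hb _ e2.
exists (maxn N N') => n; rewrite geq_max => /andP[/hN h1 /hN' h2].
apply: le_trans (ler_cm_ReIm _) _; rewrite !(ReD, ImD, ReN, ImN) /=.
by clear -h1 h2; clra.
Qed.

Lemma ccvg_le (u : nat -> C) (l a : C) (M : R) : ccvg u l ->
  (exists N : nat, forall n, (N <= n)%N -> cm (u n - a) <= M) -> cm (l - a) <= M.
Proof.
move=> H [N hN]; rewrite leNgt; apply/negP => h.
have e0 : 0 < (cm (l - a) - M) / 2 by clear -h; clra.
have [N' hN'] := H _ e0.
have := hN' _ (leq_maxr N N'); have := hN _ (leq_maxl N N').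
have := cm_tri (u (maxn N N')) l a; rewrite [cm (l - u _)]cmBC.
by clear -h; clra.
Qed.

Lemma tri6 (ln lm k A A' B B' X Y : C) : cm ((ln - lm) * k) <= cm (A - X) + cm (B - X)
  + cm (A' - Y) + cm (B' - Y) + cm (A - A' - ln * k) + cm (B - B' - lm * k).
Proof.
have -> : (ln - lm) * k = (A - X) - (B - X) - (A' - Y) + (B' - Y) - (A - A' - ln * k)
  + (B - B' - lm * k) by ring.
apply: le_trans (cmD _ _) _; rewrite lerD2r.
apply: le_trans (cmB _ _) _; rewrite lerD2r.
apply: le_trans (cmD _ _) _; rewrite lerD2r.
apply: le_trans (cmB _ _) _; rewrite lerD2r.
exact: cmB.
Qed.

Lemma tri4 (l A A' B B' L h : C) : cm (A - A' - L * h) <= cm (B - B' - l * h) +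
  cm (B - A) + cm (B' - A') + cm (l - L) * cm h.
Proof.
have -> : A - A' - L * h = (B - B' - l * h) - (B - A) + (B' - A') + (l - L) * h by ring.
apply: le_trans (cmD _ _) _; rewrite [cm (_ * h)]cmM lerD2r.
apply: le_trans (cmD _ _) _; rewrite lerD2r.
exact: cmB.
Qed.

(** The Taylor remainder K |h|^2 is the same for all n. Hence the derivatives at z0, being close to
    difference quotients with one fixed increment, form a Cauchy sequence, and Taylor's formula
    passes to the limit. Pointwise convergence suffices. *)
Lemma bounded_limit_diff (s : nat -> C -> C) (s' : C -> C) z0 (r M : R) : 0 < r ->
  (forall n, bounded_diff (s n) z0 r M) ->
  (forall z, cm (z - z0) <= r -> ccvg (s ^~ z) (s' z)) -> exists l, hasd s' z0 l.
Proof.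
move=> r0 H cv.
have z0r : cm (z0 - z0) <= r by rewrite subrr cm0 ltW.
have M0 := bounded_diff_ge0 r0 (H 0%N).
pose K := tayC * M / r ^+ 2.
have K0 : 0 <= K by rewrite /K mulr_ge0 ?invr_ge0 ?exprn_ge0 ?(ltW r0) // mulr_ge0 // tayC_ge0.
pose l n := cder (s n) z0.
have dl n : hasd (s n) z0 (l n) by apply: hasdP; have [] := H n _ z0r.
have T n h : cm h <= r / 4 -> cm (s n (z0 + h) - s n z0 - l n * h) <= K * cm h ^+ 2.
  by move=> hh; apply: taylor2 (H n) _ (dl n).
have lim_in h : cm h <= r / 4 -> cm (z0 + h - z0) <= r.
  by move=> hh; rewrite addrAC subrr add0r; clear -hh r0; clra.
have [L hL] : exists L, ccvg l L.
  apply: ccauchy_lim => e e0.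
  (* This increment makes the Taylor error K d^2 at most e d / 4; convergence is then used only at
     z0 and z0 + d. *)
  pose d := Num.min (r / 4) (e / (4 * (K + 1))).
  have K1 : 0 < K + 1 by clear -K0; clra.
  have d0 : 0 < d by rewrite lt_min !divr_gt0 // mulr_gt0.
  have dr : cm d%:C <= r / 4 by rewrite cm_real ger0_norm ?(ltW d0) // ge_min lexx.
  have dK : K * d <= e / 4.
    have h1 : d <= e / (4 * (K + 1)) by rewrite ge_min lexx orbT.
    have h2 : (K + 1) * d <= e / 4.
      rewrite mulrC -ler_pdivlMr //; apply: le_trans h1 _.
      by rewrite invfM mulrA.
    by clear -h2 d0; clra.
  have ed : 0 < e * d / 8 by rewrite divr_gt0 ?mulr_gt0.
  have [N hN] := cv _ (lim_in _ dr) _ ed.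
  have [N' hN'] := cv _ z0r _ ed.
  exists (maxn N N') => n m; rewrite !geq_max => /andP[n1 n2] /andP[m1 m2].
  have cd : cm d%:C = d by rewrite cm_real ger0_norm ?ltW.
  have tn := T n _ dr; have tm := T m _ dr; rewrite cd in tn tm.
  have a1 := hN n n1; have a2 := hN m m1; have a3 := hN' n n2; have a4 := hN' m m2.
  have Kd : K * d ^+ 2 <= e / 4 * d by rewrite expr2 mulrA ler_wpM2r // ltW.
  rewrite -(ler_pM2r d0) -[X in _ * X]cd -cmM.
  apply: le_trans (tri6 _ _ _ (s n (z0 + d%:C)) (s n z0) (s m (z0 + d%:C)) (s m z0)
    (s' (z0 + d%:C)) (s' z0)) _.
  by clear -tn tm a1 a2 a3 a4 Kd; clra.
have TT h : cm h <= r / 4 -> cm (s' (z0 + h) - s' z0 - L * h) <= K * cm h ^+ 2.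
  move=> hh; apply/ler_addgt0Pr => e e0.
  have e3 : 0 < e / (2 + cm h + 1) by rewrite divr_gt0 //; have := cm_ge0 h; clra.
  have [N1 h1] := cv _ (lim_in _ hh) _ e3; have [N2 h2] := cv _ z0r _ e3.
  have [N3 h3] := hL _ e3; pose n := maxn N1 (maxn N2 N3).
  have {}h1 := h1 n (leq_maxl _ _).
  have {}h2 := h2 n (leq_trans (leq_maxl _ _) (leq_maxr _ _)).
  have {}h3 := h3 n (leq_trans (leq_maxr _ _) (leq_maxr _ _)).
  have tn := T n _ hh.
  apply: le_trans (tri4 (l n) _ _ (s n (z0 + h)) (s n z0) _ _) _.
  have h4 : cm (l n - L) * cm h <= e / (2 + cm h + 1) * cm h by rewrite ler_wpM2r ?cm_ge0.
  have E : e / (2 + cm h + 1) * (2 + cm h + 1) = e.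
    by rewrite divfK // gt_eqF //; have := cm_ge0 h; clra.
  by clear -tn h1 h2 h4 E e3; clra.
exists L => e e0; have K1 : 0 < K + 1 by clear -K0; clra.
exists (Num.min (r / 4) (e / (K + 1))); first by rewrite lt_min !divr_gt0.
move=> h; rewrite lt_min => /andP[h1 h2]; apply: le_trans (TT _ (ltW h1)) _.
rewrite expr2 mulrA ler_wpM2r ?cm_ge0 //.
move: h2; rewrite ltr_pdivlMr // => h2.
by have := cm_ge0 h; clear -h2; clra.
Qed.

Definition inbox (x0 x1 y0 y1 : R) (z : C) := (x0 <= Re z <= x1) && (y0 <= Im z <= y1).

Lemma box_bounded (phi : C -> R) (x0 x1 y0 y1 : R) : x0 <= x1 -> y0 <= y1 ->
  (forall z, inbox x0 x1 y0 y1 z -> exists2 d : R, 0 < d & exists M : R,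
     forall w, inbox x0 x1 y0 y1 w -> cm (w - z) < d -> phi w <= M) ->
  exists M : R, forall z, inbox x0 x1 y0 y1 z -> phi z <= M.
Proof.
move=> hx hy H; pose w := x1 - x0; pose v := y1 - y0.
have w0 : 0 <= w by rewrite subr_ge0.
have v0 : 0 <= v by rewrite subr_ge0.
have x0w : x0 + w = x1 by rewrite /w addrC subrK.
have y0v : y0 + v = y1 by rewrite /v addrC subrK.
suff [M hM] : exists M : R, forall z, inbox x0 (x0 + w / 2 ^+ 0) y0 (y0 + v / 2 ^+ 0) z -> phi z <= M.
  by exists M => z hz; apply: hM; rewrite expr0 !divr1 x0w y0v.
apply: (@bisection R (fun x y n => exists M : R, forall z,
   inbox x (x + w / 2 ^+ n) y (y + v / 2 ^+ n) z -> phi z <= M) x0 y0 w v) => //.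
  move=> x y n w' v' _ _ _ _ [M1 h1] [M2 h2] [M3 h3] [M4 h4].
  exists (Num.max (Num.max M1 M2) (Num.max M3 M4)) => z /andP[/andP[z1 z2] /andP[z3 z4]].
  have ww : w / 2 ^+ n = w' + w' by rewrite /w' exprS; field; rewrite expf_neq0.
  have vv : v / 2 ^+ n = v' + v' by rewrite /v' exprS; field; rewrite expf_neq0.
  rewrite ww addrA in z2; rewrite vv addrA in z4; rewrite !le_max.
  have [a|a] := leP (Re z) (x + w'); have [b|b] := leP (Im z) (y + v').
  - by rewrite h1 // /inbox z1 a z3 b.
  - by rewrite h3 ?orbT // /inbox z1 a (ltW b) z4.
  - by rewrite h2 ?orbT // /inbox (ltW a) z2 z3 b.
  - by rewrite h4 ?orbT // /inbox (ltW a) z2 (ltW b) z4.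
move=> x y; rewrite x0w y0v => hX hY.
have [|d d0 [M hM]] := H (x +i* y); first by rewrite /inbox /= hX hY.
exists d => // x' y' n h1 h2 h3 h4 hx' hy' hn; exists M => z hz.
move: hz => /andP[/andP[z1 z2] /andP[z3 z4]].
apply: hM.
  by rewrite /inbox (le_trans h1 z1) (le_trans z2 h2) (le_trans h3 z3) (le_trans z4 h4).
apply: le_lt_trans (ler_cm_ReIm _) _; rewrite !(ReD, ImD, ReN, ImN) /=.
apply: le_lt_trans hn; rewrite mulrDl lerD // ler_norml.
  by clear -hx' z1 z2; move: hx' z2; set a := _ / _; clra.
by clear -hy' z3 z4; move: hy' z4; set a := _ / _; clra.
Qed.

(** If the infimum m were not attained, 1 / (phi - m) would be locally bounded, hence bounded on the
    rectangle, and phi would stay away from m. *)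
Lemma box_min (phi : C -> R) (x0 x1 y0 y1 : R) : x0 <= x1 -> y0 <= y1 ->
  (forall z, 0 <= phi z) ->
  (forall z, inbox x0 x1 y0 y1 z -> forall e : R, 0 < e -> exists2 d : R, 0 < d &
     forall w, inbox x0 x1 y0 y1 w -> cm (w - z) < d -> `|phi w - phi z| <= e) ->
  exists2 z, inbox x0 x1 y0 y1 z & forall w, inbox x0 x1 y0 y1 w -> phi z <= phi w.
Proof.
move=> hx hy p0 H.
pose S := [set phi z | z in [set z | inbox x0 x1 y0 y1 z]].
have S0 : S !=set0.
  by exists (phi (x0 +i* y0)), (x0 +i* y0) => //; rewrite /= /inbox /= !lexx hx hy.
have iS : has_inf S by split=> //; exists 0 => _ [z _ <-].
pose m := inf S.
have mle w : inbox x0 x1 y0 y1 w -> m <= phi w.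
  by move=> hw; apply: ge_inf; [case: iS|exists w].
apply: contrapT => nz.
have mlt w : inbox x0 x1 y0 y1 w -> m < phi w.
  move=> hw; rewrite lt_def mle // andbT; apply/negP => /eqP E.
  by apply: nz; exists w => // w' /mle; rewrite E.
have [M hM] : exists M : R, forall z, inbox x0 x1 y0 y1 z -> (phi z - m)^-1 <= M.
  apply: box_bounded => // z hz; have mz := mlt z hz.
  have e0 : 0 < (phi z - m) / 2 by rewrite divr_gt0 // subr_gt0.
  have [d d0 hd] := H z hz _ e0; exists d => //; exists ((phi z - m) / 2)^-1 => w hw wz.
  have := hd w hw wz; rewrite ler_norml => /andP[h1 _].
  rewrite lef_pV2 ?posrE ?subr_gt0 ?mlt //; clear -h1; clra.
have M0 : 0 < M.
  have hz : inbox x0 x1 y0 y1 (x0 +i* y0) by rewrite /inbox /= !lexx hx hy.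
  by apply: lt_le_trans (hM _ hz); rewrite invr_gt0 subr_gt0 mlt.
have iM : 0 < M^-1 by rewrite invr_gt0.
have [_ [z hz <-] hlt] := inf_adherent iM iS.
have := hM z hz; rewrite -[M]invrK lef_pV2 ?posrE ?subr_gt0 ?mlt // -/m in hlt *.
by move=> h; move: hlt h; rewrite -/m; clear; clra.
Qed.

Lemma ccont_box_bounded (f : C -> C) (x0 x1 y0 y1 : R) : x0 <= x1 -> y0 <= y1 ->
  (forall z, inbox x0 x1 y0 y1 z -> ccont f z) ->
  exists M : R, forall z, inbox x0 x1 y0 y1 z -> cm (f z) <= M.
Proof.
move=> hx hy H; apply: box_bounded => // z /H /(_ 1 ltr01)[d d0 hd].
exists d => //; exists (cm (f z) + 1) => w _ /hd h.
by have := cmBB (f w) (f z); clear -h; clra.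
Qed.

(* A point of a square at which |f - w| is minimal either is a solution of f z = w or
   lies on the boundary, the derivative being close to A <> 0. *)
Lemma local_surj (f : C -> C) (q A w : C) (r : R) : 0 < r -> A != 0 ->
  (forall z, cm (z - q) <= 2 * r -> exists2 l, hasd f z l & cm (l - A) <= cm A / 4) ->
  cm (w - f q) <= cm A * r / 4 -> exists2 z, cm (z - q) <= 2 * r & f z = w.
Proof.
move=> r0 A0 df hw; have cA : 0 < cm A by rewrite cm_gt0.
pose B z := inbox (Re q - r) (Re q + r) (Im q - r) (Im q + r) z.
have Bq z : B z -> cm (z - q) <= 2 * r.
  move=> /andP[h1 h2]; apply: le_trans (ler_cm_ReIm _) _.
  rewrite !(ReD, ImD, ReN, ImN).
  have h3 : `|Re z - Re q| <= r by rewrite ler_norml; clear -h1; clra.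
  have h4 : `|Im z - Im q| <= r by rewrite ler_norml; clear -h2; clra.
  by clear -h3 h4; clra.
have qr : cm (q - q) <= 2 * r by rewrite subrr cm0; clear -r0; clra.
have est z : cm (z - q) <= 2 * r -> 3 / 4 * cm A * cm (z - q) <= cm (f z - f q).
  move=> hz; have h : cm (f z - f q - A * (z - q)) <= cm A / 4 * cm (z - q).
    by apply: seg_mvt => t ht; apply: df; exact: seg_cm.
  have := cm_ge_sub (A * (z - q)) (f z - f q); rewrite [cm (A * _)]cmM.
  by clear -h; clra.
have [||||z Bz zmin] := @box_min (fun z => cm (f z - w)) (Re q - r) (Re q + r) (Im q - r) (Im q + r).
- by clear -r0; clra.
- by clear -r0; clra.
- by move=> z; exact: cm_ge0.
- move=> z Bz e e0; have [l /hasd_ccont c _] := df z (Bq z Bz).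
  have [d d0 hd] := c e e0; exists d => // y _ /hd h.
  rewrite ler_norml; have h1 := cmBB (f y - w) (f z - w); have h2 := cmBB (f z - w) (f y - w).
  rewrite (_ : f y - w - (f z - w) = f y - f z) in h1; last by ring.
  rewrite (_ : f z - w - (f y - w) = f z - f y) in h2; last by ring.
  rewrite [cm (f z - f y)]cmBC in h2; clear -h h1 h2; clra.
exists z; first exact: Bq.
apply/eqP; rewrite -subr_eq0; apply/negPn/negP => fw.
have fw0 : 0 < cm (f z - w) by rewrite cm_gt0.
have qz : cm (f z - w) <= cm A * r / 4.
  apply: le_trans (zmin q _) _; first by rewrite /inbox; clear -r0; clra.
  by rewrite cmBC.
have zq : cm (z - q) < r.
  have h1 := est _ (Bq z Bz); have h2 := cm_tri w (f z) (f q).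
  have h3 : 3 / 4 * (cm A * cm (z - q)) <= cm A * r / 2 by clear -h1 h2 hw qz; clra.
  rewrite -(ltr_pM2l cA); have : 0 < cm A * r by rewrite mulr_gt0.
  by clear -h3; clra.
have [l dl hl] := df z (Bq z Bz).
have l0 : l != 0.
  by rewrite -cm_gt0; have := cm_ge_sub A l; clear -hl cA; clra.
have e0 : 0 < cm l / 4 by rewrite divr_gt0 // cm_gt0.
have [d d0 hd] := dl _ e0.
have c0 : 0 < cm ((f z - w) / l) by rewrite cm_gt0 mulf_neq0 // invr_eq0.
(* A damped Newton step: the displacement - t (f z - w) / l diminishes |f - w| to first order. As z
   is at distance less than r from q, a small t keeps the new point in the square, and minimality is
   violated. *)
pose t := Num.min 1 (Num.min (d / 2) (r - cm (z - q)) / cm ((f z - w) / l)).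
have t0 : 0 < t by rewrite lt_min ltr01 divr_gt0 // lt_min divr_gt0 // subr_gt0.
have t1 : t <= 1 by rewrite ge_min lexx.
pose h := - (t%:C * ((f z - w) / l)).
have ch : cm h = t * cm ((f z - w) / l) by rewrite cmN cmM cm_real ger0_norm // ltW.
have ht : cm h <= Num.min (d / 2) (r - cm (z - q)).
  by rewrite ch -ler_pdivlMr // ge_min lexx orbT.
rewrite le_min in ht; move: ht => /andP[hd2 hr].
have zh : B (z + h).
  have hq : cm (z + h - q) <= r.
    by rewrite addrAC; apply: le_trans (cmD _ _) _; clear -hr; clra.
  have hRe := le_trans (ler_Re_cm _) hq; have hIm := le_trans (ler_Im_cm _) hq.
  rewrite !(ReD, ImD, ReN, ImN) !ler_norml in hRe hIm.
  by rewrite /B /inbox !(ReD, ImD, ReN, ImN); clear -hRe hIm; clra.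
have := zmin _ zh; rewrite leNgt => /negP; apply.
have E : f (z + h) - w = (f (z + h) - f z - l * h) + (1 - t)%:C * (f z - w).
  by rewrite /h rmorphB rmorph1; field.
rewrite E; apply: le_lt_trans (cmD _ _) _; rewrite cmM cm_real ger0_norm ?subr_ge0 //.
have h1 : cm (f (z + h) - f z - l * h) <= cm l / 4 * cm h by apply: hd; clear -hd2 d0; clra.
have h2 : cm l / 4 * cm h = t / 4 * cm (f z - w).
  by rewrite ch cm_div; field; rewrite gt_eqF // cm_gt0.
have : 0 < t * cm (f z - w) by rewrite mulr_gt0.
by clear -h1 h2; clra.
Qed.

(** The segment between two points of the region may be long compared with the discs where g is
    controlled. Points closer than r / 4 are handled by [deriv_lip]; for the others the bound L1 on
    g' suffices, as 2 L1 = (8 L1 / r) (r / 4). *)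
Lemma cder_box_lip (g : C -> C) (y1 A : R) : 0 < y1 -> 0 < A ->
  (forall z, 0 < Im z -> exists l, hasd g z l) ->
  exists2 L : R, 0 < L & forall u v, y1 <= Im u -> cm u <= A -> y1 <= Im v -> cm v <= A ->
    cm (cder g u) <= L /\ cm (cder g u - cder g v) <= L * cm (u - v).
Proof.
move=> y10 A0 dg.
have y12 : 0 < y1 / 2 by clra.
have hy : y1 / 2 <= A + 1 + y1 by clear -y10 A0; clra.
have hx : - A - 1 <= A + 1 by clear -A0; clra.
have [|M hM] := @ccont_box_bounded g (- A - 1) (A + 1) (y1 / 2) (A + 1 + y1) hx hy.
  move=> z /andP[_ /andP[hz _]]; have [l dl] := dg z (lt_le_trans y12 hz).
  exact: hasd_ccont dl.
pose r := Num.min (y1 / 2) 1.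
have r0 : 0 < r by rewrite lt_min y12 ltr01.
have r1 : r <= 1 by rewrite ge_min lexx orbT.
have ry : r <= y1 / 2 by rewrite ge_min lexx.
have bd u : y1 <= Im u -> cm u <= A -> bounded_diff g u r M.
  move=> u1 u2 z hz; have h1 := ler_Re_cm u; have h2 := ler_Im_cm u.
  have h3 := le_trans (ler_Re_cm _) hz; have h4 := le_trans (ler_Im_cm _) hz.
  rewrite !(ReD, ImD, ReN, ImN) !ler_norml in h1 h2 h3 h4.
  split; first by apply: dg; clear -u1 h4 ry y10; clra.
  by apply: hM; rewrite /inbox; clear -u1 u2 h1 h2 h3 h4 ry r1 y10; clra.
have du u : y1 <= Im u -> hasd g u (cder g u).
  by move=> hu; apply: hasdP; apply: dg; apply: lt_le_trans hu.
have ii : y1 <= Im (0 +i* (y1 : R)) by rewrite lexx.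
have M0 : 0 <= M.
  have : inbox (- A - 1) (A + 1) (y1 / 2) (A + 1 + y1) (0 +i* y1).
    by rewrite /inbox /=; clear -A0 y10; clra.
  by move=> /hM; apply: le_trans; exact: cm_ge0.
pose L1 := 16 * M / r; pose L2 := tayC * M / r ^+ 2.
have L10 : 0 <= L1 by rewrite /L1 !mulr_ge0 // invr_ge0 ltW.
have L20 : 0 <= L2 by rewrite /L2 !mulr_ge0 ?tayC_ge0 // invr_ge0 exprn_ge0 // ltW.
have L1r : 0 <= 8 * L1 / r by rewrite !mulr_ge0 // invr_ge0 ltW.
have db u : y1 <= Im u -> cm u <= A -> cm (cder g u) <= L1.
  by move=> u1 u2; exact: cauchy_estimate (bd u u1 u2) (du u u1).
exists (L1 + L2 + 8 * L1 / r + 1); first by clear -L10 L20 L1r; clra.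
move=> u v u1 u2 v1 v2; split.
  by have := db u u1 u2; clear -L20 L1r; clra.
have c0 := cm_ge0 (u - v).
have [h|h] := leP (cm (u - v)) (r / 4).
  have dv := du u u1; rewrite -[u](subrK v) [_ + v]addrC in dv.
  have := deriv_lip r0 (bd v v1 v2) h (du v v1) dv; rewrite [v + _]addrC subrK -/L2 => k.
  by apply: le_trans k _; rewrite ler_wpM2r //; clear -L10 L1r; clra.
have k : cm (cder g u - cder g v) <= 2 * L1.
  by apply: le_trans (cmB _ _) _; have := db u u1 u2; have := db v v1 v2; clear; clra.
apply: le_trans k _.
have -> : 2 * L1 = 8 * L1 / r * (r / 4) by field; rewrite gt_eqF.
apply: ler_pM; rewrite ?(ltW h) //; last by clear -L10 L20; clra.
by rewrite divr_ge0 // ltW.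
Qed.

End Analytic.

(** * The bump and the values it forces *)

Section Loop.
Variable R : realType.
Local Notation C := R[i].
Local Notation Re := (@complex.Re R).
Local Notation Im := (@complex.Im R).
Local Notation ii := (@ci R).

(* The inverse of the Moebius map u |-> (u - b) / (u - conj b) from the upper half-plane
   onto the unit disc. *)
Definition from_disc (b s : C) : C := (b - conjc b * s) / (1 - s).

Lemma conjcE (b : C) : conjc b = b - (2 * Im b)%:C * ii.
Proof. by case: b => x y; apply: complex_ext; rewrite !reimE /=; ring. Qed.

Lemma cm_conj (b : C) : cm (conjc b) = cm b.
Proof. by rewrite !cmE; case: b => x y /=; rewrite sqrrN. Qed.

Lemma from_disc0 (b : C) : from_disc b 0 = b.
Proof. by rewrite /from_disc mulr0 !subr0 divr1. Qed.

Lemma cm_lt1_neq (s : C) : cm s < 1 -> 1 - s != 0.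
Proof. by move=> h; rewrite -cm_gt0; have := cmBB 1 s; rewrite cm1; lra. Qed.

Lemma from_discB (b s s0 : C) : 1 - s != 0 -> 1 - s0 != 0 ->
  from_disc b s - from_disc b s0 = (2 * Im b)%:C * ii * (s - s0) / ((1 - s) * (1 - s0)).
Proof. by move=> h h0; rewrite /from_disc conjcE; field; rewrite h h0. Qed.

Lemma from_disc_im (b s : C) : cm s < 1 ->
  Im (from_disc b s) = Im b * (1 - cm s ^+ 2) / cm (1 - s) ^+ 2.
Proof.
move=> /cm_lt1_neq h; rewrite !cm_sqr /from_disc.
case: b s h => [x y] [s t] h.
have h2 : (1 - s) ^+ 2 + (0 - t) ^+ 2 != 0.
  have : cm (1 - (s +i* t)) != 0 by rewrite cm_eq0.
  by rewrite -sqrf_eq0 cm_sqr /=.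
rewrite ImM Re_inv Im_inv /=; field.
by move: h2; rewrite sub0r sqrrN.
Qed.

Lemma from_disc_pos (b s : C) : 0 < Im b -> cm s < 1 -> 0 < Im (from_disc b s).
Proof.
move=> b0 s1; rewrite from_disc_im // divr_gt0 //.
  by rewrite mulr_gt0 // subr_gt0 expr_lt1 ?cm_ge0.
by rewrite exprn_gt0 // cm_gt0 cm_lt1_neq.
Qed.

Lemma hasd_from_disc (b : C) (s : C -> C) (z l : C) : cm (s z) < 1 -> hasd s z l ->
  exists m, hasd (fun w => from_disc b (s w)) z m.
Proof.
move=> /cm_lt1_neq h dl; eexists.
have d1 := hasdB (hasd_cst b z) (hasdZ (conjc b) dl).
have d2 := hasd_comp (hasdB (hasd_cst 1 z) dl) (hasdV h).
exact: (hasdM d1 d2).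
Qed.

(* With beta = 2 Im b / u, the factor z / (z + i beta) is mapped by [from_disc b] to b + u z; the
   other two make it small far away and keep it off the unit circle where Im z < 0 is allowed. *)
Definition bump (B : R) (beta : C) (z : C) : C :=
  (1 - B^-1)%:C * (z / (z + ii * beta)) * (ii * B%:C / (z + ii * B%:C)) ^+ 2.

Lemma bump0 (B : R) (beta : C) : bump B beta 0 = 0.
Proof. by rewrite /bump !(mul0r, mulr0). Qed.

(** The last hypothesis says that |z + i T| >= T, that is, z lies off the disc of radius T which
    touches the real line at 0 from below. In this form the outer ball condition of the domain is
    used throughout. *)
Lemma cm_iB (B T : R) (z : C) : 0 < B -> 2 * B <= T -> - cm z ^+ 2 <= 2 * T * Im z ->
  B ^+ 2 + cm z ^+ 2 / 2 <= cm (z + ii * B%:C) ^+ 2.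
Proof.
move=> B0 hT; rewrite !cm_sqr; case: z => x y /= h; rewrite !reimE /=.
have T0 : 0 < T by apply: lt_le_trans hT; rewrite mulr_gt0.
suff : - (x ^+ 2 + y ^+ 2) / 2 <= 2 * B * y by rewrite !expr2; nra.
have [y0|y0] := leP 0 y.
  by apply: (@le_trans _ _ 0); [have := sqr_ge0 x; have := sqr_ge0 y; lra|rewrite !mulr_ge0 // ltW].
have h1 : 2 * T * y <= 2 * (2 * B) * y by rewrite ler_nM2r // ler_wpM2l.
by clear -h h1; lra.
Qed.

(** In the expansion of |z + i beta|^2 the term in Im z is bounded by the outer disc condition, and
    |beta|^2 - 2 Im beta Re z by completing the square. *)
Lemma cm_ibeta (beta z : C) (T : R) : 0 < Re beta -> 0 < T -> - cm z ^+ 2 <= 2 * T * Im z ->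
  cm z ^+ 2 * (1 - (Im beta / cm beta) ^+ 2 - Re beta / T) <= cm (z + ii * beta) ^+ 2.
Proof.
move=> beta0 T0 h; have b0 : 0 < cm beta by apply: lt_le_trans beta0 _; apply: le_trans (ler_norm _) (ler_Re_cm _).
have E : cm (z + ii * beta) ^+ 2 = cm z ^+ 2 + cm beta ^+ 2 + 2 * Re beta * Im z - 2 * Im beta * Re z.
  by rewrite !cm_sqr; case: (z) (beta) => [x y] [p q] /=; rewrite !reimE /=; ring.
have h1 : - cm z ^+ 2 * (Re beta / T) <= 2 * Re beta * Im z.
  have -> : 2 * Re beta * Im z = 2 * T * Im z * (Re beta / T) by field; rewrite gt_eqF.
  by apply: ler_wpM2r => //; rewrite divr_ge0 // ltW.
have h2 : - (Im beta / cm beta) ^+ 2 * cm z ^+ 2 <= cm beta ^+ 2 - 2 * Im beta * Re z.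
  have h3 := sqr_ge0 (Im beta / cm beta * Re z - cm beta).
  have h4 : (Im beta / cm beta * Re z - cm beta) ^+ 2 =
     (Im beta / cm beta) ^+ 2 * Re z ^+ 2 - 2 * Im beta * Re z + cm beta ^+ 2.
    by field; rewrite gt_eqF.
  have h5 : (Im beta / cm beta) ^+ 2 * Re z ^+ 2 <= (Im beta / cm beta) ^+ 2 * cm z ^+ 2.
    by rewrite ler_wpM2l ?sqr_ge0 // cm_sqr lerDl sqr_ge0.
  by clear -h3 h4 h5; lra.
by rewrite E; clear -h1 h2; lra.
Qed.

(** The hypotheses on Re beta and on Im beta each cost 1 / (2 B) in [cm_ibeta], so |z / (z + i
    beta)|^2 <= 1 / (1 - 1 / B). The prefactor 1 - 1 / B turns this into 1 - 1 / B, at most the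
    square of 1 - 1 / (2 B). The last factor of the bump is at most 1 and provides the quadratic
    decay. *)
Lemma bump_bound (B T : R) (beta z : C) : 0 < Re beta -> 2 <= B -> 2 * B <= T -> 2 * B * Re beta <= T ->
  2 * B * Im beta ^+ 2 <= cm beta ^+ 2 -> - cm z ^+ 2 <= 2 * T * Im z ->
  [/\ z + ii * beta != 0, z + ii * B%:C != 0, cm (bump B beta z) <= 1 - (2 * B)^-1 &
      cm (bump B beta z) * cm z ^+ 2 <= 2 * B ^+ 2].
Proof.
move=> beta0 B2 hT hT2 hb hz.
have B0 : 0 < B by apply: lt_le_trans B2.
have T0 : 0 < T by apply: lt_le_trans hT; rewrite mulr_gt0.
have b0 : 0 < cm beta by apply: lt_le_trans beta0 _; apply: le_trans (ler_norm _) (ler_Re_cm _).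
have h1 := cm_iB B0 hT hz; have h2 := cm_ibeta beta0 T0 hz.
have B20 : 0 < B ^+ 2 by rewrite exprn_gt0.
have z20 : 0 <= cm z ^+ 2 by rewrite exprn_ge0 // cm_ge0.
have Bi : B^-1 <= 1 / 2 by rewrite div1r lef_pV2 ?posrE.
have Bi0 : 0 < B^-1 by rewrite invr_gt0.
have h3 : (Im beta / cm beta) ^+ 2 <= B^-1 / 2.
  rewrite expr_div_n ler_pdivrMr ?exprn_gt0 //.
  have -> : B^-1 / 2 * cm beta ^+ 2 = cm beta ^+ 2 / (2 * B) by field; rewrite gt_eqF.
  by rewrite ler_pdivlMr ?mulr_gt0 // mulrC.
have h4 : Re beta / T <= B^-1 / 2.
  rewrite ler_pdivrMr //; have -> : B^-1 / 2 * T = T / (2 * B) by field; rewrite gt_eqF.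
  by rewrite ler_pdivlMr ?mulr_gt0 // mulrC.
have h5 : cm z ^+ 2 * (1 - B^-1) <= cm (z + ii * beta) ^+ 2.
  by apply: le_trans h2; rewrite ler_wpM2l //; clear -h3 h4; lra.
have n2 : z + ii * B%:C != 0.
  by rewrite -cm_eq0 -sqrf_eq0 gt_eqF //; clear -h1 B20 z20; lra.
have n1 : z + ii * beta != 0.
  have [->|z0] := eqVneq z 0.
    by rewrite add0r -cm_eq0 cmM cm_ci mul1r gt_eqF.
  rewrite -cm_eq0 -sqrf_eq0 gt_eqF //; apply: lt_le_trans h5.
  by rewrite mulr_gt0 ?exprn_gt0 ?cm_gt0 //; clear -Bi; lra.
set X := cm (z + ii * beta) in h5 *; set Y := cm (z + ii * B%:C) in h1 *.
have X0 : 0 < X by rewrite cm_gt0.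
have Y0 : 0 < Y by rewrite cm_gt0.
have cb : cm (bump B beta z) = (1 - B^-1) * (cm z / X) * (B ^+ 2 / Y ^+ 2).
  rewrite /bump cmM [cm (_ ^+ 2)]cmX [cm (_%:C * _)]cmM !cm_div [cm (ii * _)]cmM cm_ci mul1r.
  rewrite !cm_real (ger0_norm (ltW B0)) -/X -/Y expr_div_n ger0_norm //.
  by clear -Bi; lra.
have Y2 : B ^+ 2 / Y ^+ 2 <= 1.
  by rewrite ler_pdivrMr ?exprn_gt0 // mul1r; clear -h1 z20; lra.
have Y20 : 0 <= B ^+ 2 / Y ^+ 2 by rewrite divr_ge0 // exprn_ge0 // ltW.
have zX0 : 0 <= cm z / X by rewrite divr_ge0 ?cm_ge0 // ltW.
have zX : (1 - B^-1) * (cm z / X) <= 1 - (2 * B)^-1.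
  have e : (2 * B)^-1 = B^-1 / 2 by rewrite invfM mulrC.
  have n0 : 0 <= (1 - B^-1) * (cm z / X) by rewrite mulr_ge0 //; clear -Bi; lra.
  have n1' : 0 <= 1 - B^-1 / 2 by clear -Bi; lra.
  rewrite e -(@ler_pXn2r _ 2) ?nnegrE //.
  rewrite exprMn expr_div_n.
  have k1 : (1 - B^-1) ^+ 2 * (cm z ^+ 2 / X ^+ 2) <= 1 - B^-1.
    rewrite expr2 -mulrA ler_piMr; [by []|by clear -Bi; lra|].
    rewrite mulrA ler_pdivrMr ?exprn_gt0 // mul1r mulrC; exact: h5.
  apply: le_trans k1 _; rewrite !expr2; clear; set u := B^-1.
  by have := sqr_ge0 u; rewrite expr2; lra.
split=> //.
  by rewrite cb; apply: le_trans zX; rewrite ler_piMr // mulr_ge0 //; clear -Bi; lra.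
have zX1 : (1 - B^-1) * (cm z / X) <= 1.
  by apply: le_trans zX _; rewrite gerBl invr_ge0 mulr_ge0 // ltW.
rewrite cb; apply: (@le_trans _ _ (B ^+ 2 / Y ^+ 2 * cm z ^+ 2)).
  by apply: ler_wpM2r => //; apply: ler_piMl.
have h6 : B ^+ 2 * cm z ^+ 2 <= B ^+ 2 * (2 * Y ^+ 2).
  by apply: ler_wpM2l; [exact: ltW|clear -h1 B20 z20; clra].
by rewrite mulrAC ler_pdivrMr ?exprn_gt0 //; clear -h6; clra.
Qed.

Lemma bump_diff (B : R) (beta z : C) : z + ii * beta != 0 -> z + ii * B%:C != 0 ->
  exists l, hasd (bump B beta) z l.
Proof.
move=> h1 h2; eexists.
have d k : hasd (fun w => w + k) z 1 by have := hasdD (hasd_id z) (hasd_cst k z); rewrite addr0.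
have d1 := hasdM (hasd_id z) (hasd_comp (d _) (hasdV h1)).
have d2 := hasdZ (ii * B%:C) (hasd_comp (d _) (hasdV h2)).
exact: (hasdM (hasdZ (1 - B^-1)%:C d1) (hasdM d2 d2)).
Qed.

(** For bounded z all factors except z / (z + i beta) are 1 + O(1 / B). *)
Lemma bump_approx (B Q : R) (beta z : C) : 0 < Re beta -> 2 <= B -> 2 * Q <= B -> cm z <= Q -> 0 <= Im z ->
  Im beta ^+ 2 * 4 <= cm beta ^+ 2 ->
  cm (bump B beta z - z / (z + ii * beta)) <= 2 * (10 * Q + 4) / B.
Proof.
move=> beta0 B2 BQ zQ iz hb.
have B0 : 0 < B by apply: lt_le_trans B2.
have Q0 : 0 <= Q by apply: le_trans zQ; exact: cm_ge0.
have b0 : 0 < cm beta by apply: lt_le_trans beta0 _; apply: le_trans (ler_norm _) (ler_Re_cm _).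
have c0 : cm (z / (z + ii * beta)) <= 2.
  have T0 : 0 < 2 * Re beta by rewrite mulr_gt0.
  have := @cm_ibeta beta z (2 * Re beta) beta0 T0.
  have hz : - cm z ^+ 2 <= 2 * (2 * Re beta) * Im z.
    by apply: (@le_trans _ _ 0); [rewrite oppr_le0 exprn_ge0 ?cm_ge0|rewrite !mulr_ge0 // ltW].
  move/(_ hz).
  have -> : Re beta / (2 * Re beta) = 1 / 2 by field; rewrite gt_eqF.
  have h : (Im beta / cm beta) ^+ 2 <= 1 / 4.
    rewrite expr_div_n ler_pdivrMr ?exprn_gt0 //; clear -hb; lra.
  move=> h2; have h3 : cm z ^+ 2 * (1 / 4) <= cm (z + ii * beta) ^+ 2.
    by apply: le_trans h2; rewrite ler_wpM2l ?exprn_ge0 ?cm_ge0 //; clear -h; lra.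
  have h4 : cm z <= 2 * cm (z + ii * beta).
    rewrite -(@ler_pXn2r _ 2) ?nnegrE ?mulr_ge0 ?cm_ge0 // exprMn; clear -h3; lra.
  rewrite cm_div; have [->|n] := eqVneq (cm (z + ii * beta)) 0; first by rewrite invr0 mulr0.
  by rewrite ler_pdivrMr // lt_def n cm_ge0.
pose e := z / (ii * B%:C).
have iB0 : ii * B%:C != 0 by rewrite -cm_gt0 cmM cm_ci mul1r cm_real gtr0_norm.
have ce : cm e <= Q / B.
  by rewrite /e cm_div cmM cm_ci mul1r cm_real gtr0_norm // ler_wpM2r // invr_ge0 ltW.
have QB : Q / B <= 1 / 2 by rewrite ler_pdivrMr //; clear -BQ; lra.
have e1 : 1 / 2 <= cm (1 + e) by have := cmBB 1 (- e); rewrite opprK cm1 cmN; clear -ce QB; lra.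
have n1 : 1 + e != 0 by rewrite -cm_gt0; apply: lt_le_trans e1; rewrite divr_gt0.
have E1 : ii * B%:C / (z + ii * B%:C) = (1 + e)^-1.
  rewrite /e in n1 *; move: iB0 n1; set D := ii * B%:C => D0 n1.
  have -> : z + D = D * (1 + z / D) by field.
  by rewrite invfM mulVKf.
have -> : bump B beta z - z / (z + ii * beta) = z / (z + ii * beta) *
   (- (e * (2 + e)) * ((1 + e)^-1 ^+ 2) - (B^-1)%:C * (1 + e)^-1 ^+ 2).
  rewrite /bump E1 rmorphB rmorph1 /=; move: (z / _) (B^-1)%:C => v1 v2.
  by clearbody e; field.
have hX : cm ((1 + e)^-1 ^+ 2) <= 4.
  rewrite cmX cmV (_ : 4 = 2 ^+ 2); last by rewrite expr2; lra.
  rewrite ler_pXn2r ?nnegrE ?invr_ge0 ?cm_ge0 // -[2]invrK lef_pV2 ?posrE ?invr_gt0 //.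
    by rewrite -[2^-1]mul1r.
  by rewrite cm_gt0.
rewrite cmM; apply: (@le_trans _ _ (2 * (10 * (Q / B) + 4 / B))); last by clear; lra.
apply: ler_pM; rewrite ?cm_ge0 //; apply: le_trans (cmB _ _) _; apply: lerD.
  rewrite cmM cmN cmM; have h2 : cm (2 + e) <= 5 / 2.
    by apply: le_trans (cmD _ _) _; rewrite cm_nat; clear -ce QB; lra.
  apply: (@le_trans _ _ (Q / B * (5 / 2) * 4)); last by clear; lra.
  by apply: ler_pM; rewrite ?mulr_ge0 ?cm_ge0 //; apply: ler_pM; rewrite ?cm_ge0.
by rewrite cmM cm_real ger0_norm ?invr_ge0 ?(ltW B0) // mulrC ler_wpM2r // invr_ge0 ltW.
Qed.

Lemma ex_upper_bound (s : seq R) : exists B : R, all (fun x => x <= B) s.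
Proof.
elim: s => [|x s [B HB]]; first by exists 0.
exists (Num.max x B); rewrite /= le_max lexx /=.
by apply: sub_all HB => z zB; rewrite le_max zB orbT.
Qed.

Lemma Im_seg (p q : C) (t : R) : Im (p + t%:C * (q - p)) = (1 - t) * Im p + t * Im q.
Proof. by rewrite !reimE; ring. Qed.

(* [Phi] is a bump of size at most 1 - eta on the complements of large discs, decaying like 1 / z^2.
   Any function with derivative close to G o Phi takes, at a point of height at least [m1], every
   value near its value at the base point i (2 h). *)
Definition loop_spec (G Phi : C -> C) (T0 eta C0 c0 h1 d1 m1 Q : R) : Prop :=
  [/\ [/\ 0 < T0, 0 < eta, eta < 1, 0 < C0 & 0 < c0],
      [/\ 0 < h1, 0 < d1, h1 < m1, 0 < Q & Phi 0 = 0],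
      forall (T : R) z, T0 <= T -> - cm z ^+ 2 <= 2 * T * Im z ->
        [/\ exists l, hasd Phi z l, cm (Phi z) <= 1 - eta & cm (Phi z) * cm z ^+ 2 <= C0] &
      forall (h : R) (phi s : C -> C), 0 < h -> h <= h1 ->
        (forall z, h < Im z -> cm z < Q ->
           hasd phi z (G (s z)) /\ cm (s z - Phi z) <= d1) ->
        forall w, cm (w - phi ((2 * h)%:C * ii)) <= c0 ->
        exists z, [/\ m1 <= Im z, cm z < Q & phi z = w]].

Lemma loop_bump (g : C -> C) (a b : C) :
  (forall z, 0 < Im z -> exists l, hasd g z l) ->
  0 < Im b -> Im b <= Im a -> a != b -> g a = g b -> cder g a != 0 ->
  exists Phi, exists T0 eta C0 c0 h1 d1 m1 Q : R,
    loop_spec (fun s => cder g (from_disc b s)) Phi T0 eta C0 c0 h1 d1 m1 Q.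
Proof.
move=> dg y0 ab anb gab A0.
set d := a - b; set y := Im b in y0 ab *.
have d0 : 0 < cm d by rewrite cm_gt0 subr_eq0.
have id0 : 0 <= Im d by rewrite ImD ImN subr_ge0.
pose Q := 2 * cm d; pose C1 := 2 * (10 * Q + 4); pose C2 := C1 + 1.
have Q0 : 0 < Q by rewrite mulr_gt0.
have C10 : 0 < C1 by rewrite /C1; clear -Q0; clra.
have C20 : 0 < C2 by rewrite /C2; clear -C10; clra.
pose m := y / (Q + 2 * y); have m0 : 0 < m by rewrite divr_gt0 // addr_gt0 // mulr_gt0.
pose C3 := 4 * y * C2 / m ^+ 2.
have C30 : 0 < C3 by rewrite divr_gt0 ?exprn_gt0 // !mulr_gt0.
have y2 : 0 < y / 2 by rewrite divr_gt0.
have Ab : 0 < cm b + 2 * Q + 1 by have := cm_ge0 b; clear -Q0; clra.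
have [L L0 HL] := cder_box_lip y2 Ab dg.
pose C4 := L * C3; have C40 : 0 < C4 by rewrite mulr_gt0.
set A := cder g a in A0 *; have cA : 0 < cm A by rewrite cm_gt0.
(* Chosen before [B], so that with r1 = rho / B and c0 = |A| rho / (32 B) the error C4 (|d| + 1) / B
   equals 2 c0, whereas [local_surj] on the scale r1 / 2 about q reaches all values within 4 c0. *)
pose rho := 16 * C4 * (cm d + 1) / cm A.
have d1 : 0 < cm d + 1 by clear -d0; clra.
have rho0 : 0 < rho by apply: divr_gt0 => //; apply: mulr_gt0 => //; exact: mulr_gt0.
pose k := 16 * rho / Re d ^+ 2.
have k0 : 0 <= k by rewrite divr_ge0 ?sqr_ge0 // mulr_ge0 // ltW.
(* The constants introduced so far do not involve [B], so one large [B] meets all the demands that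
   follow. *)
have [B] := ex_upper_bound [:: 2; k * `|Re d|; 4 * (k * Re d) ^+ 2;
   4 * (k * `|Re d| * Q) / y; 2 * Q; 2 * C2 / m; 4 * C3 / y; C3; 8 * C4 / cm A;
   16 * L * rho / cm A; 16 * rho / Im d; 2 * rho / cm d].
move=> /= /and5P[hB1 hB2 hB3 hB4 /and5P[hB5 hB6 hB7 hB8 /and5P[hB9 hB10 hB11 hB12 _]]].
have B0 : 0 < B by apply: lt_le_trans hB1.
have Bi0 : 0 < B^-1 by rewrite invr_gt0.
(* The tilt: - tau Re d = k (Re d)^2 / B, which is 16 rho / B if Re d is not 0, and lifts q to
   height 8 rho / B even if Im d = 0. If Re d = 0, then Im d > 0 and a large [B] suffices. *)
pose tau := - (k * Re d / B).
have tau1 : `|tau| <= 1.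
  by rewrite normrN normf_div (gtr0_norm B0) ler_pdivrMr // mul1r normrM (ger0_norm k0).
have tau2 : 4 * B * tau ^+ 2 <= 1.
  rewrite sqrrN expr_div_n [B ^+ 2]expr2.
  have -> : 4 * B * ((k * Re d) ^+ 2 / (B * B)) = 4 * (k * Re d) ^+ 2 / B by field; rewrite gt_eqF.
  by rewrite ler_pdivrMr // mul1r.
have tauQ : `|tau| * Q <= y / 4.
  rewrite normrN normf_div (gtr0_norm B0) mulrAC ler_pdivrMr // normrM (ger0_norm k0).
  by move: hB4; rewrite ler_pdivrMr //; clear; clra.
have tau22 : tau ^+ 2 <= 1.
  by rewrite -(@real_normK _ tau) ?num_real // expr_le1.
pose u : C := 1 +i* tau.
have cu2 : cm u ^+ 2 = 1 + tau ^+ 2 by rewrite cm_sqr /= expr1n.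
have n1 : 0 < 1 + tau ^+ 2 by rewrite ltr_pwDl // sqr_ge0.
have cu1 : 1 <= cm u.
  by rewrite cm_ge_sqr // expr1n cu2 lerDl sqr_ge0.
have cu0 : 0 < cm u by apply: lt_le_trans cu1.
have u0 : u != 0 by rewrite -cm_gt0.
have cu : cm u <= 2.
  rewrite cm_le_sqr // cu2 (_ : 2 ^+ 2 = 4 :> R); last by rewrite expr2 -natrM.
  by clear -tau22; clra.
pose beta := (2 * y)%:C / u.
have Reb : Re beta = 2 * y / (1 + tau ^+ 2).
  by rewrite /beta /u ReM Re_inv Im_inv expr1n /= mul0r subr0 mul1r.
have Imb : Im beta = - (2 * y * tau / (1 + tau ^+ 2)).
  by rewrite /beta /u ImM Re_inv Im_inv expr1n /= mul0r addr0 mulNr mulrN mulrA.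
have cb2 : cm beta ^+ 2 = 4 * y ^+ 2 / (1 + tau ^+ 2).
  by rewrite cm_sqr Reb Imb; field; rewrite gt_eqF.
have Reb0 : 0 < Re beta by rewrite Reb divr_gt0 // mulr_gt0.
have Reb2 : Re beta <= 2 * y.
  by rewrite Reb ler_pdivrMr // ler_peMr ?lerDl ?sqr_ge0 // mulr_ge0 // ltW.
have Imb2 : 4 * B * Im beta ^+ 2 <= cm beta ^+ 2.
  rewrite Imb sqrrN expr_div_n cb2.
  have -> : 4 * B * ((2 * y * tau) ^+ 2 / (1 + tau ^+ 2) ^+ 2) =
      (4 * y ^+ 2 / (1 + tau ^+ 2)) * (4 * B * tau ^+ 2 / (1 + tau ^+ 2)) by field; rewrite gt_eqF.
  rewrite ler_piMr // ?ler_pdivrMr // ?mul1r; last first.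
    by rewrite (le_trans tau2) // lerDl sqr_ge0.
  by rewrite divr_ge0 ?(ltW n1) // mulr_ge0 // sqr_ge0.
have cbu : cm beta = 2 * y / cm u by rewrite cm_div cm_real gtr0_norm // mulr_gt0.
have cby : y <= cm beta by rewrite cbu ler_pdivlMr // mulrC ler_wpM2r // ltW.
have cb2y : cm beta <= 2 * y by rewrite cbu ler_pdivrMr // ler_peMr // mulr_ge0 // ltW.
pose q := d / u.
have cq : cm q <= cm d by rewrite cm_div ler_pdivrMr // ler_peMr // cm_ge0.
have Imq : 8 * rho / B <= Im q.
  have -> : Im q = (Im d - tau * Re d) / (1 + tau ^+ 2).
    by rewrite /q ImM /u Re_inv Im_inv expr1n; field; rewrite gt_eqF.
  rewrite ler_pdivlMr //.
  have h1 : 8 * rho / B * (1 + tau ^+ 2) <= 16 * rho / B.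
    have -> : 16 * rho / B = 8 * rho / B * 2 by ring.
    apply: ler_wpM2l; last by clear -tau22; clra.
    by apply: divr_ge0; [apply: mulr_ge0 => //; exact: ltW|exact: ltW].
  apply: le_trans h1 _; rewrite ler_pdivrMr // /tau mulNr opprK.
  have -> : (Im d + k * Re d / B * Re d) * B = Im d * B + k * Re d ^+ 2 by field; rewrite gt_eqF.
  have [r0|r0] := eqVneq (Re d) 0.
    have : 0 < Im d.
      rewrite lt_def id0 andbT; apply/eqP => i0; move: d0.
      by rewrite (_ : d = 0) ?cm0 ?ltxx //; apply: complex_ext.
    by rewrite r0 expr2 !mulr0 addr0 [Im d * B]mulrC => i0; rewrite -ler_pdivrMr.
  have -> : k * Re d ^+ 2 = 16 * rho by rewrite /k; field.
  by rewrite lerDr mulr_ge0 // ltW.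
pose r1 := rho / B; have r10 : 0 < r1 by rewrite divr_gt0.
have r1d : r1 <= cm d / 2.
  have h := hB12; rewrite ler_pdivrMr // in h; rewrite /r1 ler_pdivrMr //; clear -h; clra.
have uqE : b + u * q = a by rewrite /q mulrC divfK // /d addrC subrK.
(* An antiderivative of z |-> g'(b + u z), with which phi is compared. It takes equal values at 0
   and q because g a = g b. *)
pose gam (z : C) := u^-1 * g (b + u * z).
have dgam z : 0 < Im (b + u * z) -> hasd gam z (cder g (b + u * z)).
  move=> hz; have dl := hasdP (dg _ hz).
  have h2 := hasdZ u^-1 (hasd_comp (hasdD (hasd_cst b z) (hasdZ u (hasd_id z))) dl).
  have E : u^-1 * (cder g (b + u * z) * (0 + u * 1)) = cder g (b + u * z) by field.
  by rewrite E in h2.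
have uz (z : C) : cm (u * z) <= 2 * cm z by rewrite cmM ler_wpM2r ?cm_ge0.
have reg (z : C) : 0 <= Im z -> cm z <= Q -> 3 / 4 * y <= Im (b + u * z) /\ cm (b + u * z) <= cm b + 2 * Q.
  move=> iz zQ; split; last first.
    by apply: le_trans (cmD _ _) _; have := uz z; clear -zQ; clra.
  rewrite ImD ImM /u [Re (1 +i* tau)]/= [Im (1 +i* tau)]/= mul1r -/y.
  have h1 : `|tau * Re z| <= y / 4.
    rewrite normrM; apply: le_trans tauQ; apply: ler_wpM2l => //.
    exact: le_trans (ler_Re_cm _) zQ.
  by move: h1; rewrite ler_norml; clear -iz; clra.
have s0E (z : C) : z + ii * beta != 0 -> from_disc b (z / (z + ii * beta)) = b + u * z.
  move=> hz; have ub : u * beta = (2 * y)%:C by rewrite /beta mulrC divfK.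
  have ib : ii * beta != 0.
    rewrite -cm_gt0 cmM cm_ci mul1r; exact: lt_le_trans cby.
  have E : 1 - z / (z + ii * beta) = ii * beta / (z + ii * beta) by field.
  rewrite /from_disc E conjcE -/y -ub.
  have ib2 := ib; rewrite mulf_eq0 negb_or in ib2; case/andP: ib2 => ib3 ib4.
  by field; rewrite ib3 ib4 hz.
pose T0 := 2 * B + 2 * B * (2 * y).
have T0p : 0 < T0 by rewrite addr_gt0 // !mulr_gt0.
have bb (T : R) (z : C) : T0 <= T -> - cm z ^+ 2 <= 2 * T * Im z ->
  [/\ z + ii * beta != 0, z + ii * B%:C != 0, cm (bump B beta z) <= 1 - (2 * B)^-1 &
      cm (bump B beta z) * cm z ^+ 2 <= 2 * B ^+ 2].
  move=> hT hz; apply: bump_bound hz => //.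
  - by apply: le_trans hT; rewrite lerDl !mulr_ge0 // ltW.
  - apply: le_trans hT; apply: (@le_trans _ _ (2 * B * (2 * y))); last by rewrite lerDr mulr_ge0 // ltW.
    by apply: ler_wpM2l => //; rewrite mulr_ge0 // ltW.
  have p : 0 <= B * Im beta ^+ 2 by rewrite mulr_ge0 ?sqr_ge0 // ltW.
  by clear -p Imb2; clra.
have near (z s : C) : 0 <= Im z -> cm z <= Q -> cm (s - bump B beta z) <= B^-1 ->
    cm (cder g (from_disc b s) - cder g (b + u * z)) <= C4 / B.
  move=> iz zQ sz.
  have hz : - cm z ^+ 2 <= 2 * T0 * Im z.
    by apply: (@le_trans _ _ 0); rewrite ?oppr_le0 ?exprn_ge0 ?cm_ge0 // !mulr_ge0 // ltW.
  have [hz1 hz2 _ _] := bb T0 z (lexx _) hz.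
  have hb4 : Im beta ^+ 2 * 4 <= cm beta ^+ 2.
    have p : Im beta ^+ 2 * 1 <= Im beta ^+ 2 * B.
      by apply: ler_wpM2l; [exact: sqr_ge0|clear -hB1; clra].
    by clear -p Imb2; clra.
  have h1 := bump_approx Reb0 hB1 hB5 zQ iz hb4.
  rewrite -/C1 in h1; set s0 := z / (z + ii * beta) in h1.
  have h2 : cm (s - s0) <= C2 / B.
    apply: le_trans (cm_tri (bump B beta z) _ _) _.
    by rewrite /C2 mulrDl mul1r addrC; apply: lerD.
  have cm0 : m <= cm (1 - s0).
    have -> : 1 - s0 = ii * beta / (z + ii * beta) by rewrite /s0; field.
    rewrite cm_div cmM cm_ci mul1r ler_pdivlMr ?cm_gt0 // /m mulrAC ler_pdivrMr; last first.
      by clear -Q0 y0; clra.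
    have h3 : cm (z + ii * beta) <= Q + 2 * y.
      by apply: le_trans (cmD _ _) _; rewrite cmM cm_ci mul1r; exact: lerD.
    by apply: ler_pM; rewrite ?cm_ge0 ?(ltW y0).
  have hm : C2 / B <= m / 2.
    have h := hB6; rewrite ler_pdivrMr // in h; rewrite ler_pdivrMr //; clear -h; clra.
  have cm1 : m / 2 <= cm (1 - s).
    have := cm_ge_sub (1 - s0) (1 - s).
    have -> : 1 - s - (1 - s0) = - (s - s0) by ring.
    by rewrite cmN; clear -cm0 h2 hm; clra.
  have m20 : 0 < m / 2 by rewrite divr_gt0.
  have n0 : 1 - s0 != 0 by rewrite -cm_gt0; apply: lt_le_trans cm0.
  have n1' : 1 - s != 0 by rewrite -cm_gt0; apply: lt_le_trans cm1.
  have h4 : cm (from_disc b s - (b + u * z)) <= C3 / B.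
    rewrite -(s0E z hz1) from_discB // cm_div [cm (_ * (s - s0))]cmM [cm (_%:C * ii)]cmM cm_ci mulr1.
    rewrite cm_real gtr0_norm; last by rewrite mulr_gt0.
    rewrite [cm (_ * (1 - s0))]cmM -/y.
    have -> : C3 / B = 2 * y * (C2 / B) / (m / 2 * m).
      by rewrite /C3; field; rewrite !gt_eqF.
    apply: ler_pM; rewrite ?invr_ge0 ?mulr_ge0 ?cm_ge0 ?(ltW y0) //.
      by apply: ler_wpM2l => //; rewrite mulr_ge0 // ltW.
    have p1 : 0 < m / 2 * m := mulr_gt0 m20 m0.
    have p2 : 0 < cm (1 - s) * cm (1 - s0) by apply: mulr_gt0; rewrite cm_gt0.
    rewrite lef_pV2 ?posrE //.
    by apply: ler_pM; rewrite ?(ltW m0) ?(ltW m20).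
  have h5 : C3 / B <= y / 4.
    have h := hB7; rewrite ler_pdivrMr // in h; rewrite ler_pdivrMr //; clear -h; clra.
  have h6 : C3 / B <= 1 by rewrite ler_pdivrMr // mul1r.
  have [r3 r4] := reg z iz zQ.
  have r5 : y / 2 <= Im (b + u * z) by clear -r3 y0; clra.
  have r6 : cm (b + u * z) <= cm b + 2 * Q + 1 by clear -r4; clra.
  have r7 : y / 2 <= Im (from_disc b s).
    have := le_trans (ler_Im_cm _) h4; rewrite [Im (_ - _)]ImD ImN ler_norml.
    by clear -r3 h5; clra.
  have r8 : cm (from_disc b s) <= cm b + 2 * Q + 1.
    by have := cmBB (from_disc b s) (b + u * z); clear -h4 h6 r4; clra.
  have [_ h7] := HL _ _ r7 r8 r5 r6.
  apply: le_trans h7 _; rewrite /C4 -mulrA; apply: ler_wpM2l => //; exact: ltW.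
pose c0 := cm A * rho / (32 * B).
have c00 : 0 < c0 by rewrite divr_gt0 // mulr_gt0.
pose h1 := Num.min (Num.min r1 (1 / 2)) (c0 / (2 * L)).
have h10 : 0 < h1 by rewrite !lt_min r10 /= divr_gt0 //= divr_gt0 // mulr_gt0.
have h1r : h1 <= r1 by rewrite !ge_min lexx.
have h12 : h1 <= 1 / 2 by rewrite !ge_min lexx orbT.
have h1c : 2 * L * h1 <= c0.
  by rewrite mulrC -ler_pdivlMr ?mulr_gt0 // ge_min lexx orbT.
exists (bump B beta), T0, (2 * B)^-1, (2 * B ^+ 2), c0, h1, B^-1, (7 * r1), Q.
have B21 : (2 * B)^-1 < 1 by rewrite invf_lt1 ?mulr_gt0 //; clear -hB1; clra.
split.
- by split=> //; [rewrite invr_gt0 mulr_gt0|rewrite mulr_gt0 // exprn_gt0].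
- by split=> //; [clear -h1r r10; clra|exact: bump0].
- move=> T z hT hz; have [k1 k2 k3 k4] := bb T z hT hz; split=> //.
  exact: bump_diff.
move=> h phi s h0 hh1 dphi w hw.
set p := (2 * h)%:C * ii in hw.
have cp : cm p = 2 * h by rewrite cmM cm_ci mulr1 cm_real gtr0_norm // mulr_gt0.
have ip : Im p = 2 * h by rewrite !reimE; clear; clra.
have pd : cm p <= cm d by rewrite cp; clear -hh1 h1r r1d; clra.
have hIq : 8 * r1 <= Im q by rewrite /r1 mulrA.
have ipq : 2 * h <= Im q by clear -hIq hh1 h1r r10; clra.
have dQ : cm d < Q by rewrite /Q; clear -d0; clra.
have segp (t : R) : 0 <= t <= 1 -> h < Im (p + t%:C * (q - p)) /\ cm (p + t%:C * (q - p)) <= cm d.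
  move=> ht; split.
    rewrite Im_seg ip; have [t0 t1] := andP ht.
    have k1 : t * (2 * h) <= t * Im q by apply: ler_wpM2l.
    by clear -k1 h0; clra.
  have := @seg_cm R p q 0 (cm d) t ht; rewrite !subr0; exact.
(* The derivative of phi - gam is O(1 / B) on the segment from the base point p to q, which lies
   above the height h where phi is controlled. *)
have E1 : cm (phi q - phi p - (gam q - gam p)) <= C4 / B * (cm d + 1).
  pose del z := phi z - gam z.
  have -> : phi q - phi p - (gam q - gam p) = del q - del p by rewrite /del; ring.
  apply: (@le_trans _ _ (C4 / B * cm (q - p))).
    apply: lip_of_deriv => t ht; have [k1 k2] := segp t ht; set z := p + _ in k1 k2 *.
    have zQ := le_lt_trans k2 dQ; have [k3 k4] := dphi z k1 zQ.
    have iz : 0 <= Im z by apply: ltW; apply: lt_trans k1.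
    have [r3 _] := reg z iz (ltW zQ).
    have r4 : 0 < Im (b + u * z) by clear -r3 y0; clra.
    exists (cder g (from_disc b (s z)) - cder g (b + u * z)); first exact: hasdB k3 (dgam z r4).
    exact: near iz (ltW zQ) k4.
  apply: ler_wpM2l; first by rewrite divr_ge0 // ltW.
  apply: le_trans (cmB _ _) _; rewrite cp; clear -cq hh1 h12; clra.
have E2 : cm (gam p - gam 0) <= L * (2 * h).
  rewrite -[in X in _ * X]cp -[X in cm X]subr0 -/(_ - 0).
  have := @lip_of_deriv R gam 0 p L; rewrite !subr0 => H; apply: H => t ht.
  rewrite add0r; have ht' := ht; have [t0 t1] := andP ht.
  have iz : 0 <= Im (t%:C * p) by rewrite ImM ReC ImC ip mul0r addr0 mulr_ge0 // mulr_ge0 // ltW.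
  have zQ : cm (t%:C * p) <= Q.
    rewrite cmM cm_real ger0_norm //; apply: le_trans (ltW dQ); apply: le_trans pd.
    by rewrite ler_piMl ?cm_ge0.
  have [r3 r4] := reg _ iz zQ.
  have r5 : 0 < Im (b + u * (t%:C * p)) by clear -r3 y0; clra.
  exists (cder g (b + u * (t%:C * p))); first exact: dgam.
  have r6 : y / 2 <= Im (b + u * (t%:C * p)) by clear -r3 y0; clra.
  have r7 : cm (b + u * (t%:C * p)) <= cm b + 2 * Q + 1 by clear -r4; clra.
  by have [] := HL _ _ r6 r7 r6 r7.
have E3 : gam q = gam 0 by rewrite /gam uqE mulr0 addr0 gab.
have E4 : C4 / B * (cm d + 1) = 2 * c0.
  by rewrite /c0 /rho; field; rewrite !gt_eqF.
have Eq : cm (w - phi q) <= 4 * c0.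
  have -> : w - phi q = (w - phi p) - (phi q - phi p - (gam q - gam p)) - (gam q - gam p) by ring.
  apply: le_trans (cmB _ _) _; rewrite E3 [cm (gam 0 - _)]cmBC.
  have k1 := cmB (w - phi p) (phi q - phi p - (gam 0 - gam p)); rewrite E3 E4 in E1.
  have k2 : L * (2 * h) <= c0.
    apply: le_trans h1c; rewrite mulrA [L * 2]mulrC; apply: ler_wpM2l => //.
    by rewrite mulr_ge0 // ltW.
  by clear -k1 k2 E1 E2 hw; clra.
(* Since q has height at least 8 r1, a disc of radius r1 about it stays above 7 r1, which is the
   [m1] of [loop_spec]. *)
have r12 : 0 < r1 / 2 by rewrite divr_gt0.
have dq (z : C) : cm (z - q) <= r1 -> [/\ 7 * r1 <= Im z, cm z < Q & cm (z - q) <= r1].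
  move=> zq; split=> //.
    have := le_trans (ler_Im_cm _) zq; rewrite ImD ImN ler_norml; clear -hIq; clra.
  have := cmBB z q; rewrite /Q; clear -zq cq r1d d0; clra.
have [z zq fz] : exists2 z, cm (z - q) <= 2 * (r1 / 2) & phi z = w.
  apply: (@local_surj R phi q A w (r1 / 2)) => //; last first.
    apply: le_trans Eq _; rewrite /c0 /r1.
    by rewrite le_eqVlt; apply/orP; left; apply/eqP; field; rewrite gt_eqF.
  move=> z; rewrite [2 * _]mulrC divfK // => /dq[k1 k2 k3].
  have hz : h < Im z by clear -k1 hh1 h1r r10; clra.
  have iz : 0 <= Im z by apply: ltW; apply: lt_trans hz.
  have [k4 k5] := dphi z hz k2; exists (cder g (from_disc b (s z))) => //.
  have k6 := near z _ iz (ltW k2) k5.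
  have [r3 r4] := reg z iz (ltW k2).
  have r6 : y / 2 <= Im (b + u * z) by clear -r3 y0; clra.
  have r7 : cm (b + u * z) <= cm b + 2 * Q + 1 by clear -r4; clra.
  have iq : 0 <= Im q by clear -hIq r10; clra.
  have [q3 q4] := reg q iq (le_trans cq (ltW dQ)).
  have q6 : y / 2 <= Im (b + u * q) by clear -q3 y0; clra.
  have q7 : cm (b + u * q) <= cm b + 2 * Q + 1 by clear -q4; clra.
  have [_ k7] := HL _ _ r6 r7 q6 q7; rewrite uqE -/A in k7.
  have k8 : cm (b + u * z - a) <= 2 * r1.
    rewrite -uqE (_ : _ - _ = u * (z - q)); last by ring.
    by apply: le_trans (uz _) _; apply: ler_wpM2l.
  apply: le_trans (cm_tri (cder g (b + u * z)) _ _) _.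
  have k9 : C4 / B <= cm A / 8.
    have hh := hB9; rewrite ler_pdivrMr // in hh; rewrite ler_pdivrMr //; clear -hh; clra.
  have k10 : L * (2 * r1) <= cm A / 8.
    have hh := hB10; rewrite ler_pdivrMr // in hh.
    have -> : L * (2 * r1) = 2 * L * rho / B by rewrite /r1; ring.
    by rewrite ler_pdivrMr //; clear -hh; clra.
  have k11 : L * cm (b + u * z - a) <= L * (2 * r1) by apply: ler_wpM2l => //; exact: ltW.
  by clear -k6 k7 k9 k10 k11; clra.
exists z; rewrite [2 * _]mulrC divfK // in zq.
by have [k1 k2 _] := dq z zq; split.
Qed.

End Loop.

(** * Domains with inner and outer balls at the boundary *)

Section Geometry.
Variable R : realType.
Local Notation C := R[i].
Local Notation Re := (@complex.Re R).
Local Notation Im := (@complex.Im R).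

Definition clos (D : set C) (z : C) := forall r : R, 0 < r -> exists2 w, D w & cm (z - w) < r.

(** A common framework for the half-plane and for domains bounded by a closed curve with a periodic
    parameter, which is why the lower bound on |gam s - gam t| is local. The two balls at [gam t]
    lie on the two sides along the unit normal [nrm t], with a radius that does not depend on t. *)
Record good_dom (D : set C) (gam nrm : R -> C) (Lam lam d0 r0 : R) : Prop := GoodDom {
  gd_open : forall z, D z -> exists2 r : R, 0 < r & forall w, cm (z - w) < r -> D w;
  gd_Lam : 0 < Lam; gd_lam : 0 < lam; gd_d0 : 0 < d0; gd_r0 : 0 < r0;
  gd_lip : forall s t, cm (gam s - gam t) <= Lam * `|s - t|;
  gd_colip : forall s t, `|s - t| <= d0 -> lam * `|s - t| <= cm (gam s - gam t);
  gd_bd : forall z, clos D z -> ~ D z -> exists t, z = gam t;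
  gd_ball : forall t, [/\ cm (nrm t) = 1,
    forall z, cm (z - (gam t + r0%:C * nrm t)) < r0 -> D z &
    forall z, cm (z - (gam t - r0%:C * nrm t)) < r0 -> ~ D z] }.

Definition dotc (z w : C) : R := Re z * Re w + Im z * Im w.

Lemma cm_sqrD (z w : C) : cm (z + w) ^+ 2 = cm z ^+ 2 + 2 * dotc z w + cm w ^+ 2.
Proof. by rewrite !cm_sqr /dotc !reimE; ring. Qed.

Lemma cm_sqrB (z w : C) : cm (z - w) ^+ 2 = cm z ^+ 2 - 2 * dotc z w + cm w ^+ 2.
Proof. by rewrite !cm_sqr /dotc !reimE; ring. Qed.

Lemma dotcZr (z w : C) (k : R) : dotc z (k%:C * w) = k * dotc z w.
Proof. by rewrite /dotc !reimE; ring. Qed.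

Lemma dotcZl (z w : C) (k : R) : dotc (k%:C * z) w = k * dotc z w.
Proof. by rewrite /dotc !reimE; ring. Qed.

Lemma dotcDl (z z' w : C) : dotc (z + z') w = dotc z w + dotc z' w.
Proof. by rewrite /dotc !reimE; ring. Qed.

Lemma dotcN (z w : C) : dotc (- z) w = - dotc z w.
Proof. by rewrite /dotc !reimE; ring. Qed.

Lemma dotc_le (z w : C) : `|dotc z w| <= cm z * cm w.
Proof.
rewrite -(@ler_pXn2r _ 2) ?nnegrE ?mulr_ge0 ?cm_ge0 // real_normK ?num_real //.
rewrite exprMn !cm_sqr /dotc -subr_ge0.
have -> : (Re z ^+ 2 + Im z ^+ 2) * (Re w ^+ 2 + Im w ^+ 2) - (Re z * Re w + Im z * Im w) ^+ 2
  = (Re z * Im w - Im z * Re w) ^+ 2 by ring.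
exact: sqr_ge0.
Qed.

Lemma seg_exit (D : set C) (z w : C) :
  (forall z, D z -> exists2 r : R, 0 < r & forall w, cm (z - w) < r -> D w) ->
  D z -> ~ D w -> exists2 t : R, 0 < t <= 1 &
  (forall s, 0 <= s < t -> D (z + s%:C * (w - z))) /\
  clos D (z + t%:C * (w - z)) /\ ~ D (z + t%:C * (w - z)).
Proof.
move=> Dopen Dz Dw.
pose pt (s : R) := z + s%:C * (w - z).
have wz0 : 0 < cm (w - z) by rewrite cm_gt0 subr_eq0; apply/eqP => E; apply: Dw; rewrite E.
have ptB (s t : R) : cm (pt t - pt s) = `|s - t| * cm (w - z).
  rewrite (_ : pt t - pt s = (t - s)%:C * (w - z)); last by rewrite /pt rmorphB /=; ring.
  by rewrite cmM cm_real distrC.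
have nearD (t : R) : D (pt t) -> exists2 e : R, 0 < e & forall s, `|s - t| < e -> D (pt s).
  move=> /Dopen[r rp Hr]; exists (r / cm (w - z)); first by rewrite divr_gt0.
  by move=> s; rewrite ltr_pdivlMr // => h; apply: Hr; rewrite ptB.
pose S := [set s : R | 0 <= s <= 1 /\ ~ D (pt s)].
have S1 : S 1 by split; [rewrite ler01 lexx|rewrite /pt rmorph1 mul1r addrC subrK].
have iS : has_inf S by split; [exists 1|exists 0 => s [/andP[]]].
pose t := inf S.
have tle s : S s -> t <= s by move=> Ss; apply: ge_inf => //; case: iS.
have t1 : t <= 1 by exact: tle.
have lb x : (forall s, S s -> x <= s) -> x <= t by move=> H; apply: lb_le_inf => //; exists 1.
have tpos : 0 < t.
  have [|e e0 He] := nearD 0; first by rewrite /pt mul0r addr0.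
  apply: lt_le_trans e0 _; apply: lb => s [/andP[s0 s1] nD].
  rewrite leNgt; apply/negP => se; apply: nD; apply: He.
  by rewrite subr0 ger0_norm.
have below s : 0 <= s < t -> D (pt s).
  move=> /andP[s0 st]; apply: contrapT => nD.
  have : S s by split=> //; rewrite s0 /= (ltW (lt_le_trans st t1)).
  by move=> /tle; rewrite leNgt st.
have nDt : ~ D (pt t).
  move=> /nearD[e e0 He]; suff : t + e <= t by rewrite gerDl leNgt e0.
  apply: lb => s Ss; have ts := tle _ Ss; case: Ss => _ nD.
  rewrite leNgt; apply/negP => se; apply: nD; apply: He.
  by rewrite ger0_norm ?subr_ge0 // ltrBlDl.
exists t; first by rewrite tpos t1.
split=> //; split=> // r rp.
pose s := Num.max 0 (t - r / (2 * cm (w - z))).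
have rw : 0 < r / (2 * cm (w - z)) by rewrite divr_gt0 // mulr_gt0.
have st : s < t by rewrite gt_max tpos gtrBl rw.
exists (pt s); first by apply: below; rewrite st le_max lexx.
rewrite ptB distrC gtr0_norm ?subr_gt0 //.
have h : t - s <= r / (2 * cm (w - z)) by rewrite lerBlDl -lerBlDr le_max lexx orbT.
apply: (@le_lt_trans _ _ (r / (2 * cm (w - z)) * cm (w - z))); first by rewrite ler_wpM2r // ltW.
have -> : r / (2 * cm (w - z)) * cm (w - z) = r / 2 by field; rewrite gt_eqF.
by rewrite ltr_pdivrMr // ltr_pMr // ltr1n.
Qed.

Section Dom.
Variables (D : set C) (gam nrm : R -> C) (Lam lam d0 r0 : R).
Hypothesis gd : good_dom D gam nrm Lam lam d0 r0.

Lemma sub_clos z : D z -> clos D z.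
Proof. by move=> Dz r r0'; exists z => //; rewrite subrr cm0. Qed.

Lemma clos_ext z t : clos D z -> r0 <= cm (z - (gam t - r0%:C * nrm t)).
Proof.
move=> cz; rewrite leNgt; apply/negP => h.
have e0 : 0 < r0 - cm (z - (gam t - r0%:C * nrm t)) by rewrite subr_gt0.
have [w Dw zw] := cz _ e0; have [_ _ /(_ w)] := gd_ball gd t; apply=> //.
have := cm_tri z w (gam t - r0%:C * nrm t); rewrite [cm (w - z)]cmBC.
by move: zw; clear -gd; set x := cm _; set y := cm _; set v := cm _; lra.
Qed.

(** The outer ball condition squared. In a coordinate where the normal is i, it reads - |z|^2 <= 2
    r0 Im z, the region on which the bump is bounded. *)
Lemma clos_dot z t : clos D z -> - cm (z - gam t) ^+ 2 <= 2 * r0 * dotc (z - gam t) (nrm t).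
Proof.
move=> /(@clos_ext _ t); have r00 := gd_r0 gd; have [n1 _ _] := gd_ball gd t.
rewrite cm_ge_sqr ?(ltW r00) // opprB addrA addrAC.
rewrite (cm_sqrD (z - gam t)) dotcZr [cm (_%:C * _)]cmM cm_real n1 mulr1 gtr0_norm //.
by clear -gd; lra.
Qed.

Lemma int_dot z t : cm (z - gam t) ^+ 2 < 2 * r0 * dotc (z - gam t) (nrm t) -> D z.
Proof.
have r00 := gd_r0 gd; have [n1 nD _] := gd_ball gd t => h; apply: nD.
rewrite cm_lt_sqr ?(ltW r00) // opprD addrA.
rewrite (cm_sqrB (z - gam t)) dotcZr [cm (_%:C * _)]cmM cm_real n1 mulr1 gtr0_norm //.
by clear -gd h; lra.
Qed.

Lemma gam_notin t : ~ D (gam t).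
Proof.
move=> /(gd_open gd)[r r00 Hr]; have r0p := gd_r0 gd; have [n1 _ nE] := gd_ball gd t.
pose d := Num.min (r / 2) r0.
have d00 : 0 < d by rewrite lt_min divr_gt0.
have dr : d <= r / 2 by rewrite ge_min lexx.
have dr0 : d <= r0 by rewrite ge_min lexx orbT.
have cd : cm (d%:C * nrm t) = d by rewrite cmM cm_real n1 mulr1 gtr0_norm.
have Dz : D (gam t - d%:C * nrm t).
  by apply: Hr; rewrite opprB addrC subrK cd; clear -gd dr r00; clra.
apply: (nE _ _ Dz).
have -> : gam t - d%:C * nrm t - (gam t - r0%:C * nrm t) = (r0 - d)%:C * nrm t.
  by rewrite rmorphB /=; ring.
rewrite cmM cm_real n1 mulr1 ger0_norm ?subr_ge0 //; clear -gd d00; clra.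
Qed.

Lemma gam_clos t : clos D (gam t).
Proof.
move=> r r00; have r0p := gd_r0 gd; have [n1 nD _] := gd_ball gd t.
pose d := Num.min (r / 2) r0.
have d00 : 0 < d by rewrite lt_min divr_gt0.
have dr : d <= r / 2 by rewrite ge_min lexx.
have dr0 : d <= r0 by rewrite ge_min lexx orbT.
exists (gam t + d%:C * nrm t); last first.
  rewrite opprD addrA subrr add0r cmN cmM cm_real n1 mulr1 gtr0_norm //; clear -gd dr r00; clra.
apply: nD; have -> : gam t + d%:C * nrm t - (gam t + r0%:C * nrm t) = - ((r0 - d)%:C * nrm t).
  by rewrite rmorphB /=; ring.
rewrite cmN cmM cm_real n1 mulr1 ger0_norm ?subr_ge0 //; clear -gd d00; clra.
Qed.

(** The inner ball at one point and the outer ball at the other are disjoint, otherwise the midpoint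
    of their centres would lie in both. So their centres are at distance at least 2 r0; adding this
    inequality and the one with s and t exchanged, and using the parallelogram law for the two unit
    normals, gives the bound. *)
Lemma normal_lip s t : cm (nrm s - nrm t) <= cm (gam s - gam t) / r0.
Proof.
have r0p := gd_r0 gd; have [n1 nD1 nE1] := gd_ball gd s; have [n2 nD2 nE2] := gd_ball gd t.
have key a b (ca : cm (nrm a) = 1) (cb : cm (nrm b) = 1)
   (h : forall z, cm (z - (gam a + r0%:C * nrm a)) < r0 -> D z)
   (h' : forall z, cm (z - (gam b - r0%:C * nrm b)) < r0 -> ~ D z) :
   (2 * r0) ^+ 2 <= cm ((gam a - gam b) + r0%:C * (nrm a + nrm b)) ^+ 2.
  rewrite leNgt; apply/negP => k.
  pose m := 2^-1 * ((gam a + r0%:C * nrm a) + (gam b - r0%:C * nrm b)).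
  have E1 : m - (gam a + r0%:C * nrm a) = - (2^-1 * ((gam a - gam b) + r0%:C * (nrm a + nrm b))).
    by rewrite /m; field.
  have E2 : m - (gam b - r0%:C * nrm b) = 2^-1 * ((gam a - gam b) + r0%:C * (nrm a + nrm b)).
    by rewrite /m; field.
  have k2 : cm (2^-1 * ((gam a - gam b) + r0%:C * (nrm a + nrm b))) < r0.
    rewrite cmM cmV cm_nat -ltr_pdivlMl ?invr_gt0 // invrK.
    by rewrite cm_lt_sqr // mulr_ge0 // ltW.
  apply: (h' m); first by rewrite E2.
  by apply: h; rewrite E1 cmN.
have k1 := key s t n1 n2 nD1 nE2; have k2 := key t s n2 n1 nD2 nE1.
rewrite ler_pdivlMr //.
have c2 : 0 <= cm (nrm s - nrm t) * r0 by rewrite mulr_ge0 ?cm_ge0 // ltW.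
rewrite -(@ler_pXn2r _ 2) ?nnegrE ?cm_ge0 //.
have E : (gam t - gam s) + r0%:C * (nrm t + nrm s) = - ((gam s - gam t) - r0%:C * (nrm s + nrm t)).
  by ring.
rewrite E cmN in k2; rewrite cm_sqrB in k2; rewrite cm_sqrD in k1.
have p1 : cm (r0%:C * (nrm s + nrm t)) ^+ 2 = r0 ^+ 2 * cm (nrm s + nrm t) ^+ 2.
  by rewrite cmM exprMn cm_real real_normK ?num_real.
have p2 : cm (nrm s + nrm t) ^+ 2 + cm (nrm s - nrm t) ^+ 2 = 4.
  by rewrite cm_sqrD cm_sqrB n1 n2 expr1n; clear -gd; ring.
have p3 : r0 ^+ 2 * cm (nrm s + nrm t) ^+ 2 = 4 * r0 ^+ 2 - (cm (nrm s - nrm t) * r0) ^+ 2.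
  have -> : cm (nrm s + nrm t) ^+ 2 = 4 - cm (nrm s - nrm t) ^+ 2 by clear -gd p2; lra.
  by ring.
rewrite p1 p3 exprMn in k1 k2; clear -gd k1 k2.
by move: k1 k2; set x := cm _ ^+ 2; set y := (cm _ * _) ^+ 2; set v := dotc _ _; lra.
Qed.

Lemma exit_point z w : D z -> ~ D w -> exists2 t : R, 0 < t <= 1 &
  (forall s, 0 <= s < t -> D (z + s%:C * (w - z))) /\ exists t', z + t%:C * (w - z) = gam t'.
Proof.
move=> Dz Dw; have [t t01 [below [ct nt]]] := seg_exit (gd_open gd) Dz Dw.
by exists t => //; split=> //; exact: (gd_bd gd).
Qed.

Definition far (z : C) (e : R) := forall t, e <= cm (z - gam t).

Lemma far_ball z e w : D z -> far z e -> cm (w - z) < e -> D w.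
Proof.
move=> Dz fz wz; apply: contrapT => Dw.
have [t /andP[t0 t1] [_ [t' E]]] := exit_point Dz Dw.
have := fz t'; rewrite -E opprD addrA subrr add0r cmN cmM cm_real gtr0_norm //.
rewrite leNgt => /negP; apply; apply: le_lt_trans wz.
by rewrite ler_piMl ?cm_ge0.
Qed.

Lemma D_far z : D z -> exists2 e : R, 0 < e & far z e.
Proof.
move=> /(gd_open gd)[r rp Hr]; exists r => // t; rewrite leNgt; apply/negP => h.
exact: (@gam_notin t (Hr _ h)).
Qed.

Lemma ball_far z (e : R) : (forall w, cm (w - z) < e -> D w) -> far z e.
Proof.
by move=> H t; rewrite leNgt; apply/negP => h; apply: (@gam_notin t); apply: H; rewrite cmBC.
Qed.

Lemma up_ball t (s : R) (w : C) : 0 < s <= r0 -> cm (w - (gam t + s%:C * nrm t)) < s -> D w.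
Proof.
move=> /andP[s0 sr] h; have [n1 nD _] := gd_ball gd t; apply: nD.
have -> : w - (gam t + r0%:C * nrm t) = (w - (gam t + s%:C * nrm t)) - (r0 - s)%:C * nrm t.
  by rewrite rmorphB /=; ring.
apply: le_lt_trans (cmB _ _) _; rewrite [cm (_ * _)]cmM cm_real n1 mulr1 ger0_norm ?subr_ge0 //.
by clear -gd h; lra.
Qed.

(* Moving along the normal of a nearby boundary point, one cannot leave D: the exit point
   would be approached from inside its own exterior ball. *)
Lemma up_segment x t (d s : R) : D x -> cm (x - gam t) <= 2 * d -> 0 < d -> 20 * d <= r0 ->
  0 <= s <= 4 * d -> D (x + s%:C * nrm t).
Proof.
move=> Dx xt dp dr /andP[s0 s4]; apply: contrapT => nD.
have r0p := gd_r0 gd; have [n1 _ _] := gd_ball gd t.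
have [u /andP[u0 u1] [below [t' E]]] := exit_point Dx nD.
rewrite [x + _ - x]addrAC subrr add0r in below E.
have us : u * s <= 4 * d.
  by apply: le_trans s4; rewrite ler_piMl.
have us0 : 0 < s.
  rewrite lt_def s0 andbT; apply/eqP => s00; apply: nD.
  by rewrite s00 mul0r addr0.
have pp : cm (gam t' - gam t) <= 6 * d.
  rewrite -E; have -> : x + u%:C * (s%:C * nrm t) - gam t = (x - gam t) + (u * s)%:C * nrm t.
    by rewrite rmorphM /=; ring.
  apply: le_trans (cmD _ _) _; rewrite [cm (_ * _)]cmM cm_real n1 mulr1 ger0_norm ?mulr_ge0 ?(ltW u0) //.
  by clear -gd us xt; lra.
have [n1' _ nE] := gd_ball gd t'.
have nn : cm (nrm t - nrm t') <= 1 / 2.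
  apply: le_trans (normal_lip _ _) _; rewrite cmBC ler_pdivrMr //.
  by clear -gd pp dr dp; lra.
have dn : 1 / 2 <= dotc (nrm t) (nrm t').
  have := cm_sqrB (nrm t) (nrm t'); rewrite n1 n1' expr1n.
  have : cm (nrm t - nrm t') ^+ 2 <= (1 / 2) ^+ 2 by rewrite ler_pXn2r ?nnegrE ?cm_ge0 ?divr_ge0.
  by rewrite [(1 / 2) ^+ 2]expr2; clear -gd; set v := dotc _ _; set w := cm _ ^+ 2; lra.
pose a := Num.min (u * s / 2) (r0 / 2).
have a0 : 0 < a by rewrite lt_min !divr_gt0 // mulr_gt0.
have aus : a <= u * s / 2 by rewrite ge_min lexx.
have ar : a <= r0 / 2 by rewrite ge_min lexx orbT.
have usp : 0 < u * s by rewrite mulr_gt0.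
have Dy : D (gam t' - a%:C * nrm t).
  rewrite -E; have -> : x + u%:C * (s%:C * nrm t) - a%:C * nrm t = x + ((u * s - a) / s)%:C * (s%:C * nrm t).
    rewrite [x + _ + _]addrAC -!addrA; congr (_ + _).
    have -> : ((u * s - a) / s)%:C * (s%:C * nrm t) = ((u * s - a) / s * s)%:C * nrm t.
      by rewrite rmorphM /=; ring.
    by rewrite divfK ?gt_eqF // rmorphB rmorphM /=; ring.
  apply: below; apply/andP; split.
    by rewrite divr_ge0 //; clear -gd aus usp; clra.
  by rewrite ltr_pdivrMr //; clear -gd a0; clra.
apply: (nE _ _ Dy).
have -> : gam t' - a%:C * nrm t - (gam t' - r0%:C * nrm t') = r0%:C * nrm t' - a%:C * nrm t by ring.
rewrite cm_lt_sqr ?(ltW r0p) // cm_sqrB !cmM !cm_real n1 n1' !mulr1 !gtr0_norm //.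
have -> : dotc (r0%:C * nrm t') (a%:C * nrm t) = r0 * (a * dotc (nrm t) (nrm t')).
  by rewrite dotcZl dotcZr /dotc; ring.
have h1 : r0 * a * (1 / 2) <= r0 * a * dotc (nrm t) (nrm t') by rewrite ler_wpM2l // mulr_ge0 // ltW.
have h2 : a * a <= a * (r0 / 2) by rewrite ler_wpM2l // ltW.
have h3 : 0 < a * r0 by rewrite mulr_gt0.
by rewrite !expr2; clear -gd h1 h2 h3; clra.
Qed.

End Dom.

(** * Lipschitz extension to the closure of a function with bounded derivative *)

Section Lipschitz.
Variables (D : set C) (gam nrm : R -> C) (Lam lam d0 r0 : R).
Hypothesis gd : good_dom D gam nrm Lam lam d0 r0.
Variables (f : C -> C) (L : R).
Hypothesis fL : forall z, D z -> exists2 l, hasd f z l & cm l <= L.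

(** The segment from x to y may leave D when both are close to the boundary. In that case both
    points are moved by 4 d along one normal, where d = |x - y|; there they lie in an inner ball of
    radius 4 d, which is convex. The three pieces of the path have total length (4 + 4 + 1) d. *)
Lemma loc_lip x y : D x -> D y -> cm (x - y) <= r0 / 32 -> cm (f x - f y) <= 9 * L * cm (x - y).
Proof.
move=> Dx Dy xy; have r0p := gd_r0 gd.
have L0 : 0 <= L by have [l _] := fL Dx; apply: le_trans; exact: cm_ge0.
have [E|xny] := eqVneq x y; first by rewrite E !subrr cm0 mulr0.
set d := cm (x - y) in xy *; have dp : 0 < d by rewrite cm_gt0 subr_eq0.
have seg a b : (forall t : R, 0 <= t <= 1 -> D (a + t%:C * (b - a))) -> cm (f b - f a) <= L * cm (b - a).
  by move=> H; apply: lip_of_deriv => t /H; exact: fL.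
have [[t xt]|nt] := pselect (exists t, cm (x - gam t) <= 2 * d); last first.
  have fx : far gam x (2 * d).
    by move=> t; rewrite leNgt; apply/negP => h; apply: nt; exists t; exact: ltW.
  have h : cm (f y - f x) <= L * cm (y - x).
    apply: seg => t /andP[t0 t1]; apply: (far_ball gd Dx fx).
    rewrite [x + _]addrC addrK cmM cm_real ger0_norm // cmBC -/d.
    have : t * d <= d by rewrite ler_piMl // ltW.
    by clear -gd fL dp; clra.
  rewrite [cm (f x - f y)]cmBC; apply: le_trans h _; rewrite cmBC -/d ler_wpM2r ?(ltW dp) //.
  by clear -gd fL L0; lra.
have [n1 _ _] := gd_ball gd t.
have yt : cm (y - gam t) <= 2 * (3 / 2 * d).
  by apply: le_trans (cm_tri x _ _) _; rewrite cmBC -/d; clear -gd fL xt; clra.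
have d3 : 0 < 3 / 2 * d by rewrite mulr_gt0 // divr_gt0.
pose v := (4 * d)%:C * nrm t.
have cv : cm v = 4 * d by rewrite cmM cm_real n1 mulr1 gtr0_norm // mulr_gt0.
have hx : cm (f (x + v) - f x) <= L * cm v.
  rewrite -[X in L * cm X](addKr x) [- x + _]addrC; apply: seg => s /andP[s0 s1].
  rewrite [x + v - x]addrAC subrr add0r /v mulrA -rmorphM /=.
  apply: (up_segment gd Dx xt dp); first by clear -gd fL xy r0p; clra.
  have : s * (4 * d) <= 4 * d by rewrite ler_piMl // mulr_ge0 // ltW.
  by move=> h; rewrite h andbT mulr_ge0 // mulr_ge0 // ltW.
have hy : cm (f (y + v) - f y) <= L * cm v.
  rewrite -[X in L * cm X](addKr y) [- y + _]addrC; apply: seg => s /andP[s0 s1].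
  rewrite [y + v - y]addrAC subrr add0r /v mulrA -rmorphM /=.
  apply: (up_segment gd Dy yt d3); first by clear -gd fL xy r0p; clra.
  have : s * (4 * d) <= 4 * d by rewrite ler_piMl // mulr_ge0 // ltW.
  move=> h; rewrite mulr_ge0 //=; last by rewrite mulr_ge0 // ltW.
  by clear -gd fL h dp; clra.
have hxy : cm (f (x + v) - f (y + v)) <= L * d.
  have -> : d = cm ((x + v) - (y + v)) by rewrite /d; congr cm; ring.
  apply: seg => s hs; apply: (@up_ball _ _ _ _ _ _ _ gd t (4 * d)).
    by rewrite mulr_gt0 //=; clear -gd fL xy r0p; clra.
  apply: (@le_lt_trans _ _ (3 * d)); last by rewrite ltr_pM2r // ltr_nat.
  have E a : a + v - (gam t + (4 * d)%:C * nrm t) = a - gam t by rewrite /v; ring.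
  by apply: seg_cm => //; rewrite E; [clear -gd fL yt; clra|clear -gd fL xt dp; clra].
have -> : f x - f y = (f (x + v) - f (y + v)) - (f (x + v) - f x) + (f (y + v) - f y) by ring.
apply: le_trans (cmD _ _) _; apply: le_trans (lerD (cmB _ _) (lexx _)) _.
rewrite cv in hx hy; clear -gd fL hx hy hxy; clra.
Qed.

Lemma extension : exists F : C -> C, (forall z, D z -> F z = f z) /\
  forall x y, clos D x -> clos D y -> cm (x - y) <= r0 / 8 / 16 ->
    cm (F x - F y) <= 9 * L * cm (x - y).
Proof.
have r0p := gd_r0 gd.
(* Two points within r0 / 64 of z are within r0 / 32 of each other, which is the range of
   [loc_lip]. *)
have r2 : 0 < r0 / 8 / 8 by rewrite !divr_gt0.
have ext z : exists l, clos D z -> forall x, D x -> cm (x - z) <= r0 / 8 / 8 ->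
    cm (f x - l) <= 9 * L * cm (x - z).
  have [cz|nc] := pselect (clos D z); last by exists 0.
  have [w0 Dw0 _] := cz 1 ltr01.
  have L0 : 0 <= L by have [l _] := fL Dw0; apply: le_trans; exact: cm_ge0.
  have sq n : exists w, D w /\ cm (z - w) < (n.+1%:R)^-1 * (r0 / 8 / 8).
    have e0 : 0 < (n.+1%:R)^-1 * (r0 / 8 / 8) by rewrite mulr_gt0 // invr_gt0 ltr0Sn.
    by have [w h1 h2] := cz _ e0; exists w.
  have [w hw] := choice sq.
  have wz n : cm (z - w n) <= r0 / 8 / 8.
    have [_ h] := hw n; apply: le_trans (ltW h) _; rewrite ler_piMl ?(ltW r2) //.
    by rewrite invf_le1 // ler1n.
  have small (e : R) : 0 < e -> exists N : nat, forall n, (N <= n)%N -> cm (z - w n) <= e.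
    move=> e0; exists (Num.bound (r0 / 8 / 8 / e)) => n hn.
    have [_ h] := hw n; apply: le_trans (ltW h) _.
    rewrite ler_pdivrMl ?ltr0Sn // -ler_pdivrMr //.
    have e0' : 0 <= r0 / 8 / 8 / e by rewrite divr_ge0 // ltW.
    apply: le_trans (ltW (archi_boundP e0')) _; rewrite ler_nat; exact: leq_trans hn _.
  have cau x n : D x -> cm (x - z) <= r0 / 8 / 8 -> cm (f x - f (w n)) <= 9 * L * (cm (x - z) + cm (z - w n)).
    move=> Dx hx; have h := cm_tri z x (w n); have [Dw _] := hw n.
    apply: le_trans (loc_lip Dx Dw _) _; first by have := wz n; clear -gd fL h hx r0p; clra.
    by apply: ler_wpM2l => //; rewrite mulr_ge0.
  have [l hl] : exists l, ccvg (fun n => f (w n)) l.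
    apply: ccauchy_lim => e e0.
    have K0 : 0 < 18 * L + 1 by clear -gd fL L0; lra.
    have [N hN] := small (e / (18 * L + 1)) (divr_gt0 e0 K0).
    exists N => n m Nn Nm; have [Dw _] := hw n.
    apply: le_trans (cau _ _ Dw _) _; first by rewrite cmBC; have := wz n; clear -gd fL r0p; clra.
    have h1 := hN n Nn; have h2 := hN m Nm; rewrite [cm (w n - z)]cmBC.
    have h3 : 9 * L * (cm (z - w n) + cm (z - w m)) <= 9 * L * (2 * (e / (18 * L + 1))).
      by apply: ler_wpM2l; [rewrite mulr_ge0|clear -gd fL h1 h2; clra].
    apply: le_trans h3 _.
    have -> : 9 * L * (2 * (e / (18 * L + 1))) = e * (18 * L / (18 * L + 1)) by field; rewrite gt_eqF.
    by rewrite ler_piMr ?(ltW e0) // ler_pdivrMr // mul1r lerDl.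
  exists l => _ x Dx hx; apply/ler_addgt0Pr => e e0.
  have K0 : 0 < 9 * L + 1 by clear -gd fL L0; lra.
  have [N1 h1] := hl (e / 2) (divr_gt0 e0 (ltr0Sn R 1)).
  have [N2 h2] := small _ (divr_gt0 (divr_gt0 e0 (ltr0Sn R 1)) K0).
  pose n := maxn N1 N2; have {}h1 := h1 n (leq_maxl _ _); have {}h2 := h2 n (leq_maxr _ _).
  apply: le_trans (cm_tri (f (w n)) _ _) _.
  have h3 := cau x n Dx hx.
  have h4 : 9 * L * cm (z - w n) <= e / 2.
    apply: (@le_trans _ _ (9 * L * (e / 2 / (9 * L + 1)))); first by rewrite ler_wpM2l // mulr_ge0.
    have -> : 9 * L * (e / 2 / (9 * L + 1)) = e / 2 * (9 * L / (9 * L + 1)) by field; rewrite gt_eqF.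
    by rewrite ler_piMr ?divr_ge0 ?(ltW e0) // ler_pdivrMr // mul1r lerDl.
  by clear -gd fL h1 h3 h4; clra.
have [F hF] := choice ext.
exists F; split.
  move=> z Dz; have := hF z (sub_clos Dz) z Dz; rewrite subrr cm0 mulr0 (ltW r2) => /(_ isT) h.
  by apply/esym/eqP; rewrite -subr_eq0 -cm_eq0 eq_le h cm_ge0.
move=> x y cx cy xy.
have [w0 Dw0 _] := cx 1 ltr01.
have L0 : 0 <= L by have [l _] := fL Dw0; apply: le_trans; exact: cm_ge0.
apply/ler_addgt0Pr => e e0; have K0 : 0 < 18 * L + 1 by clear -gd fL L0; lra.
pose e1 := Num.min (e / (18 * L + 1)) (r0 / 8 / 16).
have e10 : 0 < e1 by rewrite lt_min divr_gt0 //= !divr_gt0.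
have e1r : e1 <= r0 / 8 / 16 by rewrite ge_min lexx orbT.
have e1e : 18 * L * e1 <= e.
  apply: (@le_trans _ _ ((18 * L + 1) * e1)); first by rewrite ler_wpM2r ?lerDl // ltW.
  by rewrite mulrC -ler_pdivlMr // ge_min lexx.
have [w Dw xw] := cx e1 e10.
have yw : cm (y - w) <= cm (x - y) + e1.
  by apply: le_trans (cm_tri x _ _) _; rewrite [cm (y - x)]cmBC; clear -gd fL xw; clra.
have h1 := hF x cx w Dw; have h2 := hF y cy w Dw.
rewrite [cm (w - x)]cmBC in h1; rewrite [cm (w - y)]cmBC in h2.
have {}h1 := h1 (le_trans (ltW xw) (le_trans e1r _)).
have {}h2 : cm (f w - F y) <= 9 * L * cm (y - w).
  by apply: h2; clear -gd fL yw xy e1r r0p; clra.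
have {}h1 : cm (f w - F x) <= 9 * L * cm (x - w).
  by apply: h1; clear -gd fL r0p; clra.
have -> : F x - F y = (f w - F y) - (f w - F x) by ring.
apply: le_trans (cmB _ _) _.
have L9 : 0 <= 9 * L by rewrite mulr_ge0.
have h3 : 9 * L * cm (y - w) <= 9 * L * (cm (x - y) + e1) by rewrite ler_wpM2l.
have h4 : 9 * L * cm (x - w) <= 9 * L * e1 by rewrite ler_wpM2l // ltW.
by clear -gd fL h1 h2 h3 h4 e1e; clra.
Qed.

End Lipschitz.
End Geometry.

(** * One stage of the construction of sigma *)

Section Stage.
Variable R : realType.
Local Notation C := R[i].
Local Notation Re := (@complex.Re R).
Local Notation Im := (@complex.Im R).

(* Coordinate at the boundary point [gam t] at scale [e], in which the inward normal is i. *)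
Definition bdcoord (gam nrm : R -> C) (t e : R) (z : C) : C :=
  (z - gam t) / (e%:C * (- ci * nrm t)).

Lemma inv_sqr_step (a : R) : 0 < a -> ((a + 1) ^+ 2)^-1 <= a^-1 - (a + 1)^-1.
Proof.
move=> a0; have a1 : 0 < a + 1 by apply: addr_gt0.
have -> : a^-1 - (a + 1)^-1 = (a * (a + 1))^-1 by field; rewrite !gt_eqF.
by rewrite lef_pV2 ?posrE ?mulr_gt0 ?exprn_gt0 // expr2 ler_pM2r // lerDl ler01.
Qed.

Lemma sum_inv_sqr (k : nat) : \sum_(0 <= j < k) ((j.+1%:R : R) ^+ 2)^-1 <= 2.
Proof.
case: k => [|k]; first by rewrite big_geq.
suff H : \sum_(0 <= j < k.+1) ((j.+1%:R : R) ^+ 2)^-1 <= 2 - (k.+1%:R)^-1.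
  by apply: le_trans H _; rewrite gerBl invr_ge0.
elim: k => [|k IH]; first by rewrite big_nat1 expr1n invr1; lra.
rewrite big_nat_recr //=; have k0 : 0 < (k.+1%:R : R) by rewrite ltr0n.
have := inv_sqr_step k0; rewrite -(natrD _ _ 1) !addn1.
by move=> h; move: (lerD IH h); rewrite [2 - _ + _]addrA subrK.
Qed.

(** The bound does not depend on n: this leaves the number of children of a node free. *)
Lemma sum_inv_dist (n m : nat) : (m < n)%N ->
  \sum_(0 <= j < n | j != m) ((`|j%:R - m%:R|) ^+ 2)^-1 <= (4 : R).
Proof.
move=> mn.
have low : \sum_(0 <= j < m) ((`|j%:R - m%:R : R|) ^+ 2)^-1 <= 2.
  suff -> : \sum_(0 <= j < m) ((`|j%:R - m%:R : R|) ^+ 2)^-1 =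
      \sum_(0 <= j < m) ((j.+1%:R : R) ^+ 2)^-1 by exact: sum_inv_sqr.
  elim: m {mn} => [|k IH]; first by rewrite !big_geq.
  rewrite big_nat_recl // big_nat_recr //= -IH addrC.
  congr (_ + _); first by rewrite sub0r normrN ger0_norm.
  apply: eq_bigr => j _; congr (_ ^+ 2)^-1.
  by rewrite -[k.+1]addn1 -[j.+1]addn1 !natrD; congr `|_|; ring.
have high : \sum_(m.+1 <= j < n) ((`|j%:R - m%:R : R|) ^+ 2)^-1 <= 2.
  rewrite -{1}[m.+1]add0n big_addn; apply: le_trans (sum_inv_sqr (n - m.+1)).
  apply: ler_sum => j _; by rewrite -addSnnS natrD addrK ger0_norm ?ler0n.
rewrite (big_cat_nat (n := m)) //=; last exact: ltnW.
rewrite [X in _ + X]big_mkcond big_ltn //= eqxx add0r -big_mkcond /=.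
rewrite (_ : (4 : R) = 2 + 2); last by ring.
apply: lerD; first apply: le_trans low; last apply: le_trans high.
  by rewrite big_mkcond ler_sum // => j _; case: ifP => // _; rewrite invr_ge0 exprn_ge0.
by rewrite big_mkcond ler_sum // => j _; case: ifP => // _; rewrite invr_ge0 exprn_ge0.
Qed.

Lemma step_num (a e f : R) : 0 < e -> a + e + (1 - f + e) <= 1 - f + (a + 4 * e).
Proof. by lra. Qed.

Definition exd (f : C -> C) (z : C) := exists l, hasd f z l.

Lemma exd_sum (I : Type) (r : seq I) (F : I -> C -> C) z :
  (forall i, exd (F i) z) -> exd (fun w => \sum_(i <- r) F i w) z.
Proof.
move=> H; elim: r => [|i r [l IH]].
  by exists 0; apply: (hasd_local ltr01 _ (hasd_cst 0 z)) => w _; rewrite big_nil.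
have [m hm] := H i; exists (m + l); apply: (hasd_local ltr01 _ (hasdD hm IH)) => w _.
by rewrite big_cons.
Qed.

(** * Sums of equidistant bumps along the boundary *)

Section Blocks.
Variables (D : set C) (gam nrm : R -> C) (Lam lam d0 r0 : R).
Hypothesis gd : good_dom D gam nrm Lam lam d0 r0.
Local Notation loc := (bdcoord gam nrm).

Lemma locE (t e : R) (z : C) : 0 < e -> z - gam t = e%:C * (- ci * nrm t) * loc t e z.
Proof.
move=> e0; have [n1 _ _] := gd_ball gd t.
by rewrite /bdcoord mulrC mulfVK // -cm_gt0 !cmM cm_real cmN cm_ci n1 gtr0_norm // !mulr1.
Qed.

Lemma cm_loc (t e : R) (z : C) : 0 < e -> cm (z - gam t) = e * cm (loc t e z).
Proof.
move=> e0; have [n1 _ _] := gd_ball gd t.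
by rewrite {1}(locE t z e0) !cmM cm_real gtr0_norm // cmN cm_ci n1 mul1r mulr1.
Qed.

Lemma dotc_loc (t e : R) (z : C) : 0 < e -> dotc (z - gam t) (nrm t) = e * Im (loc t e z).
Proof.
move=> e0; have [n1 _ _] := gd_ball gd t.
rewrite {1}(locE t z e0) -mulrA dotcZl; congr (_ * _).
have := cm_sqr (nrm t); rewrite n1 expr1n => n2.
by rewrite -[RHS]mul1r n2 /dotc !reimE; ring.
Qed.

(** At scale e the outer ball of radius r0 becomes one of radius r0 / e, which exceeds [T0] for
    small e. *)
Lemma loc_ext (t e : R) (z : C) : 0 < e -> clos D z ->
  - cm (loc t e z) ^+ 2 <= 2 * (r0 / e) * Im (loc t e z).
Proof.
move=> e0 cz; have := clos_dot gd (t) cz; rewrite (cm_loc t z e0) (dotc_loc t z e0).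
set x := cm _; set y := Im _ => h.
rewrite -(@ler_pM2l _ (e ^+ 2)) ?exprn_gt0 //; move: h.
have -> : e ^+ 2 * (2 * (r0 / e) * y) = 2 * r0 * (e * y) by field; rewrite gt_eqF.
by have -> : e ^+ 2 * (- x ^+ 2) = - (e * x) ^+ 2 by ring.
Qed.

Lemma exd_loc (t e : R) (z : C) : exd (loc t e) z.
Proof.
exists ((e%:C * (- ci * nrm t))^-1 * (1 - 0)).
have := hasdZ (e%:C * (- ci * nrm t))^-1 (hasdB (hasd_id z) (hasd_cst (gam t) z)).
by apply: (hasd_local ltr01) => w _; rewrite mulrC.
Qed.

Lemma exd_comp (f s : C -> C) z : exd s z -> exd f (s z) -> exd (fun w => f (s w)) z.
Proof. by move=> [l hl] [m hm]; exists (m * l); exact: hasd_comp hl hm. Qed.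

Variables (Phi : C -> C) (T0 eta C0 : R).
Hypotheses (T00 : 0 < T0) (C00 : 0 < C0).
Hypothesis HPhi : forall (T : R) z, T0 <= T -> - cm z ^+ 2 <= 2 * T * Im z ->
  [/\ exists l, hasd Phi z l, cm (Phi z) <= 1 - eta & cm (Phi z) * cm z ^+ 2 <= C0].

Lemma phi_loc (t e : R) (z : C) : clos D z -> 0 < e -> e * T0 <= r0 ->
  [/\ exd (fun w => Phi (loc t e w)) z, cm (Phi (loc t e z)) <= 1 - eta &
      cm (Phi (loc t e z)) * cm (z - gam t) ^+ 2 <= C0 * e ^+ 2].
Proof.
move=> cz e0 eT; have TT : T0 <= r0 / e by rewrite ler_pdivlMr // mulrC.
have [dP P1 P2] := HPhi TT (loc_ext t e0 cz); split=> //.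
  exact: exd_comp (exd_loc t e z) dP.
by rewrite (cm_loc t z e0) exprMn mulrCA [C0 * _]mulrC ler_pM2l // exprn_gt0.
Qed.

Definition block (t h e : R) (n : nat) (z : C) := \sum_(0 <= j < n) Phi (loc (t + h * j%:R) e z).

(** Bump j is at distance at least a |j - m| from z, so the decay of Phi leaves a sum of inverse
    squares. *)
Lemma block_sep (t h e a : R) (n m : nat) (z : C) : clos D z -> 0 < e -> e * T0 <= r0 -> 0 < a ->
  (m < n)%N ->
  (forall j, (j < n)%N -> a * `|j%:R - m%:R| <= cm (z - gam (t + h * j%:R))) ->
  cm (block t h e n z - Phi (loc (t + h * m%:R) e z)) <= 4 * C0 * e ^+ 2 / a ^+ 2.
Proof.
move=> cz e0 eT a0 mn H.
rewrite /block (bigD1_seq m) ?mem_index_iota ?iota_uniq //= [X in cm X]addrC addKr.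
apply: le_trans (cm_sum _ _ _) _.
rewrite big_nat_cond.
apply: (@le_trans _ _ (\sum_(0 <= j < n | j != m) (C0 * e ^+ 2 / a ^+ 2 * (`|j%:R - m%:R| ^+ 2)^-1))).
  rewrite [X in _ <= X]big_nat_cond; apply: ler_sum => j /andP[/= jn jm].
  have [_ _ h3] := phi_loc (t + h * j%:R) cz e0 eT.
  have d0' : 0 < a * `|j%:R - m%:R|.
    by rewrite mulr_gt0 // normr_gt0 subr_eq0 eqr_nat.
  rewrite -mulrA -invfM -exprMn ler_pdivlMr ?exprn_gt0 //; apply: le_trans h3.
  by rewrite ler_wpM2l ?cm_ge0 // lerXn2r ?nnegrE ?cm_ge0 ?(ltW d0') //; exact: H.
rewrite -mulr_sumr; apply: le_trans (ler_wpM2l _ (sum_inv_dist mn)) _.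
  by rewrite divr_ge0 ?exprn_ge0 // ?mulr_ge0 ?exprn_ge0 // ltW.
by rewrite le_eqVlt; apply/orP; left; apply/eqP; ring.
Qed.

Lemma block_far (t h e a : R) (n : nat) (z : C) : clos D z -> 0 < e -> e * T0 <= r0 -> 0 < a ->
  (forall j, (j < n)%N -> a <= cm (z - gam (t + h * j%:R))) ->
  cm (block t h e n z) <= n%:R * (C0 * e ^+ 2 / a ^+ 2).
Proof.
move=> cz e0 eT a0 H; apply: le_trans (cm_sum _ _ _) _.
apply: (@le_trans _ _ (\sum_(0 <= j < n) (C0 * e ^+ 2 / a ^+ 2))); last first.
  by rewrite big_const_nat subn0 iter_addr_0 mulr_natl.
rewrite big_nat_cond [X in _ <= X]big_nat_cond; apply: ler_sum => j /andP[/= jn _].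
have [_ _ h3] := phi_loc (t + h * j%:R) cz e0 eT.
rewrite ler_pdivlMr ?exprn_gt0 //; apply: le_trans h3.
by rewrite ler_wpM2l ?cm_ge0 // lerXn2r ?nnegrE ?cm_ge0 ?(ltW a0) //; exact: H.
Qed.

(** If m minimizes the distance to z, then twice the distance from z to point j is at least the
    distance between the points j and m, which is bounded below by [gd_colip]. *)
Lemma nearest (t h : R) (n : nat) (z : C) : (0 < n)%N -> 0 < h -> h * n%:R <= d0 ->
  exists2 m, (m < n)%N & forall j, (j < n)%N ->
    cm (z - gam (t + h * m%:R)) <= cm (z - gam (t + h * j%:R)) /\
    lam * h / 2 * `|j%:R - m%:R| <= cm (z - gam (t + h * j%:R)).
Proof.
case: n => // n _ h0 hn.
pose F (i : 'I_n.+1) := cm (z - gam (t + h * i%:R)).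
case: (@arg_minP _ _ _ ord0 xpredT F isT) => m _ Hm.
exists m => // j jn; have := Hm (Ordinal jn) isT; rewrite /F /= => hj; split=> //.
have : cm (gam (t + h * j%:R) - gam (t + h * m%:R)) <= 2 * cm (z - gam (t + h * j%:R)).
  have := cm_tri z (gam (t + h * j%:R)) (gam (t + h * m%:R)); rewrite [cm (gam (t + h * j%:R) - z)]cmBC.
  by move: hj; clear -gd T00 C00 HPhi; lra.
have E : `|t + h * j%:R - (t + h * m%:R)| = h * `|j%:R - m%:R|.
  by rewrite -[in RHS](gtr0_norm h0) -normrM; congr `|_|; ring.
have : lam * `|t + h * j%:R - (t + h * m%:R)| <= cm (gam (t + h * j%:R) - gam (t + h * m%:R)).
  apply: (gd_colip gd); rewrite E; apply: le_trans hn; rewrite ler_pM2l //.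
  have jn' : (j%:R <= n.+1%:R :> R) by rewrite ler_nat ltnW.
  have mn' : (m%:R <= n.+1%:R :> R) by rewrite ler_nat ltnW.
  by rewrite ler_norml; apply/andP; split; move: (ler0n R j) (ler0n R m) jn' mn'; clear -gd T00 C00 HPhi; lra.
by rewrite E; set x := cm _; set y := cm _; set u := `|_|; clear -gd T00 C00 HPhi; lra.
Qed.

Lemma lam_le : lam <= Lam.
Proof.
have dp := gd_d0 gd; have lp := gd_colip gd (s := 0) (t := d0).
have := gd_lip gd 0 d0; rewrite sub0r normrN (gtr0_norm dp) in lp *.
by move=> h; move: (le_trans (lp (lexx _)) h); rewrite ler_pM2r.
Qed.

(* A node (t, r) of [qs] reserves the disc of radius r about [gam t], on which [sig] is small. *)
Definition stinv (sig : C -> C) (qs : seq (R * R)) (A rmax : R) : Prop :=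
  [/\ forall z, clos D z -> exd sig z /\ cm (sig z) <= 1 - eta + A,
      forall p, p \in qs -> 0 < p.2 <= rmax /\
        forall z, clos D z -> cm (z - gam p.1) <= p.2 -> cm (sig z) <= A &
      forall p q, p \in qs -> q \in qs -> p != q -> p.2 + q.2 <= cm (gam p.1 - gam q.1)].

Section BlockStep.
Variables (et kap rho rmax A : R) (N : R -> nat) (sig : C -> C) (qs : seq (R * R)).
Hypotheses (et0 : 0 < et) (kap0 : 0 < kap) (kap1 : kap <= 1) (rho0 : 0 < rho) (rho1 : rho <= 1).
Hypotheses (kapet : 16 * C0 * kap ^+ 2 <= lam ^+ 2 * et) (rk : rho * kap <= lam / 4).
Hypothesis Phi_small : forall z, cm z <= rho -> cm (Phi z) <= et.
Hypotheses (rm1 : rmax / (8 * Lam) <= d0) (rm2 : rmax / (8 * Lam) * T0 <= r0).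
Hypothesis N0 : forall r, (0 < N r)%N.
Hypothesis Nbig : forall r, (size qs)%:R * (C0 / Lam ^+ 2) <= et * (N r)%:R.
Hypothesis A0 : 0 <= A.
Hypothesis inv : stinv sig qs A rmax.

(** The children of a node of radius r share the parameter length r / (8 Lam), so they all lie
    within r / 8 of it. *)
Definition hh (r : R) := r / (8 * Lam) / (N r)%:R.
Definition child (p : R * R) (j : nat) : R * R := (p.1 + hh p.2 * j%:R, rho * (kap * hh p.2)).
Definition children := [seq child p j | p <- qs, j <- iota 0 (N p.2)].
Definition pblock (p : R * R) := block p.1 (hh p.2) (kap * hh p.2) (N p.2).
(** Each node must receive one block only, and the separation in [stinv] concerns distinct nodes;
    hence [undup]. *)
Definition blockstep (z : C) := sig z + \sum_(p <- undup qs) pblock p z.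

Lemma NR r : 0 < ((N r)%:R : R). Proof. by rewrite ltr0n. Qed.

Lemma hhN r : hh r * (N r)%:R = r / (8 * Lam).
Proof. by rewrite /hh mulfVK // gt_eqF ?NR. Qed.

Lemma node_facts p : p \in qs -> [/\ 0 < hh p.2, 0 < kap * hh p.2 <= hh p.2,
  kap * hh p.2 * T0 <= r0, hh p.2 * (N p.2)%:R <= d0 & Lam * (hh p.2 * (N p.2)%:R) = p.2 / 8].
Proof.
move=> pq; have [_ /(_ _ pq)[/andP[p0 pr] _] _] := inv; have L0 := gd_Lam gd.
have L8 : 0 < 8 * Lam by rewrite mulr_gt0.
have h0 : 0 < hh p.2 by rewrite !divr_gt0 // NR.
have hl : hh p.2 <= p.2 / (8 * Lam).
  by rewrite -hhN ler_peMr ?(ltW h0) // ler1n.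
have pl : p.2 / (8 * Lam) <= rmax / (8 * Lam) by rewrite ler_pM2r ?invr_gt0.
have kh : kap * hh p.2 <= hh p.2 by rewrite ler_piMl // ltW.
split=> //.
- by rewrite mulr_gt0.
- apply: le_trans rm2; rewrite ler_pM2r //; apply: le_trans kh _; exact: le_trans hl pl.
- by rewrite hhN; exact: le_trans pl rm1.
- by rewrite hhN; field; rewrite gt_eqF.
Qed.

Lemma child_dist p j : p \in qs -> (j <= N p.2)%N -> cm (gam (child p j).1 - gam p.1) <= p.2 / 8.
Proof.
move=> pq jn; have [h0 _ _ _ E] := node_facts pq.
apply: le_trans (gd_lip gd _ _) _; rewrite -E /child /= addrC addrA addNr add0r.
rewrite (ler_pM2l (gd_Lam gd)) normrM (gtr0_norm h0) (ler_pM2l h0) ger0_norm ?ler0n //.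
by rewrite ler_nat.
Qed.

Lemma child_rad p j : p \in qs -> 0 < (child p j).2 /\ (child p j).2 <= p.2 / 8 /\
  (child p j).2 <= lam * hh p.2 / 4.
Proof.
move=> pq; have [h0 /andP[k0 kh] _ _ E] := node_facts pq.
have L1 : rho * (kap * hh p.2) <= lam * hh p.2 / 4.
  by rewrite mulrA [lam * _ / 4]mulrAC ler_pM2r.
split; first by rewrite /child /= mulr_gt0.
split=> //; rewrite /child /=; apply: le_trans L1 _; rewrite -E.
apply: (@le_trans _ _ (lam * hh p.2)).
  have := mulr_ge0 (ltW (gd_lam gd)) (ltW h0); set x := lam * _; clra.
rewrite mulrA -[X in X <= _]mulr1; apply: ler_pM => //; last by rewrite ler1n.
  by rewrite mulr_ge0 ?(ltW h0) ?(ltW (gd_lam gd)).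
by rewrite ler_pM2r // lam_le.
Qed.

(** Let l be the parameter length of the block. Its N bumps of scale kap l / N, seen from a distance
    at least Lam l, add up to at most C0 kap^2 / (Lam^2 N). A large N thus compensates for the
    number of nodes already present. *)
Lemma pblock_far p z : p \in qs -> clos D z -> p.2 <= cm (z - gam p.1) ->
  (size qs)%:R * cm (pblock p z) <= et.
Proof.
move=> pq cz pz; have [h0 /andP[k0 kh] kT _ E] := node_facts pq.
have [_ /(_ _ pq)[/andP[p0 _] _] _] := inv; have L0 := gd_Lam gd.
set l := hh p.2 * (N p.2)%:R in E; have l0 : 0 < l by rewrite mulr_gt0 // NR.
have b : cm (pblock p z) <= (N p.2)%:R * (C0 * (kap * hh p.2) ^+ 2 / (Lam * l) ^+ 2).
  apply: block_far => //; first by rewrite mulr_gt0.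
  move=> j jn; have := child_dist pq (ltnW jn); rewrite /child /= => c.
  have := cm_tri (gam (p.1 + hh p.2 * j%:R)) z (gam p.1); rewrite E.
  by move: c pz p0; set u := cm _; set v := cm _; set w := cm _; clra.
have n0 : (0 : R) < (N p.2)%:R by apply: NR.
apply: le_trans (ler_wpM2l (ler0n _ _) b) _.
rewrite -(ler_pM2r n0); apply: le_trans (Nbig p.2).
have -> : (size qs)%:R * ((N p.2)%:R * (C0 * (kap * hh p.2) ^+ 2 / (Lam * l) ^+ 2)) * (N p.2)%:R
  = (size qs)%:R * (C0 / Lam ^+ 2) * kap ^+ 2.
  by rewrite /l; field; rewrite !gt_eqF.
rewrite ler_piMr ?expr_le1 // ?(ltW kap0) // mulr_ge0 ?ler0n // divr_ge0 ?exprn_ge0 // ltW //.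
Qed.

Lemma others (P : pred (R * R)) z : clos D z ->
  (forall p, p \in qs -> P p -> p.2 <= cm (z - gam p.1)) ->
  cm (\sum_(p <- undup qs | P p) pblock p z) <= et.
Proof.
move=> cz H; apply: le_trans (cm_sum _ _ _) _.
case: (posnP (size qs)) => [/size0nil -> | s0].
  by rewrite big_nil ltW.
have sR : (0 : R) < (size qs)%:R by rewrite ltr0n.
apply: (@le_trans _ _ (\sum_(p <- undup qs | P p) (et / (size qs)%:R))).
  rewrite big_seq_cond [X in _ <= X]big_seq_cond; apply: ler_sum => p /andP[]; rewrite mem_undup => pq Pp.
  by rewrite ler_pdivlMr // mulrC; apply: pblock_far => //; exact: H.
rewrite big_const_seq iter_addr_0 -[X in X <= _]mulr_natr.
apply: (@le_trans _ _ (et / (size qs)%:R * (size qs)%:R)); last by rewrite divfK // gt_eqF.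
apply: ler_wpM2l; first by rewrite divr_ge0 // ltW.
by rewrite ler_nat; apply: leq_trans (count_size _ _) (size_undup _).
Qed.

Lemma blockstep_far z : clos D z -> (forall p, p \in qs -> p.2 <= cm (z - gam p.1)) ->
  cm (blockstep z - sig z) <= et.
Proof. by move=> cz H; rewrite /blockstep addrC addKr; apply: others => // p pq _; exact: H. Qed.

Lemma disj p q z : p \in qs -> q \in qs -> p != q -> cm (z - gam p.1) <= p.2 ->
  q.2 <= cm (z - gam q.1).
Proof.
move=> pq qq pnq zp; have [_ _ /(_ _ _ pq qq pnq)] := inv.
have := cm_tri z (gam p.1) (gam q.1).
rewrite [cm (gam p.1 - z)]cmBC; move: zp; by set x := cm _; set y := cm _; set w := cm _; clra.
Qed.

Lemma blockstep_in p z : p \in qs -> clos D z -> cm (z - gam p.1) <= p.2 ->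
  cm (blockstep z - pblock p z - sig z) <= et.
Proof.
move=> pq cz zp; rewrite /blockstep (bigD1_seq p) ?mem_undup ?undup_uniq //=.
set X := \sum_(_ <- _ | _) _.
have -> : sig z + (pblock p z + X) - pblock p z - sig z = X by ring.
by apply: others => // q qq qp; apply: disj pq qq _ zp; rewrite eq_sym.
Qed.

Lemma pblock_sep p z m : p \in qs -> clos D z -> (m < N p.2)%N ->
  (forall j, (j < N p.2)%N -> lam * hh p.2 / 2 * `|j%:R - m%:R| <= cm (z - gam (child p j).1)) ->
  cm (pblock p z - Phi (loc (child p m).1 (kap * hh p.2) z)) <= et.
Proof.
move=> pq cz mN H; have [h0 /andP[k0 kh] kT _ _] := node_facts pq; have l0 := gd_lam gd.
have a0 : 0 < lam * hh p.2 / 2 by rewrite divr_gt0 // mulr_gt0.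
apply: le_trans (block_sep cz k0 kT a0 mN H) _.
have -> : 4 * C0 * (kap * hh p.2) ^+ 2 / (lam * hh p.2 / 2) ^+ 2 = 16 * C0 * kap ^+ 2 / lam ^+ 2.
  by field; rewrite !gt_eqF.
by rewrite ler_pdivrMr ?exprn_gt0 // [et * _]mulrC.
Qed.

Lemma child_sep p j m : p \in qs -> (j < N p.2)%N -> (m < N p.2)%N ->
  lam * hh p.2 * `|j%:R - m%:R| <= cm (gam (child p j).1 - gam (child p m).1).
Proof.
move=> pq jn mn; have [h0 _ _ hN _] := node_facts pq.
have E : `|(child p j).1 - (child p m).1| = hh p.2 * `|j%:R - m%:R|.
  by rewrite -[in RHS](gtr0_norm h0) -normrM /child /=; congr `|_|; ring.
rewrite -mulrA -E; apply: (gd_colip gd); rewrite E; apply: le_trans hN; rewrite ler_pM2l //.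
have jn' : (j%:R <= (N p.2)%:R :> R) by rewrite ler_nat ltnW.
have mn' : (m%:R <= (N p.2)%:R :> R) by rewrite ler_nat ltnW.
by rewrite ler_norml; apply/andP; split; move: (ler0n R j) (ler0n R m) jn' mn'; lra.
Qed.

Lemma near_child p m z : p \in qs -> (m < N p.2)%N -> cm (z - gam (child p m).1) <= lam * hh p.2 / 4 ->
  cm (z - gam p.1) <= p.2 /\ forall j, (j < N p.2)%N ->
    lam * hh p.2 / 2 * `|j%:R - m%:R| <= cm (z - gam (child p j).1).
Proof.
move=> pq mn zc; have [h0 _ _ _ E] := node_facts pq; have l0 := gd_lam gd.
have [_ /(_ _ pq)[/andP[p0 _] _] _] := inv.
have lh0 : 0 < lam * hh p.2 by rewrite mulr_gt0.
split.
  have := child_dist pq (ltnW mn); have := cm_tri (gam (child p m).1) z (gam p.1).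
  have lp : lam * hh p.2 <= p.2 / 8.
    rewrite -E -[X in X <= _]mulr1 mulrA; apply: ler_pM => //; last by rewrite ler1n.
      exact: ltW.
    by rewrite ler_pM2r // lam_le.
  by move: zc p0 lp; set u := cm _; set v := cm _; set w := cm _; clra.
move=> j jn; have [->|jm] := eqVneq j m; first by rewrite subrr normr0 mulr0 cm_ge0.
have sep := child_sep pq jn mn.
have n1 : 1 <= `|j%:R - m%:R : R|.
  have [jm'|mj] := ltnP j m.
    by rewrite distrC ger0_norm -?natrB ?ler0n ?(ltnW jm') // ler1n subn_gt0.
  by rewrite ger0_norm -?natrB ?ler0n // ler1n subn_gt0 ltn_neqAle eq_sym jm mj.
have := cm_tri z (gam (child p j).1) (gam (child p m).1); rewrite [cm (gam (child p j).1 - z)]cmBC.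
have n2 : lam * hh p.2 <= lam * hh p.2 * `|j%:R - m%:R| by rewrite ler_peMr // ltW.
rewrite [lam * _ / 2 * _]mulrAC.
by move: zc sep n2; set u := cm _; set v := cm _; set w := cm _; set y := _ * `|_|; clra.
Qed.

Lemma blockstep_child p m z : p \in qs -> clos D z -> (m < N p.2)%N ->
  cm (z - gam (child p m).1) <= lam * hh p.2 / 4 ->
  cm (blockstep z - Phi (loc (child p m).1 (kap * hh p.2) z)) <= A + 2 * et.
Proof.
move=> pq cz mn zc; have [zp H] := near_child pq mn zc.
have b1 := pblock_sep pq cz mn H; have b2 := blockstep_in pq cz zp.
have [_ /(_ _ pq)[_ /(_ _ cz zp) b3] _] := inv.
set P := Phi _ in b1 *.
have -> : blockstep z - P = (blockstep z - pblock p z - sig z) + (pblock p z - P) + sig z by ring.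
have := cmD (blockstep z - pblock p z - sig z + (pblock p z - P)) (sig z).
have := cmD (blockstep z - pblock p z - sig z) (pblock p z - P).
move: b1 b2 b3; set x1 := cm _; set x2 := cm _; set x3 := cm _; set x4 := cm (_ + _).
by set x5 := cm (_ + sig z); clra.
Qed.

Lemma blockstep_le p z (B : R) : p \in qs -> clos D z -> cm (z - gam p.1) <= p.2 ->
  cm (pblock p z) <= B -> cm (blockstep z) <= A + et + B.
Proof.
move=> pq cz zp b1; have b2 := blockstep_in pq cz zp.
have [_ /(_ _ pq)[_ /(_ _ cz zp) b3] _] := inv.
have -> : blockstep z = (blockstep z - pblock p z - sig z) + pblock p z + sig z by ring.
have := cmD (blockstep z - pblock p z - sig z + pblock p z) (sig z).
have := cmD (blockstep z - pblock p z - sig z) (pblock p z).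
move: b1 b2 b3; set x1 := cm _; set x2 := cm _; set x3 := cm _; set x4 := cm (_ + _).
by set x5 := cm (_ + sig z); clra.
Qed.

(** Only the bump of the nearest child matters, and it decays like the inverse square of the
    distance a. This is used at heights where the derivative of f must be close to its value without
    bumps. *)
Lemma blockstep_mid p z (a : R) : p \in qs -> clos D z -> cm (z - gam p.1) <= p.2 -> 0 < a ->
  (forall j, (j < N p.2)%N -> a <= cm (z - gam (child p j).1)) ->
  cm (blockstep z) <= A + et + (et + C0 * (kap * hh p.2) ^+ 2 / a ^+ 2).
Proof.
move=> pq cz zp a0 H; apply: (blockstep_le pq) => //.
have [h0 /andP[k0 kh] kT hN _] := node_facts pq.
have [m mn Hm] := nearest p.1 z (N0 p.2) h0 hN.
have b := pblock_sep pq cz mn (fun j jn => proj2 (Hm j jn)).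
have [_ _ b2] := phi_loc (child p m).1 cz k0 kT.
have b3 : cm (Phi (loc (child p m).1 (kap * hh p.2) z)) <= C0 * (kap * hh p.2) ^+ 2 / a ^+ 2.
  rewrite ler_pdivlMr ?exprn_gt0 //; apply: le_trans b2; rewrite ler_wpM2l ?cm_ge0 //.
  by rewrite lerXn2r ?nnegrE ?cm_ge0 ?(ltW a0) //; exact: H.
have := cmBB (pblock p z) (Phi (loc (child p m).1 (kap * hh p.2) z)).
by move: b b3; set x1 := cm _; set x2 := cm _; set x3 := cm _; set y := _ / a ^+ 2; clra.
Qed.

Lemma mem_children q : q \in children ->
  exists p j, [/\ p \in qs, (j < N p.2)%N & q = child p j].
Proof.
move=> /allpairsPdep[p [j [pq]]]; rewrite mem_iota add0n => jn ->.
by exists p, j.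
Qed.

Lemma child_mem p j : p \in qs -> (j < N p.2)%N -> child p j \in children.
Proof.
by move=> pq jn; apply/allpairsPdep; exists p, j; split=> //; rewrite mem_iota add0n.
Qed.

(** At most one block is large at a given point, and there [sig] is at most A; off the reserved
    discs the change is at most [et]. The new reserved discs are those where the child's own bump is
    small, by [Phi_small]. Children of different nodes are separated since a child strays at most 1
    / 8 of the radius of its node and has at most 1 / 8 of its radius. *)
Lemma blockstep_inv : eta <= 1 -> stinv blockstep children (A + 4 * et) (rmax / 8).
Proof.
move=> eta1; have e0 := et0; have [I1 I2 I3] := inv.
split=> [z cz|q /mem_children[p [j [pq jn ->]]]|q q' /mem_children[p [j [pq jn ->]]] /mem_children[p' [j' [pq' jn' ->]]]].
- have [s1 s2] := I1 z cz; split.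
    have [l hl] := s1; have [m hm] : exd (fun w => \sum_(p <- undup qs) pblock p w) z.
      rewrite (_ : (fun w => _) = fun w => \sum_(p <- undup qs) (if p \in qs then pblock p w else 0)); last first.
        by apply/funext => w; apply: eq_big_seq => p; rewrite mem_undup => ->.
      apply: exd_sum => p; have [pq|_] := boolP (p \in qs); last by exists 0; exact: hasd_cst.
      have [h0 /andP[k0 kh] kT _ _] := node_facts pq.
      by apply: exd_sum => j; have [e _ _] := phi_loc (p.1 + hh p.2 * j%:R) cz k0 kT.
    by exists (l + m); exact: hasdD.
  have [/hasP[p pq zp]|/hasPn no] := boolP (has (fun p => cm (z - gam p.1) <= p.2) qs).
    have [h0 /andP[k0 kh] kT hN _] := node_facts pq.
    have [m mn Hm] := nearest p.1 z (N0 p.2) h0 hN.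
    have b := pblock_sep pq cz mn (fun j jn => proj2 (Hm j jn)).
    have [_ b2 _] := phi_loc (child p m).1 cz k0 kT.
    have b3 : cm (pblock p z) <= 1 - eta + et.
      have := cmBB (pblock p z) (Phi (loc (child p m).1 (kap * hh p.2) z)).
      by move: b b2; set x1 := cm _; set x2 := cm _; set x3 := cm _; clra.
    by apply: le_trans (blockstep_le pq cz zp b3) (step_num _ _ et0).
  have nf p : p \in qs -> p.2 <= cm (z - gam p.1) by move=> /no; rewrite -ltNge => /ltW.
  have b := blockstep_far cz nf; have := cmBB (blockstep z) (sig z).
  by move: b s2; set x1 := cm _; set x2 := cm _; set x3 := cm _; clra.
- have [c1 [c2 c3]] := child_rad j pq; have [/andP[p0 pr] _] := I2 _ pq.
  split; first by rewrite c1 /=; apply: le_trans c2 _; rewrite ler_pM2r ?invr_gt0.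
  move=> z cz zc; have [h0 /andP[k0 kh] kT _ _] := node_facts pq.
  have b := blockstep_child pq cz jn (le_trans zc c3).
  have b2 : cm (Phi (loc (child p j).1 (kap * hh p.2) z)) <= et.
    apply: Phi_small; rewrite -(ler_pM2l k0) [_ * rho]mulrC.
    by apply: le_trans zc; rewrite (cm_loc (child p j).1 z k0).
  have := cmBB (blockstep z) (Phi (loc (child p j).1 (kap * hh p.2) z)).
  by move: b b2; set x1 := cm _; set x2 := cm _; set x3 := cm _; clra.
have [c1 [c2 c3]] := child_rad j pq; have [c1' [c2' c3']] := child_rad j' pq'.
have [/andP[p0 pr] _] := I2 _ pq; have [/andP[p0' pr'] _] := I2 _ pq'.
have [E|pp'] := eqVneq p p'; last first.
  move=> _; have := I3 _ _ pq pq' pp'.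
  have := child_dist pq (ltnW jn); have := child_dist pq' (ltnW jn').
  have := cm_tri (gam (child p j).1) (gam p.1) (gam p'.1).
  have := cm_tri (gam (child p' j').1) (gam (child p j).1) (gam p'.1).
  rewrite [cm (gam p.1 - gam (child p j).1)]cmBC.
  move: c2 c2' p0 p0'; set x1 := cm _; set x2 := cm _; set x3 := cm _; set x4 := cm _.
  by set x5 := cm _; clra.
move: jn' c3'; rewrite -E => jn' c3'; case: (eqVneq j j') => [->|jj' _]; first by rewrite eqxx.
have := child_sep pq jn jn'; have [h0 _ _ _ _] := node_facts pq; have l0 := gd_lam gd.
have lh0 : 0 < lam * hh p.2 by rewrite mulr_gt0.
have n1 : 1 <= `|j%:R - j'%:R : R|.
  have [jm'|mj] := ltnP j j'.
    by rewrite distrC ger0_norm -?natrB ?ler0n ?(ltnW jm') // ler1n subn_gt0.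
  by rewrite ger0_norm -?natrB ?ler0n // ler1n subn_gt0 ltn_neqAle eq_sym jj' mj.
have n2 : lam * hh p.2 <= lam * hh p.2 * `|j%:R - j'%:R| by rewrite ler_peMr // ltW.
by move: c3 c3' n2; set u := cm _; set y := _ * `|_|; clra.
Qed.

End BlockStep.

(** The kernel i / (zeta + i), with zeta the local coordinate, is 1 at the boundary point and at
    most 1 on the closure. The complementary factor zeta / (zeta + i) may exceed 1 because the
    closure reaches below the tangent, but only by [et] once the outer ball is large at scale e. *)
Lemma seed_bump (et : R) (t e : R) (z : C) : 0 < et -> 0 < e -> e * (1 + et^-1) <= r0 -> clos D z ->
  [/\ 1 <= cm (loc t e z + ci), cm (loc t e z) <= (1 + et) * cm (loc t e z + ci) &
      exd (fun w => ci / (loc t e w + ci)) z].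
Proof.
move=> et0 e0 eT cz.
have ext := loc_ext t e0 cz; set x := loc t e z in ext *.
have r00 := gd_r0 gd; have ei : 0 < et^-1 by rewrite invr_gt0.
set T := r0 / e in ext.
have TT : 1 + et^-1 <= T by rewrite ler_pdivlMr // mulrC.
have T1 : 1 <= T by apply: le_trans TT; rewrite lerDl ltW.
have T0' : 0 < T by apply: lt_le_trans T1.
have x0 : 0 <= cm x ^+ 2 by rewrite sqr_ge0.
have E : cm (x + ci) ^+ 2 = cm x ^+ 2 + 2 * Im x + 1.
  by rewrite !cm_sqr !reimE; ring.
have E2 : cm x ^+ 2 * (1 - T^-1) + 1 <= cm (x + ci) ^+ 2.
  rewrite E lerD2r; rewrite -(ler_pM2l T0').
  have -> : T * (cm x ^+ 2 * (1 - T^-1)) = T * cm x ^+ 2 - cm x ^+ 2 by field; rewrite gt_eqF.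
  by move: ext; rewrite mulrDr; set y := cm x ^+ 2; set w := Im x; clear -gd T00 C00 HPhi; clra.
have Ti : T^-1 <= 1 by rewrite invf_le1.
have c1 : 1 <= cm (x + ci).
  rewrite -(@ler_pXn2r _ 2) ?nnegrE ?cm_ge0 // expr1n; apply: le_trans E2.
  by rewrite lerDr mulr_ge0 // subr_ge0.
split=> //.
  rewrite -(@ler_pXn2r _ 2) ?nnegrE ?cm_ge0 ?mulr_ge0 ?cm_ge0 ?addr_ge0 ?(ltW et0) // exprMn.
  apply: le_trans (ler_wpM2l (sqr_ge0 _) E2).
  have k : 1 <= (1 + et) ^+ 2 * (1 - T^-1).
    apply: (@le_trans _ _ ((1 + et) * (1 - T^-1))); last first.
      rewrite ler_wpM2r ?subr_ge0 // expr2 ler_peMr ?addr_ge0 ?(ltW et0) //.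
      by rewrite lerDl ltW.
    have a : T^-1 <= (1 + et^-1)^-1 by rewrite lef_pV2 ?posrE ?addr_gt0.
    have b : (1 + et) * (1 - (1 + et^-1)^-1) = 1.
      by field; rewrite !gt_eqF ?addr_gt0.
    by rewrite -{1}b ler_wpM2l ?addr_ge0 ?(ltW et0) // lerD2l lerN2.
  rewrite mulrDr mulr1 mulrCA -[X in X <= _]mulr1; apply: (@le_trans _ _ (cm x ^+ 2 * ((1 + et) ^+ 2 * (1 - T^-1)))).
    by rewrite ler_wpM2l.
  by rewrite lerDl sqr_ge0.
have n0 : x + ci != 0 by rewrite -cm_gt0; apply: lt_le_trans c1.
have [l hl] := exd_loc t e z.
have h1 : hasd (fun w => loc t e w + ci) z (l + 0) by apply: hasdD => //; exact: hasd_cst.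
exists (ci * (- (loc t e z + ci)^-1 ^+ 2 * (l + 0))).
exact: hasdZ (hasd_comp h1 (hasdV n0)).
Qed.

(** To make room for a new node, the value v of [sig] at [gam t] is removed by the kernel of
    [seed_bump]. Near [gam t], [sig] is close to v and what remains is v zeta / (zeta + i), of
    modulus at most (1 + et) |v| and tiny when zeta is; farther away the kernel is at most [et], so
    the old reserved discs survive. *)
Lemma seed_step (et m A rmax t : R) (sig : C -> C) (qs : seq (R * R)) :
  0 < et -> 0 < m -> m <= rmax -> 0 <= A -> A <= eta -> stinv sig qs A rmax ->
  (forall p, p \in qs -> m <= p.2 /\ 2 * p.2 <= cm (gam t - gam p.1)) ->
  exists r sig', [/\ 0 < r <= m, stinv sig' ((t, r) :: qs) (A + 3 * et) rmax &
    forall z, clos D z -> m <= cm (z - gam t) -> cm (sig' z - sig z) <= et].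
Proof.
move=> et0 m0 mr A0 Ae [I1 I2 I3] far_qs; have r00 := gd_r0 gd.
set v := sig (gam t).
have [dv cv] := I1 _ (gam_clos gd t).
have v1 : cm v <= 1 by apply: le_trans cv _; move: Ae; clear -gd T00 C00 HPhi; clra.
have [l /hasd_ccont/(_ _ et0)[del del0 Hdel]] := dv.
have ei : 0 < et^-1 by rewrite invr_gt0.
have ei1 : 0 < 1 + et^-1 by rewrite addr_gt0.
pose mm := Num.min del m; have mm0 : 0 < mm by rewrite lt_min del0.
have md : mm <= del by rewrite ge_min lexx.
have mmm : mm <= m by rewrite ge_min lexx orbT.
(* The first bound is what [seed_bump] asks for; the second makes the kernel at most [et] from
   distance [mm] on. *)
pose e := Num.min (r0 / (1 + et^-1)) (et * mm / (2 * (1 + et))).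
have e0 : 0 < e by rewrite lt_min !divr_gt0 // !mulr_gt0 // addr_gt0.
have eT : e * (1 + et^-1) <= r0 by rewrite -ler_pdivlMr // ge_min lexx.
have em : 2 * (1 + et) * e <= et * mm.
  by rewrite mulrC -ler_pdivlMr ?mulr_gt0 ?addr_gt0 // ge_min lexx orbT.
pose b z := - v * (ci / (loc t e z + ci)).
have cb z : clos D z -> cm (b z) <= 1.
  move=> cz; have [c1 _ _] := seed_bump t et0 e0 eT cz.
  rewrite /b cmM cmN cm_div cm_ci mul1r -[X in _ <= X](mulr1 1); apply: ler_pM => //; rewrite ?cm_ge0 ?invr_ge0 ?cm_ge0 //.
  by rewrite invf_le1 //; apply: lt_le_trans c1.
have bfar z (d : R) : clos D z -> mm <= d -> d <= cm (z - gam t) -> cm (b z) <= et.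
  move=> cz mmd dz; have [c1 c2 _] := seed_bump t et0 e0 eT cz.
  have c0 : 0 < cm (loc t e z + ci) by apply: lt_le_trans c1.
  rewrite /b cmM cmN cm_div cm_ci mul1r; apply: (@le_trans _ _ (1 / cm (loc t e z + ci))).
    by rewrite ler_wpM2r // invr_ge0 ltW.
  rewrite ler_pdivrMr //.
  have ee : 0 < e * (1 + et) by rewrite mulr_gt0 // addr_gt0.
  rewrite -(ler_pM2r ee) mul1r -mulrA; apply: (@le_trans _ _ (et * mm)).
    by apply: le_trans em; rewrite mulrC ler_pM2r // ler_peMl ?addr_ge0 ?(ltW et0) // ler1n.
  rewrite ler_pM2l //; apply: le_trans mmd _; apply: le_trans dz _.
  by rewrite (cm_loc t z e0) mulrCA ler_pM2l // mulrC [X in _ <= X]mulrC mulrC.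
have bnear z : clos D z -> cm (v + b z) <= cm v * (1 + et) /\ cm (v + b z) <= cm (loc t e z).
  move=> cz; have [c1 c2 _] := seed_bump t et0 e0 eT cz.
  have c0 : 0 < cm (loc t e z + ci) by apply: lt_le_trans c1.
  have -> : v + b z = v * (loc t e z / (loc t e z + ci)).
    by rewrite /b; field; rewrite -cm_gt0.
  rewrite cmM cm_div; split; first by rewrite ler_wpM2l ?cm_ge0 // ler_pdivrMr.
  apply: (@le_trans _ _ (1 * (cm (loc t e z) / cm (loc t e z + ci)))).
    by rewrite ler_wpM2r // divr_ge0 ?cm_ge0.
  by rewrite mul1r ler_pdivrMr // ler_peMr ?cm_ge0.
pose r := Num.min (mm / 2) (et * e).
have rr0 : 0 < r by rewrite lt_min divr_gt0 // mulr_gt0.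
have rmm : r <= mm / 2 by rewrite ge_min lexx.
have re : r <= et * e by rewrite ge_min lexx orbT.
have rmd : r < del by move: md mm0 rmm; clear -gd T00 C00 HPhi; clra.
have rm : r <= m by move: mmm mm0 rmm; clear -gd T00 C00 HPhi; clra.
exists r, (fun z => sig z + b z); split; first by rewrite rr0.
- split.
  + move=> z cz; have [dz sz] := I1 z cz; split.
      have [l1 h1] := dz; have [_ _ [l2 h2]] := seed_bump t et0 e0 eT cz.
      by exists (l1 + - v * l2); apply: hasdD => //; exact: hasdZ.
    have [near|farz] := ltP (cm (z - gam t)) del.
      have := Hdel z near; have [bn _] := bnear z cz.
      have -> : sig z + b z = (sig z - v) + (v + b z) by rewrite addrA subrK.
      have := cmD (sig z - v) (v + b z); rewrite -/v.
      have : cm v * (1 + et) <= 1 - eta + A + et.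
        by rewrite mulrDr mulr1; apply: lerD => //; rewrite ler_piMl // ltW.
      move: bn et0; set x1 := cm (v + b z); set x2 := cm (sig z - v); set x3 := cm (_ + _).
      by set x4 := _ * _; clear -gd T00 C00 HPhi; clra.
    have := bfar z del cz md farz; have := cmD (sig z) (b z).
    move: sz et0; set x1 := cm (b z); set x2 := cm (sig z); set x3 := cm (_ + _).
    by clear -gd T00 C00 HPhi; clra.
  + move=> p; rewrite inE => /orP[/eqP -> /=|pq].
      rewrite rr0 (le_trans rm mr); split=> // z cz zr.
      have := Hdel z (le_lt_trans zr rmd); have [_ bn] := bnear z cz.
      have zl : cm (loc t e z) <= et.
        rewrite -(ler_pM2l e0) -(cm_loc t z e0) [e * et]mulrC; exact: le_trans zr re.
      have -> : sig z + b z = (sig z - v) + (v + b z) by rewrite addrA subrK.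
      have := cmD (sig z - v) (v + b z); rewrite -/v.
      move: bn et0 zl A0; set x1 := cm (v + b z); set x2 := cm (sig z - v); set x3 := cm (_ + _).
      by set x4 := cm _; clear -gd T00 C00 HPhi; clra.
    have [H1 H2] := I2 _ pq; split=> // z cz zp; have H3 := H2 z cz zp.
    have [mp pt] := far_qs _ pq.
    have : cm (b z) <= et.
      apply: (bfar z m cz mmm).
      have := cm_tri z (gam t) (gam p.1); rewrite [cm (gam t - z)]cmBC.
      move: mp pt zp; set x1 := cm _; set x2 := cm _; set x3 := cm _.
      by clear -gd T00 C00 HPhi; clra.
    have := cmD (sig z) (b z).
    move: H3 et0; set x1 := cm (b z); set x2 := cm (sig z); set x3 := cm (_ + _).
    by clear -gd T00 C00 HPhi; clra.
  + have key p : p \in qs -> r + p.2 <= cm (gam t - gam p.1).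
      by move=> /far_qs[]; move: rm; clear -gd T00 C00 HPhi; set x := cm _; clra.
    move=> p q; rewrite !inE => /orP[/eqP ->|pq] /orP[/eqP ->|qq] //=.
    * by rewrite eqxx.
    * by move=> _; exact: key.
    * by move=> _; rewrite addrC cmBC; exact: key.
    * exact: I3.
by move=> z cz mz; rewrite addrC addKr; exact: bfar mz.
Qed.

Lemma stinv_mono sig qs (A A' rmax : R) : A <= A' -> stinv sig qs A rmax -> stinv sig qs A' rmax.
Proof.
move=> AA [I1 I2 I3]; split=> // [z /I1[h1 h2]|p /I2[h1 h2]]; split=> //.
  by apply: le_trans h2 _; rewrite lerD2l.
by move=> z cz zp; apply: le_trans (h2 z cz zp) AA.
Qed.

Lemma ex_radius_bound (qs : seq (R * R)) (B : R) : 0 < B -> (forall p, p \in qs -> 0 < p.2) ->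
  exists m, [/\ 0 < m, m <= B & forall p, p \in qs -> m <= p.2].
Proof.
move=> B0; elim: qs => [|q qs IH] H; first by exists B.
have [|m [m0 mB Hm]] := IH; first by move=> p pq; apply: H; rewrite inE pq orbT.
exists (Num.min m q.2); split.
- by rewrite lt_min m0 H // mem_head.
- by rewrite ge_min mB.
- move=> p; rewrite inE => /orP[/eqP ->|/Hm h]; first by rewrite ge_min lexx orbT.
  by rewrite ge_min h.
Qed.

(* At a point which is safe for some stage, all later corrections are controlled by the [et k]. *)
Definition safe (qs : seq (R * R)) (z : C) (d : R) : Prop :=
  [/\ clos D z, far gam z d, exists2 p, p \in qs & p.2 <= d &
      forall p, p \in qs -> p.2 <= cm (z - gam p.1)].

(** The interface to the limit argument: children become nodes, safe points move little, and inside
    the disc of a node the new function is close to a single bump near a child and decays away from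
    all children. *)
Definition stage (et kap rho A : R) (N : R -> nat) (sig : C -> C) (qs : seq (R * R))
    (sig' : C -> C) (qs' : seq (R * R)) : Prop :=
  [/\ forall p j, p \in qs -> (j < N p.2)%N -> child kap rho N p j \in qs',
      forall z d, safe qs z d -> safe qs' z d /\ cm (sig' z - sig z) <= 2 * et &
      forall p z d, p \in qs -> clos D z -> cm (z - gam p.1) <= p.2 -> far gam z d ->
        rho * (kap * hh N p.2) <= d ->
        [/\ safe qs' z d,
            forall j, (j < N p.2)%N -> cm (z - gam (child kap rho N p j).1) <= lam * hh N p.2 / 4 ->
              cm (sig' z - Phi (loc (child kap rho N p j).1 (kap * hh N p.2) z)) <= A + 3 * et &
            forall a, 0 < a -> (forall j, (j < N p.2)%N -> a <= cm (z - gam (child kap rho N p j).1)) ->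
              cm (sig' z) <= A + 3 * et + C0 * (kap * hh N p.2) ^+ 2 / a ^+ 2]].

Lemma stage_ex (et kap rho rmax A t : R) (fN : R -> nat) (sig : C -> C) (qs : seq (R * R)) :
  0 < et -> 0 < kap -> kap <= 1 -> 0 < rho -> rho <= 1 ->
  16 * C0 * kap ^+ 2 <= lam ^+ 2 * et -> rho * kap <= lam / 4 ->
  (forall z, cm z <= rho -> cm (Phi z) <= et) ->
  0 < rmax -> rmax / (8 * Lam) <= d0 -> rmax / (8 * Lam) * T0 <= r0 ->
  0 <= A -> A + 7 * et <= eta -> eta <= 1 -> stinv sig qs A rmax ->
  exists (N : R -> nat) sig' qs',
    [/\ forall r, (fN r <= N r)%N /\ (0 < N r)%N, stinv sig' qs' (A + 7 * et) (rmax / 8),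
        stage et kap rho A N sig qs sig' qs' &
        exists2 p, p \in qs' & cm (gam t - gam p.1) <= rmax].
Proof.
move=> et0 kap0 kap1 rho0 rho1 kapet rk Psm rmax0 rm1 rm2 A0 Ae eta1 inv.
have [Nb HNb] : exists Nb : nat, (size qs)%:R * (C0 / Lam ^+ 2) <= et * Nb%:R.
  set X := _ * (C0 / _); have X0 : 0 <= X.
    by rewrite mulr_ge0 ?ler0n // divr_ge0 ?exprn_ge0 // ltW // (gd_Lam gd).
  exists (Num.bound (X / et)); rewrite mulrC -ler_pdivrMr //.
  by apply: ltW; apply: archi_boundP; rewrite divr_ge0 // ltW.
(* The prescribed lower bound, the number needed to make the blocks small far away, and 1. *)
pose N r := maxn (maxn (fN r) Nb) 1.
have N0 r : (0 < N r)%N by rewrite /N leq_max orbT.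
have NfN r : (fN r <= N r)%N by rewrite /N !leq_max leqnn.
have Nbig r : (size qs)%:R * (C0 / Lam ^+ 2) <= et * (N r)%:R.
  by apply: le_trans HNb _; rewrite ler_pM2l // ler_nat /N !leq_max leqnn orbT.
pose s1 := blockstep kap N sig qs; pose q1 := children kap rho N qs.
have inv1 : stinv s1 q1 (A + 4 * et) (rmax / 8).
  exact: (blockstep_inv et0 kap0 kap1 rho0 kapet rk Psm rm1 rm2 N0 Nbig inv eta1).
have r80 : 0 < rmax / 8 by rewrite divr_gt0.
have child1 p j : p \in qs -> (j < N p.2)%N -> child kap rho N p j \in q1.
  exact: child_mem.
have crad p j (pq : p \in qs) := child_rad kap0 kap1 rho0 rk rm1 rm2 N0 inv j pq.
have cdist p j (pq : p \in qs) (jn : (j < N p.2)%N) :=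
  child_dist rho kap0 kap1 rm1 rm2 N0 inv pq (ltnW jn).
have prest z d (cz : clos D z) (fz : far gam z d) :
    (exists2 p, p \in q1 & p.2 <= d) -> (forall p, p \in q1 -> p.2 <= cm (z - gam p.1)) -> safe q1 z d.
  by [].
(* The reserved discs of the children are inside those of their nodes, and smaller; so a point
   outside the old discs is outside the new ones. *)
have safe1 z d : safe qs z d -> safe q1 z d /\ cm (s1 z - sig z) <= et.
  move=> [cz fz [p pq pd] H]; split; last exact: (blockstep_far rho et0 kap0 kap1 rm1 rm2 N0 Nbig inv cz H).
  apply: prest => //.
    exists (child kap rho N p 0); first exact: child1.
    have [c0 [c1 c2]] := crad p 0 pq; have [_ I2 _] := inv; have [/andP[p0 _] _] := I2 _ pq.
    by move: c1 p0 pd; set u := (child _ _ _ _ _).2; clear -gd T00 C00 HPhi; lra.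
  move=> q /mem_children[p' [j [pq' jn ->]]].
  have [c0 [c1 c2]] := crad p' j pq'; have c3 := cdist p' j pq' jn; have h := H _ pq'.
  have [_ I2 _] := inv; have [/andP[p0 _] _] := I2 _ pq'.
  have := cm_tri (gam (child kap rho N p' j).1) z (gam p'.1).
  move: c1 c3 h p0; set u := (child _ _ _ _ _).2; set x1 := cm _; set x2 := cm _; set x3 := cm _.
  by clear -gd T00 C00 HPhi; clra.
have local1 p z d : p \in qs -> clos D z -> cm (z - gam p.1) <= p.2 -> far gam z d ->
        rho * (kap * hh N p.2) <= d -> safe q1 z d.
  move=> pq cz zp fz rd; apply: prest => //.
    by exists (child kap rho N p 0); first exact: child1.
  move=> q /mem_children[p' [j [pq' jn ->]]].
  have [E|pp'] := eqVneq p' p; first by apply: le_trans (fz _); rewrite E.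
  have [c0 [c1 c2]] := crad p' j pq'; have c3 := cdist p' j pq' jn.
  rewrite eq_sym in pp'; have h := disj inv pq pq' pp' zp.
  have [_ I2 _] := inv; have [/andP[p0 _] _] := I2 _ pq'.
  have := cm_tri (gam (child kap rho N p' j).1) z (gam p'.1).
  move: c1 c3 h p0; set u := (child _ _ _ _ _).2; set x1 := cm _; set x2 := cm _; set x3 := cm _.
  by clear -gd T00 C00 HPhi; clra.
(* A root is added at [gam t] only if no node is within [rmax] of it. The existing nodes, of radius
   at most rmax / 8, are then as far from it as [seed_step] requires. *)
have [near|nonear] := pselect (exists2 p, p \in q1 & cm (gam t - gam p.1) <= rmax).
  exists N, s1, q1; split=> //.
    by apply: stinv_mono inv1; move: et0; clear -gd T00 C00 HPhi; lra.
  split=> //.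
    move=> z d /safe1[h1 h2]; split=> //; apply: le_trans h2 _.
    by move: et0; clear -gd T00 C00 HPhi; lra.
  move=> p z d pq cz zp fz rd; split; first exact: (local1 p).
    move=> j jn zc.
    apply: le_trans (blockstep_child et0 kap0 kap1 kapet rm1 rm2 N0 Nbig inv pq cz jn zc) _.
    by move: et0; clear -gd T00 C00 HPhi; lra.
  move=> a a0 Ha.
  apply: le_trans (blockstep_mid et0 kap0 kap1 kapet rm1 rm2 N0 Nbig inv pq cz zp a0 Ha) _.
  by move: et0; set x := _ / a ^+ 2; clear -gd T00 C00 HPhi; clra.
have [_ I2' _] := inv1.
have [m [m0 mB Hm]] := ex_radius_bound r80 (fun p pq => proj1 (andP (proj1 (I2' p pq)))).
have fq p : p \in q1 -> m <= p.2 /\ 2 * p.2 <= cm (gam t - gam p.1).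
  move=> pq; split; first exact: Hm.
  have [/andP[p0 pr] _] := I2' _ pq.
  rewrite leNgt; apply/negP => h; apply: nonear; exists p => //.
  by move: h pr rmax0; set x := cm _; clear -gd T00 C00 HPhi; clra.
have [||r [sig' [/andP[rr0 rm] inv' Hs]]] := seed_step et0 m0 mB _ _ inv1 fq.
- by move: et0 A0; clear -gd T00 C00 HPhi; lra.
- by move: et0 Ae; clear -gd T00 C00 HPhi; lra.
have safe2 z d : safe q1 z d -> safe ((t, r) :: q1) z d /\ cm (sig' z - s1 z) <= et.
  move=> [cz fz [p pq pd] H].
  have md : m <= d by apply: le_trans pd; exact: Hm.
  split; last by apply: Hs => //; apply: le_trans (fz t).
  split=> //; first by exists p => //; rewrite inE pq orbT.
  move=> q; rewrite inE => /orP[/eqP -> /=|/H //].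
  by apply: le_trans rm _; apply: le_trans (fz t).
exists N, sig', ((t, r) :: q1); split=> //.
- by apply: stinv_mono inv'; rewrite -addrA lerD2l; clear -gd T00 C00 HPhi; lra.
- split.
  + by move=> p j pq jn; rewrite inE child1 ?orbT.
  + move=> z d /safe1[/safe2[h1 h2] h3]; split=> //.
    have := cm_tri (s1 z) (sig' z) (sig z).
    by move: h2 h3; set x := cm _; set y := cm _; set w := cm _; clear -gd T00 C00 HPhi; clra.
  + move=> p z d pq cz zp fz rd; have [sf h1] := safe2 _ _ (local1 _ _ _ pq cz zp fz rd).
    split=> //.
      move=> j jn zc.
      have := blockstep_child et0 kap0 kap1 kapet rm1 rm2 N0 Nbig inv pq cz jn zc.
      rewrite -/s1; have := cm_tri (s1 z) (sig' z) (Phi (loc (child kap rho N p j).1 (kap * hh N p.2) z)).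
      by move: h1; set x := cm _; set y := cm _; set w := cm _; clear -gd T00 C00 HPhi; clra.
    move=> a a0 Ha.
    have := blockstep_mid et0 kap0 kap1 kapet rm1 rm2 N0 Nbig inv pq cz zp a0 Ha.
    rewrite -/s1; have := cmBB (sig' z) (s1 z).
    by move: h1; set x := cm _; set y := cm _; set w := cm _; set v := _ / a ^+ 2; clear -gd T00 C00 HPhi; clra.
by exists (t, r); rewrite ?mem_head //= subrr cm0 ltW.
Qed.

End Blocks.
End Stage.

(** * The limit function, its boundary values and the tree of nodes *)

Lemma digits_diff (R : realType) (u u' j j' : R) : 0 <= u - j -> u - j < 1 -> 0 <= u' - j' ->
  u' - j' < 1 -> 1 <= j' - j -> `|u - u'| <= 2 * (j' - j).
Proof. by move=> *; rewrite ler_norml; apply/andP; split; lra. Qed.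

Section Core.
Variable R : realType.
Local Notation C := R[i].
Local Notation Re := (@complex.Re R).
Local Notation Im := (@complex.Im R).
Variables (D : set C) (gam nrm : R -> C) (Lam lam d0 r0 : R).
Hypothesis gd : good_dom D gam nrm Lam lam d0 r0.
Local Notation loc := (bdcoord gam nrm).

(* A point above a boundary point at height [a], within distance [b] of it, is at depth [a / 2]
   when [b] is small with respect to [sqrt a]: compare with the interior ball. *)
Lemma depth (t a b : R) (z : C) : 0 < a -> cm (z - gam t) <= b -> a <= dotc (z - gam t) (nrm t) ->
  (b + a / 2) ^+ 2 <= r0 * a -> D z /\ far gam z (a / 2).
Proof.
move=> a0 zb az hb; have [n1 _ _] := gd_ball gd t; have r00 := gd_r0 gd.
have H w : cm (w - z) < a / 2 -> D w.
  move=> wz; apply: (int_dot gd (t := t)).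
  have -> : w - gam t = (w - z) + (z - gam t) by rewrite addrA subrK.
  have h1 : cm (w - z + (z - gam t)) < b + a / 2.
    by apply: le_lt_trans (cmD _ _) _; rewrite addrC; apply: ler_ltD.
  have h2 : cm (w - z + (z - gam t)) ^+ 2 < (b + a / 2) ^+ 2.
    rewrite ltr_pXn2r ?nnegrE ?cm_ge0 //.
    by apply: ltW; apply: le_lt_trans h1; exact: cm_ge0.
  have h3 : a / 2 < dotc (w - z + (z - gam t)) (nrm t).
    rewrite dotcDl; have := dotc_le (w - z) (nrm t); rewrite n1 mulr1 ler_norml => /andP[h _].
    by move: h wz az; clear -gd; set x := cm _; set y := dotc _ _; set v := dotc _ _; clra.
  have h4 : r0 * a < 2 * r0 * dotc (w - z + (z - gam t)) (nrm t).
    by rewrite -mulrA mulrCA ltr_pM2l //; move: h3; clear -gd; set x := dotc _ _; clra.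
  exact: lt_le_trans h2 (ltW (le_lt_trans hb h4)).
split; last exact: (ball_far gd).
by apply: H; rewrite subrr cm0 divr_gt0.
Qed.

Variables (Phi : C -> C) (T0 eta C0 : R).
Hypotheses (T00 : 0 < T0) (C00 : 0 < C0).
Variables (delta R0 : R) (kap rho : nat -> R) (N : nat -> R -> nat).
Variables (sig : nat -> C -> C) (qs : nat -> seq (R * R)).
Definition et k := delta / 2 ^+ k.+1.
(** The sum of 7 [et i] over i < k: the loss accumulated over the first k stages. *)
Definition Ak k := 7 * delta * (1 - (2 ^+ k)^-1).
Hypotheses (delta0 : 0 < delta) (deta : 14 * delta <= eta) (R00 : 0 < R0) (R01 : R0 <= 1).
Hypothesis kap01 : forall k, 0 < kap k <= 1.
Hypothesis rho01 : forall k, 0 < rho k <= 1.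
Hypothesis rk : forall k, rho k * kap k <= lam / 4.
Hypotheses (rm1 : R0 / (8 * Lam) <= d0) (rm2 : R0 / (8 * Lam) * T0 <= r0).
Hypothesis N0 : forall k r, (0 < N k r)%N.
Hypothesis SI : forall k, stinv D gam eta (sig k) (qs k) (Ak k) (R0 / 8 ^+ k).
Hypothesis SS : forall k, stage D gam nrm Lam lam Phi C0 (et k) (kap k) (rho k) (Ak k) (N k)
  (sig k) (qs k) (sig k.+1) (qs k.+1).
Hypothesis q0 : forall k, exists p, p \in qs k.

Lemma pow2_gt0 k : 0 < (2 : R) ^+ k. Proof. by rewrite exprn_gt0. Qed.
Lemma et_gt0 k : 0 < et k. Proof. by rewrite divr_gt0 // pow2_gt0. Qed.
Lemma Ak_le k : Ak k <= 7 * delta.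
Proof.
rewrite /Ak ler_piMr ?mulr_ge0 ?(ltW delta0) // gerBl invr_ge0; exact: ltW (pow2_gt0 _).
Qed.
Lemma et_le k : et k <= delta.
Proof. by rewrite /et ler_pdivrMr ?pow2_gt0 // ler_peMr ?(ltW delta0) // exprn_ege1 // ler1n. Qed.

Lemma pow8_gt0 k : 0 < (8 : R) ^+ k. Proof. by rewrite exprn_gt0. Qed.

Lemma rmk_le k : R0 / 8 ^+ k <= R0.
Proof. by rewrite ler_pdivrMr ?pow8_gt0 // ler_peMr ?(ltW R00) // exprn_ege1 // ler1n. Qed.

Lemma rm1k k : R0 / 8 ^+ k / (8 * Lam) <= d0.
Proof.
apply: le_trans rm1; rewrite ler_pM2r ?rmk_le // invr_gt0 mulr_gt0 //; exact: gd_Lam gd.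
Qed.

Lemma rm2k k : R0 / 8 ^+ k / (8 * Lam) * T0 <= r0.
Proof.
apply: le_trans rm2; rewrite ler_pM2r // ler_pM2r ?rmk_le // invr_gt0 mulr_gt0 //; exact: gd_Lam gd.
Qed.

Lemma safe_far k z d i : safe D gam (qs k) z d ->
  safe D gam (qs (k + i)) z d /\ cm (sig (k + i) z - sig k z) <= 2 * delta * ((2 ^+ k)^-1 - (2 ^+ (k + i))^-1).
Proof.
move=> s; elim: i => [|i [s1 c1]].
  by rewrite addn0 !subrr mulr0 cm0.
have [_ /(_ z d s1)[s2 c2] _] := SS (k + i); rewrite addnS; split=> //.
have := cm_tri (sig (k + i) z) (sig (k + i).+1 z) (sig k z).
have E : 2 * et (k + i) = 2 * delta * ((2 ^+ (k + i))^-1 - (2 ^+ (k + i).+1)^-1).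
  have := pow2_gt0 (k + i); rewrite /et exprS => p0; field; rewrite gt_eqF //.
move: c1 c2; rewrite E; set a := (2 ^+ k)^-1; set b := (2 ^+ (k + i))^-1; set c := (2 ^+ (k + i).+1)^-1.
rewrite !mulrBr; set x := cm _; set y := cm _; set w := cm _.
set u := _ * a; set v := _ * b; set t := _ * c; clra.
Qed.

Lemma ex_pow8 (e : R) : 0 < e -> exists k, R0 / 8 ^+ k <= e.
Proof.
move=> e0; have [n hn] := small_pow2 R0 e0; exists n.
apply: le_trans (ltW hn); rewrite ler_pM2l // lef_pV2 ?posrE ?pow2_gt0 ?pow8_gt0 //.
by rewrite lerXn2r ?nnegrE // ler_nat.
Qed.

(** From some stage on all radii are below the distance from z to the boundary. *)
Lemma ex_safe z : D z -> exists k d, safe D gam (qs k) z d.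
Proof.
move=> Dz; have [e e0 fz] := D_far gd Dz; have [k hk] := ex_pow8 e0.
have [_ I2 _] := SI k; have pe p : p \in qs k -> p.2 <= e.
  by move=> /I2[/andP[_ h] _]; exact: le_trans h hk.
exists k, e; split=> //; first exact: sub_clos.
  by have [p pq] := q0 k; exists p => //; exact: pe.
by move=> p /pe h; exact: le_trans h (fz _).
Qed.

Lemma sig_le k z : clos D z -> exd (sig k) z /\ cm (sig k z) <= 1 - eta / 2.
Proof.
move=> cz; have [/(_ z cz)[h1 h2] _ _] := SI k; split=> //; apply: le_trans h2 _.
by have := Ak_le k; have := deta; set x := Ak k; clra.
Qed.

(** Once z is safe, the later changes at z form a geometric series; the limit is analytic by
    [bounded_limit_diff]. The last clause sums up all changes after stage k, and is the only way in
    which later stages are seen below. *)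
Lemma limit_fun : exists sinf : C -> C,
  (forall z, D z -> exd sinf z /\ cm (sinf z) <= 1 - eta / 2) /\
  forall k z d, safe D gam (qs k) z d -> cm (sinf z - sig k z) <= 2 * delta.
Proof.
have cvg z : exists l, D z -> ccvg (fun n => sig n z) l.
  have [Dz|nD] := pselect (D z); last by exists 0.
  have [k [d s]] := ex_safe Dz.
  suff [l hl] : exists l, ccvg (fun n => sig n z) l by exists l.
  apply: ccauchy_lim => e e0.
  have [n hn] := small_pow2 (4 * delta) e0.
  exists (k + n)%N.
  have key m : (k + n <= m)%N -> cm (sig m z - sig (k + n) z) <= e / 2.
    move=> knm; rewrite -(subnKC knm).
    have [s1 _] := safe_far n s; have [_ ] := safe_far (m - (k + n)) s1.
    have : 4 * delta / 2 ^+ (k + n) <= 4 * delta / 2 ^+ n.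
      rewrite ler_pM2l ?mulr_gt0 // lef_pV2 ?posrE ?pow2_gt0 //.
      by rewrite ler_weXn2l // ?ler1n // leq_addl.
    have : 0 < (2 ^+ (k + n + (m - (k + n))))^-1 :> R by rewrite invr_gt0 pow2_gt0.
    have dp := delta0; move: hn; set a := (2 ^+ n)^-1; set b := (2 ^+ (k + n))^-1; set c := (2 ^+ _)^-1.
    set x := cm _ => h1 c0 h2 h3; apply: le_trans h3 _.
    have : 0 <= delta * c by rewrite mulr_ge0 // ltW.
    by rewrite mulrBr; move: h1 h2; rewrite -!(mulrA _ delta); set u := delta * a; set v := delta * b; set w := delta * c; clra.
  move=> m1 m2 /key h1 /key h2.
  have := cm_tri (sig (k + n) z) (sig m1 z) (sig m2 z); rewrite [cm (sig (k + n) z - sig m2 z)]cmBC.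
  by move: h1 h2; set x := cm _; set y := cm _; set w := cm _; clra.
have [sinf Hs] := choice cvg; exists sinf; split.
  move=> z Dz; have [r rp Hr] := gd_open gd Dz; split.
    have r2 : 0 < r / 2 by rewrite divr_gt0.
    have ballD w : cm (w - z) <= r / 2 -> D w.
      move=> h; apply: Hr; rewrite cmBC; move: h rp; set x := cm _; clra.
    apply: (@bounded_limit_diff _ sig sinf z (r / 2) (1 - eta / 2)) => // [n w /ballD Dw|w /ballD Dw].
      exact: (sig_le n (sub_clos Dw)).
    exact: Hs.
  have := ccvg_le (a := 0) (M := 1 - eta / 2) (Hs z Dz); rewrite subr0; apply.
  by exists 0%N => n _; rewrite subr0; have [_] := sig_le n (sub_clos Dz).
move=> k z d s; have cz : clos D z by case: s.
(* A safe point is not on the boundary: its distance to it is at least some positive node radius. *)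
have Dz : D z.
  apply: contrapT => nD; have [t E] := gd_bd gd cz nD; case: s => _ /(_ t) h [p pq pd] _.
  have [_ /(_ _ pq)[/andP[p0 _] _] _] := SI k.
  by move: h; rewrite E subrr cm0 leNgt; move: (lt_le_trans p0 pd) => ->.
apply: (ccvg_le (Hs z Dz)); exists k => n kn; have [_] := safe_far (n - k) s.
rewrite subnKC // => h; apply: le_trans h _.
rewrite ler_piMr ?mulr_ge0 ?(ltW delta0) //.
apply: (@le_trans _ _ (2 ^+ k)^-1); first by rewrite gerBl invr_ge0 ltW // pow2_gt0.
by rewrite invf_le1 ?pow2_gt0 // exprn_ege1 // ler1n.
Qed.

Variables (G : C -> C) (sinf f F : C -> C) (X : nat -> R) (c0 h1 d1 m1 Q hL K rF : R).
Hypothesis Hs : forall k z d, safe D gam (qs k) z d -> cm (sinf z - sig k z) <= 2 * delta.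
Hypothesis Hf : forall z, D z -> hasd f z (G (sinf z)).
Hypothesis HF1 : forall z, D z -> F z = f z.
Hypothesis HF2 : forall x y, clos D x -> clos D y -> cm (x - y) <= rF -> cm (F x - F y) <= K * cm (x - y).
Hypothesis loops : forall (h : R) (phi s : C -> C), 0 < h -> h <= h1 ->
   (forall z, h < Im z -> cm z < Q -> hasd phi z (G (s z)) /\ cm (s z - Phi z) <= d1) ->
   forall w, cm (w - phi ((2 * h)%:C * ci)) <= c0 -> exists z, [/\ m1 <= Im z, cm z < Q & phi z = w].
Hypotheses (dd1 : 12 * delta <= d1) (hL0 : 0 < hL) (hL1 : hL <= h1) (hm1 : h1 < m1) (Q0 : 0 < Q).
Hypotheses (hLQ : 2 * hL <= Q) (K0 : 0 <= K) (KhL : K * (3 * hL) <= c0).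
Hypothesis rhoL : forall k, rho k <= hL / 2.
Hypothesis kapQ : forall k, kap k * Q <= lam / 4.
Hypothesis hX : forall k p, p \in qs k -> hh Lam (N k) p.2 <= X k.
Hypotheses (XQ : forall k, X k * (Q + hL) ^+ 2 <= r0 * hL) (XF : forall k, 3 * hL * X k <= rF).

Local Notation chd k p j := (child Lam (kap k) (rho k) (N k) p j).
Local Notation eps k p := (kap k * hh Lam (N k) p.2).

Lemma eps_gt0 k p : p \in qs k -> [/\ 0 < hh Lam (N k) p.2, 0 < eps k p & eps k p <= hh Lam (N k) p.2].
Proof.
move=> pq; have /andP[ka kb] := kap01 k.
by have [h /andP[a b] _ _ _] := node_facts gd T00 ka kb (rm1k k) (rm2k k) (N0 k) (SI k) pq.
Qed.

Lemma hasd_zoom (c v : C) (l z : C) : v != 0 -> hasd f (c + v * z) l ->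
  hasd (fun w => f (c + v * w) / v) z l.
Proof.
move=> v0 h.
have h2 : hasd (fun w => c + v * w) z (0 + v * 1).
  by apply: hasdD; [exact: hasd_cst|apply: hasdZ; exact: hasd_id].
have := hasdZ v^-1 (hasd_comp h2 h); rewrite add0r mulr1.
have -> : v^-1 * (l * v) = l by field.
by apply: (hasd_local ltr01) => w _ /=; rewrite mulrC.
Qed.

Lemma loop_pt k p j z (d : R) : p \in qs k -> (j < N k p.2)%N -> clos D z -> far gam z d ->
  rho k * eps k p <= d -> cm (z - gam (chd k p j).1) <= lam * hh Lam (N k) p.2 / 4 ->
  cm (sinf z - Phi (loc (chd k p j).1 (eps k p) z)) <= 12 * delta.
Proof.
move=> pq jn cz fz rd zc; have /andP[ka kb] := kap01 k.
have [zp _] := near_child gd T00 ka kb (rm1k k) (rm2k k) (N0 k) (SI k) pq jn zc.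
have [_ _ /(_ p z d pq cz zp fz rd)[sf /(_ j jn zc) h _]] := SS k.
have := Hs sf; have := et_le k; have := Ak_le k.
have := cm_tri (sig k.+1 z) (sinf z) (Phi (loc (chd k p j).1 (eps k p) z)).
by move: h; set x := cm _; set y := cm _; set w := cm _; clra.
Qed.

(** Rescaled at a child c, f becomes the function phi of [loop_spec]. The base point i (2 hL)
    corresponds to a point at distance O(hL eps) from [gam t], so F (gam t) is within reach by the
    Lipschitz bound [KhL]. Points of height at least hL correspond to points of D by [depth], the
    boundary being almost flat at this scale. *)
Lemma loop_hit k p j t : p \in qs k -> (j < N k p.2)%N -> cm (gam t - gam (chd k p j).1) <= (chd k p j).2 ->
  exists z, [/\ D z, f z = F (gam t) & cm (z - gam t) <= (Q + hL) * eps k p].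
Proof.
move=> pq jn tc; have [h0 e0 eh] := eps_gt0 pq; have hx := hX pq; have r00 := gd_r0 gd.
set c := (chd k p j).1 in tc *; set e := eps k p in e0 eh *.
have [n1 _ _] := gd_ball gd c.
set v := e%:C * (- ci * nrm c).
have cv : cm v = e by rewrite !cmM cm_real cmN cm_ci n1 gtr0_norm // !mulr1.
have v0 : v != 0 by rewrite -cm_gt0 cv.
have locv z : loc c e (gam c + v * z) = z.
  by rewrite /bdcoord addrC addKr mulrC mulKf.
have dotv z : dotc (gam c + v * z - gam c) (nrm c) = e * Im z.
  by rewrite (dotc_loc gd _ _ e0) locv.
have cmv z : cm (gam c + v * z - gam c) = e * cm z.
  by rewrite (cm_loc gd _ _ e0) locv.
have eX : e <= X k by exact: le_trans eh hx.
have X0 : 0 < X k by apply: lt_le_trans eX.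
have dp z a : hL <= a -> a <= Q -> a <= Im z -> cm z <= Q -> D (gam c + v * z) /\ far gam (gam c + v * z) (e * hL / 2).
  move=> ha aQ az zQ; apply: (depth (t := c) (b := e * Q)).
  - by rewrite mulr_gt0.
  - by rewrite cmv ler_pM2l.
  - by rewrite dotv ler_pM2l //; exact: le_trans az.
  apply: (@le_trans _ _ (e * (X k * (Q + hL) ^+ 2))).
    have -> : (e * Q + e * hL / 2) ^+ 2 = e * (e * (Q + hL / 2) ^+ 2) by field.
    rewrite ler_pM2l // ler_pM ?sqr_ge0 ?(ltW e0) //.
    rewrite lerXn2r ?nnegrE ?addr_ge0 ?(ltW Q0) ?(ltW hL0) // ?lerD2l ?divr_ge0 ?(ltW hL0) //.
    by have := hL0; clra.
  by rewrite [r0 * _]mulrCA ler_pM2l.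
pose phi z := f (gam c + v * z) / v; pose s z := sinf (gam c + v * z).
have hyp z : hL < Im z -> cm z < Q -> hasd phi z (G (s z)) /\ cm (s z - Phi z) <= d1.
  move=> hz zQ.
  have hQ : hL <= Q.
    by apply: ltW; apply: lt_trans hz _; apply: le_lt_trans zQ; apply: le_trans (ler_norm _) (ler_Im_cm z).
  have [Dz fz] := dp z hL (lexx _) hQ (ltW hz) (ltW zQ).
  split; first by apply: hasd_zoom => //; exact: Hf.
  rewrite /s -{2}(locv z); apply: le_trans dd1.
  apply: loop_pt (sub_clos Dz) fz _ _ => //.
    by rewrite mulrC -mulrA -/e ler_pM2l.
  rewrite -/c cmv; apply: (@le_trans _ _ (e * Q)); first by rewrite ler_pM2l // ltW.
  rewrite /e mulrAC [lam * _ / 4]mulrAC ler_pM2r //.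
have cr : (chd k p j).2 <= e * hL / 2.
  by rewrite /child /= -/e mulrC -mulrA ler_pM2l.
set z0 := gam c + v * ((2 * hL)%:C * ci).
have z0E : z0 - gam c = v * ((2 * hL)%:C * ci) by rewrite /z0 addrC addKr.
have cz0 : cm (z0 - gam c) = e * (2 * hL).
  by rewrite z0E cmM cv cmM cm_real cm_ci mulr1 gtr0_norm // mulr_gt0.
have [|||Dz0 _] := dp ((2 * hL)%:C * ci) (2 * hL) _ hLQ.
- by have := hL0; clra.
- by rewrite !reimE; clra.
- by rewrite cmM cm_real cm_ci mulr1 gtr0_norm // mulr_gt0.
have dz0 : cm (gam t - z0) <= e * (3 * hL).
  have := cm_tri (gam c) (gam t) z0; rewrite [cm (gam c - z0)]cmBC cz0.
  have eh0 : 0 < e * hL by rewrite mulr_gt0.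
  move: tc cr; rewrite mulrCA [e * (3 * hL)]mulrCA; set u := e * hL in eh0 *; set x := cm _; set y := cm _; clra.
have hw : cm (F (gam t) / v - phi ((2 * hL)%:C * ci)) <= c0.
  rewrite /phi -/z0 -mulrBl cmM cmV cv ler_pdivrMr // -(HF1 Dz0).
  apply: le_trans (HF2 (gam_clos gd t) (sub_clos Dz0) _) _.
    apply: le_trans dz0 _; apply: le_trans (XF k); rewrite mulrC ler_pM2l ?mulr_gt0 //.
  apply: (@le_trans _ _ (K * (e * (3 * hL)))); first by rewrite ler_wpM2l.
  by rewrite mulrCA mulrC ler_pM2r.
have [z [z1 z2 z3]] := loops hL0 hL1 hyp hw.
have hLz : hL < Im z by apply: lt_le_trans z1; exact: le_lt_trans hm1.
have hQ : hL <= Q by apply: le_trans hLQ; have := hL0; clra.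
have [Dz _] := dp z hL (lexx _) hQ (ltW hLz) (ltW z2).
exists (gam c + v * z); split=> //.
  by move: z3; rewrite /phi => /(congr1 (fun x => x * v)); rewrite !divfK.
have := cm_tri (gam c) (gam c + v * z) (gam t); rewrite cmv [cm (gam c - gam t)]cmBC.
have : e * cm z <= e * Q by rewrite ler_pM2l // ltW.
have : 0 < e * hL by rewrite mulr_gt0.
rewrite [(Q + hL) * e]mulrC mulrDr; move: tc cr; set u := e * hL; set w := e * Q; set y := e * cm z.
by set x := cm _; set x' := cm _; clra.
Qed.

Variables (G0 : C) (H tau mu : R).
Hypothesis Gnear : forall w, cm w <= 12 * delta + 16 * C0 / H ^+ 2 -> cm (G w - G0) <= tau.
Hypotheses (H0 : 0 < H) (tau0 : 0 <= tau) (tauH : 2 * Lam * tau <= mu / 2).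
Hypothesis kapH : forall k, kap k * H * (2 * K + 2 * cm G0) <= mu / 2.
Hypothesis kapH2 : forall k, kap k * H <= Lam.
Hypothesis rhoH : forall k, rho k <= H / 4.
Hypothesis XH : forall k, X k * (32 * Lam ^+ 2) <= r0 * (kap k * H).
Hypotheses (XL : forall k, 4 * Lam * X k <= r0) (XHr : forall k, H * X k <= r0) (XHF : forall k, H * X k <= rF).

Local Notation top k p j := (gam (chd k p j).1 + (H * eps k p)%:C * nrm (chd k p j).1).

Lemma chd_step k p j : p \in qs k -> cm (gam (chd k p j.+1).1 - gam (chd k p j).1) <= Lam * hh Lam (N k) p.2.
Proof.
move=> pq; have [h0 _ _] := eps_gt0 pq; apply: le_trans (gd_lip gd _ _) _.
rewrite /child /= opprD addrACA subrr add0r -mulrBr -natrB // subSnn mulr1 gtr0_norm //.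
Qed.

Lemma top_step k p j : p \in qs k ->
  cm (top k p j.+1 - top k p j - (gam (chd k p j.+1).1 - gam (chd k p j).1)) <= 2 * (H * eps k p) /\
  cm (top k p j.+1 - top k p j) <= 2 * (Lam * hh Lam (N k) p.2) /\
  cm (nrm (chd k p j.+1).1 - nrm (chd k p j).1) <= 1 / 4.
Proof.
move=> pq; have [h0 e0 eh] := eps_gt0 pq; have st := chd_step j pq; have r00 := gd_r0 gd.
have L0 := gd_Lam gd; have hx := hX pq.
set c := (chd k p j).1 in st *; set c' := (chd k p j.+1).1 in st *.
have nl := normal_lip gd c' c.
have [n1 _ _] := gd_ball gd c; have [n1' _ _] := gd_ball gd c'.
have n2 : cm (nrm c' - nrm c) <= 2 by apply: le_trans (cmB _ _) _; rewrite n1 n1'; lra.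
have He0 : 0 < H * eps k p by rewrite mulr_gt0.
have E : gam c' + (H * eps k p)%:C * nrm c' - (gam c + (H * eps k p)%:C * nrm c) - (gam c' - gam c)
   = (H * eps k p)%:C * (nrm c' - nrm c) by ring.
have lh : Lam * hh Lam (N k) p.2 <= r0 / 4.
  rewrite ler_pdivlMr //; apply: le_trans (XL k); rewrite mulrC mulrA ler_pM2l // mulr_gt0 //.
have hr : H * eps k p <= r0.
  by apply: le_trans (XHr k); rewrite ler_pM2l //; exact: le_trans eh hx.
split; [|split].
- by rewrite E cmM cm_real gtr0_norm // mulrC ler_pM2r.
- rewrite -(subrK (gam c' - gam c) (gam c' + _ - _)) E; apply: le_trans (cmD _ _) _.
  rewrite [X in _ <= X]mulr_natl mulr2n; apply: lerD => //.
  rewrite cmM cm_real gtr0_norm //; apply: le_trans st.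
  apply: (@le_trans _ _ (r0 * (cm (gam c' - gam c) / r0))).
    by apply: ler_pM; rewrite ?cm_ge0 // ltW.
  by rewrite mulrC divfK // gt_eqF.
apply: le_trans nl _; rewrite ler_pdivrMr //; apply: le_trans st _.
by apply: le_trans lh _; clra.
Qed.

(** At height H eps the bumps have decayed to 16 C0 / H^2, so f' is close to G0. Between
    neighbouring children at distance about h the boundary bends by O(h^2) only, which is small
    against H kap h by [XH]; so the segment between the raised points stays in D at depth comparable
    to H eps. *)
Lemma path_pt k p j (s : R) : p \in qs k -> (j < N k p.2)%N -> 0 <= s <= 1 ->
  let x := top k p j + s%:C * (top k p j.+1 - top k p j) in D x /\ cm (G (sinf x) - G0) <= tau.
Proof.
move=> pq jn /andP[s0 s1] x; have [h0 e0 eh] := eps_gt0 pq; have st := chd_step j pq; have r00 := gd_r0 gd.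
have L0 := gd_Lam gd; have hx := hX pq; have [_ [t2 t3]] := top_step j pq.
set h := hh Lam (N k) p.2 in h0 e0 eh st hx t2 *; set e := kap k * h in e0 eh t2 x *.
set c := (chd k p j).1 in st t2 t3 x *; set c' := (chd k p j.+1).1 in st t2 t3 x *.
have [n1 _ _] := gd_ball gd c; have [n1' _ _] := gd_ball gd c'.
have He0 : 0 < H * e by rewrite mulr_gt0.
have Hek : H * e <= Lam * h.
  by rewrite /e mulrA [H * _]mulrC ler_pM2r.
have xc : cm (x - gam c) <= 3 * (Lam * h).
  have -> : x - gam c = (H * e)%:C * nrm c +
      s%:C * (gam c' + (H * e)%:C * nrm c' - (gam c + (H * e)%:C * nrm c)) by rewrite /x; ring.
  apply: le_trans (cmD _ _) _; rewrite cmM cm_real n1 mulr1 gtr0_norm // cmM cm_real ger0_norm //.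
  have : s * cm (gam c' + (H * e)%:C * nrm c' - (gam c + (H * e)%:C * nrm c)) <= 2 * (Lam * h).
    by apply: le_trans t2; rewrite ler_piMl ?cm_ge0.
  by move: Hek; set u := s * cm _; set w := Lam * h; clra.
have dx : H * e / 2 <= dotc (x - gam c) (nrm c).
  have -> : x - gam c = (H * e)%:C * nrm c +
      s%:C * ((gam c' - gam c) + (H * e)%:C * (nrm c' - nrm c)) by rewrite /x; ring.
  rewrite dotcDl dotcZl dotcZl dotcDl dotcZl.
  have -> : dotc (nrm c) (nrm c) = 1.
    by rewrite -(expr1n _ 2) -n1 cm_sqr /dotc !expr2.
  have k1 := clos_dot gd c (gam_clos gd c').
  have k2 : - (1 / 4) <= dotc (nrm c' - nrm c) (nrm c).
    have := dotc_le (nrm c' - nrm c) (nrm c); rewrite n1 mulr1 ler_norml => /andP[a _].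
    by move: a t3; set y := cm _; set w := dotc _ _; clra.
  have k3 : cm (gam c' - gam c) ^+ 2 <= r0 * (H * e) / 2.
    apply: (@le_trans _ _ ((Lam * h) ^+ 2)).
      by rewrite lerXn2r ?nnegrE ?cm_ge0 // mulr_ge0 // ltW.
    have := XH k; have : h * (32 * Lam ^+ 2) <= X k * (32 * Lam ^+ 2).
      by rewrite ler_pM2r // mulr_gt0 // exprn_gt0.
    move=> a b; have := le_trans a b; rewrite -(ler_pM2l h0).
    have -> : h * (r0 * (kap k * H)) = r0 * (H * e) by rewrite /e; ring.
    have -> : h * (h * (32 * Lam ^+ 2)) = 32 * (Lam * h) ^+ 2 by ring.
    by have := sqr_ge0 (Lam * h); set y := _ ^+ 2; set w := r0 * _; clra.
  have k4 : - (H * e / 4) <= dotc (gam c' - gam c) (nrm c).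
    rewrite -(ler_pM2l r00); move: k1 k3.
    have -> : 2 * r0 * dotc (gam c' - gam c) (nrm c) = 2 * (r0 * dotc (gam c' - gam c) (nrm c)) by ring.
    have -> : r0 * - (H * e / 4) = - (r0 * (H * e) / 4) by ring.
    by set y := _ ^+ 2; set w := r0 * (H * e); set w' := r0 * _; clra.
  have k5 : H * e * - (1 / 4) <= H * e * dotc (nrm c' - nrm c) (nrm c) by rewrite ler_pM2l.
  have k6 : s * - (H * e / 2) <= s * (dotc (gam c' - gam c) (nrm c) + H * e * dotc (nrm c' - nrm c) (nrm c)).
    apply: ler_wpM2l => //; move: k4 k5; set y := dotc _ _; set w := _ * dotc _ _; clra.
  have k7 : s * (H * e / 2) <= H * e / 2 by rewrite ler_piMl // ltW // divr_gt0.
  move: k6 k7; rewrite mulrN mulr1; set y := s * (dotc _ _ + _); set w := s * (H * e / 2); clra.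
have hyp : (3 * (Lam * h) + H * e / 2 / 2) ^+ 2 <= r0 * (H * e / 2).
  apply: (@le_trans _ _ ((4 * (Lam * h)) ^+ 2)).
    have lh0 : 0 < Lam * h by rewrite mulr_gt0.
    have le34 : 3 * (Lam * h) + H * e / 2 / 2 <= 4 * (Lam * h).
      by move: Hek He0 lh0; set y := H * e; set w := Lam * h; clra.
    have p1 : 0 <= 3 * (Lam * h) + H * e / 2 / 2.
      by move: He0 lh0; set y := H * e; set w := Lam * h; clra.
    by apply: lerXn2r => //; rewrite ?nnegrE //; exact: le_trans p1 le34.
  have := XH k; have : h * (32 * Lam ^+ 2) <= X k * (32 * Lam ^+ 2).
    by rewrite ler_pM2r // mulr_gt0 // exprn_gt0.
  move=> a b; have := le_trans a b; rewrite -(ler_pM2l h0).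
  have -> : h * (r0 * (kap k * H)) = 2 * (r0 * (H * e / 2)) by rewrite /e; field.
  have -> : h * (h * (32 * Lam ^+ 2)) = 2 * (4 * (Lam * h)) ^+ 2 by ring.
  by rewrite ler_pM2l.
have [|Dx fx] := depth _ xc dx hyp; first by rewrite divr_gt0.
split=> //; have cx := sub_clos Dx.
have /andP[ka kb] := kap01 k.
have [_ _ _ _ E] := node_facts gd T00 ka kb (rm1k k) (rm2k k) (N0 k) (SI k) pq.
have xp : cm (x - gam p.1) <= p.2.
  have := child_dist gd T00 (rho k) ka kb (rm1k k) (rm2k k) (N0 k) (SI k) pq (ltnW jn).
  have : Lam * h <= p.2 / 8.
    by rewrite -E -/h ler_pM2l // ler_peMr ?(ltW h0) // ler1n.
  have := cm_tri (gam c) x (gam p.1); rewrite -/c; move: xc.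
  have [_ I2 _] := SI k; have [/andP[p0 _] _] := I2 _ pq.
  by move: p0; set y := Lam * h; set u := cm _; set v := cm _; set w := cm _; clra.
have rd : rho k * (kap k * hh Lam (N k) p.2) <= H * e / 2 / 2.
  rewrite -/h -/e; have := rhoH k; rewrite -(ler_pM2r e0).
  by rewrite [H / 4 * e]mulrAC; set u := H * e; clra.
have [_ _ /(_ p x _ pq cx xp fx rd)[sf _ mid]] := SS k.
have a0 : 0 < H * e / 2 / 2 by rewrite !divr_gt0.
have := mid _ a0 (fun j _ => fx _); rewrite -/h -/e.
have -> : C0 * e ^+ 2 / (H * e / 2 / 2) ^+ 2 = 16 * C0 / H ^+ 2 by field; rewrite !gt_eqF.
have := Hs sf => h1'; move=> h2'; apply: Gnear.
have := cmBB (sinf x) (sig k.+1 x); have := et_le k; have := Ak_le k.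
by move: h1' h2'; set u := cm _; set v := cm _; set w := cm _; set y := 16 * C0 / _; clra.
Qed.

(** From one child to the next by way of the raised points: the two vertical pieces cost 2 K H eps,
    little against h because kap is small, and along the top f' is within [tau] of G0. *)
Lemma step_diff k p j : p \in qs k -> (j.+1 < N k p.2)%N ->
  cm (F (gam (chd k p j.+1).1) - F (gam (chd k p j).1) - G0 * (gam (chd k p j.+1).1 - gam (chd k p j).1))
   <= mu * hh Lam (N k) p.2.
Proof.
move=> pq jn; have [h0 e0 eh] := eps_gt0 pq; have r00 := gd_r0 gd; have hx := hX pq.
have [t1 [t2 _]] := top_step j pq.
have He0 : 0 < H * eps k p by rewrite mulr_gt0.
have jn' := ltnW jn.
have topD i : (i < N k p.2)%N -> D (top k p i).
  by move=> inn; have [] := path_pt (s := 0) pq inn; rewrite ?lexx ?ler01 // mul0r addr0.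
have topF i : (i < N k p.2)%N -> cm (F (gam (chd k p i).1) - f (top k p i)) <= K * (H * eps k p).
  move=> inn; have Dt := topD i inn; have [n1 _ _] := gd_ball gd (chd k p i).1.
  have E : cm (gam (chd k p i).1 - top k p i) = H * eps k p.
    by rewrite opprD addrA subrr add0r cmN cmM cm_real n1 mulr1 gtr0_norm.
  rewrite -(HF1 Dt); apply: le_trans (HF2 (gam_clos gd _) (sub_clos Dt) _) _; rewrite E //.
  by apply: le_trans (XHF k); rewrite ler_pM2l //; exact: le_trans eh hx.
have mid : cm (f (top k p j.+1) - f (top k p j) - G0 * (top k p j.+1 - top k p j))
    <= tau * cm (top k p j.+1 - top k p j).
  apply: seg_mvt => s s01; have [Dx gx] := path_pt pq jn' s01.
  by exists (G (sinf (top k p j + s%:C * (top k p j.+1 - top k p j)))) => //; exact: Hf.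
have f1 := topF _ jn'; have f2 := topF _ jn.
set A := F (gam _) in f2 *; set B := F (gam _) in f1 *.
set a := f (top _ _ j.+1) in mid f2; set b := f (top _ _ j) in mid f1.
set dT := top _ _ j.+1 - _ in t1 t2 mid; set dg := gam _ - gam _ in t1 *.
have -> : A - B - G0 * dg = (A - a) - (B - b) + (a - b - G0 * dT) + G0 * (dT - dg) by ring.
have m1' : cm (G0 * (dT - dg)) <= cm G0 * (2 * (H * eps k p)).
  by rewrite cmM ler_wpM2l ?cm_ge0.
have m2 : tau * cm dT <= tau * (2 * (Lam * hh Lam (N k) p.2)) by rewrite ler_wpM2l.
have b1 : kap k * H * (2 * K + 2 * cm G0) * hh Lam (N k) p.2 <= mu / 2 * hh Lam (N k) p.2.
  by rewrite ler_pM2r.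
have b2 : 2 * Lam * tau * hh Lam (N k) p.2 <= mu / 2 * hh Lam (N k) p.2 by rewrite ler_pM2r.
have := cmD (A - a - (B - b) + (a - b - G0 * dT)) (G0 * (dT - dg)).
have := cmD (A - a - (B - b)) (a - b - G0 * dT); have := cmB (A - a) (B - b).
have E1 : kap k * H * (2 * K + 2 * cm G0) * hh Lam (N k) p.2 =
  2 * (K * (H * eps k p)) + cm G0 * (2 * (H * eps k p)) by ring.
have E2 : 2 * Lam * tau * hh Lam (N k) p.2 = tau * (2 * (Lam * hh Lam (N k) p.2)) by ring.
move: b1 b2 m1' m2 mid f1 f2; rewrite E1 E2.
have -> : mu * hh Lam (N k) p.2 = mu / 2 * hh Lam (N k) p.2 + mu / 2 * hh Lam (N k) p.2 by field.
set y1 := cm G0 * _; set y2 := K * _; set y3 := tau * (2 * _); set y4 := tau * cm _; set y5 := mu / 2 * _.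
set x1 := cm _; set x2 := cm _; set x3 := cm _; set x4 := cm _; set x5 := cm _; set x6 := cm _.
by set x7 := cm _; clra.
Qed.

Lemma steps_diff k p i j : p \in qs k -> (i <= j)%N -> (j < N k p.2)%N ->
  cm (F (gam (chd k p j).1) - F (gam (chd k p i).1) - G0 * (gam (chd k p j).1 - gam (chd k p i).1))
   <= mu * hh Lam (N k) p.2 * (j%:R - i%:R).
Proof.
move=> pq ij; rewrite -(subnKC ij); elim: (j - i)%N => [|m IH] jn.
  by rewrite addn0 !subrr mulr0 subr0 cm0 mulr0.
rewrite addnS in jn *; have hA := step_diff pq jn; have h2 := IH (ltnW jn).
set A := F (gam (chd k p _.+1).1) in hA *; set B := F (gam (chd k p (i + m)).1) in hA h2.
set a := gam (chd k p _.+1).1 in hA *; set b := gam (chd k p (i + m)).1 in hA h2.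
set A' := F _ in h2 *; set a' := gam _ in h2 *.
have -> : A - A' - G0 * (a - a') = (A - B - G0 * (a - b)) + (B - A' - G0 * (b - a')) by ring.
apply: le_trans (cmD _ _) _; apply: le_trans (lerD hA h2) _.
by rewrite -[X in X <= _]mulr1 -[(i + m).+1]addn1 !natrD le_eqVlt; apply/orP; left; apply/eqP; ring.
Qed.

Hypothesis G00 : G0 != 0.
Hypothesis muG : mu <= lam * cm G0 / 2.
Hypothesis rhoK : forall k, K * rho k <= lam * cm G0 / 8.

Lemma rad_hh k p j : p \in qs k -> (chd k p j).2 <= rho k * hh Lam (N k) p.2 /\ (chd k p j).2 <= rF.
Proof.
move=> pq; have [hp e0 eh] := eps_gt0 pq; have /andP[ra rb] := rho01 k.
have c1 : (chd k p j).2 <= rho k * hh Lam (N k) p.2 by rewrite /child /= ler_pM2l.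
split=> //; apply: le_trans c1 _; apply: le_trans (XF k).
have := hX pq => hx; apply: ler_pM => //; try exact: ltW.
by apply: le_trans (rhoL k) _; have := hL0; clra.
Qed.

(** Put m = j - i. By [steps_diff], F increases from child i to child j by at least |G0| lam h m
    minus mu h m, hence by half of |G0| lam h m. The descendants of each child stray from it by less
    than its radius, which costs at most one eighth for each of the two. *)
Lemma separated k p i j (a b : R) : p \in qs k -> (i < j)%N -> (j < N k p.2)%N ->
  `|a - (chd k p i).1| <= (chd k p i).2 / (7 * Lam) -> `|b - (chd k p j).1| <= (chd k p j).2 / (7 * Lam) ->
  cm G0 * lam / 4 * hh Lam (N k) p.2 * (j%:R - i%:R) <= cm (F (gam a) - F (gam b)).
Proof.
move=> pq ij jn ai bj; have L0 := gd_Lam gd; have [hp e0 eh] := eps_gt0 pq.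
have iN : (i < N k p.2)%N by apply: ltn_trans jn.
have /andP[ka kb] := kap01 k; have cG : 0 < cm G0 by rewrite cm_gt0.
have close c m : `|c - (chd k p m).1| <= (chd k p m).2 / (7 * Lam) ->
    cm (F (gam c) - F (gam (chd k p m).1)) <= lam * cm G0 / 8 * hh Lam (N k) p.2.
  move=> cmm; have [r1 r2] := rad_hh m pq.
  have g1 : cm (gam c - gam (chd k p m).1) <= (chd k p m).2 / 7.
    apply: le_trans (gd_lip gd _ _) _; apply: (@le_trans _ _ (Lam * ((chd k p m).2 / (7 * Lam)))).
      by rewrite ler_pM2l.
    by rewrite le_eqVlt; apply/orP; left; apply/eqP; field; rewrite gt_eqF.
  have c20 : 0 <= (chd k p m).2.
    by rewrite /child /= mulr_ge0 ?(ltW e0) //; have /andP[/ltW] := rho01 k.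
  have g2 : cm (gam c - gam (chd k p m).1) <= (chd k p m).2.
    by move: g1 c20; set x := cm _; set y := (child _ _ _ _ _ _).2; clra.
  apply: le_trans (HF2 (gam_clos gd _) (gam_clos gd _) (le_trans g2 r2)) _.
  apply: (@le_trans _ _ (K * (rho k * hh Lam (N k) p.2))).
    by rewrite ler_wpM2l // (le_trans g2).
  by rewrite mulrA ler_pM2r.
have ca := close a i ai; have cb := close b j bj.
have sd := steps_diff pq (ltnW ij) jn.
have sep := child_sep gd T00 (rho k) ka kb (rm1k k) (rm2k k) (N0 k) (SI k) pq jn iN.
have m1' : (1 : R) <= j%:R - i%:R by rewrite -natrB ?(ltnW ij) // ler1n subn_gt0.
rewrite ger0_norm in sep; last by apply: le_trans m1'.
set m := j%:R - i%:R in m1' sd sep *.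
set u := gam (chd k p j).1 in sd sep cb; set v := gam (chd k p i).1 in sd sep ca.
set h := hh Lam (N k) p.2 in hp sd sep ca cb *.
have b1 : cm G0 * (lam * h * m) <= cm (G0 * (u - v)) by rewrite cmM ler_pM2l.
have b2 : mu * h * m <= lam * cm G0 / 2 * h * m.
  by rewrite ler_pM2r ?(lt_le_trans ltr01) // ler_pM2r.
have b3 : lam * cm G0 / 8 * h <= lam * cm G0 / 8 * h * m.
  by rewrite ler_peMr // mulr_ge0 ?(ltW hp) // divr_ge0 // mulr_ge0 // ?(ltW (gd_lam gd)) // ltW.
have b4 := cmBB (G0 * (u - v)) (F u - F v); rewrite [cm (G0 * (u - v) - _)]cmBC in b4.
have b5 := cm_tri (F (gam b)) (F u) (F v).
have b6 := cm_tri (F (gam a)) (F (gam b)) (F v); rewrite [cm (F (gam b) - F (gam a))]cmBC in b6.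
rewrite [cm (F u - F (gam b))]cmBC in b5.
have -> : cm G0 * lam / 4 * h * m = 1/4 * (cm G0 * (lam * h * m)) by field.
have E2 : lam * cm G0 / 2 * h * m = 1/2 * (cm G0 * (lam * h * m)) by field.
have E3 : lam * cm G0 / 8 * h * m = 1/8 * (cm G0 * (lam * h * m)) by field.
move: b1 b2 b3 b4 b5 b6 ca cb sd; rewrite E2 E3; set y := cm G0 * (lam * h * m).
set y1 := mu * h * m; set y2 := lam * cm G0 / 8 * h.
set x1 := cm _; set x2 := cm _; set x3 := cm _; set x4 := cm _; set x5 := cm _; set x6 := cm _.
by set x7 := cm _; clra.
Qed.

(** * Addresses in the tree and the Hoelder estimate *)

Section Branches.
Variables (k0 : nat) (p0 : R * R).
Hypothesis p0q : p0 \in qs k0.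
Hypothesis N2 : forall k r, (2 <= N k r)%N.

(* Address of t in the tree of nodes below [p0], the k-th digit being taken in base [N k r]:
   [branch t i] consists of the remainder of t and the i-th node reached. *)
Definition digit i (x : R) (p : R * R) := Num.truncn (x * (N (k0 + i) p.2)%:R).
Fixpoint branch (t : R) (i : nat) : R * (R * R) :=
  if i is i'.+1 then
    let: (x, p) := branch t i' in
    (x * (N (k0 + i') p.2)%:R - (digit i' x p)%:R, chd (k0 + i') p (digit i' x p))
  else (t, p0).
(** The radius of a child depends only on that of its parent, so all nodes of one generation have
    the same radius and the same number of children: [prodN i] is the number of addresses of length
    i. *)
Fixpoint rad (i : nat) : R :=
  if i is i'.+1 then rho (k0 + i') * (kap (k0 + i') * hh Lam (N (k0 + i')) (rad i')) else p0.2.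
Fixpoint prodN (i : nat) : R := if i is i'.+1 then prodN i' * (N (k0 + i') (rad i'))%:R else 1.

Lemma branch_inv t i : 0 <= t < 1 ->
  [/\ 0 <= (branch t i).1 < 1, (branch t i).2 \in qs (k0 + i) & (branch t i).2.2 = rad i].
Proof.
move=> t01; elim: i => [|i IH]; first by rewrite addn0.
move: IH => /=; case: (branch t i) => [x p] /= [/andP[x0 x1] pq pr].
have nn : 0 < (N (k0 + i) p.2)%:R :> R by rewrite ltr0n N0.
have xn : 0 <= x * (N (k0 + i) p.2)%:R by rewrite mulr_ge0 // ltW.
have /andP[d1' d2'] := truncn_itv xn.
split.
- by rewrite subr_ge0 d1' ltrBlDr addrC natr1.
- have [H1 _ _] := SS (k0 + i); rewrite addnS; apply: H1 => //.
  rewrite -(ltr_nat R); apply: le_lt_trans d1' _.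
  by rewrite gtr_pMl.
by rewrite pr.
Qed.

Lemma digit_lt t i : 0 <= t < 1 ->
  (digit i (branch t i).1 (branch t i).2 < N (k0 + i) (branch t i).2.2)%N.
Proof.
move=> /(branch_inv i)[/andP[x0 x1] _ _]; set x := (branch t i).1 in x0 x1 *; set p := (branch t i).2.
have nn : 0 < (N (k0 + i) p.2)%:R :> R by rewrite ltr0n N0.
have xn : 0 <= x * (N (k0 + i) p.2)%:R by rewrite mulr_ge0 // ltW.
have /andP[d1' d2'] := truncn_itv xn.
by rewrite -(ltr_nat R); apply: le_lt_trans d1' _; rewrite gtr_pMl.
Qed.

Lemma branchS t i : branch t i.+1 =
  ((branch t i).1 * (N (k0 + i) (branch t i).2.2)%:R - (digit i (branch t i).1 (branch t i).2)%:R,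
   chd (k0 + i) (branch t i).2 (digit i (branch t i).1 (branch t i).2)).
Proof. by rewrite /=; case: (branch t i). Qed.

Lemma rad_gt0 i : 0 < rad i.
Proof.
have [_ /= H1 H2] := branch_inv i (t := 0) (introT andP (conj (lexx _) ltr01)).
by rewrite -H2; have [_ /(_ _ H1)[/andP[]]] := SI (k0 + i).
Qed.

Lemma rad_le i : rad i <= R0 / 8 ^+ (k0 + i).
Proof.
have [_ /= H1 H2] := branch_inv i (t := 0) (introT andP (conj (lexx _) ltr01)).
by rewrite -H2; have [_ /(_ _ H1)[/andP[]]] := SI (k0 + i).
Qed.

Lemma radS i : rad i.+1 <= rad i / 8.
Proof.
have [_ /= H1 H2] := branch_inv i (t := 0) (introT andP (conj (lexx _) ltr01)).
have /andP[ka kb] := kap01 (k0 + i); have /andP[ra rb] := rho01 (k0 + i).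
have [_ [h _]] := child_rad gd T00 ka kb ra (rk (k0 + i)) (rm1k (k0 + i)) (rm2k (k0 + i)) (N0 (k0 + i)) (SI (k0 + i)) 0 H1.
by move: h; rewrite /child /= H2.
Qed.

(** The displacement is at most rad i / (8 Lam). As rad i.+1 <= rad i / 8, it is bounded by a
    difference that telescopes; the 7 comes from the geometric series of ratio 1 / 8. *)
Lemma branch_step t i : 0 <= t < 1 ->
  0 <= (branch t i.+1).2.1 - (branch t i).2.1 <= (rad i - rad i.+1) / (7 * Lam).
Proof.
move=> t01; have dl := digit_lt i t01; have [_ pq pr] := branch_inv i t01.
rewrite branchS /child /= addrC addKr.
have [h0 _ _] := eps_gt0 pq; have L0 := gd_Lam gd.
rewrite mulr_ge0 ?(ltW h0) //=; set j := digit _ _ _ in dl *.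
apply: (@le_trans _ _ (hh Lam (N (k0 + i)) (branch t i).2.2 * (N (k0 + i) (branch t i).2.2)%:R)).
  by rewrite ler_pM2l // ler_nat ltnW.
rewrite (hhN Lam (N0 (k0 + i))) pr.
rewrite ler_pdivrMr ?mulr_gt0 //.
have -> : (rad i - rad i.+1) / (7 * Lam) * (8 * Lam) = 8 / 7 * (rad i - rad i.+1) by field; rewrite gt_eqF.
by have := radS i; have := rad_gt0 i; set a := rad i; set b := rad i.+1; clra.
Qed.

Lemma branch_mono t i m : 0 <= t < 1 ->
  `|(branch t (i + m)).2.1 - (branch t i).2.1| <= (rad i - rad (i + m)) / (7 * Lam).
Proof.
move=> t01; have L7 : 0 < 7 * Lam by rewrite mulr_gt0 // (gd_Lam gd).
elim: m => [|m IH]; first by rewrite addn0 !subrr normr0 mul0r.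
have /andP[s0 s1] := branch_step (i + m) t01; rewrite addnS.
rewrite -[X in `|X|](subrKA (branch t (i + m)).2.1); apply: le_trans (ler_normD _ _) _.
rewrite (ger0_norm s0); apply: le_trans (lerD s1 IH) _.
by rewrite -mulrDl ler_pM2r ?invr_gt0 // addrC addrA subrK.
Qed.

Lemma branch_lim : exists T : R -> R, forall t i, 0 <= t < 1 ->
  `|T t - (branch t i).2.1| <= rad i / (7 * Lam).
Proof.
have L7 : 0 < 7 * Lam by rewrite mulr_gt0 // (gd_Lam gd).
have ex t : exists l, 0 <= t < 1 -> forall i, `|l - (branch t i).2.1| <= rad i / (7 * Lam).
  have [t01|no] := boolP (0 <= t < 1); last by exists 0.
  have key i m : (i <= m)%N -> `|(branch t m).2.1 - (branch t i).2.1| <= rad i / (7 * Lam).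
    move=> im; rewrite -(subnKC im); apply: le_trans (branch_mono i (m - i) t01) _.
    by rewrite ler_pM2r ?invr_gt0 // gerBl ltW // rad_gt0.
  have [e e0|l hl] := @cauchy_lim _ (fun i => (branch t i).2.1).
    have [k hk] := ex_pow8 (divr_gt0 (mulr_gt0 e0 L7) (ltr0Sn R 1)).
    have rk' : rad k <= e * (7 * Lam) / 2.
      apply: le_trans hk; apply: le_trans (rad_le k) _; rewrite ler_pM2l // lef_pV2 ?posrE ?pow8_gt0 //.
      by rewrite ler_weXn2l ?ler1n // leq_addl.
    have re : rad k / (7 * Lam) <= e / 2.
      by rewrite ler_pdivrMr // mulrAC.
    exists k => n m kn km; have := key _ _ kn; have := key _ _ km.
    move: re; have := ler_normD ((branch t n).2.1 - (branch t k).2.1) ((branch t k).2.1 - (branch t m).2.1).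
    rewrite subrKA [`|(branch t k).2.1 - _|]distrC; set x := `|_|; set y := `|_|; set z := `|_|; set w := rad k / _.
    by clra.
  exists l => _ i; rewrite leNgt; apply/negP => h.
  have e0 : 0 < (`|l - (branch t i).2.1| - rad i / (7 * Lam)) / 2 by rewrite divr_gt0 // subr_gt0.
  have [n hn] := hl _ e0.
  have := key i (maxn i n) (leq_maxl _ _); have := hn (maxn i n) (leq_maxr _ _).
  have := ler_normD (l - (branch t (maxn i n)).2.1) ((branch t (maxn i n)).2.1 - (branch t i).2.1).
  rewrite subrKA [`|l - (branch t (maxn i n)).2.1|]distrC.
  move: h; set x := `|_|; set y := `|_|; set z := `|_|; set w := rad i / _; clra.
have [T HT] := choice ex; exists T => t i t01; exact: HT.
Qed.

Hypothesis NH : forall k r, 0 < r -> 1 <= (N k r)%:R * (rho k * (kap k * (r / (8 * Lam)))) ^+ k.+1.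

Lemma prodN_ge i : 2 ^+ i <= prodN i.
Proof.
elim: i => [|i IH] //=; rewrite exprSr; apply: ler_pM => //.
by rewrite (ler_nat R 2).
Qed.

Lemma prodN_gt0 i : 0 < prodN i.
Proof. by apply: lt_le_trans (prodN_ge i); exact: pow2_gt0. Qed.

(** Each generation satisfies rad i ^ s <= 1 <= N rad i.+1 ^ s. Indeed rad i.+1 = x / N with N >=
    x^-(k+1), so N (x / N)^s is at least x to the power s - (1 - s)(k + 1) when x <= 1, and this
    exponent is not positive because k >= k0; the case x > 1 is direct. *)
Lemma rad_pow (s : R) i : 0 < s -> s < 1 -> s <= (1 - s) * k0.+1%:R ->
  rad 0 `^ s <= prodN i * rad i `^ s.
Proof.
move=> s0 s1 sk; elim: i => [|i IH]; first by rewrite mul1r.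
apply: le_trans IH _; rewrite [prodN i.+1]/= -mulrA ler_pM2l ?prodN_gt0 //.
have r1 : rad i <= 1.
  by apply: le_trans (rad_le i) _; apply: le_trans (rmk_le _) _.
have ri := rad_gt0 i; have L0 := gd_Lam gd.
apply: (@le_trans _ _ 1).
  by have := ge0_ler_powR (ltW s0) (ltW ri : rad i \in Num.nneg) (ler01 : 1 \in Num.nneg) r1; rewrite powR1.
set k := (k0 + i)%N; set n := N k (rad i).
have n0 : 0 < n%:R :> R by rewrite ltr0n N0.
set x := rho k * (kap k * (rad i / (8 * Lam))).
have /andP[ka kb] := kap01 k; have /andP[ra rb] := rho01 k.
have x0 : 0 < x by rewrite !mulr_gt0 // invr_gt0 mulr_gt0.
have E : rad i.+1 = x / n%:R by rewrite /= /x /hh -/k -/n; field; rewrite !gt_eqF.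
have xn : 0 < x / n%:R by rewrite divr_gt0.
apply: (@le_trans _ _ (expR 0)); first by rewrite expR0.
rewrite E /powR gt_eqF // -{1}(lnK n0) -expRD ler_expR.
have lE : ln (x / n%:R) = ln x - ln n%:R by rewrite ln_div.
have := NH k ri; rewrite -/x -/n => h.
have : 0 <= ln (n%:R * x ^+ k.+1) by rewrite ln_ge0.
rewrite lnM ?posrE ?exprn_gt0 // lnXn // -[ln x *+ _]mulr_natr => h2; rewrite lE.
have kk : (1 - s) * k0.+1%:R <= (1 - s) * k.+1%:R.
  by rewrite ler_pM2l ?subr_gt0 // ler_nat ltnS leq_addr.
have n1 : 0 <= ln n%:R :> R by rewrite ln_ge0 // ler1n N0.
have [xle|xgt] := leP (ln x) 0; last first.
  have -> : ln n%:R + s * (ln x - ln n%:R) = (1 - s) * ln n%:R + s * ln x by ring.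
  by rewrite addr_ge0 // mulr_ge0 ?subr_ge0 // ltW.
have a1 : ln x * ((1 - s) * k.+1%:R - s) <= 0.
  by rewrite mulr_le0_ge0 // subr_ge0; exact: le_trans sk kk.
have a2 : 0 <= (1 - s) * (ln n%:R + ln x * k.+1%:R).
  by rewrite mulr_ge0 // subr_ge0 ltW.
have -> : ln n%:R + s * (ln x - ln n%:R) = (1 - s) * (ln n%:R + ln x * k.+1%:R) -
  ln x * ((1 - s) * k.+1%:R - s) by ring.
by rewrite subr_ge0; exact: le_trans a1 a2.
Qed.

(** Every common digit multiplies the difference of the remainders by the number of children. *)
Lemma branch_same t t' i : 0 <= t < 1 -> 0 <= t' < 1 ->
  (forall l, (l <= i)%N -> (branch t l).2 = (branch t' l).2) ->
  (t - t') * prodN i = (branch t i).1 - (branch t' i).1.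
Proof.
move=> t01 t01'; elim: i => [|i IH] Hb; first by rewrite mulr1.
have Hb' l : (l <= i)%N -> (branch t l).2 = (branch t' l).2.
  by move=> li; apply: Hb; exact: ltnW.
have IH' := IH Hb'; have [_ pq pr] := branch_inv i t01.
have ei := Hb' i (leqnn _); have eS := Hb i.+1 (leqnn _).
rewrite [prodN _]/= mulrA IH'; move: eS; rewrite !branchS -ei pr.
set j := digit i _ _; set j' := digit i (branch t' i).1 _ => eS.
have [h0 _ _] := eps_gt0 pq.
suff -> : (j%:R : R) = j'%:R by rewrite /=; ring.
have /(congr1 fst) := eS; rewrite /child /= => /addrI/mulfI; apply.
by rewrite gt_eqF.
Qed.

Lemma first_diff t t' : 0 <= t < 1 -> 0 <= t' < 1 -> t != t' -> exists i,
  (forall l, (l <= i)%N -> (branch t l).2 = (branch t' l).2) /\ (branch t i.+1).2 <> (branch t' i.+1).2.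
Proof.
move=> t01 t01' tt.
have [ex|no] := pselect (exists i, (branch t i).2 != (branch t' i).2); last first.
  have same i : (branch t i).2 = (branch t' i).2.
    by apply/eqP; apply: contrapT => /negP h; apply: no; exists i.
  exfalso; have d0' : 0 < `|t - t'| by rewrite normr_gt0 subr_eq0.
  have [n hn] := small_pow2 1 d0'.
  have := branch_same t01 t01' (i := n) (fun l _ => same l).
  have [/andP[a0 a1] _ _] := branch_inv n t01; have [/andP[b0 b1] _ _] := branch_inv n t01'.
  move=> /(congr1 Num.norm); rewrite normrM (gtr0_norm (prodN_gt0 n)).
  have lt1 : `|(branch t n).1 - (branch t' n).1| < 1.
    by rewrite ltr_norml; apply/andP; split; move: a0 a1 b0 b1; clra.
  move=> E; move: lt1; rewrite -E ltNge => /negP; apply.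
  apply: (@le_trans _ _ (`|t - t'| * 2 ^+ n)); last by rewrite ler_pM2l // prodN_ge.
  by rewrite -ler_pdivrMr ?pow2_gt0 // ltW.
have [i /eqP hi imin] := ex_minnP ex; case: i hi imin => [|i] hi imin; first by [].
exists i; split=> // l li; apply/eqP; apply: contrapT => /negP h.
by have := imin l h; rewrite leqNgt ltnS li.
Qed.

Variable T : R -> R.
Hypothesis HT : forall t i, 0 <= t < 1 -> `|T t - (branch t i).2.1| <= rad i / (7 * Lam).

Lemma gam_T t i : 0 <= t < 1 -> cm (gam (T t) - gam (branch t i).2.1) <= rad i / 7.
Proof.
move=> t01; apply: le_trans (gd_lip gd _ _) _; have L0 := gd_Lam gd.
apply: (@le_trans _ _ (Lam * (rad i / (7 * Lam)))); first by rewrite ler_pM2l //; exact: HT.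
by rewrite le_eqVlt; apply/orP; left; apply/eqP; field; rewrite gt_eqF.
Qed.

(** For every i the point [gam (T t)] lies in the reserved disc of its node of generation i + 1, so
    [loop_hit] applies at all scales. *)
Lemma near_preimage t (e : R) : 0 <= t < 1 -> 0 < e ->
  exists z, [/\ D z, f z = F (gam (T t)) & cm (z - gam (T t)) < e].
Proof.
move=> t01 e0; have L0 := gd_Lam gd; have QL : 0 < Q + hL by rewrite addr_gt0.
have [i hi] : exists i, (Q + hL) * (rad i / (8 * Lam)) < e.
  have e1 : 0 < e * Lam / (Q + hL) by rewrite divr_gt0 // mulr_gt0.
  have [n hn] := ex_pow8 e1; exists n.
  have : rad n <= e * Lam / (Q + hL).
    apply: le_trans hn; apply: le_trans (rad_le n) _; rewrite ler_pM2l // lef_pV2 ?posrE ?pow8_gt0 //.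
    by rewrite ler_weXn2l ?ler1n // leq_addl.
  rewrite ler_pdivlMr // => h.
  rewrite mulrA ltr_pdivrMr ?mulr_gt0 // [(Q + hL) * _]mulrC; apply: le_lt_trans h _.
  by rewrite [8 * _]mulrC mulrA ltr_pMr ?mulr_gt0 // ltr1n.
have [_ pq pr] := branch_inv i t01; have dl := digit_lt i t01.
have tc := gam_T i.+1 t01; have r0' := rad_gt0 i.+1.
have [_ _ pr'] := branch_inv i.+1 t01.
have [||z [Dz fz zT]] := @loop_hit (k0 + i) (branch t i).2 (digit i (branch t i).1 (branch t i).2) (T t) pq.
- exact: dl.
- move: tc pr'; rewrite branchS /= => tc pr'; rewrite pr'; apply: le_trans tc _.
  by change (rad i.+1 / 7 <= rad i.+1); move: r0'; set x := rad _; clra.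
exists z; split=> //; apply: le_lt_trans zT _; apply: le_lt_trans hi.
rewrite ler_pM2l //; have [h0 e1 eh] := eps_gt0 pq; apply: le_trans eh _.
rewrite -pr -(hhN Lam (N0 (k0 + i))) ler_peMr ?(ltW h0) // ler1n //.
Qed.

(** Let the addresses first differ at generation i, by m digits out of n. Then |t - t'| <= 2 m /
    (prodN i n), while [separated] bounds the distance of the images below by a multiple of rad i m
    / n. The two are compared by [rad_pow]. *)
Lemma holder (s : R) : 0 < s -> s < 1 -> s <= (1 - s) * k0.+1%:R -> exists2 c : R, 0 < c &
  forall t t', 0 <= t < 1 -> 0 <= t' < 1 -> `|t - t'| <= c * cm (F (gam (T t)) - F (gam (T t'))) `^ s.
Proof.
move=> s0 s1 sk; have L0 := gd_Lam gd; have l0 := gd_lam gd; have cG : 0 < cm G0 by rewrite cm_gt0.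
pose b := cm G0 * lam / 4 / (8 * Lam).
have b0 : 0 < b by rewrite !divr_gt0 // mulr_gt0.
have bs : 0 < b `^ s by rewrite powR_gt0.
have rs : 0 < rad 0 `^ s by rewrite powR_gt0 // rad_gt0.
exists (2 / (b `^ s * rad 0 `^ s)); first by rewrite divr_gt0 // mulr_gt0.
have key t t' i : 0 <= t < 1 -> 0 <= t' < 1 ->
    (forall l, (l <= i)%N -> (branch t l).2 = (branch t' l).2) ->
    (digit i (branch t i).1 (branch t i).2 < digit i (branch t' i).1 (branch t' i).2)%N ->
    `|t - t'| <= 2 / (b `^ s * rad 0 `^ s) * cm (F (gam (T t)) - F (gam (T t'))) `^ s.
  move=> t01 t01' same; have := branch_same t01 t01' same.
  have [/andP[x0 x1] pq pr] := branch_inv i t01; have [/andP[x0' x1'] pq' pr'] := branch_inv i t01'.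
  have ei := same i (leqnn _).
  have := HT i.+1 t01; have := HT i.+1 t01'; have := digit_lt i t01'.
  have [_ _ prS] := branch_inv i.+1 t01; have [_ _ prS'] := branch_inv i.+1 t01'.
  have [/andP[] + + _ _] := branch_inv i.+1 t01; have [/andP[] + + _ _] := branch_inv i.+1 t01'.
  move: prS prS'; rewrite !branchS -ei pr; set p := (branch t i).2 in pq pr *.
  set j := digit i _ _; set j' := digit i (branch t' i).1 _.
  set x := (branch t i).1 in x0 x1 j *; set x' := (branch t' i).1 in x0' x1' j' *.
  set n := N (k0 + i) (rad i) => /= prS prS' y0' y1' y0 y1 jn' h' h E jj.
  have sepa : cm G0 * lam / 4 * hh Lam (N (k0 + i)) p.2 * (j'%:R - j%:R) <= cm (F (gam (T t)) - F (gam (T t'))).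
    by apply: (separated pq jj); rewrite /child /= pr // -{1}pr.
  have n0 : 0 < n%:R :> R by rewrite ltr0n N0.
  have m1' : (1 : R) <= j'%:R - j%:R by rewrite -natrB ?(ltnW jj) // ler1n subn_gt0.
  have mn : j'%:R - j%:R <= n%:R :> R.
    by rewrite lerBlDr ler_wpDr // ler_nat ltnW.
  set m := j'%:R - j%:R in m1' mn sepa.
  have P0 := prodN_gt0 i; have ri := rad_gt0 i.
  have xx : `|x - x'| * n%:R <= 2 * m.
    rewrite -[X in _ * X](gtr0_norm n0) -normrM mulrBl.
    by apply: digits_diff y0 y1 y0' y1' m1'.
  have tP : `|t - t'| * prodN i = `|x - x'|.
    by rewrite -E normrM (gtr0_norm P0).
  have mn0 : 0 <= m / n%:R by rewrite divr_ge0 // ?(ltW n0) //; apply: le_trans m1'.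
  have sep2 : b * (rad i * (m / n%:R)) <= cm (F (gam (T t)) - F (gam (T t'))).
    apply: le_trans sepa; rewrite le_eqVlt; apply/orP; left; apply/eqP.
    by rewrite /b /hh pr -/n; field; rewrite !gt_eqF.
  have sep3 : b `^ s * (rad i `^ s * (m / n%:R)) <= cm (F (gam (T t)) - F (gam (T t'))) `^ s.
    apply: (@le_trans _ _ ((b * (rad i * (m / n%:R))) `^ s)); last first.
      by apply: ge0_ler_powR; rewrite ?nnegrE ?cm_ge0 ?(ltW s0) // mulr_ge0 ?(ltW b0) // mulr_ge0 // ltW.
    have -> := powRM s (ltW b0) (mulr_ge0 (ltW ri) mn0); have -> := powRM s (ltW ri) mn0.
    (* As m / n is at most 1, its power of exponent s < 1 is at least m / n itself. *)
    rewrite !ler_pM2l ?powR_gt0 //; apply: ger1_powR; last exact: ltW.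
    have m0 : 0 < m by apply: lt_le_trans m1'.
    by apply/andP; split; [rewrite divr_gt0|rewrite ler_pdivrMr // mul1r].
  have pw := rad_pow i s0 s1 sk.
  rewrite -(ler_pM2r P0) tP -(ler_pM2r n0); apply: le_trans xx _.
  set W := cm _ `^ s in sep3 *.
  have e1 : b `^ s * rad 0 `^ s * m <= W * prodN i * n%:R.
    apply: (@le_trans _ _ (b `^ s * (rad i `^ s * (m / n%:R)) * prodN i * n%:R)); last first.
      by rewrite ler_pM2r // ler_pM2r.
    have -> : b `^ s * (rad i `^ s * (m / n%:R)) * prodN i * n%:R = b `^ s * (prodN i * rad i `^ s) * m.
      by field; rewrite gt_eqF.
    by rewrite ler_wpM2r ?(le_trans ler01) // ler_pM2l.
  have bsr : 0 < b `^ s * rad 0 `^ s by rewrite mulr_gt0.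
  rewrite -(ler_pM2l bsr).
  have -> : b `^ s * rad 0 `^ s * (2 / (b `^ s * rad 0 `^ s) * W * prodN i * n%:R) = 2 * (W * prodN i * n%:R).
    by field; rewrite !gt_eqF.
  by rewrite mulrCA ler_pM2l.
move=> t t' t01 t01'; have [->|tt] := eqVneq t t'.
  by rewrite subrr normr0 mulr_ge0 ?powR_ge0 // divr_ge0 // mulr_ge0 // ltW.
have [i [same diff]] := first_diff t01 t01' tt; have ei := same i (leqnn _).
have [lt|lt|eq] := ltngtP (digit i (branch t i).1 (branch t i).2) (digit i (branch t' i).1 (branch t' i).2).
- exact: key same lt.
- rewrite distrC cmBC; apply: (key t' t i) => // l li; by rewrite same.
by exfalso; apply: diff; rewrite !branchS /= eq ei.
Qed.

End Branches.

Hypothesis N2 : forall k r, (2 <= N k r)%N.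
Hypothesis NH : forall k r, 0 < r -> 1 <= (N k r)%:R * (rho k * (kap k * (r / (8 * Lam)))) ^+ k.+1.
Hypothesis Htgt : forall t0 (e : R) k0, 0 < e -> exists k p, [/\ (k0 <= k)%N, p \in qs k & cm (gam t0 - gam p.1) <= e].
Hypothesis rF0 : 0 < rF.

Lemma core_out (t0 r s : R) : 0 < r -> 0 < s -> s < 1 -> exists (c : R) (T : R -> R),
  [/\ 0 < c, forall t, 0 <= t < 1 -> cm (F (gam (T t)) - F (gam t0)) < r /\
        forall e, 0 < e -> exists z, [/\ D z, f z = F (gam (T t)) & cm (z - gam (T t)) < e] &
      forall t t', 0 <= t < 1 -> 0 <= t' < 1 ->
        `|t - t'| <= c * cm (F (gam (T t)) - F (gam (T t'))) `^ s].
Proof.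
move=> rp s0 s1.
pose e := Num.min (rF / 2) (r / (4 * (K + 1))).
have K1 : 0 < K + 1 by rewrite ltr_wpDl.
have e0 : 0 < e by rewrite lt_min !divr_gt0 // mulr_gt0.
have eF : e <= rF / 2 by rewrite ge_min lexx.
have er : (K + 1) * (4 * e) <= r.
  have : e <= r / (4 * (K + 1)) by rewrite ge_min lexx orbT.
  by rewrite ler_pdivlMr ?mulr_gt0 // (_ : e * (4 * (K + 1)) = (K + 1) * (4 * e)) //; ring.
have [n1 hn1] := ex_pow8 e0.
have s1' : 0 < 1 - s by rewrite subr_gt0.
(* The root is taken at a late stage for two reasons: beyond [n1] its tree is small, and beyond [n2]
   the exponent s is admissible in [rad_pow]. *)
pose n2 := Num.bound (s / (1 - s)).
have hn2 : s <= (1 - s) * n2%:R.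
  by rewrite mulrC -ler_pdivrMr // ltW // archi_boundP // divr_ge0 // ltW.
have [k0 [p0 [kn p0q pt]]] := Htgt t0 (maxn n1 n2) e0.
have [T HT] := branch_lim p0q.
have sk : s <= (1 - s) * k0.+1%:R.
  apply: le_trans hn2 _; rewrite ler_pM2l // ler_nat; apply: leqW.
  by apply: leq_trans kn; exact: leq_maxr.
have [c c0' Hc] := holder p0q N2 NH HT s0 s1 sk.
exists c, T; split=> // t t01; split; last by move=> e' e0'; exact: near_preimage HT _ _ t01 e0'.
have g1 := gam_T HT 0 t01.
have p2e : rad k0 p0 0 <= e.
  apply: le_trans hn1; apply: le_trans (rad_le p0q 0) _; rewrite addn0 ler_pM2l // lef_pV2 ?posrE ?pow8_gt0 //.
  by rewrite ler_weXn2l ?ler1n //; apply: leq_trans kn; exact: leq_maxl.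
have r00' := rad_gt0 p0q 0.
have g2 : cm (gam (T t) - gam t0) <= 2 * e.
  have := cm_tri (gam p0.1) (gam (T t)) (gam t0); rewrite [cm (gam p0.1 - gam t0)]cmBC.
  by move: g1 pt p2e r00'; rewrite /=; set x := cm _; set y := cm _; set w := cm _; clra.
have g3 : cm (gam (T t) - gam t0) <= rF by apply: le_trans g2 _; move: eF; clra.
apply: le_lt_trans (HF2 (gam_clos gd _) (gam_clos gd _) g3) _.
apply: le_lt_trans (ler_wpM2l K0 g2) _.
have : 0 <= K * e by rewrite mulr_ge0 // ltW.
by move: er e0; rewrite mulrDl mul1r !(mulrCA K); set x := K * e; clra.
Qed.

End Core.

(** * Choice of the constants and iteration of the stages *)

Section Instance.
Variable R : realType.
Local Notation C := R[i].
Local Notation Re := (@complex.Re R).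
Local Notation Im := (@complex.Im R).

Lemma ex_pos_lb (s : seq R) : all (fun x => 0 < x) s -> exists2 m : R, 0 < m & all (fun x => m <= x) s.
Proof.
elim: s => [|x s IH] /=; first by exists 1.
move=> /andP[x0 /IH[m m0 Hm]]; exists (Num.min x m); first by rewrite lt_min x0.
rewrite ge_min lexx /=; apply/allP => y /(allP Hm) h.
by rewrite ge_min h orbT.
Qed.

(** Enumerating pairs of a rational and an integer makes every rational occur at arbitrarily late
    indices. These are the parameters near which roots are requested, so roots of late stages are
    dense too. *)
Lemma dense_seq : exists tgt : nat -> R, forall (t e : R) (k0 : nat), 0 < e ->
  exists2 k, (k0 <= k)%N & `|tgt k - t| <= e.
Proof.
exists (fun k => if unpickle k is Some (q, n) then ratr ((q, n) : rat * nat).1 else 0) => t e k0 e0.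
have te : t - e < t + e by lra.
have [q] := rat_in_itvoo te.
rewrite in_itv /= => /andP[q1 q2].
have [n hn] : exists n : nat, leq k0 (pickle (q, n)).
  apply: contrapT => no.
  have lt (n : nat) : (pickle (q, n) < k0)%N by rewrite ltnNge; apply/negP => h; apply: no; exists n.
  pose f (i : 'I_k0.+1) : 'I_k0 := Ordinal (lt i).
  have := @leq_card _ _ f; rewrite !card_ord ltnn => H; apply: notF; apply: H => i j /(congr1 val) /= E.
  by have [/ord_inj] := pcan_inj (@pickleK (rat * nat)%type) E.
exists (pickle (q, n)) => //; rewrite pickleK /=.
by rewrite ler_norml; apply/andP; split; move: q1 q2; lra.
Qed.

Variables (D : set C) (gam nrm : R -> C) (Lam lam d0 r0 : R).
Hypothesis gd : good_dom D gam nrm Lam lam d0 r0.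
Variables (G Phi : C -> C) (T0 eta C0 c0 h1 d1 m1 Q L LG : R).
Hypothesis spec : loop_spec G Phi T0 eta C0 c0 h1 d1 m1 Q.
Hypotheses (L0 : 0 < L) (LG0 : 0 < LG) (G00 : G 0 != 0).
Hypothesis Glip : forall s s', cm s <= 1 - eta / 2 -> cm s' <= 1 - eta / 2 -> cm (G s - G s') <= LG * cm (s - s').

Lemma Phi_small_ex (e : R) : 0 < e -> exists2 r : R, 0 < r & forall z, cm z <= r -> cm (Phi z) <= e.
Proof.
case: spec => [[T00 _ _ C00 _] [_ _ _ _ P0] HP _] e0.
have [|[l /hasd_ccont/(_ _ e0)[d dp Hd]] _ _] := HP T0 0 (lexx _).
  by rewrite cm0 expr0n /= oppr0 mulr0.
exists (d / 2); first by rewrite divr_gt0.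
move=> z zd; have := Hd z; rewrite !subr0 P0 subr0; apply.
by move: zd dp; set x := cm z; clra.
Qed.

Lemma stages_ex (delta R0 : R) (kap rho : nat -> R) (fN : nat -> R -> nat) (tgt : nat -> R) :
  0 < delta -> 14 * delta <= eta -> eta <= 1 ->
  0 < R0 -> R0 / (8 * Lam) <= d0 -> R0 / (8 * Lam) * T0 <= r0 ->
  (forall k, 0 < kap k <= 1) -> (forall k, 0 < rho k <= 1) -> (forall k, rho k * kap k <= lam / 4) ->
  (forall k, 16 * C0 * kap k ^+ 2 <= lam ^+ 2 * et delta k) ->
  (forall k z, cm z <= rho k -> cm (Phi z) <= et delta k) ->
  exists N sig qs, [/\ forall k r, (fN k r <= N k r)%N /\ (0 < N k r)%N,
    forall k, stinv D gam eta (sig k) (qs k) (Ak delta k) (R0 / 8 ^+ k),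
    forall k, stage D gam nrm Lam lam Phi C0 (et delta k) (kap k) (rho k) (Ak delta k) (N k)
      (sig k) (qs k) (sig k.+1) (qs k.+1),
    forall k, exists2 p, p \in qs k.+1 & cm (gam (tgt k) - gam p.1) <= R0 / 8 ^+ k &
    sig 0 = (fun _ => 0) /\ qs 0 = [:: (0, R0)]].
Proof.
move=> delta0 deta eta1 R00 rm1 rm2 kap01 rho01 rk kapet Psm.
case: spec => [[T00 eta0 _ C00 _] [_ _ _ _ P0] HP _].
pose S := (nat * (C -> C) * seq (R * R))%type.
pose good (x : S) := stinv D gam eta x.1.2 x.2 (Ak delta x.1.1) (R0 / 8 ^+ x.1.1).
(* What a stage provides is stated under the hypothesis [good x], so that every state has a
   successor and dependent choice applies; [good] is then recovered by induction from the initial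
   state. *)
pose next (x y : S) := y.1.1 = x.1.1.+1 /\ (good x -> good y /\ exists N : R -> nat,
  [/\ forall r, (fN x.1.1 r <= N r)%N /\ (0 < N r)%N,
    stage D gam nrm Lam lam Phi C0 (et delta x.1.1) (kap x.1.1) (rho x.1.1) (Ak delta x.1.1) N x.1.2 x.2 y.1.2 y.2 &
    exists2 p, p \in y.2 & cm (gam (tgt x.1.1) - gam p.1) <= R0 / 8 ^+ x.1.1]).
have AS k : Ak delta k.+1 = Ak delta k + 7 * et delta k.
  by rewrite /Ak /et exprS; have := pow2_gt0 R k => p0; field; rewrite gt_eqF.
have step x : exists y, next x y.
  have [gx|ng] := pselect (good x); last by exists (x.1.1.+1, x.1.2, x.2); split.
  case: x gx => [[k s] q] /= gx; have /andP[ka kb] := kap01 k; have /andP[ra rb] := rho01 k.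
  have rmk : 0 < R0 / 8 ^+ k by rewrite divr_gt0 ?pow8_gt0.
  have A0 : 0 <= Ak delta k.
    rewrite /Ak mulr_ge0 ?mulr_ge0 ?(ltW delta0) // subr_ge0 invf_le1 ?pow2_gt0 //.
    by rewrite exprn_ege1 // ler1n.
  have Ae : Ak delta k + 7 * et delta k <= eta.
    by rewrite -AS; apply: le_trans (Ak_le delta0 _) _; move: deta delta0; lra.
  have [N [s' [q' [HN gy st tg]]]] := stage_ex gd T00 C00 HP (tgt k) (fN k) (et_gt0 delta0 k) ka kb ra rb
    (kapet k) (rk k) (Psm k) rmk (rm1k gd R00 rm1 k) (rm2k gd T00 R00 rm2 k) A0 Ae eta1 gx.
  exists (k.+1, s', q'); split=> // _; split; last by exists N.
  have E : R0 / 8 ^+ k.+1 = R0 / 8 ^+ k / 8.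
    by rewrite exprSr; have := pow8_gt0 R k => p8; field; rewrite gt_eqF.
  by rewrite /good /= AS E.
have [w [w0 wS]] := dependent_choice (fun x => cid (step x)) ((0%N, fun _ => 0, [:: (0, R0)]) : S).
have wk k : (w k).1.1 = k.
  by elim: k => [|k IH]; [rewrite w0|have [-> _] := wS k; rewrite IH].
have wg k : good (w k).
  elim: k => [|k IH]; last by have [_ /(_ IH)[]] := wS k.
  rewrite /good w0 /= /Ak !expr0 invr1 subrr mulr0 mulr1; split.
  - move=> z _; split; first by exists 0; exact: hasd_cst.
    by rewrite cm0 addr0 subr_ge0.
  - by move=> p; rewrite inE => /eqP -> /=; rewrite R00 lexx; split=> // z _ _; rewrite cm0.
  - by move=> p q; rewrite !inE => /eqP -> /eqP ->; rewrite eqxx.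
have wn k : exists N : R -> nat,
  [/\ forall r, (fN k r <= N r)%N /\ (0 < N r)%N,
    stage D gam nrm Lam lam Phi C0 (et delta k) (kap k) (rho k) (Ak delta k) N (w k).1.2 (w k).2 (w k.+1).1.2 (w k.+1).2 &
    exists2 p, p \in (w k.+1).2 & cm (gam (tgt k) - gam p.1) <= R0 / 8 ^+ k].
  by have [_ /(_ (wg k))[_]] := wS k; rewrite wk.
have [N HN] := choice wn.
exists N, (fun k => (w k).1.2), (fun k => (w k).2); split.
- by move=> k r; have [] := HN k.
- by move=> k; have := wg k; rewrite /good wk.
- by move=> k; have [] := HN k.
- by move=> k; have [] := HN k.
- by rewrite w0.
Qed.

(** The constants form a chain: [delta] and [H] are adapted to the tolerance [q] on the argument of
    G, [kap] to [H], [rho] to [hL] and [H], and [X], the admissible distance between neighbouring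
    children, to [kap]. The number of children comes last and can therefore be as large as
    needed. *)
Lemma core : exists sinf : C -> C,
  [/\ forall z, D z -> exd sinf z /\ cm (sinf z) <= 1 - eta / 2,
      forall z, D z -> far gam z 1 -> cm (G (sinf z) - G 0) <= cm (G 0) / 2 &
      forall f F : C -> C, (forall z, D z -> hasd f z (G (sinf z))) -> (forall z, D z -> F z = f z) ->
        (forall x y, clos D x -> clos D y -> cm (x - y) <= r0 / 8 / 16 -> cm (F x - F y) <= 9 * L * cm (x - y)) ->
        forall t0 r s : R, 0 < r -> 0 < s -> s < 1 -> exists (c : R) (T : R -> R),
        [/\ 0 < c, forall t, 0 <= t < 1 -> cm (F (gam (T t)) - F (gam t0)) < r /\
              forall e, 0 < e -> exists z, [/\ D z, f z = F (gam (T t)) & cm (z - gam (T t)) < e] &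
            forall t t', 0 <= t < 1 -> 0 <= t' < 1 ->
              `|t - t'| <= c * cm (F (gam (T t)) - F (gam (T t'))) `^ s]].
Proof.
have sp := spec.
case: sp => [[T00 eta0 eta1 C00 c00] [h10 d10 hm1 Q0 P0] HP loops].
have La0 := gd_Lam gd; have la0 := gd_lam gd; have d00 := gd_d0 gd; have r00 := gd_r0 gd.
have cG : 0 < cm (G 0) by rewrite cm_gt0.
pose K := 9 * L; have K0 : 0 < K by rewrite mulr_gt0.
pose rF := r0 / 8 / 16; have rF0 : 0 < rF by rewrite !divr_gt0.
pose mu := lam * cm (G 0) / 2; have mu0 : 0 < mu by rewrite divr_gt0 // mulr_gt0.
pose tau := mu / (4 * Lam); have tau0 : 0 < tau by rewrite divr_gt0 // mulr_gt0.
have [q q0 /and3P[q1 q2 _]] : exists2 q, 0 < q & all (fun x => q <= x) [:: 1 / 4; tau / (2 * LG)].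
  by apply: ex_pos_lb; rewrite /= !divr_gt0 ?mulr_gt0.
have [delta delta0 /and5P[de1 de2 de3 de4 _]] : exists2 x, 0 < x &
    all (fun y => x <= y) [:: eta / 14; d1 / 12; q / 12; cm (G 0) / 2 / (2 * LG)].
  by apply: ex_pos_lb; rewrite /= !divr_gt0 ?mulr_gt0.
have E1 : 14 * delta <= eta by move: de1; clear -gd spec L0 LG0 G00 Glip; lra.
have E2 : 12 * delta <= d1 by move: de2; clear -gd spec L0 LG0 G00 Glip; lra.
have E3 : 12 * delta <= q by move: de3; clear -gd spec L0 LG0 G00 Glip; lra.
have E4 : LG * (2 * delta) <= cm (G 0) / 2.
  by move: de4; rewrite ler_pdivlMr ?mulr_gt0 // (_ : delta * (2 * LG) = LG * (2 * delta)) //; ring.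
have [H H1 HH] : exists2 H : R, 1 <= H & 16 * C0 / H ^+ 2 <= q.
  exists (1 + 16 * C0 / q); first by rewrite lerDl ltW // divr_gt0 // mulr_gt0.
  set a := 1 + _; have a1 : 1 <= a by rewrite lerDl ltW // divr_gt0 // mulr_gt0.
  have a0 : 0 < a by apply: lt_le_trans a1.
  rewrite ler_pdivrMr ?exprn_gt0 // -ler_pdivrMl //.
  apply: (@le_trans _ _ a); first by rewrite /a [q^-1 * _]mulrC lerDr.
  by rewrite expr2 ler_peMl // ltW.
have H0 : 0 < H by apply: lt_le_trans H1.
have [hL hL0 /and4P[hL1 hL2 hL3 _]] : exists2 x, 0 < x &
    all (fun y => x <= y) [:: h1; Q / 2; c0 / (K * 3)].
  by apply: ex_pos_lb; rewrite /= h10 !divr_gt0 ?mulr_gt0.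
have hLQ : 2 * hL <= Q by move: hL2; clear -gd spec L0 LG0 G00 Glip; lra.
have KhL : K * (3 * hL) <= c0 by move: hL3; rewrite ler_pdivlMr ?mulr_gt0 // mulrC -mulrA.
have KG : 0 < 2 * K + 2 * cm (G 0) by rewrite addr_gt0 // mulr_gt0.
have kap_ex k : exists x, [/\ 0 < x, x <= 1, x <= lam ^+ 2 * et delta k / (16 * C0), x <= lam / 4 / Q &
    x <= Lam / H /\ x <= mu / 2 / (H * (2 * K + 2 * cm (G 0)))].
  have [x x0 /and5P[a1 a2 a3 a4 /andP[a5 _]]] : exists2 x, 0 < x & all (fun y => x <= y)
      [:: 1; lam ^+ 2 * et delta k / (16 * C0); lam / 4 / Q; Lam / H; mu / 2 / (H * (2 * K + 2 * cm (G 0)))].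
    by apply: ex_pos_lb; rewrite /= ltr01 !divr_gt0 ?mulr_gt0 ?exprn_gt0 ?et_gt0.
  by exists x.
have [kap Hkap] := choice kap_ex.
have rho_ex k : exists x, [/\ 0 < x, x <= 1, x <= lam / 4, x <= hL / 2 /\ x <= H / 4 &
    x <= lam * cm (G 0) / 8 / K /\ forall z, cm z <= x -> cm (Phi z) <= et delta k].
  have [rP rP0 HrP] := Phi_small_ex (et_gt0 delta0 k).
  have [x x0 /and5P[a1 a2 a3 a4 /and3P[a5 a6 _]]] : exists2 x, 0 < x & all (fun y => x <= y)
      [:: 1; lam / 4; hL / 2; H / 4; lam * cm (G 0) / 8 / K; rP].
    by apply: ex_pos_lb; rewrite /= ltr01 rP0 !divr_gt0 ?mulr_gt0.
  by exists x; split=> //; split=> // z zx; apply: HrP; exact: le_trans zx a6.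
have [rho Hrho] := choice rho_ex.
have kap0 k : 0 < kap k by have [] := Hkap k.
have rho0 k : 0 < rho k by have [] := Hrho k.
have X_ex k : exists x, [/\ 0 < x, x <= r0 * hL / (Q + hL) ^+ 2, x <= rF / (3 * hL),
    x <= r0 * (kap k * H) / (32 * Lam ^+ 2) & [/\ x <= r0 / (4 * Lam), x <= r0 / H & x <= rF / H]].
  have [x x0 /and5P[a1 a2 a3 a4 /and3P[a5 a6 _]]] : exists2 x, 0 < x & all (fun y => x <= y)
      [:: r0 * hL / (Q + hL) ^+ 2; rF / (3 * hL); r0 * (kap k * H) / (32 * Lam ^+ 2); r0 / (4 * Lam); r0 / H; rF / H].
    by apply: ex_pos_lb; rewrite /= !divr_gt0 ?mulr_gt0 ?exprn_gt0 ?addr_gt0 // mulr_gt0.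
  by exists x.
have [X HX] := choice X_ex.
have X0 k : 0 < X k by have [] := HX k.
have [R0 R00 /and4P[R1 R2 R3 _]] : exists2 x, 0 < x & all (fun y => x <= y)
    [:: 1; d0 * (8 * Lam); r0 / T0 * (8 * Lam)].
  by apply: ex_pos_lb; rewrite /= ltr01 !mulr_gt0 ?invr_gt0.
have L8 : 0 < 8 * Lam by rewrite mulr_gt0.
have rm1 : R0 / (8 * Lam) <= d0 by rewrite ler_pdivrMr.
have rm2 : R0 / (8 * Lam) * T0 <= r0 by rewrite -ler_pdivlMr // ler_pdivrMr.
(* The three summands provide at least two children, a mutual distance at most [X k], and the growth
   of N used in [rad_pow]. *)
pose fN k r := (2 + Num.bound (R0 / (8 * Lam) / X k) +
  Num.bound (((rho k * (kap k * (r / (8 * Lam)))) ^+ k.+1)^-1))%N.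
have [tgt Htgt] := dense_seq.
have kap01 k : 0 < kap k <= 1 by have [a b _ _ _] := Hkap k; rewrite a.
have rho01 k : 0 < rho k <= 1 by have [a b _ _ _] := Hrho k; rewrite a.
have rk k : rho k * kap k <= lam / 4.
  have [_ _ a _ _] := Hrho k; apply: le_trans a; rewrite ler_piMr ?(ltW (rho0 k)) //.
  by have /andP[] := kap01 k.
have kapet k : 16 * C0 * kap k ^+ 2 <= lam ^+ 2 * et delta k.
  have [a b c _ _] := Hkap k; move: c; rewrite ler_pdivlMr ?mulr_gt0 // mulrC; apply: le_trans.
  by rewrite ler_pM2l ?mulr_gt0 // expr2 ler_piMr // ltW.
have Psm k z : cm z <= rho k -> cm (Phi z) <= et delta k by have [_ _ _ _ [_ h]] := Hrho k; exact: h.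
have [N [sig [qs [HN SI SS HT [sig0 qs0]]]]] := stages_ex fN tgt delta0 E1 (ltW eta1) R00 rm1 rm2 kap01 rho01 rk kapet Psm.
have N0 k r : (0 < N k r)%N by have [] := HN k r.
have q0' k : exists p, p \in qs k.
  by case: k => [|k]; [exists (0, R0); rewrite qs0 mem_head | have [p pq _] := HT k; exists p].
have [sinf [Hs1 Hs2]] := limit_fun gd delta0 E1 R00 SI SS q0'.
have small : 1 - eta / 2 >= 1 / 2 by move: eta1; clear -gd spec L0 LG0 G00 Glip; lra.
have near0 w : cm w <= 12 * delta + 16 * C0 / H ^+ 2 -> cm (G w - G 0) <= tau.
  move=> wl; have w2 : cm w <= 2 * q by apply: le_trans wl _; move: E3 HH; set y := _ / _; clear -gd spec L0 LG0 G00 Glip; clra.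
  apply: le_trans (Glip _ _) _; rewrite ?cm0 ?subr0.
  - by apply: le_trans w2 _; move: q1 small; clear -gd spec L0 LG0 G00 Glip; lra.
  - by move: small; clear -gd spec L0 LG0 G00 Glip; lra.
  apply: le_trans (ler_wpM2l (ltW LG0) w2) _.
  by move: q2; rewrite ler_pdivlMr ?mulr_gt0 // (_ : q * (2 * LG) = LG * (2 * q)) //; ring.
exists sinf; split=> //.
  move=> z Dz fz.
  (* At stage 0 the function is 0 and the only node has radius R0 <= 1, so a point at distance 1
     from the boundary is already safe and [sinf] is at most 2 delta there. *)
  have sf : safe D gam (qs 0) z 1.
    split=> //; [exact: sub_clos | by exists (0, R0); rewrite ?qs0 ?mem_head |].
    by move=> p; rewrite qs0 inE => /eqP ->; apply: le_trans R1 (fz _).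
  have := Hs2 _ _ _ sf; rewrite sig0 subr0 => h; apply: le_trans (Glip _ _) _.
  - by have [_] := Hs1 _ Dz.
  - by rewrite cm0; move: small; clear -gd spec L0 LG0 G00 Glip; lra.
  by rewrite subr0; apply: le_trans E4; rewrite ler_pM2l.
move=> f F Hf HF1 HF2 t0 r s rp s0 s1.
have hX k p : p \in qs k -> hh Lam (N k) p.2 <= X k.
  move=> pq; have [_ /(_ _ pq)[/andP[p0 pr] _] _] := SI k.
  have n0 : 0 < (N k p.2)%:R :> R by rewrite ltr0n N0.
  rewrite /hh ler_pdivrMr //; apply: (@le_trans _ _ (R0 / (8 * Lam))).
    by rewrite ler_pM2r ?invr_gt0 //; apply: le_trans pr (rmk_le R00 k).
  rewrite -ler_pdivrMl // [_ * (R0 / _)]mulrC; have [h _] := HN k p.2.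
  apply: (@le_trans _ _ (Num.bound (R0 / (8 * Lam) / X k))%:R).
    by rewrite ltW // archi_boundP // ltW // !divr_gt0.
  by rewrite ler_nat; apply: leq_trans h; rewrite /fN addnAC addnC leq_addr.
have N2 k u : (2 <= N k u)%N.
  by have [h _] := HN k u; apply: leq_trans h; rewrite /fN -addnA leq_addr.
have NH k u : 0 < u -> 1 <= (N k u)%:R * (rho k * (kap k * (u / (8 * Lam)))) ^+ k.+1.
  move=> u0; set x := rho k * _; have x0 : 0 < x by rewrite mulr_gt0 // mulr_gt0 // divr_gt0.
  have xk : 0 < x ^+ k.+1 by rewrite exprn_gt0.
  rewrite -ler_pdivrMr // mul1r; have [h _] := HN k u.
  apply: (@le_trans _ _ (Num.bound ((x ^+ k.+1)^-1))%:R).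
    by rewrite ltW // archi_boundP // invr_ge0 ltW.
  by rewrite ler_nat; apply: leq_trans h; rewrite /fN -/x leq_addl.
have HTg u (e : R) k0 : 0 < e -> exists k p, [/\ (k0 <= k)%N, p \in qs k & cm (gam u - gam p.1) <= e].
  move=> e0; have e20 : 0 < e / 2 by rewrite divr_gt0.
  have [n hn] := ex_pow8 R00 e20.
  have e3 : 0 < e / 2 / Lam by rewrite !divr_gt0.
  have [k kn hk] := Htgt u (e / 2 / Lam) (maxn k0 n) e3.
  have [p pq hp] := HT k; exists k.+1, p; split=> //.
    by apply: leqW; apply: leq_trans kn; exact: leq_maxl.
  have g1 : cm (gam u - gam (tgt k)) <= e / 2.
    apply: le_trans (gd_lip gd _ _) _; rewrite distrC mulrC -ler_pdivlMr //.
  have g2 : cm (gam (tgt k) - gam p.1) <= e / 2.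
    apply: le_trans hp _; apply: le_trans hn; rewrite ler_pM2l // lef_pV2 ?posrE ?pow8_gt0 //.
    by rewrite ler_weXn2l ?ler1n //; apply: leq_trans kn; exact: leq_maxr.
  by apply: le_trans (cm_tri _ _ _) (le_trans (lerD g1 g2) _); rewrite -splitr.
have rhoL k : rho k <= hL / 2 by have [_ _ _ [] ] := Hrho k.
have rhoH k : rho k <= H / 4 by have [_ _ _ [] ] := Hrho k.
have rhoK k : K * rho k <= lam * cm (G 0) / 8.
  by have [_ _ _ _ [h _]] := Hrho k; rewrite mulrC -ler_pdivlMr.
have kapQ k : kap k * Q <= lam / 4 by have [_ _ _ h _] := Hkap k; rewrite -ler_pdivlMr.
have kapH k : kap k * H * (2 * K + 2 * cm (G 0)) <= mu / 2.
  by have [_ _ _ _ [_ h]] := Hkap k; rewrite -mulrA -ler_pdivlMr ?mulr_gt0.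
have kapH2 k : kap k * H <= Lam by have [_ _ _ _ [h _]] := Hkap k; rewrite -ler_pdivlMr.
have XQ k : X k * (Q + hL) ^+ 2 <= r0 * hL.
  by have [_ h _ _ _] := HX k; rewrite -ler_pdivlMr ?exprn_gt0 // addr_gt0.
have XF k : 3 * hL * X k <= rF.
  by have [_ _ h _ _] := HX k; rewrite mulrC -ler_pdivlMr ?mulr_gt0.
have XH k : X k * (32 * Lam ^+ 2) <= r0 * (kap k * H).
  by have [_ _ _ h _] := HX k; rewrite -ler_pdivlMr // mulr_gt0 // exprn_gt0.
have XL k : 4 * Lam * X k <= r0.
  by have [_ _ _ _ [h _ _]] := HX k; rewrite mulrC -ler_pdivlMr ?mulr_gt0.
have XHr k : H * X k <= r0 by have [_ _ _ _ [_ h _]] := HX k; rewrite mulrC -ler_pdivlMr.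
have XHF k : H * X k <= rF by have [_ _ _ _ [_ _ h]] := HX k; rewrite mulrC -ler_pdivlMr.
have tauH : 2 * Lam * tau <= mu / 2.
  by rewrite le_eqVlt; apply/orP; left; apply/eqP; rewrite /tau; field; rewrite gt_eqF.
exact: (@core_out R D gam nrm Lam lam d0 r0 gd Phi T0 eta C0 T00 delta R0 kap rho N sig qs
  delta0 R00 R1 kap01 rho01 rk rm1 rm2 N0 SI SS G sinf f F X c0 h1 d1 m1 Q hL K rF Hs2 Hf HF1 HF2 loops E2 hL0 hL1 hm1
  Q0 hLQ (ltW K0) KhL rhoL kapQ hX XQ XF (G 0) H tau mu near0 H0 (ltW tau0) tauH kapH kapH2 rhoH XH XL XHr XHF
  G00 (lexx _) rhoK N2 NH HTg rF0 t0 r s rp s0 s1).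
Qed.

End Instance.

(** * Hausdorff measure: Hoelder lower bound and Lipschitz upper bound *)

Section Hausdorff.
Variable R : realType.
Local Notation C := R[i].
Local Notation mu := (@lebesgue_measure R).
Local Open Scope ereal_scope.
Implicit Types (U E : set (Cplx R)).

Lemma dist_cm (x y : Cplx R) : dist x y = cm (x - y)%R.
Proof. by rewrite /dist cmRe. Qed.

Lemma diam_fin U (u : Cplx R) (d : R) : U u -> diam U <= d%:E ->
  exists r : R, [/\ (0 <= r <= d)%R, diam U = r%:E & forall x y, U x -> U y -> (cm (x - y)%R <= r)%R].
Proof.
move=> Uu; have H x y : U x -> U y -> (cm (x - y)%R)%:E <= diam U.
  by move=> Ux Uy; apply: ereal_sup_ubound; exists x => //; exists y => //; rewrite dist_cm.
have := H _ _ Uu Uu; move: H; rewrite subrr cm0; case: (diam U) => [r| |] //.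
move=> H r0 rd; exists r; split=> //.
by rewrite -!lee_fin r0.
Qed.

Lemma diam_pow_ge0 (s : R) U : 0 <= diam_pow s U.
Proof. by rewrite /diam_pow; case: ifP => // _; exact: poweR_ge0. Qed.

(** The mass distribution principle for the image of Lebesgue measure under w. A set of diameter r
    in a cover of E contains w t only for t in an interval of length 2 c r^s; these intervals cover
    [0, 1[, so the sum of the r^s is at least 1 / (2 c). *)
Lemma holder_pos E (c s s' : R) (w : R -> C) : (0 < c)%R -> (0 <= s)%R -> (s <= s')%R -> (0 < s')%R ->
  (forall t, (0 <= t < 1)%R -> E (w t)) ->
  (forall t t', (0 <= t < 1)%R -> (0 <= t' < 1)%R -> (`|t - t'| <= c * cm (w t - w t')%R `^ s')%R) ->
  0 < hausdorff_measure s E.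
Proof.
move=> c0 s0 ss s'0 Ew Hw.
apply: (@lt_le_trans _ _ ((2 * c)^-1)%:E); first by rewrite lte_fin invr_gt0 mulr_gt0.
apply: (@le_trans _ _ (hausdorff_pre s 1 E)); last by apply: ereal_sup_ubound; exists 1%R => //=.
apply: le_ereal_inf_tmp => _ [U [EU dU] <-].
have c2 : (0 < 2 * c)%R by rewrite mulr_gt0.
rewrite -[X in X <= _]mule1 lee_pdivrMl //.
rewrite -nneseriesZl; last by move=> n _; exact: diam_pow_ge0.
have I_ex n : exists I : set R, [/\ measurable I, forall t, (0 <= t < 1)%R -> U n (w t) -> I t &
    mu I <= (2 * c)%:E * diam_pow s (U n)].
  have [[t [t01 Ut]]|no] := pselect (exists t, (0 <= t < 1)%R /\ U n (w t)); last first.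
    exists set0; split=> //; last first.
      by rewrite measure0 mule_ge0 ?diam_pow_ge0 // lee_fin ltW.
    by move=> t t01 Ut; apply: no; exists t.
  have [r [/andP[r0 r1] dr Hr]] := diam_fin Ut (dU n).
  have dp : diam_pow s (U n) = (r `^ s)%:E.
    rewrite /diam_pow asboolF ?dr ?poweR_EFin // => E0.
    by move: Ut; rewrite E0.
  (* The covers have diameters at most 1, so the exponent s' may be lowered to s. *)
  have rs : (r `^ s' <= r `^ s)%R.
    have [->|rn0] := eqVneq r 0%R; first by rewrite powR0 ?gt_eqF // powR_ge0.
    by apply: ger_powR => //; rewrite lt_def rn0 r0.
  have h0 : (0 <= c * r `^ s)%R by rewrite mulr_ge0 ?powR_ge0 // ltW.
  exists `[(t - c * r `^ s)%R, (t + c * r `^ s)%R]%classic; split=> //.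
    move=> u u01 Uu /=; rewrite in_itv /=.
    have : (`|u - t| <= c * r `^ s)%R.
      apply: le_trans (Hw _ _ u01 t01) _; rewrite ler_pM2l //; apply: le_trans rs.
      by apply: ge0_ler_powR; rewrite ?nnegrE ?cm_ge0 ?(ltW s'0) //; exact: Hr.
    by rewrite ler_distlC => /andP[a b]; apply/andP; split; [rewrite lerBlDl|]; move: a b; rewrite ?lerBlDr; lra.
  rewrite lebesgue_measure_itv /= lte_fin; case: ifP => _; last first.
    by rewrite mule_ge0 ?diam_pow_ge0 // lee_fin ltW.
  by rewrite dp -EFinD -EFinM lee_fin -mulrA; set a := (c * _)%R; clra.
have [I HI] := choice I_ex.
have m1 : mu `[0%R, 1%R[%classic = 1.
  by rewrite lebesgue_measure_itv /= lte_fin ltr01 sube0.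
rewrite -m1.
apply: (@le_trans _ _ (\sum_(0 <= n <oo) mu (I n))).
  apply: measure_sigma_subadditive => //.
    by move=> n; have [] := HI n.
  move=> t /=; rewrite in_itv /= => t01.
  have [n _ Ut] := EU _ (Ew t t01); exists n => //.
  by have [_ h _] := HI n; exact: h.
apply: lee_nneseries => [n _ _|n _]; first exact: measure_ge0.
by have [] := HI n.
Qed.

Lemma hausdorff_measure_ge0 (s : R) E : 0 <= hausdorff_measure s E.
Proof.
apply: (@le_trans _ _ (hausdorff_pre s 1 E)); last by apply: ereal_sup_ubound; exists 1%R => //=.
apply: le_ereal_inf_tmp => _ [U _ <-].
by apply: nneseries_ge0 => n _ _; exact: diam_pow_ge0.
Qed.

(** The images of about 2 A / h intervals of length h have diameter at most K h, so the sum of the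
    powers is at most (2 A + 1) K (K h)^(s - 1), which tends to 0 with h because s > 1. *)
Lemma lipschitz_null E (phi : R -> C) (A K eta s : R) : (0 < A)%R -> (0 < K)%R -> (0 < eta)%R -> (1 < s)%R ->
  (forall x, E x -> exists2 t, (`|t| <= A)%R & x = phi t) ->
  (forall t t', (`|t - t'| <= eta)%R -> (cm (phi t - phi t')%R <= K * `|t - t'|)%R) ->
  hausdorff_measure s E = 0.
Proof.
move=> A0 K0 eta0 s1 EA lip.
apply/eqP; rewrite eq_le hausdorff_measure_ge0 andbT.
apply: ge_ereal_sup => _ [d /= d0 <-].
apply/lee_addgt0Pr => e e0; rewrite add0e.
have A1 : (0 < (2 * A + 1) * K)%R by rewrite mulr_gt0 // addr_gt0 // mulr_gt0.
have s10 : (0 < s - 1)%R by rewrite subr_gt0.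
(* Chosen so that (2 A + 1) K q^(s - 1) = e. *)
pose q := ((e / ((2 * A + 1) * K)) `^ ((s - 1)^-1))%R.
have q0 : (0 < q)%R by rewrite powR_gt0 // divr_gt0.
pose h := (Num.min (Num.min 1 eta) (Num.min (d / K) (q / K)))%R.
have h0 : (0 < h)%R by rewrite !lt_min ltr01 eta0 !divr_gt0.
have h1 : (h <= 1)%R by rewrite !ge_min lexx.
have heta : (h <= eta)%R by rewrite !ge_min lexx orbT.
have hd : (K * h <= d)%R by rewrite mulrC -ler_pdivlMr // !ge_min lexx !orbT.
have hq : (K * h <= q)%R by rewrite mulrC -ler_pdivlMr // !ge_min lexx !orbT.
(* One more interval than the integer part, so that the right end point is covered; the excess is at
   most h <= 1. *)
pose M := (Num.truncn (2 * A / h)%R).+1.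
have A2h : (0 <= 2 * A / h)%R by rewrite divr_ge0 // ?mulr_ge0 // ltW.
have Mh : (M%:R * h <= 2 * A + 1)%R.
  have /andP[a _] := truncn_itv A2h.
  rewrite /M -natr1 mulrDl mul1r lerD //.
  by rewrite -ler_pdivlMr.
pose tt n := (- A + n%:R * h)%R.
pose U n : set (Cplx R) := if (n < M)%N then [set phi t | t in [set t | (tt n <= t <= tt n + h)%R]] else set0.
have diamU n : diam (U n) <= (K * h)%:E.
  apply: ge_ereal_sup => _ [x Ux [y Uy <-]]; rewrite lee_fin dist_cm.
  move: Ux Uy; rewrite /U; case: ifP => // _ [t /= /andP[t1 t2] <-] [t' /= /andP[t3 t4] <-].
  have tt' : (`|t - t'| <= h)%R by rewrite ler_norml; apply/andP; split; move: t1 t2 t3 t4; lra.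
  by apply: le_trans (lip _ _ (le_trans tt' heta)) _; rewrite ler_pM2l.
apply: (@le_trans _ _ (\sum_(0 <= n <oo) diam_pow s (U n))).
  apply: ereal_inf_lbound; exists U => //; split; last first.
    by move=> n; apply: le_trans (diamU n) _; rewrite lee_fin.
  move=> x /EA[t tA ->].
  have tA0 : (0 <= (t + A) / h)%R.
    by rewrite divr_ge0 ?(ltW h0) //; move: tA; rewrite ler_norml => /andP[a _]; move: a; lra.
  have tA1 : ((t + A) / h <= 2 * A / h)%R.
    by rewrite ler_pM2r ?invr_gt0 //; move: tA; rewrite ler_norml => /andP[_ a]; move: a; lra.
  have /andP[n1 n2] := truncn_itv tA0.
  exists (Num.truncn ((t + A) / h)%R) => //; rewrite /U ifT; last first.
    rewrite /M ltnS -(ler_nat R); have /andP[_ b] := truncn_itv A2h.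
    have : ((Num.truncn ((t + A) / h))%:R < (Num.truncn (2 * A / h)).+1%:R :> R)%R.
      by apply: le_lt_trans n1 (le_lt_trans tA1 b).
    by rewrite ltr_nat ltnS -(ler_nat R).
  exists t => //=; rewrite /tt.
  move: n1 n2; set m := Num.truncn _; rewrite -natr1 ler_pdivlMr // ltr_pdivrMr // [((_ + 1) * h)%R]mulrDl mul1r.
  set m' := (_ * h)%R => n1 n2; apply/andP; split; move: n1 n2; clra.
have dpn n : diam_pow s (U n) <= ((K * h) `^ s)%:E.
  rewrite /diam_pow; case: asboolP => [_|Un]; first by rewrite lee_fin powR_ge0.
  have [u Uu] : U n !=set0 by apply/set0P/eqP.
  have [r [/andP[r0 r1] -> _]] := diam_fin Uu (diamU n).
  rewrite poweR_EFin lee_fin; apply: ge0_ler_powR => //; rewrite ?nnegrE //; last by rewrite mulr_ge0 // ltW.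
  by apply: le_trans (ltW s1).
rewrite (@nneseries_split _ _ 0 M); last by move=> k _; exact: diam_pow_ge0.
rewrite [X in _ + X]eseries0 ?adde0 ?add0n; last first.
  by move=> i Mi _; rewrite /diam_pow asboolT // /U ltnNge Mi.
apply: (@le_trans _ _ (\sum_(0 <= k < M) ((K * h) `^ s)%:E)).
  by apply: lee_sum => k _; exact: dpn.
rewrite sumEFin lee_fin big_const_nat subn0 iter_addr_0 -mulr_natl.
have Kh0 : (0 < K * h)%R by rewrite mulr_gt0.
rewrite -(mulr_powRB1 (ltW Kh0)); last by apply: lt_trans s1.
apply: (@le_trans _ _ ((2 * A + 1) * K * (K * h) `^ (s - 1))%R).
  rewrite mulrA ler_pM2r ?powR_gt0 //.
  by rewrite [(K * h)%R]mulrC mulrA ler_pM2r.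
have qs : (q `^ (s - 1) = e / ((2 * A + 1) * K))%R.
  rewrite /q -powRrM mulVf ?gt_eqF // powRr1 // divr_ge0 // ltW //.
rewrite mulrC -ler_pdivlMr // -qs.
by apply: ge0_ler_powR; rewrite ?nnegrE ?(ltW s10) ?(ltW Kh0) ?(ltW q0).
Qed.

Lemma dim_eq1 E (phi : R -> C) (A K eta : R) : (0 < A)%R -> (0 < K)%R -> (0 < eta)%R ->
  (forall x, E x -> exists2 t, (`|t| <= A)%R & x = phi t) ->
  (forall t t', (`|t - t'| <= eta)%R -> (cm (phi t - phi t')%R <= K * `|t - t'|)%R) ->
  (forall s, (0 < s)%R -> (s < 1)%R -> exists (c : R) (w : R -> C), [/\ (0 < c)%R,
     forall t, (0 <= t < 1)%R -> E (w t) &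
     forall t t', (0 <= t < 1)%R -> (0 <= t' < 1)%R -> (`|t - t'| <= c * cm (w t - w t')%R `^ s)%R]) ->
  hausdorff_dim E = 1.
Proof.
move=> A0 K0 eta0 EA lip low; apply/eqP; rewrite eq_le; apply/andP; split.
  apply/lee_addgt0Pr => e e0; apply: ereal_inf_lbound; exists (1 + e)%R => //.
  split; first by rewrite addr_ge0 // ltW.
  by apply: (lipschitz_null A0 K0 eta0 _ EA lip); rewrite ltrDl.
apply: le_ereal_inf_tmp => _ [s [s0 Hs] <-]; rewrite lee_fin leNgt; apply/negP => s1.
(* The mean of s and 1 is positive even for s = 0 and exceeds s, as [holder_pos] requires. *)
have [||c [w [c0 Ew Hw]]] := low ((1 + s) / 2)%R; try by move: s0 s1; lra.
have := holder_pos c0 s0 _ _ Ew Hw; rewrite Hs ltxx => h; apply: notF; apply: h.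
  by move: s1; lra.
by move: s0; lra.
Qed.

End Hausdorff.

(** * The theorem for domains with inner and outer balls *)

Section Main.
Variable R : realType.
Local Notation C := R[i].
Local Notation Re := (@complex.Re R).
Local Notation Im := (@complex.Im R).

(** By [bisection] on the finiteness of S in a rectangle: without an accumulation point, every
    sufficiently small rectangle around a point contains at most that point of S. *)
Lemma accum_pt (S : set C) (A : R) : (forall z, S z -> cm z <= A) -> infinite_set S ->
  exists p : C, forall e : R, 0 < e -> exists z, [/\ S z, z != p & cm (z - p) < e].
Proof.
move=> SA inf; apply: contrapT => no; apply: inf.
have iso (p : C) : exists2 e : R, 0 < e & forall z, S z -> z != p -> e <= cm (z - p).
  apply: contrapT => h; apply: no; exists p => e e0; apply: contrapT => k; apply: h; exists e => // z Sz zp.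
  by rewrite leNgt; apply/negP => ze; apply: k; exists z.
pose B := `|A|; have B0 : 0 <= B by rewrite normr_ge0.
pose box (x y w : R) : set C := [set z | x <= Re z <= x + w /\ y <= Im z <= y + w].
pose P x y n := finite_set (S `&` box x y (2 * B / 2 ^+ n)).
suff : P (- B) (- B) 0%N.
  apply: sub_finite_set => z Sz; split=> //; rewrite /box /= expr0 divr1.
  have zB : cm z <= B by apply: le_trans (SA z Sz) (ler_norm _).
  have := le_trans (ler_Re_cm z) zB; have := le_trans (ler_Im_cm z) zB; rewrite !ler_norml.
  by move=> /andP[a b] /andP[c d]; split; apply/andP; split; move: a b c d; lra.
have B20 : 0 <= 2 * B by rewrite mulr_ge0.
apply: (bisection (w := 2 * B) (v := 2 * B)) => // [x y n w' v' _ _ _ _ P1 P2 P3 P4|x y _ _].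
  apply: (@sub_finite_set _ _
    ((S `&` box x y w' `|` S `&` box (x + w') y w') `|` (S `&` box x (y + w') w' `|` S `&` box (x + w') (y + w') w'))).
    move=> z [Sz [/= /andP[a b] /andP[c d]]].
    have E : 2 * B / 2 ^+ n = w' + w'.
      have p2 : 0 < (2 : R) ^+ n by rewrite exprn_gt0.
      by rewrite /w' exprS; field; rewrite gt_eqF.
    rewrite E in b d.
    have [xl|xl] := leP (Re z) (x + w'); have [yl|yl] := leP (Im z) (y + w').
    - by left; left; split=> //; split; apply/andP; split.
    - by right; left; split=> //; split; apply/andP; split=> //; rewrite ?(ltW yl) // -addrA.
    - by left; right; split=> //; split; apply/andP; split=> //; rewrite ?(ltW xl) // -addrA.
    - by right; right; split=> //; split; apply/andP; split; rewrite ?(ltW xl) ?(ltW yl) // -addrA.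
  by rewrite !finite_setU.
have [e e0 He] := iso (x +i* y); exists e => // x' y' n _ _ _ _ /andP[a b] /andP[c d] small.
apply: (@sub_finite_set _ _ [set (x +i* y : C)]) => // z [Sz [/= /andP[a' b'] /andP[c' d']]].
apply/eqP; apply: contraT => zn.
have := He z Sz zn; have := ler_cm_ReIm (z - (x +i* y)); rewrite !reimE /=.
have h1 : `|Re z + - x| <= 2 * B / 2 ^+ n by rewrite ler_norml; apply/andP; split; move: a b a' b'; set u := _ / _; clra.
have h2 : `|Im z + - y| <= 2 * B / 2 ^+ n by rewrite ler_norml; apply/andP; split; move: c d c' d'; set u := _ / _; clra.
move: small h1 h2; rewrite mulrDl; set u := _ / _; set n1 := `|_|; set n2 := `|_|; set k := cm _.
by move=> *; exfalso; lra.
Qed.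

(** A finite subset of D has a positive distance from the point p outside D. *)
Lemma accum_infinite (D : set (Cplx R)) (f : Cplx R -> Cplx R) (p w : C) : ~ D p ->
  (forall e : R, 0 < e -> exists z, [/\ D z, f z = w & cm (z - p) < e]) -> infinite_valence D f w.
Proof.
move=> nD H; split; first by have [z [Dz fz _]] := H 1 ltr01; exists z.
move=> /finite_seqP[s Es].
have inS z : (z \in s) <-> (D `&` f @^-1` [set w]) z by rewrite Es.
have [|m m0 /allP Hm] := @ex_pos_lb R [seq cm (z - p : C) | z <- s].
  apply/allP => _ /mapP[z /inS[Dz _] ->]; rewrite cm_gt0 subr_eq0.
  by apply/eqP => E; apply: nD; rewrite -E.
have [z [Dz fz zm]] := H m m0.
have zs : z \in s by apply/inS.
have := Hm (cm (z - p : C)) (map_f (fun z : C => cm (z - p)) zs).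
by rewrite leNgt zm.
Qed.

Lemma hasd_inj_near (f : C -> C) (p l : C) : hasd f p l -> l != 0 ->
  exists2 d : R, 0 < d & forall z, cm (z - p) < d -> z != p -> f z != f p.
Proof.
move=> h l0; have cl : 0 < cm l by rewrite cm_gt0.
have [d dp Hd] := h (cm l / 2) (divr_gt0 cl (ltr0Sn R 1)).
exists d => // z zd zp; apply/eqP => E.
have := Hd (z - p) zd; rewrite [p + (z - p)]addrC subrK E subrr sub0r cmN cmM.
have zp0 : 0 < cm (z - p) by rewrite cm_gt0 subr_eq0.
by rewrite ler_pM2r //; move: cl; set x := cm l; lra.
Qed.

(** The disc of radius 1 - eta / 2 is mapped into a region of the half-plane on which [cder_box_lip]
    applies. *)
Lemma disc_facts (b s : C) (eta : R) : 0 < eta -> eta < 1 -> 0 < Im b -> cm s <= 1 - eta / 2 ->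
  [/\ cm s < 1, eta / 2 <= cm (1 - s), Im b * (eta / 8) <= Im (from_disc b s) & cm (from_disc b s) <= 4 * cm b / eta].
Proof.
move=> e0 e1 b0 sl; have s1 : cm s < 1 by apply: le_lt_trans sl _; lra.
have d1 : eta / 2 <= cm (1 - s).
  by have := cmBB 1 s; rewrite cm1; move: sl; set x := cm s; set y := cm _; lra.
have d2 : cm (1 - s) <= 2.
  by have := cmB 1 s; rewrite cm1; move: s1; set x := cm s; set y := cm _; lra.
have d0 : 0 < cm (1 - s) by apply: lt_le_trans d1; lra.
split=> //.
  rewrite from_disc_im // ler_pdivlMr ?exprn_gt0 // -mulrA ler_pM2l //.
  have h1 : cm (1 - s) ^+ 2 <= 4.
    have -> : (4 : R) = 2 ^+ 2 by rewrite expr2; lra.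
    by rewrite lerXn2r ?nnegrE ?cm_ge0.
  have h2 : cm s ^+ 2 <= cm s by rewrite expr2 ler_piMl ?cm_ge0 // ltW.
  apply: (@le_trans _ _ (eta / 8 * 4)); first by rewrite ler_pM2l // divr_gt0.
  by move: h2 sl; set x := cm s ^+ 2; set y := cm s; lra.
rewrite /from_disc cm_div ler_pdivrMr //.
have h3 : cm (b - conjc b * s) <= 2 * cm b.
  apply: le_trans (cmB _ _) _; rewrite cmM cm_conj.
  have : cm b * cm s <= cm b by rewrite ler_piMr ?cm_ge0 // ltW.
  by set x := _ * _; set y := cm b; lra.
apply: le_trans h3 _; apply: (@le_trans _ _ (4 * cm b / eta * (eta / 2))).
  by rewrite le_eqVlt; apply/orP; left; apply/eqP; field; rewrite gt_eqF.
by apply: ler_wpM2l => //; rewrite divr_ge0 ?mulr_ge0 ?cm_ge0 // ltW.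
Qed.

(* What the theorem needs at infinity: the sublevel sets of |f| and of |F o gam| are bounded, up to
   the choice of the parameter.  It is trivial for bounded domains. *)
Definition coercive (D : set C) (gam nrm : R -> C) (r0 : R) := forall (f F f' : C -> C) (G0 : C) (K M : R),
  G0 != 0 -> (forall z, D z -> hasd f z (f' z)) ->
  (forall z, D z -> far gam z 1 -> cm (f' z - G0) <= cm G0 / 2) ->
  (forall z, D z -> F z = f z) -> 0 <= K ->
  (forall x y, clos D x -> clos D y -> cm (x - y) <= r0 / 8 / 16 -> cm (F x - F y) <= K * cm (x - y)) ->
  exists2 A : R, 0 < A & (forall z, D z -> cm (f z) <= M -> cm z <= A) /\
    forall t, cm (F (gam t)) <= M -> exists2 t', `|t'| <= A & gam t' = gam t.

Lemma main_good (g : C -> C) (D : set C) (gam nrm : R -> C) (Lam lam d0 r0 : R) (a b : C) :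
  (forall z, 0 < Im z -> exists l, hasd g z l) ->
  0 < Im a -> 0 < Im b -> a != b -> g a = g b -> (forall z, 0 < Im z -> cder g z != 0) ->
  good_dom D gam nrm Lam lam d0 r0 -> coercive D gam nrm r0 ->
  exists rho : C -> C, [/\ forall z, D z -> exists l, hasd rho z l, forall z, D z -> 0 < Im (rho z) &
    forall f : C -> C, (forall z, D z -> hasd f z (cder g (rho z))) ->
    exists F : C -> C, [/\ forall z, D z -> F z = f z,
      exists K d : R, [/\ 0 < K, 0 < d & forall x y, clos D x -> clos D y -> cm (x - y) <= d -> cm (F x - F y) <= K * cm (x - y)] &
      forall (r : R) (t0 : R), 0 < r ->
        hausdorff_dim (ball (F (gam t0) : Cplx R) r%:C `&` infinite_valence (D : set (Cplx R)) f) = 1%E]].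
Proof.
move=> dg a0 b0 ab gab dg0 gd coer.
(* [loop_bump] starts at b and returns at a, which must not be lower than b. *)
wlog le_ba : a b a0 b0 ab gab / Im b <= Im a.
  move=> W; have [h|/ltW h] := leP (Im b) (Im a); first exact: (W a b).
  by apply: (W b a) => //; rewrite eq_sym.
have [Phi [T0 [eta [C0 [c0 [h1 [d1 [m1 [Q spec]]]]]]]]] := loop_bump dg b0 le_ba ab gab (dg0 _ a0).
set G := (fun s => cder g (from_disc b s)) in spec.
have [[T00 eta0 eta1 C00 c00] _ _ _] := spec.
have y10 : 0 < Im b * (eta / 8) by rewrite mulr_gt0 // divr_gt0.
have cb : 0 < cm b by rewrite cm_gt0; apply/eqP => E; move: b0; rewrite E ltxx.
have A0 : 0 < 4 * cm b / eta by rewrite divr_gt0 // mulr_gt0.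
have [L L0 HL] := cder_box_lip y10 A0 dg.
have GL s : cm s <= 1 - eta / 2 -> cm (G s) <= L.
  by move=> sl; have [_ _ h3 h4] := disc_facts eta0 eta1 b0 sl; have [] := HL _ _ h3 h4 h3 h4.
(* The second factor is the Lipschitz constant of [from_disc b] on this disc, read off
   [from_discB]. *)
pose LG := L * (2 * Im b / (eta / 2) ^+ 2).
have eta20 : 0 < eta / 2 by rewrite divr_gt0.
have LG0 : 0 < LG by rewrite mulr_gt0 // divr_gt0 ?exprn_gt0 // mulr_gt0.
have Glip s s' : cm s <= 1 - eta / 2 -> cm s' <= 1 - eta / 2 -> cm (G s - G s') <= LG * cm (s - s').
  move=> sl sl'; have [k1 k2 k3 k4] := disc_facts eta0 eta1 b0 sl.
  have [k1' k2' k3' k4'] := disc_facts eta0 eta1 b0 sl'.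
  have [_ h] := HL _ _ k3 k4 k3' k4'; apply: le_trans h _; rewrite -mulrA ler_pM2l //.
  rewrite from_discB ?cm_lt1_neq // cm_div !cmM cm_real cm_ci mulr1 gtr0_norm ?mulr_gt0 //.
  rewrite [X in _ <= X]mulrAC; apply: ler_wpM2l; first by rewrite mulr_ge0 ?cm_ge0 // ltW // mulr_gt0.
  have pc : 0 < cm (1 - s) * cm (1 - s') by rewrite mulr_gt0 // (lt_le_trans eta20).
  have pe : 0 < (eta / 2) ^+ 2 by rewrite exprn_gt0.
  rewrite lef_pV2 ?posrE // expr2.
  by apply: ler_pM => //; exact: ltW.
have G00 : G 0 != 0 by rewrite /G from_disc0; exact: dg0.
have [sinf [S1 S2 S3]] := core gd spec L0 LG0 G00 Glip.
have sl z : D z -> cm (sinf z) < 1.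
  by move=> /S1[_ h]; have [] := disc_facts eta0 eta1 b0 h.
exists (fun z => from_disc b (sinf z)); split.
- by move=> z Dz; have [[l hl] _] := S1 z Dz; exact: hasd_from_disc (sl z Dz) hl.
- by move=> z Dz; apply: from_disc_pos => //; exact: sl.
move=> f Hf.
have fL z : D z -> exists2 l, hasd f z l & cm l <= L.
  move=> Dz; exists (G (sinf z)); first exact: Hf.
  by apply: GL; have [] := S1 z Dz.
have [F [F1 F2]] := extension gd fL.
have r00 := gd_r0 gd; have La0 := gd_Lam gd.
have rF0 : 0 < r0 / 8 / 16 by rewrite !divr_gt0.
have K0 : 0 < 9 * L by rewrite mulr_gt0.
exists F; split=> //; first by exists (9 * L), (r0 / 8 / 16).
move=> r t0 r_gt0.
have S3' := S3 f F Hf F1 F2 t0.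
(* The values in the given ball have modulus at most |F (gam t0)| + r; so their preimages, and the
   boundary parameters to consider, are bounded by [A]. *)
have [A A0' [bd1 bd2]] := coer f F (fun z => G (sinf z)) (G 0) (9 * L) (cm (F (gam t0)) + r) G00 Hf S2 F1 (ltW K0) F2.
apply: (@dim_eq1 R _ (fun t => F (gam t)) A (9 * L * Lam) (r0 / 8 / 16 / Lam)) => //.
- by rewrite mulr_gt0.
- by rewrite divr_gt0.
- move=> w [/ball_cm bw [[z0' Dz0' fz0'] inf]].
  have wM : cm w <= cm (F (gam t0)) + r.
    have := cmBB w (F (gam t0)); rewrite cmBC; move: bw; set x := cm _; set y := cm _; set v := cm _; clear; clra.
  have Sb z : (D `&` f @^-1` [set w]) z -> cm z <= A.
    by move=> [Dz fz]; apply: bd1 => //; rewrite fz.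
  have [p Hp] := accum_pt Sb inf.
  have cp : clos D p.
    by move=> e e0; have [z [[Dz _] _ zp]] := Hp e e0; exists z => //; rewrite cmBC.
  have Fp : F p = w.
    apply/eqP; rewrite -subr_eq0 -cm_eq0; apply/eqP; apply/le_anti; rewrite cm_ge0 andbT.
    rewrite leNgt; apply/negP => h.
    pose e := Num.min (r0 / 8 / 16) (cm (F p - w) / (9 * L)).
    have e0 : 0 < e by rewrite lt_min rF0 divr_gt0.
    have [z [[Dz fz] _ zp]] := Hp e e0.
    have zp1 : cm (p - z) <= r0 / 8 / 16 by rewrite cmBC ltW // (lt_le_trans zp) // ge_min lexx.
    have zp2 : cm (p - z) < cm (F p - w) / (9 * L) by rewrite cmBC (lt_le_trans zp) // ge_min lexx orbT.
    have := F2 p z cp (sub_clos Dz) zp1; rewrite (F1 z Dz) fz.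
    by move: zp2; rewrite ltr_pdivlMr // mulrC => h2 h3; have := lt_le_trans h2 h3; rewrite ltxx.
  have nDp : ~ D p.
    move=> Dp; have l0 : G (sinf p) != 0.
      by apply: dg0; apply: from_disc_pos => //; exact: sl.
    have [d dp Hd] := hasd_inj_near (Hf p Dp) l0.
    have [z [[Dz fz] znp zp]] := Hp d dp.
    by have /eqP := Hd z zp znp; apply; rewrite fz -Fp (F1 p Dp).
  have [t Et] := gd_bd gd cp nDp.
  have [|t' tA Et'] := bd2 t; first by rewrite -Et Fp.
  by exists t' => //; rewrite Et' -Et.
- move=> t t' tt; apply: le_trans (F2 _ _ (gam_clos gd _) (gam_clos gd _) _) _.
    by apply: le_trans (gd_lip gd _ _) _; rewrite mulrC -ler_pdivlMr.
  by rewrite -[X in _ <= X]mulrA ler_pM2l //; exact: gd_lip gd _ _.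
move=> s s0 s1; have [c [T [c0' HT hold]]] := S3' r s r_gt0 s0 s1.
exists c, (fun t => F (gam (T t))); split=> // t t01; have [h2 h3] := HT t t01.
split; first by apply/ball_cm; rewrite cmBC.
by apply: (@accum_infinite D f (gam (T t))) => //; exact: gam_notin gd _.
Qed.

Lemma half_plane_good : good_dom (fun z => 0 < Im z) (fun t => t%:C) (fun _ => ci) 1 1 1 1.
Proof.
split=> //.
- move=> z z0; exists (Im z) => // w zw.
  have := ler_Im_cm (z - w); rewrite ImD ImN ler_norml => /andP[_ h].
  by move: zw h; set x := cm _; lra.
- by move=> s t; rewrite -rmorphB /= cm_real mul1r.
- by move=> s t _; rewrite -rmorphB /= cm_real mul1r.
- move=> z cz nz; exists (Re z); apply: complex_ext => //=.
  apply/eqP; rewrite eq_le leNgt (introN idP nz) /= leNgt; apply/negP => h.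
  have [w w0] := cz (- Im z) ltac:(lra).
  have := ler_Im_cm (z - w); rewrite ImD ImN ler_norml => /andP[h1 _].
  by move: w0 h1; set x := cm _; lra.
- move=> t; split; first exact: cm_ci.
    move=> z; have := ler_Im_cm (z - (t%:C + 1%:C * ci)); rewrite !reimE ler_norml => /andP[h _].
    by move: h; set x := cm _; lra.
  move=> z; have := ler_Im_cm (z - (t%:C - 1%:C * ci)); rewrite !reimE ler_norml => /andP[_ h].
  by move: h; set x := cm _; lra.
Qed.

(** Above height 1, f - G0 z is Lipschitz with constant |G0| / 2, so |f| grows at least like |G0|
    |z| / 2. Lower points are moved up by i, which changes F by at most K. *)
Lemma half_plane_coercive : coercive (fun z => 0 < Im z) (fun t => t%:C) (fun _ => ci) 1.
Proof.
move=> f F f' G0 K M G00 Hf far_f FE K0 lip.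
have cG : 0 < cm G0 by rewrite cm_gt0.
have gd := half_plane_good.
have up (x y : C) : 1 <= Im x -> 1 <= Im y -> cm (f y - f x - G0 * (y - x)) <= cm G0 / 2 * cm (y - x).
  move=> x1 y1; apply: seg_mvt => t /andP[t0 t1].
  have I1 : 1 <= Im (x + t%:C * (y - x)).
    rewrite Im_seg; have : (1 - t) * 1 <= (1 - t) * Im x by rewrite ler_wpM2l // subr_ge0.
    have : t * 1 <= t * Im y by rewrite ler_wpM2l.
    by set u := _ * Im x; set v := t * Im y; lra.
  exists (f' (x + t%:C * (y - x))); first by apply: Hf; apply: lt_le_trans I1.
  apply: far_f; first by apply: lt_le_trans I1.
  move=> s; apply: le_trans (ler_Im_cm _); rewrite ImD ImN ImC oppr0 addr0.
  by apply: le_trans (ler_norm _).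
(* any point of the closure is within 1 of a point at height at least 1, by [m] short vertical steps *)
have vert n (z : C) (s : R) : 0 <= Im z -> 0 <= s <= 1 / 8 / 16 ->
    cm (F (z + (n%:R * s)%:C * ci) - F z) <= K * (n%:R * s).
  move=> z0 /andP[s0 s1]; elim: n => [|n IH]; first by rewrite !mul0r addr0 subrr cm0 mulr0.
  have ns : 0 <= n%:R * s by rewrite mulr_ge0.
  have cl w : 0 <= Im w -> clos (fun z => 0 < Im z) w.
    move=> w0 e e0; exists (w + (e / 2)%:C * ci).
      by rewrite !reimE; lra.
    by rewrite opprD addrA subrr add0r cmN cmM cm_real cm_ci mulr1 ger0_norm; lra.
  have st : cm (F (z + (n.+1%:R * s)%:C * ci) - F (z + (n%:R * s)%:C * ci)) <= K * s.
    have E : cm (z + (n.+1%:R * s)%:C * ci - (z + (n%:R * s)%:C * ci)) = s.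
      have -> : z + (n.+1%:R * s)%:C * ci - (z + (n%:R * s)%:C * ci) = s%:C * ci.
        by rewrite -natr1 mulrDl mul1r rmorphD /=; ring.
      by rewrite cmM cm_real cm_ci mulr1 ger0_norm.
    rewrite -{3}E; apply: lip; rewrite ?E //; apply: cl; rewrite !reimE mulr1 mul0r; last by lra.
    by move: ns; rewrite -natr1 mulrDl; lra.
  have := cm_tri (F (z + (n%:R * s)%:C * ci)) (F (z + (n.+1%:R * s)%:C * ci)) (F z).
  have -> : K * (n.+1%:R * s) = K * (n%:R * s) + K * s by rewrite -natr1; ring.
  by move: IH st; set u := cm _; set v := cm _; set w := cm _; set y := K * s; set y' := K * _; lra.
have shift (z : C) : 0 <= Im z -> cm (F (z + ci) - F z) <= K.
  move=> z0; have := vert (8 * 16)%N z (1 / 8 / 16) z0.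
  have -> : ((8 * 16)%N%:R * (1 / 8 / 16) : R) = 1 by rewrite natrM; field.
  rewrite mulr1 [1%:C * ci]mul1r; apply; apply/andP; split=> //.
pose A := 2 * (M + K + cm (F ci)) / cm G0 + 1.
have bound (z : C) : 0 <= Im z -> cm (F z) <= M -> cm z <= `|A| + 1.
  move=> z0 FM; have s1 := shift z z0.
  have I1 : 1 <= Im (z + ci) by rewrite !reimE lerDr.
  have I2 : 1 <= Im (ci : C) by rewrite !reimE.
  have u1 := up ci (z + ci) I2 I1.
  rewrite addrK in u1.
  have e1 : F (z + ci) = f (z + ci) by apply: FE; apply: lt_le_trans I1.
  have e2 : F ci = f ci by apply: FE; apply: lt_le_trans I2.
  rewrite -e1 -e2 in u1.
  have b1 := cmBB (G0 * z) (F (z + ci) - F ci); rewrite [cm (G0 * z - _)]cmBC cmM in b1.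
  have b2 := cmB (F (z + ci)) (F ci); have b3 := cmBB (F (z + ci)) (F z).
  have : cm G0 / 2 * cm z <= M + K + cm (F ci).
    have -> : cm G0 / 2 * cm z = cm G0 * cm z - cm G0 / 2 * cm z by field.
    move: b1 b2 b3 u1 s1 FM; set x1 := cm G0 * _; set x2 := cm G0 / 2 * _; set x3 := cm _; set x4 := cm _.
    by set x5 := cm _; set x6 := cm _; set x7 := cm _; set x8 := cm _; lra.
  rewrite mulrC -ler_pdivlMr ?divr_gt0 // => h; apply: le_trans h _.
  have -> : (M + K + cm (F ci)) / (cm G0 / 2) = A - 1 by rewrite /A; field; rewrite gt_eqF.
  by have := ler_norm A; lra.
exists (`|A| + 1); first by rewrite ltr_wpDl.
split=> [z z0 fM|t Ft]; first by apply: bound; [exact: ltW|rewrite FE].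
exists t => //; rewrite -cm_real; apply: bound => //.
Qed.

End Main.

(** * Mean value estimates and periodic functions of a real variable *)

Section RealFun.
Variable R : realType.

Lemma mvt_bound (u : R -> R) (M : R) : (forall t, derivable u t 1) -> (forall t, `|derive1 u t| <= M) ->
  forall s t, `|u s - u t| <= M * `|s - t|.
Proof.
move=> du bu; suff H s t : s <= t -> `|u s - u t| <= M * `|s - t|.
  by move=> s t; have [/H//|/ltW/H] := leP s t; rewrite distrC [`|t - s|]distrC.
move=> st; have [||c _ E] := @MVT_segment R u (derive1 u) s t st _ _.
- move=> x _; rewrite derive1E; exact: derivableP.
- by apply: derivable_within_continuous => x _.
by rewrite distrC E normrM [`|t - s|]distrC ler_wpM2r.
Qed.

(** The mean value theorem is used twice, for u and for its derivative, which gives M in place of M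
    / 2. *)
Lemma taylor_bound (u : R -> R) (M : R) : (forall t, derivable u t 1) -> (forall t, derivable (derive1 u) t 1) ->
  (forall t, `|derive1 (derive1 u) t| <= M) -> forall s t, `|u s - u t - derive1 u t * (s - t)| <= M * `|s - t| ^+ 2.
Proof.
move=> du ddu bu s t.
have [c cst E] : exists2 c, `|c - t| <= `|s - t| & u s - u t = derive1 u c * (s - t).
  have dd (x : R) : is_derive x (1 : R) u (derive1 u x) by rewrite derive1E; exact: derivableP.
  have wc a b : {within `[a, b], continuous u} by apply: derivable_within_continuous => x _.
  have [st|/ltW ts] := leP s t.
    have [c + E] := @MVT_segment R u (derive1 u) s t st (fun x _ => dd x) (wc _ _).
    rewrite in_itv /= => /andP[a b]; exists c.
      by rewrite distrC [`|s - t|]distrC !ger0_norm ?subr_ge0 // lerD2l lerN2.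
    by rewrite -opprB E -mulrN opprB.
  have [c + E] := @MVT_segment R u (derive1 u) t s ts (fun x _ => dd x) (wc _ _).
  rewrite in_itv /= => /andP[a b]; exists c => //.
  by rewrite !ger0_norm ?subr_ge0 // lerD2r.
rewrite E -mulrBl normrM expr2 mulrA ler_wpM2r //.
apply: le_trans (mvt_bound ddu bu c t) _; rewrite ler_wpM2l //.
by apply: le_trans (bu 0).
Qed.

Lemma periodic_int (T : Type) (u : R -> T) : (forall t, u (t + 1) = u t) -> forall (d : int) t, u (t + d%:~R) = u t.
Proof.
move=> per; have pn (n : nat) t : u (t + n%:R) = u t.
  by elim: n => [|n IH]; [rewrite addr0|rewrite -natr1 addrA per].
case=> n t; first exact: pn.
by rewrite NegzE mulrNz -[in RHS](subrK (n.+1%:~R) t) pn.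
Qed.

Lemma unit_shift (t : R) : exists2 d : int, 0 <= t + d%:~R < 1 & True.
Proof.
exists (- Num.floor t) => //; have /andP[a b] := floor_itv t.
by rewrite mulrNz subr_ge0 a ltrBlDl -intrD1.
Qed.

Lemma derive_periodic (u : R -> R) : (forall t, u (t + 1) = u t) -> forall t, derive1 u (t + 1) = derive1 u t.
Proof.
move=> per t; rewrite /derive1.
suff -> : (fun h : R => h^-1 *: (u (h + (t + 1)) - u (t + 1))) = (fun h => h^-1 *: (u (h + t) - u t)) by [].
by apply/funext => h; rewrite addrA !per.
Qed.

Lemma periodic_bounded (u : R -> R) : (forall t, derivable u t 1) -> (forall t, u (t + 1) = u t) ->
  exists M, forall t, `|u t| <= M.
Proof.
move=> du per.
have wc : {within `[0 : R, 1], continuous u} by apply: derivable_within_continuous => x _.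
have [c _ Hc] := EVT_max ler01 wc; have [c' _ Hc'] := EVT_min ler01 wc.
exists (`|u c| + `|u c'|) => t; have [d /andP[t0 t1] _] := unit_shift t.
rewrite -(periodic_int per d t).
have tI : t + d%:~R \in `[0 : R, 1]%R by rewrite in_itv /= t0 ltW.
have h1 := Hc _ tI; have h2 := Hc' _ tI.
have := ler_norm (u c); have := ler_norm (- u c'); rewrite normrN.
have := normr_ge0 (u c); have := normr_ge0 (u c'); move: h1 h2.
set a := `|u c|; set b := `|u c'|; set x := u _; set y := u c; set z := u c'.
by move=> *; rewrite ler_norml; apply/andP; split; lra.
Qed.
End RealFun.

(** * A smooth closed curve has tangent discs of uniform radius *)

Section Curve.
Variable R : realType.
Local Notation C := R[i].
Local Notation Re := (@complex.Re R).
Local Notation Im := (@complex.Im R).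

Lemma lip_min (phi : R -> R) (K a b : R) : a <= b -> 0 < K -> (forall t, 0 <= phi t) ->
  (forall s t, `|phi s - phi t| <= K * `|s - t|) -> exists2 s, a <= s <= b & forall u, a <= u <= b -> phi s <= phi u.
Proof.
move=> ab K0 p0 lip.
have [|z /andP[z1 z2] Hz] := @box_min R (fun z => phi (Re z)) a b 0 0 ab (lexx _) (fun z => p0 _).
  move=> z _ e e0; exists (e / K) => [|w _ wz]; first by rewrite divr_gt0.
  apply: le_trans (lip _ _) _; rewrite mulrC -ler_pdivlMr //; apply: le_trans (ltW wz).
  by have := ler_Re_cm (w - z); rewrite ReD ReN.
exists (Re z) => // u ub; apply: (Hz (u +i* 0)); by rewrite /inbox /= ub !lexx.
Qed.

Lemma dotcDr (z w w' : C) : dotc z (w + w') = dotc z w + dotc z w'.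
Proof. by rewrite /dotc !reimE; ring. Qed.

Lemma orth_decomp (w u : C) (d : R) : 0 < d -> cm u = d -> dotc w u = 0 ->
  w = (dotc w (ci * u / d%:C))%:C * (ci * u / d%:C).
Proof.
move=> d0 ud o.
have -> : ci * u / d%:C = d^-1%:C * (ci * u) by rewrite fmorphV mulrC.
have q : Re u ^+ 2 + Im u ^+ 2 = d ^+ 2 by rewrite -cm_sqr ud.
have dn : d ^+ 2 != 0 by rewrite gt_eqF // exprn_gt0.
rewrite /dotc in o *.
apply: complex_ext; rewrite !reimE; apply: (mulfI dn).
  have -> : d ^+ 2 * Re w = (Re u ^+ 2 + Im u ^+ 2) * Re w - Re u * (Re w * Re u + Im w * Im u) by rewrite o q; ring.
  by field; rewrite gt_eqF.
have -> : d ^+ 2 * Im w = (Re u ^+ 2 + Im u ^+ 2) * Im w - Im u * (Re w * Re u + Im w * Im u) by rewrite o q; ring.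
by field; rewrite gt_eqF.
Qed.

Variables (gam dg : R -> C) (Lam M v : R).
Hypotheses (per : forall t, gam (t + 1) = gam t) (dper : forall t, dg (t + 1) = dg t).
Hypotheses (Lam0 : 0 < Lam) (M0 : 0 < M) (v0 : 0 < v).
Hypothesis glip : forall s t, cm (gam s - gam t) <= Lam * `|s - t|.
Hypothesis tay : forall s t, cm (gam s - gam t - (s - t)%:C * dg t) <= M * `|s - t| ^+ 2.
Hypothesis dlip : forall s t, cm (dg s - dg t) <= M * `|s - t|.
Hypothesis vdg : forall t, v <= cm (dg t).
Hypothesis inj : forall s t, 0 <= s < 1 -> 0 <= t < 1 -> gam s = gam t -> s = t.

Definition nv (t : R) : C := ci * dg t / (cm (dg t))%:C.
(** The first bound makes the Taylor remainder at most half the linear term; the second keeps [d0]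
    below half a period. *)
Definition d0 := Num.min (v / (2 * M)) (1 / 4).

Lemma dg_gt0 t : 0 < cm (dg t). Proof. exact: lt_le_trans v0 (vdg t). Qed.

Lemma cm_nv t : cm (nv t) = 1.
Proof. by rewrite /nv cm_div cmM cm_ci mul1r cm_real gtr0_norm ?dg_gt0 // divff // gt_eqF // dg_gt0. Qed.

Lemma d0_gt0 : 0 < d0. Proof. by rewrite lt_min !divr_gt0 // mulr_gt0. Qed.
Lemma d0_le : d0 <= 1 / 4. Proof. by rewrite ge_min lexx orbT. Qed.

Lemma gam_colip s t : `|s - t| <= d0 -> v / 2 * `|s - t| <= cm (gam s - gam t).
Proof.
move=> st; have h := tay s t; have b := cmBB ((s - t)%:C * dg t) (gam s - gam t).
rewrite cmBC in h.
have e1 : v * `|s - t| <= cm ((s - t)%:C * dg t) by rewrite cmM cm_real mulrC ler_wpM2l.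
have e2 : M * `|s - t| ^+ 2 <= v / 2 * `|s - t|.
  rewrite expr2 mulrA ler_wpM2r // mulrC -ler_pdivlMr //; apply: le_trans st _.
  by rewrite -mulrA -invfM ge_min lexx.
have := cmBB ((s - t)%:C * dg t) (gam s - gam t).
by move: h e1 e2; set x := cm _; set y := cm _; set w := cm _; set p := M * _; set n := `|_|; lra.
Qed.

Lemma dot_nv t (k : R) : dotc (k%:C * dg t) (nv t) = 0.
Proof.
have -> : nv t = (cm (dg t))^-1%:C * (ci * dg t) by rewrite /nv fmorphV mulrC.
by rewrite dotcZr dotcZl /dotc !reimE; ring.
Qed.

Lemma nv_lip s t : cm (nv s - nv t) <= 2 * M / v * `|s - t|.
Proof.
have s0 := dg_gt0 s; have t0 := dg_gt0 t.
have E : nv s - nv t = ci * ((dg s - dg t) / (cm (dg s))%:C +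
    dg t * ((cm (dg t) - cm (dg s))%:C / ((cm (dg s))%:C * (cm (dg t))%:C))).
  rewrite /nv rmorphB /=; field.
  by rewrite -!cm_gt0 !cm_real !gtr0_norm ?s0 ?t0.
rewrite E cmM cm_ci mul1r; apply: le_trans (cmD _ _) _.
rewrite cm_div cm_real (gtr0_norm s0) cmM cm_div cmM !cm_real (gtr0_norm s0) (gtr0_norm t0).
have -> : cm (dg t) * (`|cm (dg t) - cm (dg s)| / (cm (dg s) * cm (dg t))) = `|cm (dg t) - cm (dg s)| / cm (dg s).
  by field; rewrite !gt_eqF.
have h1 : `|cm (dg t) - cm (dg s)| <= cm (dg s - dg t).
  have := cmBB (dg t) (dg s); have := cmBB (dg s) (dg t); rewrite [cm (dg t - dg s)]cmBC.
  by move=> a b; rewrite ler_norml; apply/andP; split; move: a b; set x := cm _; set y := cm _; set w := cm _; lra.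
rewrite -mulrDl; apply: (@le_trans _ _ (2 * (M * `|s - t|) / cm (dg s))).
  rewrite ler_pM2r ?invr_gt0 //; have := dlip s t; move: h1.
  by set x := cm _; set y := `|_|; set w := M * _; lra.
rewrite -mulrA [_ / cm _]mulrC !mulrA [2 * M / v * _]mulrAC.
rewrite [2 / cm (dg s)]mulrC; rewrite ler_pdivlMr //.
have -> : (cm (dg s))^-1 * 2 * M * `|s - t| * v = 2 * M * `|s - t| * (v / cm (dg s)) by ring.
by rewrite ler_piMr ?mulr_ge0 ?(ltW M0) // ler_pdivrMr // mul1r.
Qed.

(** The distance attains its minimum for s in one period and u in [d0, 1 / 2]. It is not 0: by
    injectivity, gam s = gam (s + u) forces u to be an integer. *)
Lemma gam_sep : exists2 m : R, 0 < m & forall s u, d0 <= u <= 1 / 2 -> m <= cm (gam s - gam (s + u)).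
Proof.
have d00 := d0_gt0; have d01 := d0_le.
have [|||z /andP[/andP[x0 x1] /andP[y0 y1]] Hz] := @box_min R (fun z => cm (gam (Re z) - gam (Re z + Im z))) 0 1 d0 (1 / 2) ler01.
- by lra.
- by move=> z; exact: cm_ge0.
- move=> z _ e e0; exists (e / (3 * Lam)) => [|w _ wz]; first by rewrite divr_gt0 // mulr_gt0.
  have h1 : cm (gam (Re w) - gam (Re z)) <= Lam * cm (w - z).
    apply: le_trans (glip _ _) _; rewrite ler_pM2l //.
    by have := ler_Re_cm (w - z); rewrite ReD ReN.
  have h2 : cm (gam (Re w + Im w) - gam (Re z + Im z)) <= 2 * (Lam * cm (w - z)).
    apply: le_trans (glip _ _) _; rewrite mulrCA ler_pM2l //.
    have := ler_Re_cm (w - z); have := ler_Im_cm (w - z); rewrite ReD ReN ImD ImN.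
    have := ler_normD (Re w - Re z) (Im w - Im z).
    have -> : Re w - Re z + (Im w - Im z) = Re w + Im w - (Re z + Im z) by ring.
    by set a := `|_|; set b := `|_|; set c := `|_|; set d := cm _; lra.
  have h3 : 3 * (Lam * cm (w - z)) <= e.
    by move: (ltW wz); rewrite ler_pdivlMr ?mulr_gt0 // mulrC mulrA.
  have E : cm ((gam (Re w) - gam (Re w + Im w)) - (gam (Re z) - gam (Re z + Im z))) <= e.
    have -> : (gam (Re w) - gam (Re w + Im w)) - (gam (Re z) - gam (Re z + Im z)) =
      (gam (Re w) - gam (Re z)) - (gam (Re w + Im w) - gam (Re z + Im z)) by ring.
    apply: le_trans (cmB _ _) _; move: h1 h2 h3.
    by set a := cm _; set b := cm _; set c := Lam * _; lra.
  have e1 := cmBB (gam (Re w) - gam (Re w + Im w)) (gam (Re z) - gam (Re z + Im z)).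
  have e2 := cmBB (gam (Re z) - gam (Re z + Im z)) (gam (Re w) - gam (Re w + Im w)).
  rewrite [cm (gam (Re z) - gam (Re z + Im z) - _)]cmBC in e2.
  by rewrite ler_norml; apply/andP; split; move: E e1 e2; set a := cm _; set b := cm _; set c := cm _; lra.
exists (cm (gam (Re z) - gam (Re z + Im z))).
  rewrite cm_gt0 subr_eq0; apply/eqP => E.
  have [d /andP[a1 a2] _] := unit_shift (Re z).
  have [e /andP[b1 b2] _] := unit_shift (Re z + Im z).
  have := inj (introT andP (conj a1 a2)) (introT andP (conj b1 b2)).
  rewrite !(periodic_int per) => /(_ E) E2.
  have I : Im z = (d - e)%:~R by rewrite intrB; move: E2; lra.
  have h1 : (0 : R) < (d - e)%:~R by rewrite -I; apply: lt_le_trans y0.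
  have h2 : (d - e)%:~R < (1 : R) by rewrite -I; move: y1; lra.
  by move: h2; rewrite ltrz1 ltNge -gtz0_ge1 -(ltr0z R) h1.
move=> s u /andP[u0 u1]; have [d /andP[a1 a2] _] := unit_shift s.
have := Hz ((s + d%:~R) +i* u); rewrite /inbox /= a1 (ltW a2) u0 u1 => /(_ isT).
by rewrite [s + _ + u]addrAC !(periodic_int per).
Qed.

(** Equivalently, the curve does not enter the two discs of radius r0 tangent to it at [gam t]. For
    s close to t, Taylor's formula bounds the normal component by M (s - t)^2; otherwise, modulo the
    period, the two points are at distance at least 2 r0 by [gam_sep]. *)
Lemma ball_cond : exists2 r0 : R, 0 < r0 & forall s t, `|dotc (gam s - gam t) (nv t)| <= cm (gam s - gam t) ^+ 2 / (2 * r0).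
Proof.
have [m m0 Hm] := gam_sep.
pose r0 := Num.min (v ^+ 2 / (8 * M)) (m / 2).
have r00 : 0 < r0 by rewrite lt_min !divr_gt0 // ?exprn_gt0 // mulr_gt0.
exists r0 => // s t.
have r20 : 0 < 2 * r0 by rewrite mulr_gt0.
have [s' [Es st]] : exists s', gam s = gam s' /\ `|s' - t| <= 1 / 2.
  have [d /andP[a1 a2] _] := unit_shift (s - t + 1 / 2).
  exists (s + d%:~R); rewrite (periodic_int per); split=> //.
  by rewrite ler_norml; apply/andP; split; move: a1 a2; lra.
rewrite Es ler_pdivlMr //.
have [near|far] := leP `|s' - t| d0.
  have co := gam_colip near.
  have -> : dotc (gam s' - gam t) (nv t) = dotc (gam s' - gam t - (s' - t)%:C * dg t) (nv t).
    by rewrite [RHS]dotcDl [dotc (- _) _]dotcN dot_nv oppr0 addr0.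
  have h1 : `|dotc (gam s' - gam t - (s' - t)%:C * dg t) (nv t)| <= M * `|s' - t| ^+ 2.
    by apply: le_trans (dotc_le _ _) _; rewrite cm_nv mulr1.
  apply: le_trans (ler_wpM2r (ltW r20) h1) _.
  have h2 : (v / 2 * `|s' - t|) ^+ 2 <= cm (gam s' - gam t) ^+ 2.
    by rewrite lerXn2r ?nnegrE ?cm_ge0 // mulr_ge0 // divr_ge0 // ltW.
  apply: le_trans h2; rewrite exprMn mulrAC ler_wpM2r ?sqr_ge0 //.
  have : r0 <= v ^+ 2 / (8 * M) by rewrite ge_min lexx.
  rewrite ler_pdivlMr ?mulr_gt0 // => h.
  have -> : M * (2 * r0) = r0 * (8 * M) / 4 by field.
  have -> : (v / 2) ^+ 2 = v ^+ 2 / 4 by field.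
  by rewrite ler_pM2r // invr_gt0.
have h : m <= cm (gam s' - gam t).
  have [le|lt] := leP t s'.
    have := Hm t (s' - t); rewrite [t + _]addrC subrK cmBC; apply.
    by move: far st; rewrite ger0_norm ?subr_ge0 // => a b; rewrite (ltW a).
  have := Hm s' (t - s'); rewrite [s' + _]addrC subrK; apply.
  by move: far st; rewrite distrC gtr0_norm ?subr_gt0 // => a b; rewrite (ltW a).
have h1 := dotc_le (gam s' - gam t) (nv t); rewrite cm_nv mulr1 in h1.
apply: le_trans (ler_wpM2r (ltW r20) h1) _; rewrite expr2 ler_wpM2l ?cm_ge0 //.
apply: le_trans h; rewrite mulrC -ler_pdivlMr // ge_min lexx orbT //.
Qed.

(** * Which side of the curve belongs to the domain *)

Section Sides.
Variables (D : set C) (r0 B : R).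
Hypothesis r00 : 0 < r0.
Hypothesis bc : forall s t, `|dotc (gam s - gam t) (nv t)| <= cm (gam s - gam t) ^+ 2 / (2 * r0).
Hypothesis Dopen : forall z, D z -> exists2 r : R, 0 < r & forall w, cm (z - w) < r -> D w.
Hypothesis bd : forall z, (clos D z /\ ~ D z) <-> exists t, z = gam t.
Hypothesis DB : forall z, D z -> cm z <= B.

Definition cc (k t : R) : C := gam t + (k * r0)%:C * nv t.

Lemma cc_avoid (k s t : R) : `|k| = 1 -> r0 <= cm (gam s - cc k t).
Proof.
move=> k1; have r20 : 0 < 2 * r0 by rewrite mulr_gt0.
rewrite cm_ge_sqr ?(ltW r00) // /cc opprD addrA (cm_sqrB (gam s - gam t)) dotcZr cmM cm_real cm_nv mulr1.
rewrite normrM k1 mul1r (gtr0_norm r00) lerDr.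
have := bc s t; rewrite ler_pdivlMr // => h.
have h2 : k * r0 * dotc (gam s - gam t) (nv t) <= r0 * `|dotc (gam s - gam t) (nv t)|.
  apply: le_trans (ler_norm _) _; rewrite !normrM k1 mul1r (gtr0_norm r00) //.
have h3 : 2 * (r0 * `|dotc (gam s - gam t) (nv t)|) <= cm (gam s - gam t) ^+ 2.
  by apply: le_trans h; rewrite le_eqVlt; apply/orP; left; apply/eqP; ring.
by move: h2 h3; set c := r0 * `|_|; set b := _ ^+ 2; set d := k * r0 * _; lra.
Qed.

(** A tangent disc contains no point of the curve, so a segment in it cannot leave D: the disc lies
    in D or is disjoint from D. *)
Lemma crossing (z w c : C) (k t : R) : `|k| = 1 -> c = cc k t -> cm (z - c) < r0 -> cm (w - c) < r0 -> D z -> D w.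
Proof.
move=> k1 -> zc wc Dz; apply: contrapT => nw.
have [u /andP[u0 u1] [_ /bd[s Es]]] := seg_exit Dopen Dz nw.
have := cc_avoid s t k1; rewrite -Es.
have -> : z + u%:C * (w - z) - cc k t = (1 - u)%:C * (z - cc k t) + u%:C * (w - cc k t).
  by rewrite rmorphB /=; ring.
rewrite leNgt => /negP; apply; apply: le_lt_trans (cmD _ _) _.
rewrite !cmM !cm_real (ger0_norm (ltW u0)) ger0_norm ?subr_ge0 //.
have h1 : u * cm (w - cc k t) < u * r0 by rewrite ltr_pM2l.
have h2 : (1 - u) * cm (z - cc k t) <= (1 - u) * r0 by rewrite ler_wpM2l ?subr_ge0 // ltW.
by move: h1 h2; rewrite [(1 - u) * r0]mulrBl mul1r; set x := u * cm _; set y := (1 - u) * cm _; set v' := u * r0; lra.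
Qed.

(** The centres depend on t in a Lipschitz way. Consecutive centres of a fine subdivision lie in
    each other's discs, and [crossing] transports membership from one to the next. *)
Lemma side_const (k s t : R) : `|k| = 1 -> D (cc k s) -> D (cc k t).
Proof.
move=> k1.
pose Lc := Lam + r0 * (2 * M / v).
have Lc0 : 0 < Lc by rewrite addr_gt0 // mulr_gt0 // divr_gt0 // mulr_gt0.
have lip a b : cm (cc k a - cc k b) <= Lc * `|a - b|.
  have -> : cc k a - cc k b = (gam a - gam b) + (k * r0)%:C * (nv a - nv b) by rewrite /cc; ring.
  apply: le_trans (cmD _ _) _; rewrite cmM cm_real normrM k1 mul1r (gtr0_norm r00) mulrDl.
  by apply: lerD => //; rewrite -mulrA ler_pM2l //; exact: nv_lip.
have step a b : Lc * `|a - b| < r0 -> D (cc k a) -> D (cc k b).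
  move=> h; apply: (crossing (c := cc k a) k1) => //; first by rewrite subrr cm0.
  by apply: le_lt_trans h; rewrite distrC.
pose n := (Num.bound (Lc * `|t - s| / r0)).+1.
have n0 : 0 < n%:R :> R by rewrite ltr0n.
pose pt i := s + i%:R / n%:R * (t - s).
have hn : Lc * `|t - s| < r0 * n%:R.
  rewrite -ltr_pdivrMl // [r0^-1 * _]mulrC; apply: (@lt_trans _ _ (Num.bound (Lc * `|t - s| / r0))%:R).
    by rewrite archi_boundP // divr_ge0 ?(ltW r00) // mulr_ge0 // ltW.
  by rewrite ltr_nat.
have st i : D (cc k (pt i)) -> D (cc k (pt i.+1)).
  apply: step.
  have -> : pt i - pt i.+1 = - ((t - s) / n%:R) by rewrite /pt -natr1; field; rewrite gt_eqF.
  by rewrite normrN normrM normfV (gtr0_norm n0) mulrA ltr_pdivrMr.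
move=> Ds; have all_i i : D (cc k (pt i)).
  by elim: i => [|i /st //]; rewrite /pt mul0r mul0r addr0.
by have := all_i n; rewrite /pt divff ?gt_eqF // mul1r addrC subrK.
Qed.

Lemma nearest_pt (z : C) : exists s, forall u, cm (z - gam s) <= cm (z - gam u).
Proof.
have [|s _ Hs] := @lip_min (fun t => cm (z - gam t)) Lam 0 1 ler01 Lam0 (fun t => cm_ge0 _).
  move=> s t; have e1 := cmBB (z - gam s) (z - gam t); have e2 := cmBB (z - gam t) (z - gam s).
  have E : z - gam s - (z - gam t) = gam t - gam s by ring.
  rewrite E in e1; rewrite [cm (z - gam t - _)]cmBC E in e2.
  have := glip t s; rewrite distrC => h.
  by rewrite ler_norml; apply/andP; split; move: e1 e2 h; set a := cm _; set b := cm _; set c := cm _; set d := Lam * _; lra.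
exists s => u; have [d /andP[a b] _] := unit_shift u.
by rewrite -(periodic_int per d u); apply: Hs; rewrite a ltW.
Qed.

Lemma normal_form (z : C) (s : R) : (forall u, cm (z - gam s) <= cm (z - gam u)) ->
  exists2 tau : R, `|tau| = cm (z - gam s) & z = gam s + tau%:C * nv s.
Proof.
move=> Hs; set w := z - gam s.
have orth : dotc w (dg s) = 0.
  apply/eqP; apply: contraT => dn0; set p := dotc w (dg s) in dn0.
  have p0 : 0 < `|p| by rewrite normr_gt0.
  (* moving along the curve by [h] changes the square of the distance by [- 2 h p + O(h ^ 2)] *)
  pose Cq := Lam ^+ 2 + 2 * cm w * M + 1.
  have Cq0 : 0 < Cq by rewrite ltr_wpDl // addr_ge0 ?sqr_ge0 // !mulr_ge0 ?cm_ge0 // ltW.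
  pose h := p / Cq.
  have := Hs (s + h).
  have E : z - gam (s + h) = w - (gam (s + h) - gam s) by rewrite /w; ring.
  rewrite E cm_le_sqr ?cm_ge0 // (cm_sqrB w).
  have g1 : cm (gam (s + h) - gam s) ^+ 2 <= Lam ^+ 2 * h ^+ 2.
    rewrite -(real_normK (num_real h)) -exprMn lerXn2r ?nnegrE ?cm_ge0 ?mulr_ge0 ?(ltW Lam0) //.
    by have := glip (s + h) s; rewrite [s + h - s]addrC addKr.
  have g2 : h * p - cm w * (M * h ^+ 2) <= dotc w (gam (s + h) - gam s).
    have -> : gam (s + h) - gam s = (gam (s + h) - gam s - h%:C * dg s) + h%:C * dg s by rewrite subrK.
    have t1 := tay (s + h) s; rewrite [s + h - s]addrC addKr real_normK ?num_real // in t1.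
    set rem := gam (s + h) - gam s - h%:C * dg s in t1 *.
    rewrite dotcDr dotcZr -/p.
    have := dotc_le w rem; rewrite ler_norml => /andP[t2 _].
    have t3 : cm w * cm rem <= cm w * (M * h ^+ 2) by rewrite ler_wpM2l ?cm_ge0.
    by move: t2 t3; set a := dotc _ _; set b := _ * cm rem; set c := _ * (M * _); lra.
  have hp : h * p = Cq * h ^+ 2 by rewrite /h; field; rewrite gt_eqF.
  have h2 : 0 < h ^+ 2 by rewrite exprn_even_gt0 //= mulf_neq0 // invr_neq0 // gt_eqF.
  rewrite -subr_ge0; move: g1 g2; rewrite hp /Cq.
  have -> : cm w * (M * h ^+ 2) = cm w * M * h ^+ 2 by ring.
  have -> : (Lam ^+ 2 + 2 * cm w * M + 1) * h ^+ 2 = Lam ^+ 2 * h ^+ 2 + 2 * (cm w * M * h ^+ 2) + h ^+ 2 by ring.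
  have d0' : 0 <= cm w * M * h ^+ 2 by exact: mulr_ge0 (mulr_ge0 (cm_ge0 _) (ltW M0)) (sqr_ge0 _).
  have c0' : 0 <= Lam ^+ 2 * h ^+ 2 by rewrite mulr_ge0 ?sqr_ge0.
  rewrite -/w; move: d0' c0' h2; set a := cm (gam _ - _) ^+ 2; set b := dotc _ _; set c := Lam ^+ 2 * _.
  set d := cm w * M * h ^+ 2; set e := h ^+ 2; set q := cm w ^+ 2.
  by clearbody a b c d e q; move=> *; exfalso; lra.
have dn := dg_gt0 s.
have E := orth_decomp dn erefl orth; rewrite -/(nv s) in E.
exists (dotc w (nv s)); last by rewrite -E /w addrC subrK.
by rewrite {2}E cmM cm_real cm_nv mulr1.
Qed.

Lemma near_side (z : C) (s : R) : (forall u, cm (z - gam s) <= cm (z - gam u)) -> cm (z - gam s) < r0 ->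
  z <> gam s -> exists2 k : R, `|k| = 1 & cm (z - cc k s) < r0.
Proof.
move=> Hs zr zn; have [tau taun E] := normal_form Hs.
have tau0 : tau != 0 by apply/eqP => t0; apply: zn; rewrite E t0 mul0r addr0.
exists (Num.sg tau); first by rewrite normr_sg tau0.
have -> : z - cc (Num.sg tau) s = (tau - Num.sg tau * r0)%:C * nv s by rewrite {1}E /cc rmorphB /=; ring.
rewrite cmM cm_real cm_nv mulr1 {1}[tau]numEsg -mulrBr normrM normr_sg tau0 mul1r taun.
have tp : 0 < cm (z - gam s) by rewrite -taun normr_gt0.
by rewrite ltr_norml; apply/andP; split; move: tp zr; set x := cm _; lra.
Qed.

(** This replaces the Jordan curve theorem. A point of D close to the curve lies on the normal at
    its nearest point, hence in a tangent disc, so one side belongs to D. If both did, the closure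
    of D would be open, which is impossible for a bounded nonempty set. *)
Lemma one_side : exists2 k : R, `|k| = 1 & (forall t, D (cc k t)) /\ (forall t, ~ D (cc (- k) t)).
Proof.
have [c0' n0] := (bd (gam 0)).2 (ex_intro _ 0 erefl).
have [z Dz zg] := c0' r0 r00.
have zng s : z <> gam s.
  by move=> E; have [_ /(_ Dz)] := (bd z).2 (ex_intro _ s E).
have [s Hs] := nearest_pt z.
have zr : cm (z - gam s) < r0 by apply: le_lt_trans (Hs 0) _; rewrite cmBC.
have [k k1 zk] := near_side Hs zr (zng s).
have Dk t : D (cc k t).
  apply: (side_const (s := s)) => //; apply: (crossing (z := z) (c := cc k s) k1) => //.
  by rewrite subrr cm0.
exists k => //; split=> // t Dt.
have km : `|- k| = 1 by rewrite normrN.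
have both j u : `|j| = 1 -> D (cc j u).
  move=> j1; have [->|jk] := eqVneq j k; first exact: Dk.
  suff -> : j = - k by exact: side_const km Dt.
  have : (j - k) * (j + k) = 0.
    by rewrite -subr_sqr -[j ^+ 2]real_normK ?num_real // -[k ^+ 2]real_normK ?num_real // j1 k1 subrr.
  move/eqP; rewrite mulf_eq0 subr_eq0 (negPf jk) /= addr_eq0 => /eqP //.
(* Near a boundary point, every point off the curve lies in a tangent disc on one of the two sides,
   hence in D under the assumption to be refuted. *)
have cl_open w : clos D w -> exists2 r : R, 0 < r & forall w', cm (w - w') < r -> clos D w'.
  move=> cw; have [/Dopen[r rp Hr]|nDw] := pselect (D w).
    by exists r => // w' /Hr; exact: sub_clos.
  have [u Eu] := (bd w).1 (conj cw nDw).
  exists r0 => // w' ww'; have [s' Hs'] := nearest_pt w'.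
  have [->|wn] := pselect (w' = gam s').
    by have [] := (bd (gam s')).2 (ex_intro _ s' erefl).
  have wr : cm (w' - gam s') < r0 by apply: le_lt_trans (Hs' u) _; rewrite -Eu cmBC.
  have [j j1 wj] := near_side Hs' wr wn; apply: sub_clos.
  by apply: (crossing (z := cc j s') (c := cc j s') j1) => //; [rewrite subrr cm0|exact: both].
have nfar : ~ clos D (`|B| + 2)%:C.
  move=> /(_ 1 ltr01)[w /DB wB].
  have := cmBB (`|B| + 2)%:C w; rewrite cm_real ger0_norm ?addr_ge0 //.
  by have := ler_norm B; move: wB; set x := cm _; set y := cm _; lra.
(* On the way to a distant point there is a first exit from the open set [clos D]; it is a limit of
   points of [clos D], hence of D, and so belongs to [clos D] after all. *)
have [u _ [_ [cu]]] := seg_exit cl_open (sub_clos Dz) nfar; apply.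
move=> e e0; have e20 : 0 < e / 2 by rewrite divr_gt0.
have [p cp pu] := cu _ e20; have [q Dq qp] := cp _ e20; exists q => //.
by apply: le_lt_trans (cm_tri p _ _) _; rewrite [e]splitr; apply: ltrD.
Qed.

Lemma jordan_good : exists (nrm : R -> C), good_dom D gam nrm Lam (v / 2) d0 r0.
Proof.
have [k k1 [Dk nDk]] := one_side; have km : `|- k| = 1 by rewrite normrN.
have E1 t : gam t + r0%:C * (k%:C * nv t) = cc k t by rewrite /cc rmorphM /=; ring.
have E2 t : gam t - r0%:C * (k%:C * nv t) = cc (- k) t by rewrite /cc rmorphM rmorphN /=; ring.
exists (fun t => k%:C * nv t); split=> //.
- by rewrite divr_gt0.
- exact: d0_gt0.
- exact: gam_colip.
- by move=> z cz nz; exact: (bd z).1.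
move=> t; rewrite E1 E2; split=> [|z zc|z zc Dz].
- by rewrite cmM cm_real k1 cm_nv mulr1.
- have cr : cm (cc k t - cc k t) < r0 by rewrite subrr cm0.
  exact: crossing k1 erefl cr zc (Dk t).
have cr : cm (cc (- k) t - cc (- k) t) < r0 by rewrite subrr cm0.
exact: (nDk t) (crossing km erefl zc cr Dz).
Qed.
End Sides.

End Curve.

(** * The two kinds of domains and the conclusion *)

Section Final.
Variable R : realType.
Local Notation C := R[i].
Local Notation Re := (@complex.Re R).
Local Notation Im := (@complex.Im R).

(** The domain is bounded, and any boundary parameter may be replaced by one in [0, 1[. *)
Lemma bounded_coercive (D : set C) (gam nrm : R -> C) (r0 B : R) :
  (forall z, D z -> cm z <= B) -> (forall t, gam (t + 1) = gam t) -> coercive D gam nrm r0.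
Proof.
move=> DB per f F f' G0 K M _ _ _ _ _ _; exists (`|B| + 1); first by rewrite ltr_wpDl.
split=> [z /DB zB _|t _]; first by apply: le_trans zB _; apply: le_trans (ler_norm B) _; rewrite lerDl.
have [d /andP[a b] _] := unit_shift t; exists (t + d%:~R); last exact: periodic_int.
by rewrite ger0_norm // (le_trans (ltW b)) // lerDr.
Qed.

Lemma smooth_bounded (u : R -> R) n : smooth u -> (forall t, u (t + 1) = u t) ->
  exists M, forall t, `|iter n (@derive1 R R) u t| <= M.
Proof.
move=> su per; have pn m t : iter m (@derive1 R R) u (t + 1) = iter m (@derive1 R R) u t.
  by elim: m t => [//|m IH] t /=; exact: derive_periodic.
by apply: periodic_bounded; [exact: su|exact: pn].
Qed.

Lemma boundaryE (D : set (Cplx R)) z : open D -> boundary D z <-> clos D z /\ ~ D z.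
Proof.
by move=> oD; rewrite /boundary ((interior_id D).1 oD); split=> -[a b]; split=> //; apply/closureP_cm.
Qed.

Lemma bounded_cm (D : set (Cplx R)) : bounded_set D -> exists B, forall z, D z -> cm z <= B.
Proof.
case=> M [Mr HM]; exists (Re (M + 1)) => z Dz.
have M1 : M < M + 1 by rewrite ltrDl.
by have /= := HM (M + 1) M1 z Dz; rewrite cmRe lecE => /andP[].
Qed.

Lemma smooth_jordan_good (D : set (Cplx R)) : smooth_jordan_domain D ->
  exists gam nrm Lam lam d0 r0, [/\ good_dom D gam nrm Lam lam d0 r0, coercive D gam nrm r0 &
    forall z, boundary D z -> exists t, z = gam t].
Proof.
case=> -[_ oD _] /bounded_cm[B DB] [x [y /= [[sx sy] reg per ij bdE]]].
pose gam (t : R) : C := x t +i* y t; pose dg (t : R) : C := derive1 x t +i* derive1 y t.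
have px t : x (t + 1) = x t by case: (per t).
have py t : y (t + 1) = y t by case: (per t).
(* By periodicity the first and second derivatives are bounded on the whole line; they provide the
   global constants [Lam] and [M] of the section on curves. *)
have [a1 A1] := smooth_bounded 1 sx px; have [b1 B1] := smooth_bounded 1 sy py.
have [a2 A2] := smooth_bounded 2 sx px; have [b2 B2] := smooth_bounded 2 sy py.
have pos (u v : R -> R) a b : (forall t, `|u t| <= a) -> (forall t, `|v t| <= b) -> 0 < a + b + 1.
  by move=> ua vb; rewrite ltr_wpDl // addr_ge0 // (le_trans (normr_ge0 _) (ua 0), le_trans (normr_ge0 _) (vb 0)).
have Lam0 := pos _ _ _ _ A1 B1; have M0 := pos _ _ _ _ A2 B2.
set Lam := a1 + b1 + 1 in Lam0; set M := a2 + b2 + 1 in M0.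
have two (z : C) (a b c d : R) : 0 <= d -> c = a + b + 1 -> `|Re z| <= a * d -> `|Im z| <= b * d -> cm z <= c * d.
  move=> d0 -> h1 h2; apply: le_trans (ler_cm_ReIm _) _; rewrite !mulrDl mul1r; move: h1 h2.
  by set p := a * d; set q := b * d; lra.
have glip s t : cm (gam s - gam t) <= Lam * `|s - t|.
  apply: (two _ a1 b1) => //=; apply: mvt_bound => //; first exact: (sx 0%N); exact: (sy 0%N).
have dlip s t : cm (dg s - dg t) <= M * `|s - t|.
  apply: (two _ a2 b2) => //=; apply: mvt_bound => //; first exact: (sx 1%N); exact: (sy 1%N).
have tay s t : cm (gam s - gam t - (s - t)%:C * dg t) <= M * `|s - t| ^+ 2.
  apply: (two _ a2 b2); rewrite ?exprn_ge0 //.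
    rewrite !reimE /= mul0r subr0 [(s - t) * _]mulrC.
    by apply: taylor_bound => //; [exact: (sx 0%N)|exact: (sx 1%N)].
  rewrite !reimE /= mul0r addr0 [(s - t) * _]mulrC.
  by apply: taylor_bound => //; [exact: (sy 0%N)|exact: (sy 1%N)].
have dper t : dg (t + 1) = dg t by rewrite /dg !derive_periodic.
have clip s t : `|cm (dg s) - cm (dg t)| <= M * `|s - t|.
  have e1 := cmBB (dg s) (dg t); have e2 := cmBB (dg t) (dg s); have e3 := dlip s t.
  rewrite [cm (dg t - dg s)]cmBC in e2.
  by rewrite ler_norml; apply/andP; split; move: e1 e2 e3; set p := cm _; set q := cm _; set r := cm _; set w := M * _; clear; clra.
have [s0 _ Hs0] := lip_min ler01 M0 (fun t => cm_ge0 (dg t)) clip.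
have v0 : 0 < cm (dg s0).
  by rewrite cm_gt0; apply/eqP => -[E1 E2]; apply: (reg s0); rewrite E1 E2.
have vdg t : cm (dg s0) <= cm (dg t).
  have [d /andP[a b] _] := unit_shift t.
  by rewrite -(periodic_int dper d t); apply: Hs0; rewrite a ltW.
have inj s t : 0 <= s < 1 -> 0 <= t < 1 -> gam s = gam t -> s = t.
  by move=> s1 t1; apply: ij; rewrite inE /= in_itv.
have bd z : clos D z /\ ~ D z <-> exists t, z = gam t.
  rewrite -boundaryE // bdE; split=> [[t _ <-]|[t ->]]; by exists t.
have [r0 r00 bc] := ball_cond per Lam0 M0 v0 glip tay vdg inj.
have [nrm gd] := jordan_good per Lam0 M0 v0 glip tay dlip vdg r00 bc ((openP_cm _).1 oD) bd DB.
exists gam, nrm, Lam, (cm (dg s0) / 2), (d0 M (cm (dg s0))), r0; split=> //.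
  exact: bounded_coercive DB per.
by move=> z; rewrite boundaryE // => /bd.
Qed.

Lemma half_plane_openP : open (upper_half_plane : set (Cplx R)).
Proof. by apply/openP_cm; exact: gd_open (half_plane_good R). Qed.

Lemma frakD_good (D : set (Cplx R)) : frakD D ->
  exists gam nrm Lam lam d0 r0, [/\ good_dom D gam nrm Lam lam d0 r0, coercive D gam nrm r0 &
    forall z, boundary D z -> exists t, z = gam t].
Proof.
case=> [->|]; last exact: smooth_jordan_good.
exists (fun t => t%:C), (fun _ => ci), 1, 1, 1, 1; split.
- exact: half_plane_good.
- exact: half_plane_coercive.
move=> z /(boundaryE _ half_plane_openP)[]; exact: gd_bd (half_plane_good R) z.
Qed.

Lemma lip_within_continuous (D : set (Cplx R)) (F : Cplx R -> Cplx R) (K d : R) : 0 < K -> 0 < d ->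
  (forall x y, clos D x -> clos D y -> cm (x - y) <= d -> cm (F x - F y) <= K * cm (x - y)) ->
  {within closure D, continuous F}.
Proof.
move=> K0 d0 lip; apply/subspace_continuousP => x /closureP_cm cx U /nbhs_cm[e e0 He].
apply/nbhs_cm; exists (Num.min d (e / K)); first by rewrite lt_min d0 divr_gt0.
move=> y; rewrite lt_min => /andP[xd xe] /closureP_cm cy; apply: He.
by apply: le_lt_trans (lip x y cx cy (ltW xd)) _; rewrite mulrC -ltr_pdivlMr.
Qed.
End Final.

Theorem theoremA (R : realType) (g : Cplx R -> Cplx R) (D : set (Cplx R))
    (g_analytic : analytic_on upper_half_plane g)
    (g_nonunivalent : ~ set_inj upper_half_plane g)
    (dg_neq0 : ~ (g^`() @` upper_half_plane) 0)
    (D_frakD : frakD D) :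
  exists rho : Cplx R -> Cplx R,
    [/\ analytic_on D rho,
        rho @` D `<=` upper_half_plane &
        forall f : Cplx R -> Cplx R,
          analytic_on D f ->
          (forall z, D z -> f^`() z = g^`() (rho z)) ->
          exists F : Cplx R -> Cplx R,
            [/\ {within closure D, continuous F},
                forall z, D z -> F z = f z &
                forall (r : R) (z0 : Cplx R),
                  0 < r -> (F @` boundary D) z0 ->
                  hausdorff_dim (ball z0 r%:C `&` infinite_valence D f) = 1%E]].
Proof.
have [gam [nrm [Lam [lam [d0 [r0 [gd coer bdg]]]]]]] := frakD_good D_frakD.
have [a [b [a0 b0 ab gab]]] : exists a b : R[i], [/\ 0 < complex.Im a, 0 < complex.Im b, a != b & g a = g b].
  apply: contrapT => no; apply: g_nonunivalent => a b; rewrite !inE => a0 b0 gab.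
  by apply/eqP; apply: contraT => ab; exfalso; apply: no; exists a, b.
have hg (z : R[i]) : 0 < complex.Im z -> exists l, hasd g z l.
  by move=> z0; exists (g^`() z); apply: derivable_hasd; exact: g_analytic.
have g0 (z : R[i]) : 0 < complex.Im z -> cder g z != 0.
  by move=> z0; apply/eqP => E; apply: dg_neq0; exists z => //; rewrite -cderE.
have [rho [hrho rhoH Hf]] := main_good hg a0 b0 ab gab g0 gd coer.
exists rho; split.
- by move=> z /hrho[l /hasd_derivable[]].
- by move=> _ [z Dz <-]; exact: rhoH.
move=> f fan fE; have [|F [FE [K [d [K0 d0' lip]]] dimF]] := Hf f.
  by move=> z Dz; rewrite cderE -fE //; apply: derivable_hasd; exact: fan.
exists F; split=> [||r _ r1 [z /bdg[t ->] <-]] //; first exact: lip_within_continuous lip.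
exact: dimF.
Qed.
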